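(* Let $n\ge3$ and let $(M,g,u)$ be a static triple with negative cosmological constant, i.e. $M$ is a connected non-compact $n$-dimensional smooth manifold with empty boundary and finitely many ends, $g$ is a smooth Riemannian metric on $M$, and $u\in C^\infty(M)$ satisfies $u\,\mathrm{Ric}=\mathrm{D}^2u-n\,u\,g$, $\Delta u=n\,u$ and $u>0$ in $M$, with $u(x)\to+\infty$ as $x\to\infty$. Then $$\liminf_{x\to\infty}\left(u^2-u_{\min}^2-|\mathrm{D}u|^2\right)(x)\ \le\ 0 .$$ Moreover, if equality holds then, up to a normalization of $u$, the triple $(M,g,u)$ is isometric to the Anti de Sitter solution.
   Context: $\mathrm{Ric}$, $\mathrm{D}$, $\mathrm{D}^2$, $\Delta$ are the Ricci tensor, Levi-Civita connection, Hessian and Laplace-Beltrami operator of $g$. The equations imply that the scalar curvature is $\mathrm{R}\equiv-n(n-1)$. Set $u_{\min}=\min_M u$. ''$x\to\infty$'' means that $x$ leaves every compact subset of $M$: $u(x)\to+\infty$ as $x\to\infty$ means that for an exhaustion $\{K_i\}$ of $M$ by compact sets and any points $x_i\in M\setminus K_i$ one has $u(x_i)\to+\infty$; and $\liminf_{x\to\infty}f(x)=\sup_{K}\inf_{M\setminus K}f$ over compact $K\subset M$, with values in $[-\infty,+\infty]$. The Anti de Sitter solution is the triple $(M_0,g_0,u_0)$ with $M_0=\mathbb{R}^n$, $g_0=\frac{d|x|\otimes d|x|}{1+|x|^2}+|x|^2g_{\mathbb{S}^{n-1}}$ (extended smoothly through the origin, so it is hyperbolic space), $u_0=\sqrt{1+|x|^2}$,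 where $g_{\mathbb{S}^{n-1}}$ is the standard round metric. ''Up to a normalization of $u$, $(M,g,u)$ is isometric to $(M_0,g_0,u_0)$'' means that there are a constant $c>0$ and an isometry $\Phi:(M,g)\to(M_0,g_0)$ with $u=c\,u_0\circ\Phi$. *)

(* Defs.v *)
From HB Require Import structures.
From mathcomp Require Import all_boot all_order all_algebra.
From mathcomp Require Import all_classical all_reals all_analysis.
From mathcomp Require Import ring lra.

Set Implicit Arguments.
Unset Strict Implicit.
Unset Printing Implicit Defensive.

Import Order.TTheory GRing.Theory Num.Theory.
Import numFieldNormedType.Exports.

Local Open Scope classical_set_scope.
Local Open Scope ring_scope.

Section Smooth.
Context {R : realType}.

Definition partial n (i : 'I_n) (f : 'rV[R]_n -> R) : 'rV[R]_n -> R :=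
  fun p => 'D_(delta_mx 0 i) f p.

(* Only meant for open U; the iterated partial derivatives of f at points of U
   then depend only on the restriction of f to U. *)
Fixpoint C_on n (k : nat) (U : set 'rV[R]_n) (f : 'rV[R]_n -> R) : Prop :=
  (forall p, U p -> {for p, continuous f}) /\
  match k with
  | 0%N => True
  | k'.+1 => forall i : 'I_n,
      (forall p, U p -> derivable f p (delta_mx 0 i)) /\ C_on k' U (partial i f)
  end.

Definition smooth_on n (U : set 'rV[R]_n) (f : 'rV[R]_n -> R) : Prop :=
  forall k, C_on k U f.

Definition vsmooth_on n m (U : set 'rV[R]_n) (F : 'rV[R]_n -> 'rV[R]_m) : Prop :=
  forall a : 'I_m, smooth_on U (fun p => F p 0 a).

End Smooth.

(* A smooth atlas, not required to be maximal.  The values of chart i outside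
   dom i and of param i outside chart i @` dom i are irrelevant. *)
Record manifold (R : realType) (n : nat) := Manifold {
  carrier :> topologicalType;
  carrier_hausdorff : hausdorff_space carrier;
  carrier_second_countable : @second_countable carrier;
  atlas_index : Type;
  dom : atlas_index -> set carrier;
  chart : atlas_index -> carrier -> 'rV[R]_n;
  param : atlas_index -> 'rV[R]_n -> carrier;
  chart_at : carrier -> atlas_index;
  dom_chart_at : forall x, dom (chart_at x) x;
  dom_open : forall i, open (dom i);
  image_open : forall i, open (chart i @` dom i);
  chartK : forall i x, dom i x -> param i (chart i x) = x;
  chart_continuous : forall i x, dom i x -> {for x, continuous (chart i)};
  param_continuous : forall i p, (chart i @` dom i) p ->
    {for p, continuous (param i)};
  transition_smooth : forall i j,
    vsmooth_on (chart i @` (dom i `&` dom j)) (chart j \o param i)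
}.

Section Maps.
Context {R : realType} {n : nat}.

Definition smooth_fun (M : manifold R n) (f : M -> R) : Prop :=
  forall i : atlas_index M, smooth_on (chart i @` dom i) (f \o param i).

Definition smooth_map (M N : manifold R n) (Phi : M -> N) : Prop :=
  continuous Phi /\
  forall (i : atlas_index M) (j : atlas_index N),
    vsmooth_on (chart i @` (dom i `&` Phi @^-1` dom j))
               (chart j \o Phi \o param i).

End Maps.

(* metric g i p is the matrix of components g_ab of the metric in the chart i,
   at the point of coordinates p.  Since 'J F p has entries ('J F p) a b
   = d_a F_b, the congruence 'J *m G *m 'J^T is the tensorial change of
   coordinates of a (0,2)-tensor. *)
Record riemannian_metric (R : realType) (n : nat) (M : manifold R n) :=
  RiemannianMetric {
  metric :> atlas_index M -> 'rV[R]_n -> 'M[R]_n;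
  metric_smooth : forall (i : atlas_index M) (a b : 'I_n),
    smooth_on (chart i @` dom i) (fun p => metric i p a b);
  metric_sym : forall (i : atlas_index M) (x : M), dom i x ->
    (metric i (chart i x))^T = metric i (chart i x);
  metric_pos : forall (i : atlas_index M) (x : M) (v : 'rV[R]_n), dom i x -> v != 0 ->
    0 < (v *m metric i (chart i x) *m v^T) 0 0;
  metric_transition : forall (i j : atlas_index M) (x : M), dom i x -> dom j x ->
    metric i (chart i x) =
      'J (chart j \o param i) (chart i x) *m metric j (chart j x)
        *m ('J (chart j \o param i) (chart i x))^T
}.

Section LocalGeometry.
Context {R : realType} {n : nat}.
Variable G : 'rV[R]_n -> 'M[R]_n.
Implicit Types (f : 'rV[R]_n -> R) (p : 'rV[R]_n).

(* Gamma^k_ij *)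
Definition christoffel (k i j : 'I_n) p : R :=
  2^-1 * \sum_l invmx (G p) k l *
    (partial i (fun q => G q j l) p + partial j (fun q => G q i l) p
     - partial l (fun q => G q i j) p).

(* riemann l k i j is the component along d_l of the curvature
   Rm(d_i, d_j) d_k = D_i D_j d_k - D_j D_i d_k. *)
Definition riemann (l k i j : 'I_n) p : R :=
  partial i (christoffel l j k) p - partial j (christoffel l i k) p
  + \sum_m (christoffel l i m p * christoffel m j k p
            - christoffel l j m p * christoffel m i k p).

Definition ricci p : 'M[R]_n :=
  \matrix_(j, k) \sum_i riemann i k i j p.

Definition hessian f p : 'M[R]_n :=
  \matrix_(i, j) (partial i (partial j f) p
                  - \sum_k christoffel k i j p * partial k f p).

Definition laplacian f p : R :=
  \sum_i \sum_j invmx (G p) i j * hessian f p i j.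

Definition sqnorm_grad f p : R :=
  \sum_i \sum_j invmx (G p) i j * partial i f p * partial j f p.

End LocalGeometry.

Section RiemannianManifolds.
Context {R : realType} {n : nat}.

(* |D u|^2 as a function on M *)
Definition grad_sq (M : manifold R n) (g : riemannian_metric M) (u : M -> R)
    (x : M) : R :=
  let i := chart_at x in sqnorm_grad (g i) (u \o param i) (chart i x).

Definition riemannian_isometry (M N : manifold R n) (g : riemannian_metric M)
    (h : riemannian_metric N) (Phi : M -> N) : Prop :=
  [/\ smooth_map Phi,
      exists Psi : N -> M,
        [/\ cancel Phi Psi, cancel Psi Phi & smooth_map Psi] &
      forall (i : atlas_index M) (j : atlas_index N) (x : M), dom i x -> dom j (Phi x) ->
        g i (chart i x) =
          'J (chart j \o Phi \o param i) (chart i x) *m h j (chart j (Phi x))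
            *m ('J (chart j \o Phi \o param i) (chart i x))^T].

End RiemannianManifolds.

(* Ends in the sense of Freudenthal: elements of the inverse limit, over the
   compact subsets K, of the sets of connected components of ~` K.  The last
   clause makes the encoding unique. *)
Definition is_end (T : topologicalType) (e : set T -> set T) : Prop :=
  [/\ forall K, compact K ->
        exists2 x, (~` K) x & e K = connected_component (~` K) x,
      forall K L, compact K -> compact L -> K `<=` L -> e L `<=` e K &
      forall K, ~ compact K -> e K = set0].

Definition finitely_many_ends (T : topologicalType) : Prop :=
  finite_set [set e : set T -> set T | is_end e].

Definition compact_exhaustion (T : topologicalType) (K : nat -> set T) : Prop :=
  [/\ forall i, compact (K i), forall i, K i `<=` interior (K i.+1) &
      \bigcup_i K i = setT].

Definition tends_to_infinity (R : realType) (T : topologicalType) (u : T -> R) :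
    Prop :=
  exists2 K : nat -> set T, compact_exhaustion K &
    forall x_ : nat -> T, (forall i, ~ K i (x_ i)) ->
      u (x_ i) @[i --> \oo] --> +oo.

Definition liminf_infinity (R : realType) (T : topologicalType) (f : T -> R) :
    \bar R :=
  ereal_sup [set ereal_inf [set (f x)%:E | x in ~` K] | K in @compact T].

Record static_triple (R : realType) (n : nat) (M : manifold R n)
    (g : riemannian_metric M) (u : M -> R) : Prop := StaticTriple {
  static_connected : connected [set: M];
  static_noncompact : ~ compact [set: M];
  static_ends : finitely_many_ends M;
  static_smooth : smooth_fun u;
  static_ricci : forall (i : atlas_index M) (x : M), dom i x ->
    u x *: ricci (g i) (chart i x) =
      hessian (g i) (u \o param i) (chart i x)
      - (n%:R * u x) *: g i (chart i x);
  static_laplacian : forall (i : atlas_index M) (x : M), dom i x ->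
    laplacian (g i) (u \o param i) (chart i x) = n%:R * u x;
  static_pos : forall x, 0 < u x;
  static_infinity : tends_to_infinity u
}.

(* For a proper u the infimum is attained. *)
Definition u_min (R : realType) (T : Type) (u : T -> R) : R := inf (range u).

Section SmoothTheory.
Context {R : realType} {n : nat}.
Implicit Types (f h : 'rV[R]_n -> R) (U : set 'rV[R]_n).

Lemma C_on_continuous k U f p : C_on k U f -> U p -> {for p, continuous f}.
Proof. by case: k => [|k] [+ _]; apply. Qed.

Lemma C_on_le k U f : C_on k.+1 U f -> C_on k U f.
Proof.
elim: k f => [f []//|k IH f [cf df]]; split=> // i.
have [? ?] := df i; split=> //; exact: IH.
Qed.

Lemma C_on_sub k U V f : U `<=` V -> C_on k V f -> C_on k U f.
Proof.
move=> UV; elim: k f => [|k IH] f [cf df]; split=> //.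
- by move=> p /UV; exact: cf.
- by move=> p /UV; exact: cf.
- move=> i; have [df1 df2] := df i; split; last exact: IH.
  by move=> p /UV; exact: df1.
Qed.

Lemma C_on_cst k U (c : R) : C_on k U (cst c).
Proof.
elim: k c => [|k IH] c; split=> //; try by move=> p _; exact: cst_continuous.
move=> i; split=> [p _|]; first exact: derivable_cst.
rewrite (_ : partial _ _ = cst 0) //.
by apply/funext => p; rewrite /partial derive_cst.
Qed.

Lemma derivable_coord p v (a : 'I_n) :
  derivable (fun q : 'rV[R]_n => q 0 a) p v.
Proof. by have /derivable_mxP := @derivable_id R _ p v; apply. Qed.

Lemma derive_coord p v (a : 'I_n) : 'D_v (fun q : 'rV[R]_n => q 0 a) p = v 0 a.
Proof.
have /(congr1 (fun A : 'rV_n => A 0 a)) := derive_mx (@derivable_id R _ p v).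
by rewrite mxE derive_id.
Qed.

Lemma C_on_coord k U (a : 'I_n) : C_on k U (fun p => p 0 a).
Proof.
have c : forall p : 'rV[R]_n, {for p, continuous (fun q : 'rV[R]_n => q 0 a)}.
  by move=> p; exact: coord_continuous.
case: k => [|k]; split=> // i; split=> [p _|]; first exact: derivable_coord.
rewrite (_ : partial _ _ = cst ((delta_mx 0 i : 'rV[R]_n) 0 a)).
  exact: C_on_cst.
by apply/funext => p; rewrite /partial derive_coord.
Qed.

Lemma C_onD k f h : C_on k setT f -> C_on k setT h -> C_on k setT (f \+ h).
Proof.
elim: k f h => [|k IH] f h [cf df] [ch dh]; split=> //.
- by move=> p _; apply: continuousD; [exact: cf|exact: ch].
- by move=> p _; apply: continuousD; [exact: cf|exact: ch].
move=> i; have [df1 df2] := df i; have [dh1 dh2] := dh i; split.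
  by move=> p _; apply: derivableD; [exact: df1|exact: dh1].
rewrite (_ : partial i _ = partial i f \+ partial i h); first exact: IH.
by apply/funext => p; rewrite /partial deriveD//; [exact: df1|exact: dh1].
Qed.

Lemma C_onM k f h : C_on k setT f -> C_on k setT h -> C_on k setT (f \* h).
Proof.
elim: k f h => [|k IH] f h Cf Ch; have [cf df] := Cf; have [ch dh] := Ch; split=> //.
- by move=> p _; apply: continuousM; [exact: cf|exact: ch].
- by move=> p _; apply: continuousM; [exact: cf|exact: ch].
move=> i; have [df1 df2] := df i; have [dh1 dh2] := dh i; split.
  by move=> p _; apply: derivableM; [exact: df1|exact: dh1].
rewrite (_ : partial i _ = (f \* partial i h) \+ (h \* partial i f)).
  by apply: C_onD; apply: IH => //; exact: C_on_le.
by apply/funext => p; rewrite /partial deriveM//; [exact: df1|exact: dh1].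
Qed.

Lemma C_onV k f : (forall p, f p != 0) -> C_on k setT f ->
  C_on k setT (fun p => (f p)^-1).
Proof.
move=> f0; elim: k => [|k IH] Cf; have [cf df] := Cf; split=> //.
- by move=> p _; apply: continuousV => //; exact: cf.
- by move=> p _; apply: continuousV => //; exact: cf.
move=> i; have [df1 df2] := df i; split.
  by move=> p _; apply: derivableV => //; exact: df1.
have CV := IH (C_on_le Cf).
rewrite (_ : partial i _ =
  (cst (-1) \* ((fun p => (f p)^-1) \* (fun p => (f p)^-1))) \* partial i f).
  by apply: C_onM => //; apply: C_onM; [exact: C_on_cst|exact: C_onM].
apply/funext => p; rewrite /partial deriveV//=; last exact: df1.
by rewrite -exprVn expr2 mulN1r.
Qed.

Lemma C_on_sum k m (F : 'I_m -> 'rV[R]_n -> R) :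
  (forall j, C_on k setT (F j)) -> C_on k setT (fun p => \sum_j F j p).
Proof.
move=> CF; elim: m F CF => [|m IH] F CF.
  rewrite (_ : (fun _ => _) = cst 0); first exact: C_on_cst.
  by apply/funext => p; rewrite big_ord0.
rewrite (_ : (fun _ => _) = F ord0 \+ (fun p => \sum_(j < m) F (lift ord0 j) p)).
  by apply: C_onD => //; exact: IH.
by apply/funext => p; rewrite big_ord_recl.
Qed.

End SmoothTheory.

Lemma rV_second_countable (R : realType) (n : nat) :
  @second_countable 'rV[R]_n.
Proof.
pose b (c : 'rV[rat]_n * nat) : set 'rV[R]_n :=
  ball (map_mx ratr c.1 : 'rV[R]_n) (c.2.+1%:R^-1 : R).
exists (range b).
  exact: (sub_countable (card_image_le _ _) (countableP _)).
split.
  move=> _ [c _ <-]; exact: ball_open.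
move=> x A /nbhs_ballP[e /= e0 eA].
have [k ke] : exists k : nat, k.+1%:R^-1 < e / 2.
  have /ltr_add_invr[k] : 0 < e / 2 by rewrite divr_gt0.
  by rewrite add0r; exists k.
have k0 : 0 < k.+1%:R^-1 :> R by rewrite invr_gt0.
have [q qP] : exists q : 'rV[rat]_n, forall j, ball (ratr (q 0 j) : R) k.+1%:R^-1 (x 0 j).
  have H (j : 'I_n) : exists r : rat, ball (ratr r : R) k.+1%:R^-1 (x 0 j).
    have : x 0 j - k.+1%:R^-1 < x 0 j + k.+1%:R^-1 by rewrite ltrD2l gtrN.
    move=> /rat_in_itvoo[r]; rewrite in_itv /= => /andP[r1 r2]; exists r.
    by rewrite /ball /= ltr_distl ltrBlDr r2 andbT; rewrite ltrBlDr in r1.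
  have [r rP] := choice H.
  by exists (\row_j r j) => j; rewrite mxE.
have bx : b (q, k) x.
  by split=> // i j; rewrite (ord1 i) mxE; exact: qP.
exists (b (q, k)) => /=; first by split=> //; exists (q, k).
move=> y /= yb; apply: eA; apply: (@ball_splitr _ _ (map_mx ratr q : 'rV[R]_n)).
  exact: (le_ball (ltW ke) bx).
exact: (le_ball (ltW ke) yb).
Qed.

Section AntiDeSitter.
Context {R : realType} {n : nat}.

(* The Euclidean norm; the library's norm on 'rV[R]_n is the sup norm. *)
Definition enorm (x : 'rV[R]_n) : R := Num.sqrt (\sum_i x 0 i ^+ 2).

Lemma enorm_sqr (x : 'rV[R]_n) : enorm x ^+ 2 = \sum_i x 0 i ^+ 2.
Proof. by rewrite sqr_sqrtr// sumr_ge0// => i _; exact: sqr_ge0. Qed.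

Lemma enorm_eq0 (x : 'rV[R]_n) : (enorm x == 0) = (x == 0).
Proof.
rewrite -sqrf_eq0 enorm_sqr psumr_eq0; last by move=> i _; exact: sqr_ge0.
apply/allP/eqP => [H|-> i _]; last by rewrite mxE expr0n /= eqxx.
apply/rowP => i; rewrite mxE; apply/eqP; rewrite -sqrf_eq0.
by apply: (implyP (H i _)) => //; rewrite mem_index_enum.
Qed.

Lemma cst1D_enorm_gt0 (x : 'rV[R]_n) : 0 < 1 + enorm x ^+ 2.
Proof. by rewrite ltr_pwDl// sqr_ge0. Qed.

Definition euclidean_space : manifold R n.
Proof.
refine (@Manifold R n 'rV[R]_n (@norm_hausdorff _ _) (rV_second_countable R n)
  unit (fun=> setT) (fun=> id) (fun=> id) (fun=> tt) _ _ _ _ _ _ _) => //.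
- by move=> i; exact: openT.
- by move=> i; rewrite image_id; exact: openT.
- by move=> ? ? _ ?.
- by move=> ? ? _ ?.
- by move=> i j a k; exact: C_on_coord.
Defined.

(* g_0 in Cartesian coordinates: since the round metric pulled back by
   x / |x| satisfies |x|^2 g_S = |dx|^2 - d|x| (x) d|x|, one has
   g_0 = |dx|^2 - |x|^2 / (1 + |x|^2) d|x| (x) d|x|, and
   d|x| = sum_i (x_i / |x|) dx_i; see ads_mx_polar. *)
Definition ads_mx (x : 'rV[R]_n) : 'M[R]_n :=
  \matrix_(i, j) ((i == j)%:R - x 0 i * x 0 j / (1 + enorm x ^+ 2)).

Lemma is_derive_enorm (x : 'rV[R]_n) (i : 'I_n) : x != 0 ->
  is_derive x (delta_mx 0 i : 'rV[R]_n) enorm (x 0 i / enorm x).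
Proof.
move=> x0; have e0 : enorm x != 0 by rewrite enorm_eq0.
pose q (y : 'rV[R]_n) : R := \sum_k y 0 k ^+ 2.
have q0 : 0 < q x by rewrite /q -enorm_sqr exprn_even_gt0.
have dc k : differentiable (fun y : 'rV[R]_n => y 0 k : R) x.
  exact: differentiable_coord.
have dq : differentiable q x.
  rewrite (_ : q = \sum_k ((fun y : 'rV[R]_n => y 0 k : R) ^+ 2)).
    by apply: differentiable_sum => k; exact: differentiableX.
  by apply/funext => y; rewrite fct_sumE.
have Dq : 'D_(delta_mx 0 i) q x = 2 * x 0 i.
  rewrite (_ : q = \sum_k ((fun y : 'rV[R]_n => y 0 k : R) ^+ 2)); last first.
    by apply/funext => y; rewrite fct_sumE.
  rewrite derive_sum; last by move=> k; exact/derivableX/derivable_coord.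
  rewrite (bigD1 i)//= big1 ?addr0 => [|k ki].
    rewrite deriveX; last exact: derivable_coord.
    by rewrite derive_coord mxE !eqxx /= mulr1n /GRing.scale /= mulr1 expr1 mulr_natl.
  rewrite deriveX; last exact: derivable_coord.
  by rewrite derive_coord mxE (negbTE ki) andbF scaler0.
have ds : derivable (@Num.sqrt R) (q x) 1 by apply: ex_derive; exact: is_derive1_sqrt.
have dsq : differentiable (@Num.sqrt R) (q x) by exact/derivable1_diffP.
have dn : differentiable (Num.sqrt \o q) x by exact: differentiable_comp.
split; first exact: diff_derivable.
rewrite -[enorm]/(Num.sqrt \o q) deriveE// diff_comp//= deriv1E// -deriveE// Dq.
rewrite derive1E derive_sqrt// /GRing.scale /= -[Num.sqrt (q x)]/(enorm x).
by field.
Qed.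

Lemma partial_enorm (x : 'rV[R]_n) (i : 'I_n) : x != 0 ->
  partial i enorm x = x 0 i / enorm x.
Proof. by move=> x0; rewrite /partial; have [_ ->] := is_derive_enorm i x0. Qed.

Lemma partial_direction (x : 'rV[R]_n) (i k : 'I_n) : x != 0 ->
  partial i (fun y : 'rV[R]_n => y 0 k / enorm y) x
  = (i == k)%:R / enorm x - x 0 i * x 0 k / enorm x ^+ 3.
Proof.
move=> x0; have e0 : enorm x != 0 by rewrite enorm_eq0.
have [d1 d2] := is_derive_enorm i x0.
rewrite /partial (deriveM (f := fun y : 'rV[R]_n => y 0 k)
  (g := fun y => (enorm y)^-1)); last 2 first.
- exact: derivable_coord.
- exact: derivableV.
rewrite deriveV// d2 derive_coord mxE eqxx /= eq_sym /GRing.scale /=.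
by field.
Qed.

(* g_0 = d|x| (x) d|x| / (1 + |x|^2) + |x|^2 g_S, with g_S pulled back by
   x |-> x / |x|. *)
Lemma ads_mx_polar (x : 'rV[R]_n) (i j : 'I_n) : x != 0 ->
  ads_mx x i j =
    partial i enorm x * partial j enorm x / (1 + enorm x ^+ 2)
    + enorm x ^+ 2 * \sum_k
        partial i (fun y : 'rV[R]_n => y 0 k / enorm y) x
        * partial j (fun y : 'rV[R]_n => y 0 k / enorm y) x.
Proof.
move=> x0; have e0 : enorm x != 0 by rewrite enorm_eq0.
have e1 := lt0r_neq0 (cst1D_enorm_gt0 x).
rewrite !partial_enorm// mxE; set r := enorm x in e0 e1 *.
under eq_bigr => k _.
  rewrite !partial_direction// -/r.
  have -> : ((i == k)%:R / r - x 0 i * x 0 k / r ^+ 3) *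
            ((j == k)%:R / r - x 0 j * x 0 k / r ^+ 3) =
      r ^- 2 * ((i == k)%:R * (j == k)%:R)
      - (x 0 i / r ^+ 4) * ((j == k)%:R * x 0 k)
      - (x 0 j / r ^+ 4) * ((i == k)%:R * x 0 k)
      + (x 0 i * x 0 j / r ^+ 6) * x 0 k ^+ 2 by field.
  over.
rewrite big_split !sumrB -!mulr_sumr -enorm_sqr -/r /=.
have dl (f : 'I_n -> R) (a : 'I_n) : \sum_k (a == k)%:R * f k = f a.
  rewrite (bigD1 a)//= eqxx mul1r big1 ?addr0// => k /negbTE.
  by rewrite eq_sym => ->; rewrite mul0r.
rewrite !dl (eq_sym j); field.
by rewrite e0 e1.
Qed.

Lemma ads_mx_sym x : (ads_mx x)^T = ads_mx x.
Proof. by apply/matrixP => i j; rewrite !mxE eq_sym (mulrC (x 0 j)). Qed.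

Lemma ads_mx_pos (x v : 'rV[R]_n) : v != 0 -> 0 < (v *m ads_mx x *m v^T) 0 0.
Proof.
move=> v0; set s := enorm x ^+ 2; set t := \sum_i x 0 i * v 0 i.
set w := \sum_i v 0 i ^+ 2.
have s0 : 0 <= s by exact: sqr_ge0.
have w0 : 0 < w by rewrite /w -enorm_sqr exprn_even_gt0//= enorm_eq0.
have -> : (v *m ads_mx x *m v^T) 0 0 = w - t ^+ 2 / (1 + s).
  rewrite mxE.
  under eq_bigr => j _.
    rewrite !mxE.
    under eq_bigr => i _.
      rewrite mxE mulrBr.
      have -> : v 0 i * (x 0 i * x 0 j / (1 + enorm x ^+ 2)) =
                (x 0 i * v 0 i) * (x 0 j / (1 + s)).
        by rewrite -/s; ring.
      over.
    rewrite sumrB -mulr_suml -/t (bigD1 j)//= eqxx mulr1 big1 ?addr0; last first.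
      by move=> i /negbTE ->; rewrite mulr0.
    have -> : (v 0 j - t * (x 0 j / (1 + s))) * v 0 j =
              v 0 j ^+ 2 - (t / (1 + s)) * (x 0 j * v 0 j) by ring.
    over.
  by rewrite sumrB -mulr_sumr -/t -/w; congr (_ - _); ring.
have H : 0 <= (1 + s) ^+ 2 * w - (2 + s) * t ^+ 2.
  have -> : (1 + s) ^+ 2 * w - (2 + s) * t ^+ 2 =
            \sum_i ((1 + s) * v 0 i - t * x 0 i) ^+ 2.
    under eq_bigr => i _.
      have -> : ((1 + s) * v 0 i - t * x 0 i) ^+ 2 =
         (1 + s) ^+ 2 * v 0 i ^+ 2 - (2 * (1 + s) * t) * (x 0 i * v 0 i)
         + t ^+ 2 * x 0 i ^+ 2 by ring.
      over.
    by rewrite big_split sumrB -!mulr_sumr -/t -/w -enorm_sqr -/s /=; ring.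
  by apply: sumr_ge0 => i _; exact: sqr_ge0.
have s1 : 0 < 1 + s by rewrite ltr_pwDl.
rewrite subr_gt0 ltr_pdivrMr//.
have [->|t0] := eqVneq t 0; first by rewrite expr0n/= mulr_gt0.
have t2 : 0 < t ^+ 2 by rewrite exprn_even_gt0.
rewrite -(ltr_pM2r s1); nra.
Qed.

Lemma jacobian_id (p : 'rV[R]_n) : 'J id p = 1%:M.
Proof.
apply/row_matrixP => i; rewrite !rowE mul_rV_lin1 mulmx1.
by rewrite diff_val.
Qed.

Definition ads_metric : riemannian_metric euclidean_space.
Proof.
refine (@RiemannianMetric R n euclidean_space (fun=> ads_mx) _ _ _ _).
- move=> i a b k; apply: (@C_on_sub _ _ _ _ setT) => //.
  rewrite (_ : (fun _ => _) = cst ((a == b)%:R) \+ (cst (-1) \*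
    (((fun p : 'rV[R]_n => p 0 a) \* (fun p => p 0 b)) \*
     (fun p => (1 + \sum_c p 0 c * p 0 c)^-1)))); last first.
    apply/funext => p; rewrite mxE enorm_sqr /= mulN1r.
    by under eq_bigr do rewrite expr2.
  apply: C_onD; first exact: C_on_cst.
  apply: C_onM; first exact: C_on_cst.
  apply: C_onM; first by apply: C_onM; exact: C_on_coord.
  apply: C_onV.
    move=> p; under eq_bigr do rewrite -expr2.
    by rewrite -enorm_sqr gt_eqF// cst1D_enorm_gt0.
  apply: (@C_onD _ _ _ (cst 1) (fun p => \sum_c p 0 c * p 0 c)).
    exact: C_on_cst.
  apply: (@C_on_sum _ _ _ _ (fun c => (fun p => p 0 c) \* (fun p => p 0 c))).
  by move=> c; apply: C_onM; exact: C_on_coord.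
- by move=> i x _; exact: ads_mx_sym.
- by move=> i x v _; exact: ads_mx_pos.
- by move=> i j x _ _ /=; rewrite jacobian_id mul1mx trmx1 mulmx1.
Defined.

Definition ads_potential (x : euclidean_space) : R :=
  Num.sqrt (1 + enorm (x : 'rV[R]_n) ^+ 2).

End AntiDeSitter.
Arguments euclidean_space : clear implicits.
Arguments ads_metric : clear implicits.
Arguments ads_potential : clear implicits.

(* Main.v *)
From HB Require Import structures.
Require Import Defs.
From mathcomp Require Import all_boot all_order all_algebra.
From mathcomp Require Import all_classical all_reals all_analysis.
From mathcomp Require Import ring lra.

(* Let W = u^2 - u_min^2 - |Du|^2, which vanishes at the minimum points of u.
   By the Bochner formula Delta W - u^-1 <Du, DW> = - 2 |D^2 u - u g|^2 <= 0, so W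
   obeys the strong minimum principle, which gives liminf W <= W(x) for every x; in
   particular liminf W <= 0.  If liminf W = 0, then W is minimal at the minimum points
   of u, hence W = 0, so D^2 u = u g and |Du|^2 = u^2 - u_min^2.

   For rigidity, note that D^2 f = f g says that (f, df) is parallel for a linear
   connection A whose curvature F measures the failure of constant curvature -1.
   As (u, du) is parallel, F(Du, .) = 0, and the Bianchi identity gives a transport
   equation D_N F = - 2 u F + O(|Du|) F along N = Du.  It makes F vanish near the minimum
   points of u, and a cutoff argument along N propagates F = 0 from {u < s} to {u = s};
   so, the sublevel sets being compact, A is flat.
   Parallel sections then produce near every point n solutions x_1, ..., x_n of
   D^2 x = x g with <dx_a, dx_b> = delta_ab + x_a x_b and <dx_a, du> = x_a u: the
   coordinates of a local isometry to hyperbolic space with u = c sqrt (1 + |x|^2).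
   Two of them differ by a rotation, so local inverses extend over larger and larger
   balls of R^n to a map Psi : R^n -> M.  It is onto because M is connected.  If
   Psi(a) = Psi(b), then b = aT with a rotation T such that Psi(pT) = Psi(p), and T is the
   identity because Psi is injective near 0. *)

Set Implicit Arguments.
Unset Strict Implicit.
Unset Printing Implicit Defensive.

Import Order.TTheory GRing.Theory Num.Theory.
Import numFieldNormedType.Exports.

Local Open Scope classical_set_scope.
Local Open Scope ring_scope.

(** * Calculus in coordinates *)

(** Put T = D^2 u - u g. The static equations say that tr T = 0 and T = u (Ric + (n - 1) g), so the
    contracted Ricci identity becomes div T = u^-1 T(Du, .). Since DW = - 2 T(Du, .), the drift u^-1
    <Du, DW> is exactly what removes div T from Delta W. Growth of u acts through compact sublevel
    sets: they give the minimum of u, a lowest point at which flatness could fail, and cluster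
    points for the values of Psi on a bounded cube, where u o Psi = c sqrt (1 + |x|^2) is bounded.
    No integral curve of Du is followed. Contraction with Du turns the Bianchi identity into a
    differential inequality for the sum of the squares of the entries of F, and its product with a
    cutoff cannot have a positive interior maximum. Parallel sections are limits of Euler polygons,
    and flatness is what makes the derivatives of the polygons converge as well. The relation <dx_a,
    du> = x_a u rules out all hyperbolic isometries other than rotations about the origin, so that
    two local developments differ by an orthogonal matrix. Rows carry the sup norm, for which a
    rotation is only n-Lipschitz; this explains several factors n. *)

Section NearPoint.
Context {T : topologicalType}.
Implicit Types (U P Q : set T) (p : T).

Lemma near_open U P p : open U -> U p -> (forall q, U q -> P q) ->
  \forall q \near p, P q.
Proof. by move=> oU Up UP; apply: (filterS UP); exact: open_nbhs_nbhs. Qed.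

Lemma near_imp P Q p : (\forall q \near p, P q) -> (forall q, P q -> Q q) ->
  \forall q \near p, Q q.
Proof. by move=> + PQ; exact: filterS. Qed.

Lemma near_and P Q p : (\forall q \near p, P q) -> (\forall q \near p, Q q) ->
  \forall q \near p, P q /\ Q q.
Proof. exact: filterI. Qed.

Lemma near_forall (I : finType) (P : I -> set T) p :
  (forall i, \forall q \near p, P i q) -> \forall q \near p, forall i, P i q.
Proof. exact: filter_forall. Qed.

Lemma near_ex_open P p : (\forall q \near p, P q) ->
  exists U, [/\ open U, U p & forall q, U q -> P q].
Proof.
move=> H; exists P°; split; [exact: open_interior|exact: H|exact: interior_subset].
Qed.

End NearPoint.

Lemma continuous_atP (R : realType) (T : topologicalType) (V : normedModType R)
    (f : T -> V) p :
  {for p, continuous f} <-> forall e : R, 0 < e -> \forall q \near p, `|f p - f q| <= e.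
Proof. exact: cvgrPdist_le. Qed.

Lemma near_in_ball (R : realType) (T : pseudoMetricType R) (P : set T) p :
  (\forall q \near p, P q) -> exists2 r : R, 0 < r & forall q, ball p r q -> P q.
Proof. by move=> /nbhs_ballP[r r0 H]; exists r. Qed.

Section RowNorm.
Context {R : realType}.

Lemma coord_le_norm m n (A : 'M[R]_(m, n)) i j : `|A i j| <= `|A|.
Proof.
rewrite [leRHS]/Num.norm /= mx_normrE.
by apply/bigmax_geP; right; exists (i, j).
Qed.

Lemma norm_le_coord m n (A : 'M[R]_(m, n)) e : 0 <= e ->
  (forall i j, `|A i j| <= e) -> `|A| <= e.
Proof.
move=> e0 H; rewrite [leLHS]/Num.norm /= mx_normrE.
by apply/bigmax_leP; split=> // -[i j] _; exact: H.
Qed.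

Lemma norm_delta_le1 n (i : 'I_n) : `|delta_mx 0 i : 'rV[R]_n| <= 1.
Proof.
apply: norm_le_coord => // a b; rewrite mxE.
by case: (_ && _); rewrite ?normr1 ?normr0.
Qed.

Lemma in_ballE n (p q : 'rV[R]_n) r : ball p r q = (`|p - q| < r) :> Prop.
Proof. by rewrite -ball_normE. Qed.

Lemma open_ball_sub n (U : set 'rV[R]_n) p : open U -> U p ->
  exists2 r : R, 0 < r & ball p r `<=` U.
Proof.
move=> oU Up; have : nbhs p U by exact: open_nbhs_nbhs.
by move=> /nbhs_ballP[r r0 H]; exists r.
Qed.

Lemma ball_segment n (p a b : 'rV[R]_n) r t : 0 <= t <= 1 ->
  ball p r a -> ball p r b -> ball p r (t *: (b - a) + a).
Proof.
rewrite !in_ballE => /andP[t0 t1] pa pb.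
have -> : p - (t *: (b - a) + a) = (1 - t) *: (p - a) + t *: (p - b).
  by apply/rowP => j; rewrite !mxE; ring.
apply: le_lt_trans (ler_normD _ _) _; rewrite !normrZ.
rewrite (ger0_norm t0) ger0_norm ?subr_ge0//.
have [->|t0'] := eqVneq t 0; first by rewrite subr0 mul1r mul0r addr0.
have tp : 0 < t by rewrite lt_def t0'.
have : t * `|p - b| < t * r by rewrite ltr_pM2l.
have : (1 - t) * `|p - a| <= (1 - t) * r by rewrite ler_wpM2l ?subr_ge0// ltW.
lra.
Qed.

End RowNorm.

Section OneVariable.
Context {R : realType}.

Lemma is_derive_line n (f : 'rV[R]_n -> R) (a v : 'rV[R]_n) (t : R) :
  derivable f (t *: v + a) v ->
  is_derive t 1 (fun s : R => f (s *: v + a)) ('D_v f (t *: v + a)).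
Proof.
have E : (fun h : R => h^-1 *: (f ((h *: 1 + t) *: v + a) - f (t *: v + a)))
    = (fun h : R => h^-1 *: (f (h *: v + (t *: v + a)) - f (t *: v + a))).
  by apply/funext => h; rewrite scalerDl addrA [h%:A]mulr1.
move=> df; split; first by rewrite /derivable /= E.
by rewrite /derive /= E.
Qed.

(** The endpoints may come in either order because the coordinate increments it serves have
    arbitrary sign. *)
Lemma MVT_between (f df : R -> R) (a b : R) :
  (forall x, (a <= x <= b) || (b <= x <= a) -> is_derive x 1 f (df x)) ->
  exists2 c, (a <= c <= b) || (b <= c <= a) & f b - f a = df c * (b - a).
Proof.
have cont (x y : R) : (forall z, x <= z <= y -> is_derive z 1 f (df z)) ->
    {within `[x, y], continuous f}.
  move=> H; apply: derivable_within_continuous => z; rewrite in_itv /= => zxy.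
  by have [] := H _ zxy.
have seg (x y : R) : x <= y -> (forall z, x <= z <= y -> is_derive z 1 f (df z)) ->
    exists2 c, x <= c <= y & f y - f x = df c * (y - x).
  move=> xy H; have H0 z : z \in `]x, y[ -> is_derive z 1 f (df z).
    by rewrite in_itv /= => /andP[z1 z2]; apply: H; rewrite !ltW.
  have [c cxy E] := MVT_segment xy H0 (cont _ _ H).
  by exists c => //; move: cxy; rewrite in_itv.
move=> H; have [ab|ba] := leP a b.
  have [|c cab E] := seg a b ab; last by exists c; rewrite ?cab.
  by move=> z zab; apply: H; rewrite zab.
have [|c cab E] := seg b a (ltW ba).
  by move=> z zab; apply: H; rewrite zab orbT.
by exists c; rewrite ?cab ?orbT// -(opprB a b) mulrN -E opprB.
Qed.

End OneVariable.

Section DotProduct.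
Context {R : realType} {n : nat}.

Definition lform (c : 'I_n -> R) (v : 'rV[R]_n) : R := \sum_i v 0 i * c i.

Fact lform_linear c : linear (lform c).
Proof.
move=> k u v; rewrite /lform scaler_sumr -big_split /=.
by apply: eq_bigr => i _; rewrite !mxE /GRing.scale /=; ring.
Qed.
HB.instance Definition _ c := @GRing.isLinear.Build R 'rV[R]_n R *%R (lform c) (lform_linear c).

Lemma continuous_lform c : continuous (lform c).
Proof.
have : C_on 0 setT (lform c).
  apply: (@C_on_sum _ _ _ n (fun i v => v 0 i * c i)) => i.
  apply: (@C_onM _ _ 0 (fun v => v 0 i) (cst (c i))).
    exact: C_on_coord.
  exact: C_on_cst.
by case=> H _ p; exact: H.
Qed.

Lemma lform_le c e (v : 'rV[R]_n) : 0 <= e -> (forall i, `|c i| <= e) ->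
  `|lform c v| <= n%:R * e * `|v|.
Proof.
move=> e0 H; apply: le_trans (ler_norm_sum _ _ _) _.
apply: (@le_trans _ _ (\sum_(i < n) e * `|v|)).
  apply: ler_sum => i _; rewrite normrM mulrC ler_pM//.
  exact: coord_le_norm.
by rewrite sumr_const card_ord -[leLHS]mulr_natl mulrA.
Qed.

End DotProduct.

Section C1.
Context {R : realType} {n : nat}.
Implicit Types (f : 'rV[R]_n -> R) (U : set 'rV[R]_n).

Lemma partial_line f p i (t : R) : derivable f (t *: delta_mx 0 i + p) (delta_mx 0 i) ->
  is_derive t 1 (fun s : R => f (s *: delta_mx 0 i + p))
    (partial i f (t *: delta_mx 0 i + p)).
Proof. exact: is_derive_line. Qed.

Let trunc (k : nat) (h : 'rV[R]_n) : 'rV[R]_n :=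
  \row_i (if (i < k)%N then h 0 i else 0).

(** A staircase from [p] to [h + p] changes one coordinate at a time. On each edge the mean value
    theorem yields a partial derivative at a point of the ball, within [e] of its value at [p]. *)
Lemma C1_increment f p (r e : R) (h : 'rV[R]_n) : 0 <= e -> `|h| < r ->
  (forall q, ball p r q -> forall i, derivable f q (delta_mx 0 i)) ->
  (forall q, ball p r q -> forall i, `|partial i f q - partial i f p| <= e) ->
  `|f (h + p) - f p - lform (fun i => partial i f p) h| <= n%:R * e * `|h|.
Proof.
move=> e0 hr df De.
have step (k : 'I_n) : exists a, `|a - partial k f p| <= e /\
    f (trunc k.+1 h + p) - f (trunc k h + p) = a * h 0 k.
  have inball (s : R) : (0 <= s <= h 0 k) || (h 0 k <= s <= 0) ->
      ball p r (s *: delta_mx 0 k + (trunc k h + p)).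
    move=> hs; rewrite in_ballE; apply: le_lt_trans hr.
    rewrite addrA opprD addrCA subrr addr0 normrN.
    apply: norm_le_coord => // a i; rewrite !mxE ord1 eqxx /=.
    have [->|ik] := eqVneq i k.
      rewrite ltnn addr0 mulr1; apply: le_trans (coord_le_norm h 0 k).
      case/orP: hs => /andP[s1 s2]; first by rewrite !ger0_norm// (le_trans s1).
      by rewrite !ler0_norm ?lerN2// (le_trans s1).
    rewrite mulr0 add0r; case: ifP => _; rewrite ?normr0//.
    exact: coord_le_norm.
  have [|c cb E] := @MVT_between _ (fun s : R => f (s *: delta_mx 0 k + (trunc k h + p)))
     (fun s => partial k f (s *: delta_mx 0 k + (trunc k h + p))) 0 (h 0 k).
    move=> s hs; apply: partial_line; apply: df; exact: inball.
  exists (partial k f (c *: delta_mx 0 k + (trunc k h + p))); split; first exact/De/inball.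
  rewrite subr0 scale0r add0r in E; rewrite -E; congr (f _ - _).
  rewrite addrA; congr (_ + _); apply/rowP => i; rewrite !mxE eqxx /=.
  have [->|ik] := eqVneq i k; first by rewrite ltnn ltnSn mulr1 addr0.
  by rewrite ltnS leq_eqVlt (_ : (i == k :> nat) = false) ?mulr0 ?add0r//; apply/negbTE.
have [a aP] := choice step.
have ae k := (aP k).1; have aE k := (aP k).2.
have tel : f (h + p) - f p = \sum_k a k * h 0 k.
  have -> : h = trunc n h by apply/rowP => i; rewrite mxE ltn_ord.
  have -> : f p = f (trunc 0 h + p).
    by congr f; rewrite -[LHS]add0r; congr (_ + _); apply/rowP => i; rewrite !mxE.
  rewrite -(@telescope_sumr _ 0 n (fun k => f (trunc k h + p)))// big_mkord.
  by apply: eq_bigr => k _; rewrite aE; congr (_ * _); rewrite mxE ltn_ord.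
rewrite tel /lform -sumrB.
rewrite (_ : \sum_(i < n) _ = lform (fun k => a k - partial k f p) h).
  exact: lform_le.
by apply: eq_bigr => i _; ring.
Qed.

End C1.

Lemma continuous_ext_at (T T' : topologicalType) (f g : T -> T') (p : T) :
  (\forall q \near p, f q = g q) -> {for p, continuous f} -> {for p, continuous g}.
Proof.
move=> fg cf; rewrite /prop_for /continuous_at -(nbhs_singleton fg).
exact: cvg_trans (near_eq_cvg fg) cf.
Qed.

Section C1_differentiable.
Context {R : realType} {n : nat}.
Implicit Types (f h : 'rV[R]_n -> R) (U : set 'rV[R]_n).

Lemma C1_littleo U f p : open U -> C_on 1 U f -> U p ->
  (f : 'rV[R]_n -> R^o) \o shift p =
    cst (f p : R^o) + (lform (fun i => partial i f p) : 'rV[R]_n -> R^o)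
    +o_ (0 : 'rV[R]_n) id.
Proof.
move=> oU [cf df] Up; apply/eqaddoP => e e0.
(* The increment estimate loses a factor [n]; [n.+1] absorbs it and is nonzero in every
   dimension. *)
pose e' := e / n.+1%:R.
have e'0 : 0 < e' by rewrite divr_gt0.
have [r r0 rU] := open_ball_sub oU Up.
have nb i : nbhs p (fun q => `|partial i f q - partial i f p| <= e').
  have [_ [cp _]] := df i.
  have := cp _ Up; move=> /cvgrPdist_le /(_ _ e'0).
  by apply: filterS => q; rewrite distrC.
have : \forall q \near p, forall i, `|partial i f q - partial i f p| <= e'.
  exact: near_forall nb.
move=> /nbhs_ballP[r' /= r'0 H].
have m0 : 0 < Num.min r r' by rewrite lt_min r0 r'0.
near=> v.
have vr : `|v| < Num.min r r'.
  near: v; apply/nbhs_ballP; exists (Num.min r r') => // w.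
  by rewrite in_ballE sub0r normrN.
have -> : (f \o shift p - (cst (f p) + lform (fun i => partial i f p))) v =
   f (v + p) - f p - lform (fun i => partial i f p) v.
  by rewrite opprD addrA.
apply: (le_trans (@C1_increment _ _ f p _ e' v (ltW e'0) vr _ _)).
- move=> q qb i; have [d _] := df i; apply: d; apply: rU.
  by apply: le_ball qb; rewrite ge_min lexx.
- move=> q qb; apply: H; apply: le_ball qb; by rewrite ge_min lexx orbT.
rewrite ler_wpM2r// /e' mulrCA ler_piMr ?(ltW e0)//.
by rewrite ler_pdivrMr// mul1r ler_nat.
Unshelve. all: by end_near. Qed.

Lemma C1_diffE U f p : open U -> C_on 1 U f -> U p ->
  'd f p = lform (fun i => partial i f p) :> ('rV[R]_n -> R).
Proof.
move=> oU Cf Up; apply: diff_unique (C1_littleo oU Cf Up).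
exact: continuous_lform.
Qed.

Lemma C1_differentiable U f p : open U -> C_on 1 U f -> U p -> differentiable f p.
Proof.
move=> oU Cf Up; apply/diff_locallyP; rewrite (C1_diffE oU Cf Up); split.
  exact: continuous_lform.
exact: (C1_littleo oU Cf Up).
Qed.

Lemma C1_deriveE U f p v : open U -> C_on 1 U f -> U p ->
  'D_v f p = \sum_i v 0 i * partial i f p.
Proof.
move=> oU Cf Up; rewrite deriveE; last exact: (C1_differentiable oU Cf Up).
by rewrite (C1_diffE oU Cf Up).
Qed.

Lemma C1_is_derive_line U f a v (t : R) : open U -> C_on 1 U f -> U (t *: v + a) ->
  is_derive t 1 (fun s : R => f (s *: v + a)) (\sum_i v 0 i * partial i f (t *: v + a)).
Proof.
move=> oU Cf Ut; rewrite -(C1_deriveE v oU Cf Ut); apply: is_derive_line.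
exact/diff_derivable/(C1_differentiable oU Cf Ut).
Qed.

Lemma partial_ext U f h i p : open U -> (forall q, U q -> f q = h q) -> U p ->
  partial i f p = partial i h p.
Proof.
move=> oU fh Up; exact: near_eq_derive (near_open oU Up fh).
Qed.

Lemma derivable_ext U f h v p : open U -> (forall q, U q -> f q = h q) -> U p ->
  derivable f p v -> derivable h p v.
Proof.
move=> oU fh Up; exact: near_eq_derivable (near_open oU Up fh).
Qed.

Lemma C_on_ext k U f h : open U -> (forall q, U q -> f q = h q) ->
  C_on k U f -> C_on k U h.
Proof.
move=> oU; have cc f1 f2 : (forall q, U q -> f1 q = f2 q) ->
    (forall p, U p -> {for p, continuous f1}) -> (forall p, U p -> {for p, continuous f2}).
  by move=> E c p Up; apply: continuous_ext_at (c _ Up); exact: near_open E.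
elim: k f h => [|k IH] f h fh [cf df]; split=> //; try exact: cc cf.
move=> i; have [df1 df2] := df i; split.
  by move=> p Up; apply: (derivable_ext oU fh Up); exact: df1.
by apply: IH df2 => q Uq; exact: partial_ext oU fh Uq.
Qed.

Lemma C_on_pointwise k U f :
  (forall p, U p -> exists2 V, V p & C_on k V f) -> C_on k U f.
Proof.
elim: k f => [|k IH] f H; split=> //.
- by move=> p Up; have [V Vp CV] := H _ Up; exact: C_on_continuous CV Vp.
- by move=> p Up; have [V Vp CV] := H _ Up; exact: C_on_continuous CV Vp.
move=> i; split.
  by move=> p Up; have [V Vp [_ /(_ i)[+ _]]] := H _ Up; apply.
by apply: IH => p Up; have [V Vp [_ /(_ i)[_ C]]] := H _ Up; exists V.
Qed.

Lemma C_on_leq k l U f : (k <= l)%N -> C_on l U f -> C_on k U f.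
Proof.
move=> /subnK <-; elim: (l - k)%N => [//|m IH]; rewrite addSn => /C_on_le; exact: IH.
Qed.

Lemma C_on_D k U f h : C_on k U f -> C_on k U h -> open U -> C_on k U (fun p => f p + h p).
Proof.
move=> + + oU; elim: k f h => [|k IH] f h [cf df] [ch dh].
  by split=> // p Up; apply: continuousD; [exact: cf|exact: ch].
split; first by move=> p Up; apply: continuousD; [exact: cf|exact: ch].
move=> i; have [df1 df2] := df i; have [dh1 dh2] := dh i; split.
  by move=> p Up; apply: derivableD; [exact: df1|exact: dh1].
apply: C_on_ext oU _ (IH _ _ df2 dh2) => q Uq.
by rewrite /partial deriveD//; [exact: df1|exact: dh1].
Qed.

Lemma C_on_M k U f h : C_on k U f -> C_on k U h -> open U -> C_on k U (fun p => f p * h p).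
Proof.
move=> + + oU; elim: k f h => [|k IH] f h Cf Ch; have [cf df] := Cf; have [ch dh] := Ch.
  by split=> // p Up; apply: continuousM; [exact: cf|exact: ch].
split; first by move=> p Up; apply: continuousM; [exact: cf|exact: ch].
move=> i; have [df1 df2] := df i; have [dh1 dh2] := dh i; split.
  by move=> p Up; apply: derivableM; [exact: df1|exact: dh1].
have := C_on_D (IH _ _ (C_on_le Cf) dh2) (IH _ _ (C_on_le Ch) df2) oU.
apply: C_on_ext oU _ => q Uq.
by rewrite /partial deriveM//; [exact: df1|exact: dh1].
Qed.

Lemma C_on_N k U f : open U -> C_on k U f -> C_on k U (fun p => - f p).
Proof.
move=> oU Cf; have := C_on_M (C_on_cst k U (-1)) Cf oU.
by apply: C_on_ext => // q _; rewrite mulN1r.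
Qed.

Lemma C_on_V k U f : open U -> (forall p, U p -> f p != 0) -> C_on k U f ->
  C_on k U (fun p => (f p)^-1).
Proof.
move=> oU f0; elim: k => [|k IH] Cf; have [cf df] := Cf.
  by split=> // p Up; apply: continuousV; [exact: f0|exact: cf].
split; first by move=> p Up; apply: continuousV; [exact: f0|exact: cf].
move=> i; have [df1 df2] := df i; split.
  by move=> p Up; apply: derivableV; [exact: f0|exact: df1].
have CV := IH (C_on_le Cf).
have := C_on_N oU (C_on_M (C_on_M CV CV oU) df2 oU).
apply: C_on_ext oU _ => q Uq; rewrite /partial deriveV; [|exact: f0|exact: df1].
by rewrite -exprVn expr2 scaleNr.
Qed.

Lemma C_on_bigsum k U (I : Type) (r : seq I) (P : pred I) (F : I -> 'rV[R]_n -> R) :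
  open U -> (forall j, P j -> C_on k U (F j)) -> C_on k U (fun p => \sum_(j <- r | P j) F j p).
Proof.
move=> oU CF; elim: r => [|a r IH].
  by apply: C_on_ext oU _ (C_on_cst k U 0) => q _; rewrite big_nil.
have [Pa|Pa] := boolP (P a); last by apply: C_on_ext oU _ IH => q _; rewrite big_cons (negbTE Pa).
by apply: C_on_ext oU _ (C_on_D (CF _ Pa) IH oU) => q _; rewrite big_cons Pa.
Qed.

Lemma C_on_bigprod k U (I : Type) (r : seq I) (P : pred I) (F : I -> 'rV[R]_n -> R) :
  open U -> (forall j, P j -> C_on k U (F j)) -> C_on k U (fun p => \prod_(j <- r | P j) F j p).
Proof.
move=> oU CF; elim: r => [|a r IH].
  by apply: C_on_ext oU _ (C_on_cst k U 1) => q _; rewrite big_nil.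
have [Pa|Pa] := boolP (P a); last by apply: C_on_ext oU _ IH => q _; rewrite big_cons (negbTE Pa).
by apply: C_on_ext oU _ (C_on_M (CF _ Pa) IH oU) => q _; rewrite big_cons Pa.
Qed.

End C1_differentiable.

Section Composition.
Context {R : realType}.

Lemma row_C1_differentiable n m (V : set 'rV[R]_n) (F : 'rV[R]_n -> 'rV[R]_m) p :
  open V -> (forall b, C_on 1 V (fun q => F q 0 b)) -> V p -> differentiable F p.
Proof.
move=> oV CF Vp.
rewrite (_ : F = \sum_b (fun q => F q 0 b *: (delta_mx 0 b : 'rV[R]_m))); last first.
  by apply/funext => q; rewrite fct_sumE {1}(row_sum_delta (F q)).
apply: differentiable_sum => b; apply: differentiableZl.
exact: C1_differentiable oV (CF b) Vp.
Qed.

Lemma derive_coordE n m (V : set 'rV[R]_n) (F : 'rV[R]_n -> 'rV[R]_m) p v b :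
  open V -> (forall b, C_on 1 V (fun q => F q 0 b)) -> V p ->
  ('D_v F p) 0 b = 'D_v (fun q => F q 0 b) p.
Proof.
move=> oV CF Vp.
have dF : derivable F p v by apply: diff_derivable; exact: row_C1_differentiable oV CF Vp.
by rewrite (derive_mx dF) mxE.
Qed.

Lemma jacobianE n m (V : set 'rV[R]_n) (F : 'rV[R]_n -> 'rV[R]_m) p a b :
  open V -> (forall b, C_on 1 V (fun q => F q 0 b)) -> V p ->
  ('J F p) a b = partial a (fun q => F q 0 b) p.
Proof.
move=> oV CF Vp; rewrite /partial -(derive_coordE _ _ oV CF Vp).
rewrite deriveE; last exact: row_C1_differentiable oV CF Vp.
by rewrite /jacobian -(mul_rV_lin1 ('d F p)) -rowE [RHS]mxE.
Qed.

Lemma comp_derive n m (V : set 'rV[R]_n) (U : set 'rV[R]_m) (F : 'rV[R]_n -> 'rV[R]_m)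
    (f : 'rV[R]_m -> R) p v :
  open V -> open U -> (forall b, C_on 1 V (fun q => F q 0 b)) -> C_on 1 U f ->
  V p -> U (F p) ->
  derivable (f \o F) p v /\
  'D_v (f \o F) p = \sum_b 'D_v (fun q => F q 0 b) p * partial b f (F p).
Proof.
move=> oV oU CF Cf Vp UF.
have dF : differentiable F p by exact: row_C1_differentiable oV CF Vp.
have df : differentiable f (F p) by exact: C1_differentiable oU Cf UF.
have dfF : differentiable (f \o F) p by exact: differentiable_comp.
split; first exact: diff_derivable.
rewrite deriveE// diff_comp//= (C1_diffE oU Cf UF) /lform.
by apply: eq_bigr => b _; rewrite -(derive_coordE _ _ oV CF Vp) deriveE.
Qed.

Lemma partial_comp n m (V : set 'rV[R]_n) (U : set 'rV[R]_m) (F : 'rV[R]_n -> 'rV[R]_m)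
    (f : 'rV[R]_m -> R) p i :
  open V -> open U -> (forall b, C_on 1 V (fun q => F q 0 b)) -> C_on 1 U f ->
  V p -> U (F p) ->
  partial i (f \o F) p = \sum_b partial i (fun q => F q 0 b) p * partial b f (F p).
Proof. by move=> oV oU CF Cf Vp UF; exact: (comp_derive (delta_mx 0 i) oV oU CF Cf Vp UF).2. Qed.

Lemma row_C0_continuous n m (V : set 'rV[R]_n) (F : 'rV[R]_n -> 'rV[R]_m) p :
  (forall b, C_on 0 V (fun q => F q 0 b)) -> V p -> {for p, continuous F}.
Proof.
move=> CF Vp; apply/continuous_atP => e e0.
have nb b : \forall q \near p, `|F p 0 b - F q 0 b| <= e.
  by have [/(_ _ Vp)/continuous_atP/(_ _ e0)] := CF b.
apply: near_imp (near_forall nb) _ => q H.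
by apply: norm_le_coord => [|a b]; [exact: ltW|rewrite ord1 !mxE].
Qed.

Lemma C_on_comp k n m (V : set 'rV[R]_n) (U : set 'rV[R]_m) (F : 'rV[R]_n -> 'rV[R]_m)
    (f : 'rV[R]_m -> R) :
  open V -> open U -> (forall p, V p -> U (F p)) ->
  (forall b, C_on k V (fun q => F q 0 b)) -> C_on k U f -> C_on k V (f \o F).
Proof.
move=> oV oU VU; elim: k f => [|k IH] f CF Cf.
  split=> // p Vp; apply: continuous_comp; first exact: row_C0_continuous CF Vp.
  by apply: (C_on_continuous Cf); exact: VU.
have CF1 b : C_on 1 V (fun q => F q 0 b) by apply: C_on_leq (CF b).
have Cf1 : C_on 1 U f by exact: C_on_leq Cf.
have CF' b : C_on k V (fun q => F q 0 b) by apply: C_on_le.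
split.
  move=> p Vp; apply: continuous_comp; last by apply: (C_on_continuous Cf); exact: VU.
  by apply: row_C0_continuous Vp => b; exact: C_on_leq (CF b).
move=> i; split.
  by move=> p Vp; have [] := comp_derive (delta_mx 0 i) oV oU CF1 Cf1 Vp (VU _ Vp).
apply: (@C_on_ext _ _ k V (fun p => \sum_b partial i (fun q => F q 0 b) p * (partial b f \o F) p)) => //.
  by move=> q Vq; rewrite (partial_comp i oV oU CF1 Cf1 Vq (VU _ Vq)).
apply: C_on_bigsum => // b _; apply: C_on_M => //.
  by have [_ /(_ i)[]] := CF b.
by apply: IH => //; have [_ /(_ b)[]] := Cf.
Qed.

End Composition.

Section Schwarz.
Context {R : realType} {n : nat}.
Implicit Types (f : 'rV[R]_n -> R) (U : set 'rV[R]_n).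

(** The mean value theorem is used twice: in direction [i] for the difference of [f] and its
    translate along [j], then in direction [j] for [partial i f]. *)
Lemma second_difference f (p : 'rV[R]_n) r (i j : 'I_n) (a : R) :
  0 < a -> a + a < r -> C_on 2 (ball p r) f ->
  exists2 q, ball p r q &
    f (a *: delta_mx 0 j + (a *: delta_mx 0 i + p)) - f (a *: delta_mx 0 i + p)
     - (f (a *: delta_mx 0 j + p) - f p) = a * a * partial j (partial i f) q.
Proof.
move=> a0 ar Cf; have oB : open (ball p r) by exact: ball_open.
have C1 : C_on 1 (ball p r) f by exact: C_on_le.
have C1i : C_on 1 (ball p r) (partial i f) by have [_ /(_ i)[]] := Cf.
have inb (s t : R) : 0 <= s <= a -> 0 <= t <= a ->
    ball p r (t *: delta_mx 0 j + (s *: delta_mx 0 i + p)).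
  move=> /andP[s0 sa] /andP[t0 ta]; rewrite in_ballE addrA opprD addrCA subrr addr0 normrN.
  apply: le_lt_trans ar; apply: le_trans (ler_normD _ _) _; rewrite !normrZ !ger0_norm//.
  apply: lerD; [apply: le_trans ta|apply: le_trans sa]; rewrite ler_piMr//; exact: norm_delta_le1.
have pd (t s : R) (q : 'rV[R]_n) (k : 'I_n) g : C_on 1 (ball p r) g ->
   ball p r (s *: delta_mx 0 k + q) ->
   is_derive s 1 (fun s : R => g (s *: delta_mx 0 k + q)) (partial k g (s *: delta_mx 0 k + q)).
  by move=> [_ /(_ k)[Dg _]] Bq; apply: partial_line; exact: Dg.
have [|s] := @MVT_between _
  (fun s : R => f (s *: delta_mx 0 i + (a *: delta_mx 0 j + p)) - f (s *: delta_mx 0 i + p))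
  (fun s : R => partial i f (s *: delta_mx 0 i + (a *: delta_mx 0 j + p))
     - partial i f (s *: delta_mx 0 i + p)) 0 a.
  move=> s hs; have {}hs : 0 <= s <= a.
    by case/orP: hs => // /andP[s1 s2]; rewrite (le_trans (ltW a0) s1) (le_trans s2 (ltW a0)).
  have z0 : 0 <= (0 : R) <= a by rewrite lexx ltW.
  have za : 0 <= a <= a by rewrite lexx ltW.
  apply: is_deriveB; apply: pd => //.
    by rewrite addrCA; exact: inb.
  by have := inb _ _ hs z0; rewrite scale0r add0r.
move=> hs0; have {hs0} hs : 0 <= s <= a.
  by case/orP: hs0 => // /andP[s1 s2]; rewrite (le_trans (ltW a0) s1) (le_trans s2 (ltW a0)).
rewrite !scale0r !add0r subr0 => E1.
have [|t] := @MVT_between _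
  (fun t : R => partial i f (t *: delta_mx 0 j + (s *: delta_mx 0 i + p)))
  (fun t : R => partial j (partial i f) (t *: delta_mx 0 j + (s *: delta_mx 0 i + p))) 0 a.
  move=> t ht; apply: pd => //; apply: inb => //.
  by case/orP: ht => // /andP[s1 s2]; rewrite (le_trans (ltW a0) s1) (le_trans s2 (ltW a0)).
move=> ht0; have {ht0} ht : 0 <= t <= a.
  by case/orP: ht0 => // /andP[s1 s2]; rewrite (le_trans (ltW a0) s1) (le_trans s2 (ltW a0)).
rewrite !scale0r !add0r subr0 => E2.
exists (t *: delta_mx 0 j + (s *: delta_mx 0 i + p)); first exact: inb.
rewrite mulrC mulrA -E2 -(addrCA (s *: _)) -E1.
by rewrite (addrCA (a *: delta_mx 0 i)).
Qed.

Let dist_half (x y z d : R) : `|x - z| <= d / 2 -> `|y - z| <= d / 2 -> `|y - x| <= d.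
Proof. by rewrite !ler_norml => /andP[? ?] /andP[? ?]; apply/andP; split; lra. Qed.

(** The second difference is symmetric in [i] and [j], so the two mixed derivatives take a common
    value at two points near [p]; continuity moves both points to [p]. *)
Lemma schwarz U f p i j : open U -> C_on 2 U f -> U p ->
  partial i (partial j f) p = partial j (partial i f) p.
Proof.
move=> oU Cf Up; apply/eqP; rewrite -subr_eq0 -normr_le0; apply/ler_addgt0Pl => e e0.
have e20 : 0 < e / 2 by rewrite divr_gt0.
have cont k l : {for p, continuous (partial k (partial l f))}.
  have [_ /(_ l)[_ [_ /(_ k)[_ [c _]]]]] := Cf; exact: c.
have /continuous_atP /(_ _ e20) N1 := cont i j.
have /continuous_atP /(_ _ e20) N2 := cont j i.
have N3 : nbhs p U by exact: open_nbhs_nbhs.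
have [r r0 rH] := near_in_ball (near_and (near_and N1 N2) N3).
have Cr : C_on 2 (ball p r) f by apply: C_on_sub Cf => q /rH[].
pose a := r / 3; have a0 : 0 < a by rewrite divr_gt0.
have ar : a + a < r.
  by rewrite -ltrBrDr (_ : r - a = a + a) ?ltrDl// /a; field.
have [q1 /rH[[_ B1] _] E1] := second_difference i j a0 ar Cr.
have [q2 /rH[[B2 _] _] E2] := second_difference j i a0 ar Cr.
have E : partial j (partial i f) q1 = partial i (partial j f) q2.
  apply: (@mulfI _ (a * a)); first by rewrite mulf_neq0// gt_eqF.
  have sw (x y z w : R) : x - y - (z - w) = x - z - (y - w) by ring.
  rewrite -[LHS]E1 -[RHS]E2.
  have -> : a *: delta_mx 0 i + (a *: delta_mx 0 j + p) = a *: delta_mx 0 j + (a *: delta_mx 0 i + p).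
    exact: addrCA.
  exact: sw.
rewrite E in B1.
rewrite addr0; exact: dist_half B1 B2.
Qed.

End Schwarz.

Section Smooth.
Context {R : realType} {n : nat}.
Implicit Types (f h : 'rV[R]_n -> R) (U V : set 'rV[R]_n).

Lemma smooth_C U f k : smooth_on U f -> C_on k U f. Proof. by move=> /(_ k). Qed.

Lemma smooth_sub U V f : U `<=` V -> smooth_on V f -> smooth_on U f.
Proof. by move=> UV sf k; apply: C_on_sub UV (sf k). Qed.

Lemma smooth_ext U f h : open U -> (forall q, U q -> f q = h q) ->
  smooth_on U f -> smooth_on U h.
Proof. by move=> oU fh sf k; exact: C_on_ext oU fh (sf k). Qed.

Lemma smooth_pointwise U f :
  (forall p, U p -> exists2 V, V p & smooth_on V f) -> smooth_on U f.
Proof.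
by move=> H k; apply: C_on_pointwise => p /H[V Vp sf]; exists V.
Qed.

Lemma smooth_cst U c : smooth_on U (fun=> c).
Proof. by move=> k; exact: C_on_cst. Qed.

Lemma smooth_coord U i : smooth_on U (fun p => p 0 i).
Proof. by move=> k; exact: C_on_coord. Qed.

Lemma smoothD U f h : open U -> smooth_on U f -> smooth_on U h ->
  smooth_on U (fun p => f p + h p).
Proof. by move=> oU sf sh k; exact: C_on_D. Qed.

Lemma smoothM U f h : open U -> smooth_on U f -> smooth_on U h ->
  smooth_on U (fun p => f p * h p).
Proof. by move=> oU sf sh k; exact: C_on_M. Qed.

Lemma smoothN U f : open U -> smooth_on U f -> smooth_on U (fun p => - f p).
Proof. by move=> oU sf k; exact: C_on_N. Qed.

Lemma smoothB U f h : open U -> smooth_on U f -> smooth_on U h ->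
  smooth_on U (fun p => f p - h p).
Proof. by move=> oU sf sh; apply: smoothD => //; exact: smoothN. Qed.

Lemma smoothX U f m : open U -> smooth_on U f -> smooth_on U (fun p => f p ^+ m).
Proof.
move=> oU sf; elim: m => [|m IH]; first exact: smooth_cst.
by apply: smooth_ext oU _ (smoothM oU sf IH) => q _; rewrite exprS.
Qed.

Lemma smoothV U f : open U -> (forall p, U p -> f p != 0) -> smooth_on U f ->
  smooth_on U (fun p => (f p)^-1).
Proof. by move=> oU f0 sf k; exact: C_on_V. Qed.

Lemma smooth_sum U (I : Type) (r : seq I) (P : pred I) (F : I -> 'rV[R]_n -> R) :
  open U -> (forall j, smooth_on U (F j)) -> smooth_on U (fun p => \sum_(j <- r | P j) F j p).
Proof. by move=> oU sF k; apply: C_on_bigsum => // j _; exact: sF. Qed.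

Lemma smooth_prod U (I : Type) (r : seq I) (P : pred I) (F : I -> 'rV[R]_n -> R) :
  open U -> (forall j, smooth_on U (F j)) -> smooth_on U (fun p => \prod_(j <- r | P j) F j p).
Proof. by move=> oU sF k; apply: C_on_bigprod => // j _; exact: sF. Qed.

Lemma smooth_partial U f i : smooth_on U f -> smooth_on U (partial i f).
Proof. by move=> sf k; have [_ /(_ i)[]] := sf k.+1. Qed.

Lemma smooth_continuous U f p : smooth_on U f -> U p -> {for p, continuous f}.
Proof. by move=> /(_ 0%N)[+ _]; exact. Qed.

Lemma smooth_derivable U f p i : smooth_on U f -> U p -> derivable f p (delta_mx 0 i).
Proof. by move=> /(_ 1%N)[_ /(_ i)[+ _]]; exact. Qed.

Lemma partialD U f h i p : smooth_on U f -> smooth_on U h -> U p ->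
  partial i (fun q => f q + h q) p = partial i f p + partial i h p.
Proof.
move=> sf sh Up; rewrite /partial.
by rewrite -deriveD//; exact: smooth_derivable Up.
Qed.

Lemma partialN U f i p : smooth_on U f -> U p ->
  partial i (fun q => - f q) p = - partial i f p.
Proof. by move=> sf Up; rewrite /partial -deriveN//; exact: smooth_derivable Up. Qed.

Lemma partialB U f h i p : open U -> smooth_on U f -> smooth_on U h -> U p ->
  partial i (fun q => f q - h q) p = partial i f p - partial i h p.
Proof.
move=> oU sf sh Up; rewrite (partialD i sf (smoothN oU sh) Up).
by rewrite (partialN i sh Up).
Qed.

Lemma partialM U f h i p : smooth_on U f -> smooth_on U h -> U p ->
  partial i (fun q => f q * h q) p = partial i f p * h p + f p * partial i h p.
Proof.
move=> sf sh Up; rewrite /partial.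
rewrite (deriveM (smooth_derivable (i := i) sf Up) (smooth_derivable (i := i) sh Up)).
by rewrite /GRing.scale /= (mulrC (h p)) addrC.
Qed.

Lemma partial_cst c i p : partial i (fun _ : 'rV[R]_n => c) p = 0.
Proof. by rewrite /partial derive_cst. Qed.

Lemma partial_coord i j p : partial i (fun q : 'rV[R]_n => q 0 j) p = (i == j)%:R.
Proof. by rewrite /partial derive_coord mxE eqxx /= eq_sym. Qed.

Lemma partialZ U f i p c : smooth_on U f -> U p ->
  partial i (fun q => c * f q) p = c * partial i f p.
Proof.
move=> sf Up; rewrite (partialM i (@smooth_cst U c) sf Up) partial_cst.
by rewrite mul0r add0r.
Qed.

Lemma partial_sum U (I : Type) (r : seq I) (P : pred I) (F : I -> 'rV[R]_n -> R) i p :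
  open U -> (forall j, smooth_on U (F j)) -> U p ->
  partial i (fun q => \sum_(j <- r | P j) F j q) p = \sum_(j <- r | P j) partial i (F j) p.
Proof.
move=> oU sF Up; elim: r => [|a r IH].
  rewrite big_nil -[RHS](partial_cst 0 i p); apply: (partial_ext i oU _ Up) => q _.
  by rewrite big_nil.
rewrite big_cons -IH; case: ifP => Pa; last first.
  by apply: (partial_ext i oU _ Up) => q _; rewrite big_cons Pa.
rewrite -(partialD i (sF a) _ Up); last exact: smooth_sum.
by apply: (partial_ext i oU _ Up) => q _; rewrite big_cons Pa.
Qed.

Lemma partialC U f i j p : open U -> smooth_on U f -> U p ->
  partial i (partial j f) p = partial j (partial i f) p.
Proof. by move=> oU sf Up; exact: schwarz oU (sf 2%N) Up. Qed.

Lemma smooth_is_derive_line U f a v (t : R) : open U -> smooth_on U f -> U (t *: v + a) ->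
  is_derive t 1 (fun s : R => f (s *: v + a)) (\sum_i v 0 i * partial i f (t *: v + a)).
Proof. by move=> oU sf; exact: C1_is_derive_line. Qed.

End Smooth.

(** * Matrix-valued fields and Riemannian geometry in a chart *)

Section MatrixFields.
Context {R : realType} {n : nat}.
Implicit Types (U : set 'rV[R]_n).

Definition smx U a b (A : 'rV[R]_n -> 'M[R]_(a, b)) : Prop :=
  forall i j, smooth_on U (fun p => A p i j).

Definition dmx a b (k : 'I_n) (A : 'rV[R]_n -> 'M[R]_(a, b)) p : 'M[R]_(a, b) :=
  \matrix_(i, j) partial k (fun q => A q i j) p.

Lemma smx_sub U V a b (A : 'rV[R]_n -> 'M[R]_(a, b)) : U `<=` V -> smx V A -> smx U A.
Proof. by move=> UV sA i j; exact: smooth_sub UV (sA i j). Qed.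

Lemma dmx_ext U a b (A B : 'rV[R]_n -> 'M[R]_(a, b)) k p : open U ->
  (forall q, U q -> A q = B q) -> U p -> dmx k A p = dmx k B p.
Proof.
move=> oU AB Up; apply/matrixP => i j; rewrite !mxE.
by apply: (partial_ext k oU _ Up) => q /AB ->.
Qed.

Lemma smx_dmx U a b k (A : 'rV[R]_n -> 'M[R]_(a, b)) : open U -> smx U A -> smx U (dmx k A).
Proof.
move=> oU sA i j; apply: smooth_ext oU _ (smooth_partial k (sA i j)) => q _.
by rewrite mxE.
Qed.

Lemma smx_cst U a b (A : 'M[R]_(a, b)) : smx U (fun=> A).
Proof. by move=> i j; exact: smooth_cst. Qed.

Lemma smxM U a b c (A : 'rV[R]_n -> 'M[R]_(a, b)) (B : 'rV[R]_n -> 'M[R]_(b, c)) :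
  open U -> smx U A -> smx U B -> smx U (fun p => A p *m B p).
Proof.
move=> oU sA sB i j.
apply: (smooth_ext oU (f := fun p => \sum_k A p i k * B p k j)) => [q _|]; first by rewrite mxE.
by apply: smooth_sum => // k; exact: smoothM.
Qed.

Lemma smxD U a b (A B : 'rV[R]_n -> 'M[R]_(a, b)) :
  open U -> smx U A -> smx U B -> smx U (fun p => A p + B p).
Proof.
move=> oU sA sB i j; apply: smooth_ext oU _ (smoothD oU (sA i j) (sB i j)) => q _.
by rewrite mxE.
Qed.

Lemma smxN U a b (A : 'rV[R]_n -> 'M[R]_(a, b)) :
  open U -> smx U A -> smx U (fun p => - A p).
Proof.
move=> oU sA i j; apply: smooth_ext oU _ (smoothN oU (sA i j)) => q _.
by rewrite mxE.
Qed.

Lemma smxB U a b (A B : 'rV[R]_n -> 'M[R]_(a, b)) :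
  open U -> smx U A -> smx U B -> smx U (fun p => A p - B p).
Proof. by move=> oU sA sB; apply: smxD => //; exact: smxN. Qed.

Lemma smx_tr U a b (A : 'rV[R]_n -> 'M[R]_(a, b)) :
  open U -> smx U A -> smx U (fun p => (A p)^T).
Proof. by move=> oU sA i j; apply: smooth_ext oU _ (sA j i) => q _; rewrite mxE. Qed.

Lemma dmx_cst a b (A : 'M[R]_(a, b)) k p : dmx k (fun=> A) p = 0.
Proof. by apply/matrixP => i j; rewrite !mxE partial_cst. Qed.

Lemma dmxM U a b c (A : 'rV[R]_n -> 'M[R]_(a, b)) (B : 'rV[R]_n -> 'M[R]_(b, c)) k p :
  open U -> smx U A -> smx U B -> U p ->
  dmx k (fun q => A q *m B q) p = dmx k A p *m B p + A p *m dmx k B p.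
Proof.
move=> oU sA sB Up; apply/matrixP => i j; rewrite !mxE -big_split /=.
rewrite (partial_ext (h := fun q => \sum_l A q i l * B q l j) k oU _ Up); last first.
  by move=> q _; rewrite mxE.
rewrite (partial_sum (F := fun l q => A q i l * B q l j) _ _ _ oU _ Up); last first.
  by move=> l; exact: smoothM.
by apply: eq_bigr => l _; rewrite (partialM k (sA i l) (sB l j) Up) !mxE.
Qed.

Lemma dmxD U a b (A B : 'rV[R]_n -> 'M[R]_(a, b)) k p :
  open U -> smx U A -> smx U B -> U p ->
  dmx k (fun q => A q + B q) p = dmx k A p + dmx k B p.
Proof.
move=> oU sA sB Up; apply/matrixP => i j; rewrite !mxE -(partialD k (sA i j) (sB i j) Up).
by apply: (partial_ext k oU _ Up) => q _; rewrite mxE.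
Qed.

Lemma dmxN U a b (A : 'rV[R]_n -> 'M[R]_(a, b)) k p :
  open U -> smx U A -> U p -> dmx k (fun q => - A q) p = - dmx k A p.
Proof.
move=> oU sA Up; apply/matrixP => i j; rewrite !mxE -(partialN k (sA i j) Up).
by apply: (partial_ext k oU _ Up) => q _; rewrite mxE.
Qed.

Lemma dmxB U a b (A B : 'rV[R]_n -> 'M[R]_(a, b)) k p :
  open U -> smx U A -> smx U B -> U p ->
  dmx k (fun q => A q - B q) p = dmx k A p - dmx k B p.
Proof.
move=> oU sA sB Up; rewrite (dmxD k oU sA (smxN oU sB) Up).
by rewrite (dmxN k oU sB Up).
Qed.

Lemma dmx_tr a b (A : 'rV[R]_n -> 'M[R]_(a, b)) k p :
  dmx k (fun q => (A q)^T) p = (dmx k A p)^T.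
Proof.
apply/matrixP => i j; rewrite !mxE; congr partial.
by apply/funext => q; rewrite mxE.
Qed.

Lemma dmxC U a b (A : 'rV[R]_n -> 'M[R]_(a, b)) k l p :
  open U -> smx U A -> U p -> dmx k (dmx l A) p = dmx l (dmx k A) p.
Proof.
move=> oU sA Up; apply/matrixP => i j; rewrite [LHS]mxE [RHS]mxE.
transitivity (partial k (partial l (fun q => A q i j)) p).
  by apply: (partial_ext k oU _ Up) => q _; rewrite mxE.
rewrite (partialC k l oU (sA i j) Up).
by apply: (partial_ext l oU _ Up) => q _; rewrite mxE.
Qed.

Lemma smooth_det U m (A : 'rV[R]_n -> 'M[R]_m) : open U -> smx U A ->
  smooth_on U (fun p => \det (A p)).
Proof.
move=> oU sA; apply: smooth_sum => // s; apply: smoothM => //.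
  exact: smooth_cst.
by apply: smooth_prod => // i; exact: sA.
Qed.

(** By Cramer's rule the entries are cofactors divided by the determinant. *)
Lemma smx_invmx U m (A : 'rV[R]_n -> 'M[R]_m) : open U -> smx U A ->
  (forall p, U p -> A p \in unitmx) -> smx U (fun p => invmx (A p)).
Proof.
move=> oU sA uA i j.
apply: (smooth_ext oU (f := fun p => (\det (A p))^-1 * ((-1) ^+ (j + i) * \det (row' j (col' i (A p)))))).
  by move=> q Uq; rewrite /invmx (uA _ Uq) !mxE.
apply: smoothM => //.
  apply: smoothV => //; last exact: smooth_det.
  by move=> p /uA; rewrite unitmxE unitfE.
apply: smoothM => //; first exact: smooth_cst.
apply: smooth_det => // a b; apply: smooth_ext oU _ (sA (lift j a) (lift i b)) => q _.
by rewrite !mxE.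
Qed.

Lemma dmx_invmx U m (A : 'rV[R]_n -> 'M[R]_m) k p : open U -> smx U A ->
  (forall q, U q -> A q \in unitmx) -> U p ->
  dmx k (fun q => invmx (A q)) p = - (invmx (A p) *m dmx k A p *m invmx (A p)).
Proof.
move=> oU sA uA Up; have sI := smx_invmx oU sA uA.
have := dmxM k oU sI sA Up.
rewrite (dmx_ext (B := fun=> 1%:M) k oU _ Up); last by move=> q /uA; exact: mulVmx.
rewrite dmx_cst => /esym/eqP; rewrite addr_eq0 => /eqP E.
by rewrite -[LHS]mulmx1 -(mulmxV (uA _ Up)) mulmxA E mulNmx.
Qed.

End MatrixFields.

(** * Positive definite matrices and the traces they define *)

Section PosDef.
Context {R : realType}.

Definition posdef n (A : 'M[R]_n) : Prop :=
  forall v : 'rV[R]_n, v != 0 -> 0 < (v *m A *m v^T) 0 0.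

Lemma posdef_unit n (A : 'M[R]_n) : posdef A -> A \in unitmx.
Proof.
move=> pA; rewrite -row_free_unit -kermx_eq0; apply/negPn/negP => /rowV0Pn[v].
move=> /sub_kermxP vA v0; have := pA _ v0.
by rewrite vA mul0mx mxE ltxx.
Qed.

(** Symmetric Gaussian elimination. After the pivot [a] the Schur complement [S] is again positive
    definite, because x S x^T is the value of the form [A] on the row (- a^-1 x b^T, x). *)
Lemma posdef_diagonalize n (A : 'M[R]_n) : A^T = A -> posdef A ->
  exists E : 'M[R]_n, E *m A *m E^T = 1%:M.
Proof.
elim: n A => [|n IH] A; first by exists 1%:M; apply/matrixP => -[].
suff: forall A : 'M[R]_(1 + n), A^T = A -> posdef A ->
    exists E : 'M[R]_(1 + n), E *m A *m E^T = 1%:M by exact.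
move=> {}A sA pA.
pose a := ulsubmx A 0 0; pose b := ursubmx A; pose D := drsubmx A.
have EA : A = block_mx a%:M b b^T D.
  rewrite -[LHS](submxK A); congr block_mx; first exact: mx11_scalar.
  by rewrite /b -[in RHS]sA -trmx_dlsub trmxK.
have a0 : 0 < a.
  have nz : row_mx 1%:M 0 != 0 :> 'rV[R]_(1 + n).
    by apply/eqP => /(congr1 (fun M : 'rV_(1 + n) => M 0 (lshift n 0)))/eqP; rewrite row_mxEl !mxE eqxx oner_eq0.
  have := pA _ nz; rewrite EA tr_row_mx mul_row_block mul_row_col !mul1mx.
  by rewrite !mul0mx !addr0 trmx0 mulmx0 addr0 trmx1 mulmx1 mxE eqxx.
have an : a != 0 by rewrite gt_eqF.
have sD : D^T = D by rewrite /D trmx_drsub sA.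
pose S := D - a^-1 *: (b^T *m b).
have sS : S^T = S by rewrite /S raddfB /= sD linearZ /= trmx_mul trmxK.
have key (x : 'rV[R]_n) : row_mx (- a^-1 *: (x *m b^T)) x *m A =
    row_mx 0 (x *m S).
  rewrite EA mul_row_block mul_mx_scalar scalerA mulrN mulfV// scaleN1r addNr.
  congr row_mx; rewrite /S mulmxBr addrC -scalemxAl -scalemxAr mulmxA.
  by rewrite scaleNr.
have pS : posdef S.
  move=> x x0; have nz : row_mx (- a^-1 *: (x *m b^T)) x != 0.
    by rewrite row_mx_eq0 negb_and x0 orbT.
  by have := pA _ nz; rewrite key tr_row_mx mul_row_col mul0mx add0r.
have [E' EE'] := IH _ sS pS.
pose s := Num.sqrt a; have s2 : s * s = a by rewrite -expr2 sqr_sqrtr// ltW.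
have sn : s != 0 by rewrite gt_eqF// sqrtr_gt0.
exists (block_mx (s^-1)%:M 0 (- a^-1 *: (E' *m b^T)) E').
have sa : s^-1 * a = s by rewrite -s2 mulKf.
rewrite {1}EA mulmx_block !mul0mx !addr0 -scalar_mxM sa tr_block_mx trmx0.
have -> : - a^-1 *: (E' *m b^T) *m a%:M + E' *m b^T = 0.
  by rewrite mul_mx_scalar scalerA mulrN mulfV// scaleN1r addNr.
have -> : - a^-1 *: (E' *m b^T) *m b + E' *m D = E' *m S.
  by rewrite /S mulmxBr addrC -scalemxAl -scalemxAr mulmxA scaleNr.
rewrite mulmx_block !mul0mx !add0r EE' !mulmx0 addr0 tr_scalar_mx -scalar_mxM.
rewrite mulfV//.
have -> : s%:M *m (- a^-1 *: (E' *m b^T))^T + (s^-1)%:M *m b *m E'^T = 0.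
  rewrite linearZ /= trmx_mul trmxK !mul_scalar_mx scalerA -scalemxAl -scalerDl.
  by rewrite mulrN -s2 invfM mulrA mulfV// mul1r addNr scale0r.
by rewrite -scalar_mx_block.
Qed.

Lemma posdef_inv_factor n (A : 'M[R]_n) : A^T = A -> posdef A ->
  exists2 E : 'M[R]_n, E \in unitmx & invmx A = E^T *m E.
Proof.
move=> sA pA; have uA := posdef_unit pA.
have [E EE] := posdef_diagonalize sA pA.
have uE : E \in unitmx by have [] := mulmx1_unit (esym (esym (etrans (mulmxA _ _ _) EE))).
exists E => //; apply: (can_inj (mulmxK uA)); rewrite mulVmx//.
have /mulmx1C : (E *m A) *m E^T = 1%:M by [].
by rewrite mulmxA.
Qed.

(** With [J] the Jacobian of a change of charts, this is the invariance of the inner product of two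
    covectors. *)
Lemma congruence_cancel m (J H : 'M[R]_m) (a b : 'cV[R]_m) :
  J \in unitmx -> H \in unitmx ->
  (J *m a)^T *m invmx (J *m H *m J^T) *m (J *m b) = a^T *m invmx H *m b.
Proof.
move=> uJ uH; have uJt : J^T \in unitmx by rewrite unitmx_tr.
have -> : invmx (J *m H *m J^T) = invmx J^T *m invmx H *m invmx J.
  apply: (can_inj (mulmxK (_ : J *m H *m J^T \in unitmx))).
    by rewrite !unitmx_mul uJ uH.
  rewrite mulVmx ?unitmx_mul ?uJ ?uH// !mulmxA (mulmxKV uJ) (mulmxKV uH) mulVmx//.
by rewrite trmx_mul !mulmxA (mulmxK uJt) (mulmxKV uJ).
Qed.

Lemma trmx_invmx_sym n (A : 'M[R]_n) : A^T = A -> (invmx A)^T = invmx A.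
Proof. by move=> sA; rewrite trmx_inv sA. Qed.

(** If the inverse of [A] is E^T E, the trace is the sum of the squares of the entries of E T E^T:
    it is |T|^2 for the metric [A]. *)
Lemma mxtrace_sq_ge0 n (A T : 'M[R]_n) : A^T = A -> posdef A -> T^T = T ->
  0 <= \tr (invmx A *m T *m invmx A *m T) /\
  (\tr (invmx A *m T *m invmx A *m T) = 0 -> T = 0).
Proof.
move=> sA pA sT; have [E uE ->] := posdef_inv_factor sA pA.
pose X := E *m T *m E^T.
have XT : X^T = X by rewrite /X !trmx_mul trmxK sT mulmxA.
have -> : \tr (E^T *m E *m T *m (E^T *m E) *m T) = \sum_i \sum_j X i j ^+ 2.
  rewrite -!mulmxA mxtrace_mulC !mulmxA.
  rewrite (_ : E *m T *m E^T *m E *m T *m E^T = X *m X^T); last first.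
    by rewrite XT /X !mulmxA.
  apply: eq_bigr => i _; rewrite mxE; apply: eq_bigr => j _.
  by rewrite [X^T j i]mxE expr2.
have ge0 i : 0 <= \sum_j X i j ^+ 2 by apply: sumr_ge0 => j _; exact: sqr_ge0.
split; first exact: sumr_ge0.
move=> /eqP; rewrite psumr_eq0// => /allP X0.
have XX : X = 0.
  apply/matrixP => i j; rewrite [RHS]mxE; apply/eqP; rewrite -sqrf_eq0.
  have := X0 i (mem_index_enum _); rewrite /= psumr_eq0; last by move=> k _; exact: sqr_ge0.
  by move=> /allP/(_ j (mem_index_enum _)).
have uE' : E^T \in unitmx by rewrite unitmx_tr.
have -> : T = invmx E *m X *m invmx (E^T) by rewrite /X !mulmxA mulVmx// mul1mx mulmxK.
by rewrite XX mulmx0 mul0mx.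
Qed.

(** If the inverse of [A] is E^T E, the trace is the sum of the values of [H] on the rows of E. *)
Lemma mxtrace_invmx_ge0 n (A H : 'M[R]_n) : A^T = A -> posdef A ->
  (forall v : 'rV[R]_n, 0 <= (v *m H *m v^T) 0 0) -> 0 <= \tr (invmx A *m H).
Proof.
move=> sA pA pH; have [E uE ->] := posdef_inv_factor sA pA.
rewrite -mulmxA mxtrace_mulC; apply: sumr_ge0 => i _.
have -> : (E *m H *m E^T) i i = (row i E *m H *m (row i E)^T) 0 0.
  rewrite -row_mul [LHS]mxE [RHS]mxE; apply: eq_bigr => k _.
  by rewrite [row _ _ _ _]mxE ![_^T _ _]mxE [row _ _ _ _]mxE.
exact: pH.
Qed.

Lemma posdef_inv n (A : 'M[R]_n) : A^T = A -> posdef A -> posdef (invmx A).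
Proof.
move=> sA pA v v0; have uA := posdef_unit pA.
have -> : v *m invmx A *m v^T = (v *m invmx A) *m A *m (v *m invmx A)^T.
  by rewrite trmx_mul trmx_invmx_sym// mulmxKV// mulmxA.
apply: pA; apply: contra_neq v0 => H.
by rewrite -(mulmxKV uA v) H mul0mx.
Qed.

End PosDef.

Section MatrixEntries.
Context {R : comNzRingType}.

Lemma mxDE a b (A B : 'M[R]_(a, b)) i j : (A + B) i j = A i j + B i j.
Proof. by rewrite mxE. Qed.

Lemma mxNE a b (A : 'M[R]_(a, b)) i j : (- A) i j = - A i j.
Proof. by rewrite mxE. Qed.

Lemma mxTE a b (A : 'M[R]_(a, b)) i j : A^T i j = A j i.
Proof. by rewrite mxE. Qed.

Lemma mxME a b c (A : 'M[R]_(a, b)) (B : 'M[R]_(b, c)) i j :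
  (A *m B) i j = \sum_k A i k * B k j.
Proof. by rewrite mxE. Qed.

(** The matrices stand for a = d_i C_j, b = d_j C_i, c = C_i, d = C_j, where C is the connection and
    [g] the metric; the hypothesis says that d_i d_j g = d_j d_i g. *)
Lemma curv_skew_alg n (a b c d g : 'M[R]_n) : g^T = g ->
  a *m g + d *m (c *m g + g *m c^T) + (c *m g + g *m c^T) *m d^T + g *m a^T =
  b *m g + c *m (d *m g + g *m d^T) + (d *m g + g *m d^T) *m c^T + g *m b^T ->
  (a - b + d *m c - c *m d) *m g = - ((a - b + d *m c - c *m d) *m g)^T.
Proof.
move=> sg; rewrite trmx_mul sg !raddfD /= !raddfN /= !trmx_mul.
rewrite !(mulmxDl, mulmxDr, mulmxBl, mulmxBr, mulmxA, mulNmx, mulmxN).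
move: (a *m g) (b *m g) (d *m c *m g) (c *m d *m g) (g *m a^T) (g *m b^T).
move: (d *m g *m c^T) (c *m g *m d^T) (g *m c^T *m d^T) (g *m d^T *m c^T).
move=> x1 x2 x3 x4 x5 x6 x7 x8 x9 x10 /matrixP H; apply/matrixP => k l.
have := H k l; rewrite !mxE => {}H.
move: H; move: (x1 _ _) (x2 _ _) (x3 _ _) (x4 _ _) (x5 _ _) (x6 _ _) (x7 _ _) (x8 _ _) (x9 _ _) (x10 _ _).
move=> y1 y2 y3 y4 y5 y6 y7 y8 y9 y10 H.
apply/eqP; rewrite -subr_eq0; apply/eqP.
transitivity (y5 + (y7 + y1) + (y2 + y3) + y9 - (y6 + (y8 + y2) + (y1 + y4) + y10)); first by ring.
by rewrite H subrr.
Qed.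

Lemma commutator_antisym n (a b c d : 'M[R]_n) : a - b + c - d = - (b - a + d - c).
Proof. by apply/matrixP => k l; rewrite !mxE; ring. Qed.

Lemma commutator_cancel m n (x1 x2 x3 x4 x5 x6 x7 : 'M[R]_(m, n)) :
  x5 - (x6 + x3) - (x4 - x2) - (x5 - (x7 + x4) - (x3 - x1)) = - (x6 - x7 + x1 - x2).
Proof. by apply/matrixP => i j; rewrite !mxE; ring. Qed.

(** The algebra of the first Bianchi identity: [C] is the curvature, [D] the derivatives of the
    connection and [S] its quadratic terms; the two symmetries express vanishing torsion. *)
Lemma cyclic_cancel (I : Type) (C D S : I -> I -> I -> R) i j k :
  (forall a b c, C a b c = D a b c - D b a c + S b c a - S a c b) ->
  (forall a b c, D a b c = D a c b) -> (forall a b c, S a b c = S b a c) ->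
  C i j k + C j k i + C k i j = 0.
Proof.
move=> E HD HS; rewrite !E (HD i j k) (HD j k i) (HD k i j) (HS j k i) (HS k i j) (HS i j k).
ring.
Qed.

Lemma sub_sub_cancel m n (a b c d e f : 'M[R]_(m, n)) :
  a - b - (c - d) - (e - f) = a - c - e - (b - d - f).
Proof. by apply/matrixP => i j; rewrite !mxE; ring. Qed.

Lemma add_cancel4 m n (a b c d : 'M[R]_(m, n)) : - a - b + (c + d + a) = - b + c + d.
Proof. by apply/matrixP => i j; rewrite !mxE; ring. Qed.

Lemma add_cancel5 m n (a b c d e f : 'M[R]_(m, n)) :
  a + (- b + c + d) - e = a - e - b + c + d.
Proof. by apply/matrixP => i j; rewrite !mxE; ring. Qed.

Lemma add_cancel3 (a b c : R) : a - b - c = - b - c + a.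
Proof. by ring. Qed.

Lemma sub_eq_rearr (a b c d x y : R) : a - b - (c - d) = - x -> a - b - y = c - d - y - x.
Proof.
move=> E; apply/eqP; rewrite -subr_eq0; apply/eqP.
transitivity (a - b - (c - d) + x); first by ring.
by rewrite E addNr.
Qed.

Lemma mxZE m n a (A : 'M[R]_(m, n)) i j : (a *: A) i j = a * A i j.
Proof. by rewrite mxE. Qed.

Lemma colM m n p (A : 'M[R]_(m, n)) (B : 'M[R]_(n, p)) j : col j (A *m B) = A *m col j B.
Proof. by rewrite !colE mulmxA. Qed.

(** Covariant derivative of the covector T N when D_i N = G^-1 T e_i + a e_i, with [B] the
    connection matrix and [d] the vector e_i. *)
Lemma nabla_product_rule n (dT T B Gi : 'M[R]_n) (N t d : 'cV[R]_n) a :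
  T *m d = t ->
  dT *m N + T *m (- (B^T *m N) + Gi *m t + a *: d) - B *m (T *m N) =
  (dT - B *m T - T *m B^T) *m N + T *m (Gi *m t) + a *: t.
Proof.
move=> <-; rewrite !mulmxDr mulmxN !mulmxBl -!mulmxA -scalemxAr.
exact: add_cancel5.
Qed.

Lemma mulmx_entry_sub n (A X Y : 'M[R]_n) (z : 'cV[R]_n) i k :
  (forall j, X j k = Y j i - z j 0) -> (A *m X) i k = (A *m Y) i i - (A *m z) i 0.
Proof.
by move=> H; rewrite !mxE -sumrB; apply: eq_bigr => j _; rewrite H mulrBr.
Qed.

End MatrixEntries.

Record chart_metric (R : realType) n (U : set 'rV[R]_n) (G : 'rV[R]_n -> 'M[R]_n) : Prop :=
  ChartMetric {
  cm_open : open U;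
  cm_smooth : smx U G;
  cm_sym : forall p, U p -> (G p)^T = G p;
  cm_pos : forall p, U p -> posdef (G p)
}.

Section ChartGeometry.
Context {R : realType} {n : nat}.
Implicit Types (f : 'rV[R]_n -> R) (p : 'rV[R]_n).

Definition grad f p : 'cV[R]_n := \col_j partial j f p.

(* Covectors are columns: [dmx i a - conn G i *m a] is the covariant derivative of a. *)
Definition conn (G : 'rV[R]_n -> 'M[R]_n) (i : 'I_n) p : 'M[R]_n :=
  \matrix_(j, k) christoffel G k i j p.

(** Minus the commutator of the covariant derivatives D_i and D_j on covectors; with this sign the
    entries are the components of [riemann]. *)
Definition curv (G : 'rV[R]_n -> 'M[R]_n) (i j : 'I_n) p : 'M[R]_n :=
  dmx i (conn G j) p - dmx j (conn G i) p + conn G j p *m conn G i p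
  - conn G i p *m conn G j p.

Lemma gradE f p i j : grad f p i j = partial i f p.
Proof. by rewrite mxE. Qed.

Lemma dmxE a b (A : 'rV[R]_n -> 'M[R]_(a, b)) k p i j :
  dmx k A p i j = partial k (fun q => A q i j) p.
Proof. by rewrite mxE. Qed.

Lemma connE G i p j k : conn G i p j k = christoffel G k i j p.
Proof. by rewrite mxE. Qed.

Lemma curv_def G i j p : curv G i j p =
  dmx i (conn G j) p - dmx j (conn G i) p + conn G j p *m conn G i p
  - conn G i p *m conn G j p.
Proof. by []. Qed.

Lemma curvE G i j p k l : curv G i j p k l =
  partial i (fun q => conn G j q k l) p - partial j (fun q => conn G i q k l) p
  + \sum_m conn G j p k m * conn G i p m l - \sum_m conn G i p k m * conn G j p m l.
Proof. by rewrite /curv !(mxDE, mxNE, dmxE, mxME). Qed.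

Lemma christoffel_conn G k i j : christoffel G k i j = (fun q => conn G i q j k).
Proof. by apply/funext => q; rewrite connE. Qed.

Lemma riemannE G l k i j p : riemann G l k i j p = curv G i j p k l.
Proof.
rewrite /riemann curvE !christoffel_conn -[RHS]addrA -sumrB; congr (_ + _).
by apply: eq_bigr => m _; rewrite !christoffel_conn; congr (_ - _); exact: mulrC.
Qed.

Lemma ricciE G p j k : ricci G p j k = \sum_i curv G i j p k i.
Proof. by rewrite mxE; apply: eq_bigr => i _; rewrite riemannE. Qed.

Variables (U : set 'rV[R]_n) (G : 'rV[R]_n -> 'M[R]_n).
Hypothesis mG : chart_metric U G.

Let oU : open U := cm_open mG.
Let sG : smx U G := cm_smooth mG.

Lemma metric_unit p : U p -> G p \in unitmx.
Proof. by move=> Up; exact/posdef_unit/(cm_pos mG). Qed.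

Lemma smx_Gi : smx U (fun p => invmx (G p)).
Proof. by apply: smx_invmx => // p; exact: metric_unit. Qed.

Lemma Gi_sym p : U p -> (invmx (G p))^T = invmx (G p).
Proof. by move=> Up; apply/trmx_invmx_sym/(cm_sym mG). Qed.

Lemma smooth_christoffel k i j : smooth_on U (christoffel G k i j).
Proof.
apply: smoothM => //; first exact: smooth_cst.
apply: smooth_sum => // l; apply: smoothM => //; first exact: smx_Gi.
by apply: smoothB => //; first apply: smoothD => //; apply: smooth_partial; exact: sG.
Qed.

Lemma smx_conn i : smx U (conn G i).
Proof.
move=> j k; apply: smooth_ext oU _ (smooth_christoffel k i j) => q _.
by rewrite mxE.
Qed.

Lemma partial_metric_sym k i j p : U p ->
  partial k (fun q => G q i j) p = partial k (fun q => G q j i) p.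
Proof.
move=> Up; apply: (partial_ext k oU _ Up) => q Uq.
by rewrite -[in LHS](cm_sym mG Uq) mxE.
Qed.

Lemma christoffel_sym k i j p : U p -> christoffel G k i j p = christoffel G k j i p.
Proof.
move=> Up; congr (_ * _); apply: eq_bigr => l _; congr (_ * _).
by rewrite (partial_metric_sym l i j Up) (addrC (partial i _ p)).
Qed.

Lemma conn_torsion i j k p : U p -> conn G i p j k = conn G j p i k.
Proof. by move=> Up; rewrite !mxE christoffel_sym. Qed.

Lemma conn_low i p : U p -> conn G i p *m G p = \matrix_(j, l)
  (2^-1 * (partial i (fun q => G q j l) p + partial j (fun q => G q i l) p
           - partial l (fun q => G q i j) p)).
Proof.
move=> Up; set C := RHS.
suff -> : conn G i p = C *m invmx (G p) by rewrite mulmxKV// metric_unit.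
apply/matrixP => j k; rewrite [LHS]mxE [RHS]mxE /christoffel mulr_sumr.
apply: eq_bigr => l _.
have e : invmx (G p) k l = invmx (G p) l k by rewrite -[in LHS](Gi_sym Up) mxTE.
by rewrite [C _ _]mxE e mulrCA mulrC.
Qed.

Let half (a b c d e f : R) : a = d -> b = f -> c = e ->
  a = 2^-1 * (a + b - c) + 2^-1 * (d + e - f).
Proof. by move=> <- <- <-; field. Qed.

(** In the sum of a Christoffel symbol of the first kind and its transpose, the derivatives in the
    two other directions cancel. *)
Lemma conn_compat i p : U p ->
  dmx i G p = conn G i p *m G p + G p *m (conn G i p)^T.
Proof.
move=> Up; rewrite -{2}(cm_sym mG Up) -trmx_mul conn_low//; set C := (\matrix_(_, _) _).
have CE j l : C j l = 2^-1 * (partial i (fun q => G q j l) p +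
  partial j (fun q => G q i l) p - partial l (fun q => G q i j) p) by rewrite mxE.
apply/matrixP => j l; rewrite dmxE mxDE mxTE !CE.
by apply: half => //; exact: partial_metric_sym.
Qed.

Lemma dmx_Gi i p : U p -> dmx i (fun q => invmx (G q)) p =
  - (invmx (G p) *m conn G i p) - (conn G i p)^T *m invmx (G p).
Proof.
move=> Up; rewrite (dmx_invmx i oU sG metric_unit Up) conn_compat//.
have uG := metric_unit Up.
by rewrite mulmxDr mulmxDl opprD mulmxA mulmxK// !mulmxA mulVmx// mul1mx.
Qed.

Lemma curvC i j p : curv G i j p = - curv G j i p.
Proof.
exact: commutator_antisym.
Qed.

(** The second derivatives of [G] commute, and metric compatibility, differentiated once more,
    expresses them by the connection. *)
Lemma curv_skew i j p : U p -> curv G i j p *m G p = - (curv G i j p *m G p)^T.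
Proof.
move=> Up; have dd k l : dmx k (dmx l G) p = dmx k (conn G l) p *m G p
    + conn G l p *m (conn G k p *m G p + G p *m (conn G k p)^T)
    + (conn G k p *m G p + G p *m (conn G k p)^T) *m (conn G l p)^T
    + G p *m (dmx k (conn G l) p)^T.
  have sB := smx_conn.
  rewrite (dmx_ext (B := fun q => conn G l q *m G q + G q *m (conn G l q)^T) k oU _ Up); last first.
    by move=> q; exact: conn_compat.
  have sBt := smx_tr oU (sB l).
  rewrite (dmxD k oU (smxM oU (sB l) sG) (smxM oU sG sBt) Up).
  rewrite (dmxM k oU (sB l) sG Up) (dmxM k oU sG sBt Up) dmx_tr -conn_compat//.
  by rewrite !addrA.
apply: curv_skew_alg; first exact: (cm_sym mG Up).
transitivity (dmx i (dmx j G) p); first exact: esym (dd i j).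
by rewrite (dmxC i j oU sG Up); exact: dd.
Qed.

Opaque partial dmx conn grad curv christoffel.

Lemma curv_cyc i j k l p : U p ->
  curv G i j p k l + curv G j k p i l + curv G k i p j l = 0.
Proof.
move=> Up; apply: (@cyclic_cancel _ _ (fun a b c => curv G a b p c l)
  (fun a b c => partial a (fun q => conn G b q c l) p)
  (fun a b c => \sum_m conn G a p b m * conn G c p m l)) => a b c.
- exact: curvE.
- by apply: (partial_ext a oU _ Up) => q Uq; exact: conn_torsion.
- by apply: eq_bigr => m _; congr (_ * _); exact: conn_torsion.
Qed.

Lemma smx_grad f : smooth_on U f -> smx U (grad f).
Proof.
by move=> sf i j; apply: smooth_ext oU _ (smooth_partial i sf) => q _; rewrite gradE.
Qed.

Lemma hessE f i j p : hessian G f p i j =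
  partial i (partial j f) p - (conn G i p *m grad f p) j 0.
Proof.
rewrite [LHS]mxE; congr (_ - _); rewrite mxME; apply: eq_bigr => k _.
by rewrite connE gradE.
Qed.

Lemma hess_row f i p : (row i (hessian G f p))^T = dmx i (grad f) p - conn G i p *m grad f p.
Proof.
apply/matrixP => j k; rewrite ord1 mxTE [row _ _ _ _]mxE hessE mxDE mxNE dmxE.
congr (partial i _ p - _); by apply/funext => q; rewrite gradE.
Qed.

Lemma hess_sym f p : smooth_on U f -> U p -> (hessian G f p)^T = hessian G f p.
Proof.
move=> sf Up; apply/matrixP => i j; rewrite mxTE !hessE (partialC j i oU sf Up).
congr (_ - _); rewrite !mxME; apply: eq_bigr => k _.
by rewrite (conn_torsion j i k Up).
Qed.

Lemma smx_hess f : smooth_on U f -> smx U (hessian G f).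
Proof.
move=> sf i j; apply: (smooth_ext oU (f := fun p => partial i (partial j f) p - (conn G i p *m grad f p) j 0)).
  by move=> q _; rewrite hessE.
apply: smoothB => //; first by do 2 apply: smooth_partial.
by apply: smxM => //; [exact: smx_conn|exact: smx_grad].
Qed.

(* The Ricci identity [D_i D_k - D_k D_i = - curv i k] on the differential of f. *)
Lemma hess_commutator f i k p : smooth_on U f -> U p ->
  (dmx i (fun q => (row k (hessian G f q))^T) p - conn G i p *m (row k (hessian G f p))^T)
  - (dmx k (fun q => (row i (hessian G f q))^T) p - conn G k p *m (row i (hessian G f p))^T)
  = - (curv G i k p *m grad f p).
Proof.
move=> sf Up; have sg := smx_grad sf.
have dd a b : dmx a (fun q => (row b (hessian G f q))^T) p =
    dmx a (dmx b (grad f)) p - (dmx a (conn G b) p *m grad f p + conn G b p *m dmx a (grad f) p).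
  rewrite (dmx_ext (B := fun q => dmx b (grad f) q - conn G b q *m grad f q) a oU _ Up); last first.
    by move=> q _; exact: hess_row.
  have sb := smx_conn b.
  rewrite (dmxB a oU (smx_dmx b oU sg) (smxM oU sb sg) Up).
  by rewrite (dmxM a oU sb sg Up).
rewrite !dd !hess_row (dmxC i k oU sg Up) curv_def.
rewrite !(mulmxDl, mulmxDr, mulmxBl, mulmxBr, mulmxA, mulNmx, mulmxN).
exact: commutator_cancel.
Qed.

(** The inner product <df, dh>. It is convertible to [sqnorm_grad] when both functions coincide, so
    facts about [ipg] apply to [sqnorm_grad] directly. *)
Definition ipg f h p : R :=
  \sum_i \sum_j invmx (G p) i j * partial i f p * partial j h p.

Lemma ipgE f h p : ipg f h p = ((grad f p)^T *m invmx (G p) *m grad h p) 0 0.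
Proof.
rewrite mxME /ipg exchange_big; apply: eq_bigr => j _; rewrite mxME mulr_suml.
by apply: eq_bigr => i _; rewrite mxTE !gradE (mulrC (partial i f p)).
Qed.

Lemma smooth_ipg f h : smooth_on U f -> smooth_on U h -> smooth_on U (ipg f h).
Proof.
move=> sf sh; apply: smooth_sum => // i; apply: smooth_sum => // j.
by do ?apply: smoothM => //; [exact: smx_Gi|exact: smooth_partial|exact: smooth_partial].
Qed.

(** Metric compatibility: the connection terms of the two differentials cancel against the
    derivative of the inverse metric. *)
Lemma partial_ipg f h k p : smooth_on U f -> smooth_on U h -> U p ->
  partial k (ipg f h) p = (row k (hessian G f p) *m invmx (G p) *m grad h p) 0 0
    + ((grad f p)^T *m invmx (G p) *m (row k (hessian G h p))^T) 0 0.
Proof.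
move=> sf sh Up.
rewrite (partial_ext (h := fun q => ((grad f q)^T *m invmx (G q) *m grad h q) 0 0) k oU _ Up); last first.
  by move=> q _; exact: ipgE.
rewrite -(dmxE (fun q => (grad f q)^T *m invmx (G q) *m grad h q)) -mxDE.
congr (fun_of_matrix _ 0 0).
have s1 := smx_tr oU (smx_grad sf); have s2 := smx_grad sh.
rewrite (dmxM k oU (smxM oU s1 smx_Gi) s2 Up) (dmxM k oU s1 smx_Gi Up) dmx_tr.
rewrite dmx_Gi//.
have -> : dmx k (grad f) p = (row k (hessian G f p))^T + conn G k p *m grad f p.
  by rewrite hess_row subrK.
have -> : dmx k (grad h) p = (row k (hessian G h p))^T + conn G k p *m grad h p.
  by rewrite hess_row subrK.
rewrite raddfD /= trmxK trmx_mul.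
rewrite !(mulmxDl, mulmxDr, mulmxBl, mulmxBr, mulmxA, mulNmx, mulmxN).
move: (grad f p)^T (grad h p) (conn G k p) (invmx (G p)) (row k _) (row k _)^T => a b c d x y.
apply/matrixP => i j; rewrite !(mxDE, mxNE).
move: ((x *m d *m b) i j) ((a *m c^T *m d *m b) i j) ((a *m d *m c *m b) i j) ((a *m d *m y) i j).
move=> x1 x2 x3 x4; ring.
Qed.

Lemma laplacianE f p : smooth_on U f -> U p ->
  laplacian G f p = \tr (invmx (G p) *m hessian G f p).
Proof.
move=> sf Up; apply: eq_bigr => i _; rewrite mxME; apply: eq_bigr => j _.
by rewrite -[in LHS](hess_sym sf Up) mxTE.
Qed.

End ChartGeometry.

Opaque hessian.

(** * The Bochner formula for the deficit W *)

Section Bochner.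
Context {R : realType} {n : nat}.
Variables (U : set 'rV[R]_n) (G : 'rV[R]_n -> 'M[R]_n).
Hypothesis mG : chart_metric U G.
Variable u : 'rV[R]_n -> R.
Hypothesis su : smooth_on U u.
Implicit Types p : 'rV[R]_n.

Let oU : open U := cm_open mG.
Let sG : smx U G := cm_smooth mG.

(** For a static triple this is u (Ric + (n - 1) g), the obstruction to being Einstein multiplied by
    u. *)
Definition stress p : 'M[R]_n := hessian G u p - u p *: G p.

Definition gradv p : 'cV[R]_n := invmx (G p) *m grad u p.

(** The covariant derivative of a (0,2)-tensor: one connection term for each index. *)
Definition nabla (A : 'rV[R]_n -> 'M[R]_n) i p : 'M[R]_n :=
  dmx i A p - conn G i p *m A p - A p *m (conn G i p)^T.

Lemma stress_sym p : U p -> (stress p)^T = stress p.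
Proof. by move=> Up; rewrite /stress raddfB /= (hess_sym mG su Up) linearZ /= (cm_sym mG Up). Qed.

Lemma smx_uG : smx U (fun p => u p *: G p).
Proof.
move=> i j; apply: smooth_ext oU _ (smoothM oU su (sG i j)) => q _.
by rewrite mxE.
Qed.

Lemma smx_stress : smx U stress.
Proof. by apply: smxB => //; [exact: smx_hess|exact: smx_uG]. Qed.

Lemma grad_gradv p : U p -> grad u p = G p *m gradv p.
Proof. by move=> Up; rewrite /gradv mulKVmx// (metric_unit mG). Qed.

Lemma smx_gradv : smx U gradv.
Proof. by apply: smxM => //; [exact: (smx_Gi mG)|exact: (smx_grad mG)]. Qed.

Lemma dmx_uG i p : U p -> dmx i (fun q => u q *: G q) p = partial i u p *: G p + u p *: dmx i G p.
Proof.
move=> Up; apply/matrixP => a b; rewrite dmxE mxDE.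
rewrite (partial_ext (h := fun q => u q * G q a b) i oU _ Up); last by move=> q _; rewrite mxE.
by rewrite (partialM i su (sG a b) Up) !mxZE dmxE.
Qed.

Lemma nabla_uG i p : U p -> nabla (fun q => u q *: G q) i p = partial i u p *: G p.
Proof.
move=> Up; rewrite /nabla dmx_uG// (conn_compat mG i Up).
by rewrite -scalemxAr -scalemxAl scalerDr addrA addrAC addrK addrK.
Qed.

Lemma nabla_stress i p : U p ->
  nabla stress i p = nabla (hessian G u) i p - partial i u p *: G p.
Proof.
move=> Up; rewrite -(nabla_uG i Up) /nabla.
rewrite (dmxB i oU (smx_hess mG su) smx_uG Up) /stress mulmxBl mulmxBr.
by apply: sub_sub_cancel.
Qed.

(** Covariantly, the derivative of Du along e_i is the Hessian with one index raised, that is G^-1 T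
    e_i + u e_i with T the stress. *)
Lemma dmx_gradv i p : U p -> dmx i gradv p =
  - ((conn G i p)^T *m gradv p) + invmx (G p) *m (row i (stress p))^T + u p *: delta_mx i 0.
Proof.
move=> Up; rewrite (dmxM i oU (smx_Gi mG) (smx_grad mG su) Up) (dmx_Gi mG i Up).
have -> : dmx i (grad u) p = (row i (hessian G u p))^T + conn G i p *m grad u p.
  by rewrite hess_row subrK.
have -> : (row i (hessian G u p))^T = (row i (stress p))^T + u p *: (row i (G p))^T.
  by rewrite /stress raddfB raddfB /= linearZ /= linearZ /= subrK.
have e : invmx (G p) *m (u p *: (row i (G p))^T) = u p *: delta_mx i 0.
  rewrite -scalemxAr tr_row (cm_sym mG Up) -colM mulVmx ?(metric_unit mG)//.
  congr (_ *: _); by apply/matrixP => a b; rewrite !mxE ord1 andbT.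
rewrite !mulmxDr e mulmxBl mulNmx -!mulmxA -/(gradv p).
exact: add_cancel4.
Qed.

Lemma nabla_hess_comm i j k p : U p ->
  nabla (hessian G u) i p j k = nabla (hessian G u) k p j i - (curv G i k p *m grad u p) j 0.
Proof.
move=> Up; have := hess_commutator mG i k su Up => /matrixP/(_ j 0).
rewrite !(mxDE, mxNE).
have hr a b : dmx a (fun q => (row b (hessian G u q))^T) p j 0 = dmx a (hessian G u) p j b.
  rewrite !dmxE; apply: (partial_ext a oU _ Up) => q Uq.
  by rewrite mxTE [row _ _ _ _]mxE -[in LHS](hess_sym mG su Uq) mxTE.
have hc a b : (conn G a p *m (row b (hessian G u p))^T) j 0 = (conn G a p *m hessian G u p) j b.
  rewrite !mxME; apply: eq_bigr => m _; congr (_ * _).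
  by rewrite mxTE [row _ _ _ _]mxE -[in LHS](hess_sym mG su Up) mxTE.
have ht : (hessian G u p *m (conn G i p)^T) j k = (hessian G u p *m (conn G k p)^T) j i.
  rewrite !mxME; apply: eq_bigr => m _; congr (_ * _); rewrite !mxTE.
  exact: conn_torsion mG _ _ _ _ Up.
rewrite !hr !hc ht => E.
exact: sub_eq_rearr E.
Qed.

(** Contraction with the inverse metric commutes with covariant differentiation; the two connection
    terms match after a cyclic permutation under the trace. *)
Lemma trace_nabla (A : 'rV[R]_n -> 'M[R]_n) k p : smx U A -> U p ->
  \tr (invmx (G p) *m nabla A k p) = partial k (fun q => \tr (invmx (G q) *m A q)) p.
Proof.
move=> sA Up.
have -> : partial k (fun q => \tr (invmx (G q) *m A q)) p =
    \tr (dmx k (fun q => invmx (G q) *m A q) p).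
  rewrite (partial_sum (F := fun i q => (invmx (G q) *m A q) i i) _ _ k oU _ Up).
    by apply: eq_bigr => i _; rewrite dmxE.
  by move=> i; apply: smxM => //; exact: smx_Gi.
rewrite (dmxM k oU (smx_Gi mG) sA Up) (dmx_Gi mG k Up) /nabla.
rewrite !mulmxBr !mulmxBl !mulNmx !mulmxA !raddfD /= !raddfN /=.
rewrite -[(conn G k p)^T *m _ *m _]mulmxA [\tr ((conn G k p)^T *m _)]mxtrace_mulC.
exact: add_cancel3.
Qed.

Section Static.
Variables c : R.
Hypothesis u_gt0 : forall p, U p -> 0 < u p.
Hypothesis hRic : forall p, U p -> u p *: ricci G p = hessian G u p - (n%:R * u p) *: G p.
Hypothesis hLap : forall p, U p -> laplacian G u p = n%:R * u p.

Lemma trace_stress p : U p -> \tr (invmx (G p) *m stress p) = 0.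
Proof.
move=> Up; rewrite /stress mulmxBr raddfB /= -(laplacianE mG su Up) hLap//.
rewrite -scalemxAr mulVmx ?(metric_unit mG)// linearZ /= mxtrace1.
by rewrite /GRing.scale /= mulrC subrr.
Qed.

(** The contracted Ricci identity div D^2 u = D Delta u + Ric(Du, .), with Delta u = n u.
    Skew-symmetry of the curvature turns its contraction with du into [ricci]. *)
Lemma div_hess k p : U p ->
  \sum_i (invmx (G p) *m nabla (hessian G u) i p) i k =
  n%:R * partial k u p + (ricci G p *m gradv p) k 0.
Proof.
move=> Up.
have -> : \sum_i (invmx (G p) *m nabla (hessian G u) i p) i k =
   \tr (invmx (G p) *m nabla (hessian G u) k p)
   - \sum_i (invmx (G p) *m (curv G i k p *m grad u p)) i 0.
  rewrite /mxtrace -sumrB; apply: eq_bigr => i _; apply: mulmx_entry_sub => j.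
  exact: nabla_hess_comm.
rewrite (trace_nabla k (smx_hess mG su) Up); congr (_ + _).
  rewrite (partial_ext (h := fun q => n%:R * u q) k oU _ Up) ?(partialZ k _ su Up)//.
  by move=> q Uq; rewrite -hLap// (laplacianE mG su Uq).
rewrite mxME -sumrN.
have -> : \sum_(i < n) - (invmx (G p) *m (curv G i k p *m grad u p)) i 0 =
    \sum_i \sum_l curv G i k p l i * gradv p l 0.
  apply: eq_bigr => i _; rewrite {1}(grad_gradv Up) [curv G i k p *m (_ *m _)]mulmxA.
  rewrite (curv_skew mG i k Up) trmx_mul (cm_sym mG Up) mulNmx mulmxN mxNE opprK.
  rewrite -[G p *m _ *m _]mulmxA mulKmx ?(metric_unit mG)// mxME.
  by apply: eq_bigr => l _; rewrite mxTE.
rewrite exchange_big; apply: eq_bigr => l _.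
by rewrite ricciE mulr_suml.
Qed.

(** Subtracting div (u g) = du and replacing u Ric by D^2 u - n u g cancels all multiples of du and
    leaves T(Du, .) / u. *)
Lemma div_stress k p : U p ->
  \sum_i (invmx (G p) *m nabla stress i p) i k = (u p)^-1 * (stress p *m gradv p) k 0.
Proof.
move=> Up; have u0 : u p != 0 by rewrite gt_eqF// u_gt0.
have -> : \sum_i (invmx (G p) *m nabla stress i p) i k =
   \sum_i (invmx (G p) *m nabla (hessian G u) i p) i k - partial k u p.
  have -> : partial k u p = \sum_i (invmx (G p) *m (partial i u p *: G p)) i k.
    rewrite (bigD1 k)//= big1 ?addr0 => [|i ik].
      by rewrite -scalemxAr mulVmx ?(metric_unit mG)// !mxE eqxx mulr1.
    by rewrite -scalemxAr mulVmx ?(metric_unit mG)// !mxE (negbTE ik) mulr0.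
  by rewrite -sumrB; apply: eq_bigr => i _; rewrite nabla_stress// mulmxBr mxDE mxNE.
rewrite div_hess//.
apply: (mulfI u0); rewrite mulVKf//.
have e : u p * (ricci G p *m gradv p) k 0 = (stress p *m gradv p) k 0 + u p * partial k u p
     - n%:R * u p * partial k u p.
  have -> : u p * (ricci G p *m gradv p) k 0 = ((u p *: ricci G p) *m gradv p) k 0.
    by rewrite -scalemxAl mxZE.
  rewrite hRic// /stress !mulmxBl !(mxDE, mxNE) -!scalemxAl -!(grad_gradv Up).
  by rewrite !mxZE gradE subrK.
rewrite mulrBr mulrDr e; move: (partial k u p) (u p) ((_ *m _) k 0) => x y z.
by ring.
Qed.

Let w p := u p ^+ 2 - c - sqnorm_grad G u p.

Lemma smooth_w : smooth_on U w.
Proof.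
apply: smoothB => //; last exact: (smooth_ipg mG su su).
by apply: smoothB => //; [exact: smoothX|exact: smooth_cst].
Qed.

(** Both d(u^2) = 2 u du and d|Du|^2 = 2 D^2 u(Du, .) are evaluations of a bilinear form on Du: of u
    g and of D^2 u. *)
Lemma grad_w p : U p -> grad w p = (- 2) *: (stress p *m gradv p).
Proof.
move=> Up; apply/matrixP => k j; rewrite ord1 gradE [RHS]mxE /w.
have s2 : smooth_on U (fun q => u q ^+ 2) by exact: smoothX.
rewrite (partialB k oU (smoothB oU s2 (@smooth_cst _ _ U c)) (smooth_ipg mG su su) Up).
rewrite (partialB k oU s2 (@smooth_cst _ _ U c) Up) partial_cst subr0.
rewrite (partial_ext (h := fun q => u q * u q) k oU _ Up); last by move=> q _; rewrite expr2.
rewrite (partialM k su su Up).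
rewrite (partial_ipg mG k su su Up).
set X := (row k _ *m _ *m _) 0 0.
have -> : ((grad u p)^T *m invmx (G p) *m (row k (hessian G u p))^T) 0 0 = X.
  rewrite /X -[in RHS](trmxK (row k _ *m _ *m _)) [RHS]mxTE !trmx_mul (Gi_sym mG Up).
  by rewrite mulmxA.
have -> : (stress p *m gradv p) k 0 = X - u p * partial k u p.
  rewrite /stress mulmxBl mxDE mxNE -scalemxAl -(grad_gradv Up) mxZE gradE.
  by congr (_ - _); rewrite /X -mulmxA -row_mul [RHS]mxE.
move: (partial k u p) (u p) X => x y z; ring.
Qed.

(** Taking the divergence of - 2 T(Du, .) gives - 2 (div T)(Du) - 2 |T|^2 - 2 u tr T. The last term
    vanishes, and the first is - 2 u^-1 T(Du, Du), which equals the drift term. *)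
Lemma lap_w p : U p -> laplacian G w p - (u p)^-1 * ipg G u w p =
  - 2 * \tr (invmx (G p) *m stress p *m invmx (G p) *m stress p).
Proof.
move=> Up; have sw := smooth_w.
have hw i : (row i (hessian G w p))^T = (- 2) *:
    (nabla stress i p *m gradv p + stress p *m (invmx (G p) *m (row i (stress p))^T)
     + u p *: (row i (stress p))^T).
  rewrite hess_row grad_w//.
  have -> : dmx i (grad w) p = (- 2) *: dmx i (fun q => stress q *m gradv q) p.
    have sTN := smxM oU smx_stress smx_gradv.
    apply/matrixP => a b; rewrite dmxE [RHS]mxE dmxE -(partialZ i _ (sTN a b) Up).
    by apply: (partial_ext i oU _ Up) => q Uq; rewrite grad_w// mxE.
  rewrite (dmxM i oU smx_stress smx_gradv Up) dmx_gradv// -scalemxAr -scalerBr.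
  congr (_ *: _); apply: nabla_product_rule.
  by rewrite -colE tr_row stress_sym.
have -> : laplacian G w p = \sum_i (invmx (G p) *m (row i (hessian G w p))^T) i 0.
  apply: eq_bigr => i _; rewrite mxME; apply: eq_bigr => j _.
  by rewrite mxTE [row _ _ _ _]mxE.
under eq_bigr => i _ do rewrite hw -scalemxAr !mulmxDr mxZE !mxDE.
rewrite -mulr_sumr !big_split /=.
have -> : \sum_i (invmx (G p) *m (u p *: (row i (stress p))^T)) i 0 = 0.
  rewrite -[RHS](mulr0 (u p)) -[in RHS](trace_stress Up) mulr_sumr.
  apply: eq_bigr => i _; rewrite -scalemxAr mxZE; congr (_ * _).
  by rewrite tr_row (stress_sym Up) -colM mxE.
have -> : \sum_i (invmx (G p) *m (stress p *m (invmx (G p) *m (row i (stress p))^T))) i 0 =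
    \tr (invmx (G p) *m stress p *m invmx (G p) *m stress p).
  by apply: eq_bigr => i _; rewrite tr_row (stress_sym Up) !mulmxA -colM mxE.
have -> : \sum_i (invmx (G p) *m (nabla stress i p *m gradv p)) i 0 =
    (u p)^-1 * ((gradv p)^T *m (stress p *m gradv p)) 0 0.
  under eq_bigr => i _ do rewrite mulmxA mxME.
  rewrite exchange_big mxME mulr_sumr; apply: eq_bigr => k _.
  by rewrite -mulr_suml div_stress// mxTE mulrAC mulrA.
have -> : ipg G u w p = (- 2) * ((gradv p)^T *m (stress p *m gradv p)) 0 0.
  rewrite ipgE grad_w// -scalemxAr mxZE; congr (_ * _).
  by rewrite /gradv [(_ *m grad u p)^T]trmx_mul (Gi_sym mG Up).
move: (u p)^-1 (fun_of_matrix _ 0 0) (\tr _) => x y z; ring.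
Qed.

End Static.

End Bochner.

Lemma compact_attains_min (R : realType) (T : topologicalType) (K : set T) (f : T -> R) :
  K !=set0 -> compact K -> (forall q, K q -> {for q, continuous f}) ->
  exists2 q0, K q0 & forall q, K q -> f q0 <= f q.
Proof.
move=> K0 cK cf; have [|q0] := @compact_EVT_min _ _ f K K0 cK.
  by apply: continuous_in_subspaceT => q; rewrite inE; exact: cf.
by rewrite inE => Kq0 H; exists q0 => // q Kq; apply: H; rewrite inE.
Qed.

Lemma compact_attains_max (R : realType) (T : topologicalType) (K : set T) (f : T -> R) :
  K !=set0 -> compact K -> (forall q, K q -> {for q, continuous f}) ->
  exists2 q0, K q0 & forall q, K q -> f q <= f q0.
Proof.
move=> K0 cK cf; have [|q0] := @compact_EVT_max _ _ f K K0 cK.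
  by apply: continuous_in_subspaceT => q; rewrite inE; exact: cf.
by rewrite inE => Kq0 H; exists q0 => // q Kq; apply: H; rewrite inE.
Qed.

(** * The strong minimum principle *)

Section LocalMinimum.
Context {R : realType}.

Lemma near0_abs (P : R -> Prop) : (\forall t \near (0 : R), P t) ->
  exists2 d : R, 0 < d & forall t, `|t| < d -> P t.
Proof.
move=> /nbhs_ballP[d d0 H]; exists d => // t td; apply: H.
by rewrite -ball_normE /= sub0r normrN.
Qed.

Let between0 (t c d : R) : (0 <= c <= t) || (t <= c <= 0) -> `|t| < d -> `|c| < d.
Proof. by rewrite !ltr_norml => /orP[]/andP[? ?]/andP[? ?]; apply/andP; split; lra. Qed.

Lemma min_derive_eq0 (phi psi : R -> R) (d : R) : 0 < d ->
  (forall t : R, `|t| < d -> is_derive t 1 phi (psi t)) -> {for 0, continuous psi} ->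
  (forall t : R, `|t| < d -> phi 0 <= phi t) -> psi 0 = 0.
Proof.
move=> d0 D C M; apply/eqP; apply/negPn/negP => p0.
have e0 : 0 < `|psi 0| / 2 by rewrite divr_gt0// normr_gt0.
have [d' d'0 H] := near0_abs ((continuous_atP psi 0).1 C _ e0).
(* A step against the sign of [psi 0], so short that [psi] still has that sign along it: [phi]
   decreases. *)
pose t := - Num.sg (psi 0) * (Num.min d d' / 2).
have m0 : 0 < Num.min d d' by rewrite lt_min d0.
have h0 : 0 < Num.min d d' / 2 by rewrite divr_gt0.
have tn : `|t| < Num.min d d'.
  rewrite normrM normrN normr_sg p0 mul1r gtr0_norm// ltr_pdivrMr//.
  by rewrite ltr_pMr// ltr1n.
have [|c cb E] := @MVT_between _ phi psi 0 t.
  by move=> x /between0 xb; apply: D; apply: lt_le_trans (xb _ tn) _; rewrite ge_min lexx.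
have cd := between0 cb tn.
have := M t (lt_le_trans tn _); rewrite ge_min lexx => /(_ isT).
rewrite -subr_ge0 E subr0.
have Hc : `|psi 0 - psi c| <= `|psi 0| / 2.
  by apply: H; apply: lt_le_trans cd _; rewrite ge_min lexx orbT.
apply/negP; rewrite -ltNge /t mulNr mulrN oppr_lt0 mulrA pmulr_lgt0//.
clear - p0 Hc; case: (ltrgt0P (psi 0)) p0 => [P|P|->] // _.
  rewrite gtr0_sg// mulr1; move: Hc; rewrite (gtr0_norm P) ler_norml => /andP[? ?]; lra.
rewrite ltr0_sg// mulrN1; move: Hc; rewrite (ltr0_norm P) ler_norml => /andP[? ?]; lra.
Qed.

Lemma MVT_open (phi psi : R -> R) (t : R) : 0 < t ->
  (forall x : R, 0 <= x <= t -> is_derive x 1 phi (psi x)) ->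
  exists2 c, 0 < c < t & phi t - phi 0 = psi c * t.
Proof.
move=> t0 D; have [|||c] := @MVT _ phi psi 0 t => //.
- by move=> x; rewrite in_itv /= => /andP[x0 xt]; apply: D; rewrite !ltW.
- apply: derivable_within_continuous => x; rewrite in_itv /= => xx.
  by have [] := D _ xx.
by rewrite in_itv /= subr0 => cb E; exists c.
Qed.

(** Two uses of the mean value theorem give phi t - phi 0 = chi(b) c t with 0 < b < c < t; the open
    form [MVT_open] is what makes [c] nonzero and the product strictly negative when [chi 0 < 0]. *)
Lemma min_derive2_ge0 (phi psi chi : R -> R) (d : R) : 0 < d ->
  (forall t : R, `|t| < d -> is_derive t 1 phi (psi t)) ->
  (forall t : R, `|t| < d -> is_derive t 1 psi (chi t)) -> {for 0, continuous chi} ->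
  psi 0 = 0 ->
  (forall t : R, `|t| < d -> phi 0 <= phi t) -> 0 <= chi 0.
Proof.
move=> d0 D1 D2 C p0 M; rewrite leNgt; apply/negP => c0.
have e0 : 0 < - chi 0 / 2 by rewrite divr_gt0// oppr_gt0.
have [d' d'0 H] := near0_abs ((continuous_atP chi 0).1 C _ e0).
have m0 : 0 < Num.min d d' by rewrite lt_min d0.
pose t := Num.min d d' / 2; have t0 : 0 < t by rewrite divr_gt0.
have tm : t < Num.min d d' by rewrite ltr_pdivrMr// ltr_pMr// ltr1n.
have [td td'] : t < d /\ t < d' by move: tm; rewrite lt_min => /andP[].
have ab x : 0 <= x <= t -> `|x| < d /\ `|x| < d'.
  move=> /andP[x0 xt]; rewrite ger0_norm//; split; exact: le_lt_trans xt _.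
have chin x : 0 <= x <= t -> chi x < 0.
  move=> /ab[_ xd]; have := H x xd; clear - c0.
  rewrite ler_norml => /andP[? ?]; lra.
have [|c cb E] := @MVT_open phi psi t t0; first by move=> x /ab[xd _]; exact: D1.
have /andP[cc0 cct] := cb.
have [|b bb E'] := @MVT_open psi chi c cc0.
  by move=> x /andP[x0 xc]; apply: D2; apply: (ab x _).1; rewrite x0 (le_trans xc) ?ltW.
have /andP[bb0 bbc] := bb.
have Ec : psi c = chi b * c by move: E'; rewrite p0 subr0.
have := M t; rewrite -subr_ge0 E pmulr_lge0// (gtr0_norm t0) => /(_ td).
rewrite Ec pmulr_lge0// leNgt chin// (ltW bb0) /=.
by rewrite (le_trans (ltW bbc)) ?ltW.
Qed.

End LocalMinimum.

Section StrongMinimum.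
Context {R : realType} {n : nat}.
Implicit Types (U : set 'rV[R]_n) (p q z : 'rV[R]_n).

Lemma line_ball q (e : 'rV[R]_n) r : 0 < r ->
  exists2 d : R, 0 < d & forall t : R, `|t| < d -> ball q r (t *: e + q).
Proof.
move=> r0; have e0 : 0 < `|e| + 1 by rewrite ltr_wpDl.
exists (r / (`|e| + 1)); first by rewrite divr_gt0.
move=> t; rewrite ltr_pdivlMr// => H; rewrite in_ballE opprD addrCA subrr addr0 normrN normrZ.
by apply: le_lt_trans H; rewrite ler_wpM2l// lerDl.
Qed.

Lemma continuous_line (f : 'rV[R]_n -> R) q e : {for q, continuous f} ->
  {for 0, continuous (fun t : R => f (t *: e + q))}.
Proof.
move=> cf; apply/continuous_atP => eps eps0.
have [r r0 H] := near_in_ball ((continuous_atP f q).1 cf eps eps0).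
have [d d0 Hd] := line_ball q e r0.
apply/nbhs_ballP; exists d => // t /=; rewrite -ball_normE /= sub0r normrN => td.
by rewrite scale0r add0r; apply: H; exact: Hd.
Qed.

Lemma local_min_grad U v q (e : 'rV[R]_n) : open U -> smooth_on U v -> U q ->
  (\forall q' \near q, v q <= v q') -> \sum_i e 0 i * partial i v q = 0.
Proof.
move=> oU sv Uq M.
have [r r0 H] := near_in_ball (near_and M (near_open oU Uq (fun _ h => h))).
have [d d0 Hd] := line_ball q e r0.
have := @min_derive_eq0 _ (fun t : R => v (t *: e + q))
  (fun t : R => \sum_i e 0 i * partial i v (t *: e + q)) d d0.
rewrite scale0r add0r; apply.
- move=> t /Hd/H[_ Ut]; exact: (smooth_is_derive_line oU sv Ut).
- apply: (@continuous_line (fun q' => \sum_i e 0 i * partial i v q') q e).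
  apply: (smooth_continuous (U := U)) => //; apply: smooth_sum => // i.
  by apply: smoothM => //; [exact: smooth_cst|exact: smooth_partial].
- by move=> t /Hd/H[].
Qed.

Let sum_swap (M : 'I_n -> 'I_n -> R) (e : 'rV[R]_n) :
  \sum_k e 0 k * (\sum_i e 0 i * M k i) = \sum_i e 0 i * (\sum_j e 0 j * M j i).
Proof.
under eq_bigr do rewrite mulr_sumr; rewrite exchange_big; apply: eq_bigr => i _.
by rewrite mulr_sumr; apply: eq_bigr => j _; rewrite mulrCA.
Qed.

(** The sum is the second derivative of [v] at [q] along the line of direction [e]. *)
Lemma local_min_hess U v q (e : 'rV[R]_n) : open U -> smooth_on U v -> U q ->
  (\forall q' \near q, v q <= v q') ->
  0 <= \sum_i e 0 i * \sum_j e 0 j * partial j (partial i v) q.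
Proof.
move=> oU sv Uq M; have g0 := local_min_grad e oU sv Uq M.
have [r r0 H] := near_in_ball (near_and M (near_open oU Uq (fun _ h => h))).
have [d d0 Hd] := line_ball q e r0.
pose psi q' := \sum_i e 0 i * partial i v q'.
have spsi : smooth_on U psi.
  by apply: smooth_sum => // i; apply: smoothM => //; [exact: smooth_cst|exact: smooth_partial].
have dpsi k q' : U q' -> partial k psi q' = \sum_i e 0 i * partial k (partial i v) q'.
  move=> Uq'; rewrite (partial_sum (F := fun i q => e 0 i * partial i v q) _ _ _ oU _ Uq').
    by apply: eq_bigr => i _; rewrite (partialZ _ _ (smooth_partial i sv) Uq').
  by move=> i; apply: smoothM => //; [exact: smooth_cst|exact: smooth_partial].
rewrite -(sum_swap (fun k i => partial k (partial i v) q)).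
have -> : \sum_k e 0 k * \sum_i e 0 i * partial k (partial i v) q = \sum_k e 0 k * partial k psi q.
  by apply: eq_bigr => k _; rewrite dpsi.
have := @min_derive2_ge0 _ (fun t : R => v (t *: e + q)) (fun t : R => psi (t *: e + q))
  (fun t : R => \sum_k e 0 k * partial k psi (t *: e + q)) d d0.
have -> : 0 *: e + q = q by rewrite scale0r add0r.
apply => //.
- by move=> t /Hd/H[_ Ut]; exact: (smooth_is_derive_line oU sv Ut).
- by move=> t /Hd/H[_ Ut]; exact: (smooth_is_derive_line oU spsi Ut).
- apply: (@continuous_line (fun q' => \sum_i e 0 i * partial i psi q') q e).
  apply: (smooth_continuous (U := U)) => //; apply: smooth_sum => // i.
  by apply: smoothM => //; [exact: smooth_cst|exact: smooth_partial].
- by move=> t /Hd/H[].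
Qed.

Lemma continuous_dist (p : 'rV[R]_n) : continuous (fun q : 'rV[R]_n => `|p - q|).
Proof.
move=> q; apply/continuous_atP => e e0; apply/nbhs_ballP; exists e => // q' /=.
rewrite in_ballE => qq'; apply: le_trans (ler_dist_dist _ _) _.
by rewrite opprB addrC addrA subrK distrC ltW.
Qed.

Lemma compact_cball (p : 'rV[R]_n) (r : R) : compact [set q | `|p - q| <= r].
Proof.
apply: bounded_closed_compact.
  exists (`|p| + r); split; first exact: num_real.
  move=> x rx q /= pq; apply: le_trans (ltW rx).
  have -> : q = p - (p - q) by rewrite opprB addrC subrK.
  by apply: le_trans (ler_normB _ _) _; rewrite lerD2l.
apply: (@closed_comp _ _ (fun q => `|p - q|) [set x | x <= r]); last exact: closed_le.
by move=> q _; exact: continuous_dist.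
Qed.

Lemma compact_sphere (p : 'rV[R]_n) (r : R) : compact [set q | `|p - q| = r].
Proof.
apply: subclosed_compact (@compact_cball p r) _; last by move=> q /= ->.
apply: (@closed_comp _ _ (fun q => `|p - q|) [set x | x = r]); last exact: closed_eq.
by move=> q _; exact: continuous_dist.
Qed.

Lemma near_of_ball (P : set 'rV[R]_n) p q (r : R) : ball p r q ->
  (forall q', ball p r q' -> P q') -> \forall q' \near q, P q'.
Proof.
rewrite in_ballE => pq H; apply/nbhs_ballP; exists (r - `|p - q|); first by rewrite /= subr_gt0.
move=> q'; rewrite in_ballE => qq'; apply: H; rewrite in_ballE.
have -> : p - q' = (p - q) + (q - q') by rewrite addrA subrK.
by apply: le_lt_trans (ler_normD _ _) _; rewrite -ltrBrDl.
Qed.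

(** The squared Euclidean distance: it is smooth and its balls have smooth boundary, unlike the
    balls of the sup norm on rows. *)
Definition sqd z q : R := \sum_i (q 0 i - z 0 i) ^+ 2.

Lemma smooth_sqd U z : open U -> smooth_on U (sqd z).
Proof.
move=> oU; apply: smooth_sum => // i; apply: smoothX => //.
by apply: smoothB => //; [exact: smooth_coord|exact: smooth_cst].
Qed.

Lemma sqd_ge0 z q : 0 <= sqd z q.
Proof. by apply: sumr_ge0 => i _; exact: sqr_ge0. Qed.

Lemma sqd_eq0 z q : (sqd z q == 0) = (z == q).
Proof.
apply/eqP/eqP => [H|->]; last by rewrite /sqd big1// => i _; rewrite subrr expr0n.
apply/rowP => i; apply/esym/eqP; rewrite -subr_eq0 -sqrf_eq0.
have /eqP := H; rewrite psumr_eq0; last by move=> k _; exact: sqr_ge0.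
by move=> /allP/(_ i (mem_index_enum _)).
Qed.

Lemma sqd_ge_norm z q : `|q - z| ^+ 2 <= sqd z q.
Proof.
rewrite -ler_sqrt ?sqd_ge0// sqrtr_sqr normr_id; apply: norm_le_coord.
  exact: sqrtr_ge0.
move=> a i; rewrite ord1 -sqrtr_sqr ler_sqrt ?sqd_ge0// !mxE /sqd (bigD1 i)//= lerDl.
by apply: sumr_ge0 => k _; exact: sqr_ge0.
Qed.

Lemma sqd_le_norm z q : sqd z q <= n%:R * `|q - z| ^+ 2.
Proof.
apply: (@le_trans _ _ (\sum_(i < n) `|q - z| ^+ 2)).
  apply: ler_sum => i _; rewrite -[X in X <= _]ger0_norm ?sqr_ge0// normrX.
  rewrite lerXn2r ?nnegrE//; have := coord_le_norm (q - z) 0 i; by rewrite !mxE.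
by rewrite sumr_const card_ord -[leLHS]mulr_natl.
Qed.

Lemma partial_sqd z q i : partial i (sqd z) q = 2 * (q 0 i - z 0 i).
Proof.
have oT : open (@setT 'rV[R]_n) by exact: openT.
have sc k : smooth_on setT (fun q : 'rV[R]_n => q 0 k - z 0 k).
  by apply: smoothB => //; [exact: smooth_coord|exact: smooth_cst].
rewrite (partial_sum (F := fun k q => (q 0 k - z 0 k) ^+ 2) _ _ _ oT _ (I : setT q)); last first.
  by move=> k; exact: smoothX.
have dk k : partial i (fun q : 'rV[R]_n => (q 0 k - z 0 k) ^+ 2) q = 2 * (i == k)%:R * (q 0 k - z 0 k).
  rewrite (partial_ext (U := setT) (h := fun q => (q 0 k - z 0 k) * (q 0 k - z 0 k)))//.
    have -> : partial i (fun q : 'rV[R]_n => (q 0 k - z 0 k) * (q 0 k - z 0 k)) q =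
      partial i (fun q : 'rV[R]_n => q 0 k - z 0 k) q * (q 0 k - z 0 k)
      + (q 0 k - z 0 k) * partial i (fun q : 'rV[R]_n => q 0 k - z 0 k) q.
      exact: (partialM i (sc k) (sc k)).
    have -> : partial i (fun q : 'rV[R]_n => q 0 k - z 0 k) q = (i == k)%:R.
      rewrite (partialB i oT (@smooth_coord _ _ setT k) (@smooth_cst _ _ setT (z 0 k)))//.
      by rewrite partial_coord partial_cst subr0.
    by move: (nat_of_bool _)%:R (_ - _) => a b; ring.
rewrite (bigD1 i)//= dk eqxx mulr1 big1 ?addr0// => k ki.
by rewrite dk eq_sym (negbTE ki) mulr0 mul0r.
Qed.

End StrongMinimum.

Section Elementary.
Context {R : realType}.

Lemma pos_of_close (x y : R) : 0 < y / 2 -> `|y - x| <= y / 2 -> 0 < x.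
Proof. by rewrite ler_norml => ? /andP[? ?]; lra. Qed.

Lemma sum_linear_combination n (A F H : 'I_n -> 'I_n -> R) (b f h : 'I_n -> R) a :
  \sum_i \sum_j A i j * (F i j + a * H i j) + \sum_k b k * (f k + a * h k) =
  (\sum_i \sum_j A i j * F i j + \sum_k b k * f k)
  + a * (\sum_i \sum_j A i j * H i j + \sum_k b k * h k).
Proof.
rewrite mulrDr addrACA; congr (_ + _); rewrite mulr_sumr -big_split /=.
  apply: eq_bigr => i _; rewrite mulr_sumr -big_split /=; apply: eq_bigr => j _.
  by rewrite mulrDr (mulrCA a).
by apply: eq_bigr => k _; rewrite mulrDr (mulrCA a).
Qed.

Lemma far_from_below (x y m : R) : m < y -> x <= m -> (y - m) / 2 < `|y - x|.
Proof. by move=> ? ?; rewrite ltr_normr; apply/orP; left; lra. Qed.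

Lemma half_split (x y : R) : y != 0 -> x / 2 = y * (x / (2 * y)).
Proof. by move=> ?; field. Qed.

Lemma natr_sqr_le n (x : R) : n%:R * x ^+ 2 <= (n.+1%:R * x) ^+ 2.
Proof.
rewrite exprMn; apply: ler_wpM2r; first exact: sqr_ge0.
by rewrite -natrX ler_nat (leq_trans (leqnSn n))// leq_pmulr.
Qed.

End Elementary.

Section Elliptic.
Context {R : realType} {n : nat}.
Variables (U : set 'rV[R]_n) (G : 'rV[R]_n -> 'M[R]_n) (b : 'I_n -> 'rV[R]_n -> R).
Hypothesis mG : chart_metric U G.
Hypothesis sb : forall k, smooth_on U (b k).
Implicit Types (f h : 'rV[R]_n -> R) (p q z : 'rV[R]_n).

Let oU : open U := cm_open mG.

(** An operator without term of order zero, so that constants are annihilated. *)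
Definition elliptic f p : R :=
  \sum_i \sum_j invmx (G p) i j * partial i (partial j f) p + \sum_k b k p * partial k f p.

Lemma smooth_elliptic f : smooth_on U f -> smooth_on U (elliptic f).
Proof.
move=> sf; apply: smoothD => //.
  apply: smooth_sum => // i; apply: smooth_sum => // j; apply: smoothM => //.
    exact: (smx_Gi mG).
  by do 2 apply: smooth_partial.
by apply: smooth_sum => // k; apply: smoothM => //; exact: smooth_partial.
Qed.

Lemma elliptic_lin f h a p : smooth_on U f -> smooth_on U h -> U p ->
  elliptic (fun q => f q + a * h q) p = elliptic f p + a * elliptic h p.
Proof.
move=> sf sh Up.
have sah : smooth_on U (fun q => a * h q) by apply: smoothM => //; exact: smooth_cst.
have d1 k q : U q -> partial k (fun q => f q + a * h q) q = partial k f q + a * partial k h q.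
  by move=> Uq; rewrite (partialD k sf sah Uq) (partialZ k a sh Uq).
have d2 i j : partial i (partial j (fun q => f q + a * h q)) p =
    partial i (partial j f) p + a * partial i (partial j h) p.
  rewrite (partial_ext i oU (d1 j) Up).
  have sfj := smooth_partial j sf; have shj := smooth_partial j sh.
  have sahj : smooth_on U (fun q => a * partial j h q) by apply: smoothM => //; exact: smooth_cst.
  by rewrite (partialD i sfj sahj Up) (partialZ i a shj Up).
rewrite /elliptic -sum_linear_combination; congr (_ + _).
  by apply: eq_bigr => i _; apply: eq_bigr => j _; rewrite d2.
by apply: eq_bigr => k _; rewrite d1.
Qed.

(** Where [f] vanishes, every term in which a factor [f] remains undifferentiated disappears. *)
Lemma elliptic_sqr f p : smooth_on U f -> U p -> f p = 0 ->
  elliptic (fun q => f q * f q) p =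
  2 * ((grad f p)^T *m invmx (G p) *m grad f p) 0 0.
Proof.
move=> sf Up f0.
have d1 k q : U q -> partial k (fun q => f q * f q) q = partial k f q * f q + f q * partial k f q.
  by move=> Uq; rewrite (partialM k sf sf Uq).
have d2 i j : partial i (partial j (fun q => f q * f q)) p = 2 * (partial i f p * partial j f p).
  rewrite (partial_ext i oU (d1 j) Up).
  have sfj := smooth_partial j sf.
  rewrite (partialD i (smoothM oU sfj sf) (smoothM oU sf sfj) Up).
  rewrite (partialM i sfj sf Up) (partialM i sf sfj Up) f0 mulr0 add0r mul0r addr0.
  by rewrite [RHS]mulr_natl mulr2n (mulrC (partial j f p)).
rewrite /elliptic [X in _ + X]big1 ?addr0; last first.
  by move=> k _; rewrite d1// f0 mulr0 mul0r addr0 mulr0.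
rewrite mxME exchange_big mulr_sumr; apply: eq_bigr => j _.
rewrite mxME mulr_suml mulr_sumr; apply: eq_bigr => i _.
rewrite d2 mxTE !gradE.
by move: (invmx _ _ _) (partial i f p) (partial j f p) => a1 a2 a3; ring.
Qed.

(** At a local minimum the drift sees a zero gradient, and the principal part is the trace of a
    nonnegative form against the inverse metric. *)
Lemma elliptic_min_ge0 f p : smooth_on U f -> U p -> (\forall q \near p, f p <= f q) ->
  0 <= elliptic f p.
Proof.
move=> sf Up M.
have -> : elliptic f p = \tr (invmx (G p) *m (\matrix_(i, j) partial i (partial j f) p)).
  rewrite /elliptic [X in _ + X]big1 ?addr0.
    apply: eq_bigr => i _; rewrite mxME; apply: eq_bigr => j _; congr (_ * _).
    by rewrite mxE (partialC i j oU sf Up).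
  move=> k _; have := local_min_grad (delta_mx 0 k) oU sf Up M.
  rewrite (bigD1 k)//= mxE !eqxx mul1r big1 ?addr0 => [->|i ik]; first by rewrite mulr0.
  by rewrite mxE (negbTE ik) andbF mul0r.
apply: mxtrace_invmx_ge0; [exact: (cm_sym mG)|exact: (cm_pos mG)|move=> v].
have := local_min_hess v oU sf Up M; congr (_ <= _).
rewrite mxME; apply: eq_bigr => i _; rewrite mxTE mulrC mxME; congr (_ * _).
by apply: eq_bigr => j _; rewrite mxE.
Qed.

Section Barrier.
Variables (w : 'rV[R]_n -> R) (m : R).
Hypothesis sw : smooth_on U w.
Hypothesis Lw : forall p, U p -> elliptic w p <= 0.
Hypothesis mw : forall p, U p -> m <= w p.

(** With s = |z - y1|^2 - |z - q|^2, which vanishes at [y1], L(s^2) = 2 |ds|^2 > 0 there, since the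
    gradient of s is a nonzero multiple of z - y1. A large multiple of s^2 therefore dominates L
    s. *)
Lemma barrier_exists z y1 : U y1 -> z != y1 -> exists beta kappa : R,
  0 < kappa /\
  0 < elliptic (fun q => (sqd z y1 - sqd z q) +
        beta * ((sqd z y1 - sqd z q) * (sqd z y1 - sqd z q)) + (- kappa) * sqd y1 q) y1.
Proof.
move=> Uy zy.
pose s q := sqd z y1 - sqd z q.
have ss : smooth_on U s by apply: smoothB => //; [exact: smooth_cst|exact: smooth_sqd].
have sr : smooth_on U (sqd y1) by exact: smooth_sqd.
have Q0 : 0 < ((grad s y1)^T *m invmx (G y1) *m grad s y1) 0 0.
  rewrite -[X in _ *m X]trmxK; apply: (posdef_inv (cm_sym mG Uy) (cm_pos mG Uy)).
  apply: contraNneq zy => H; apply/eqP/rowP => i.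
  have /matrixP/(_ 0 i) := H; rewrite mxTE gradE mxE.
  rewrite (partialB i oU (@smooth_cst _ _ U (sqd z y1)) (smooth_sqd z oU) Uy) partial_cst.
  rewrite partial_sqd sub0r => /eqP; rewrite oppr_eq0 mulf_eq0 pnatr_eq0/= subr_eq0.
  by move=> /eqP.
set Q := fun_of_matrix _ 0 0 in Q0.
have sss := smoothM oU ss ss.
have ssb c : smooth_on U (fun q => s q + c * (s q * s q)).
  by apply: smoothD => //; apply: smoothM => //; exact: smooth_cst.
have E beta kappa : elliptic (fun q => s q + beta * (s q * s q) + (- kappa) * sqd y1 q) y1
    = elliptic s y1 + beta * (2 * Q) - kappa * elliptic (sqd y1) y1.
  rewrite (elliptic_lin _ (ssb beta) sr Uy) (elliptic_lin _ ss sss Uy).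
  by rewrite (elliptic_sqr ss Uy) ?mulNr// /s subrr.
(* This [beta] makes L s + 2 beta Q at least 1, and this [kappa] keeps kappa L|q - y1|^2 below 1. *)
exists ((`|elliptic s y1| + 1) / (2 * Q)), (2 * (`|elliptic (sqd y1) y1| + 1))^-1.
have k0 : 0 < 2 * (`|elliptic (sqd y1) y1| + 1) by rewrite mulr_gt0// ltr_wpDl.
split; first by rewrite invr_gt0.
rewrite E divfK ?mulf_neq0 ?gt_eqF//.
move: (elliptic s y1) (elliptic (sqd y1) y1) k0 => x y k0.
have hy : (2 * (`|y| + 1))^-1 * y < 1.
  rewrite mulrC ltr_pdivrMr// mul1r; apply: le_lt_trans (ler_norm y) _.
  by rewrite mulrDr mulr1 mulr_natl mulr2n -addrA ltrDl ltr_wpDl.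
have hx : 0 <= x + `|x| by rewrite -lerBlDl sub0r -normrN ler_norm.
rewrite subr_gt0; apply: lt_le_trans hy _.
by rewrite addrA lerDr.
Qed.

(* Hopf's barrier [s + beta s^2 - kappa |q - y1|^2], with [s = |z - y1|^2 - |z - q|^2], is a
   strict subsolution near y1 and is negative near y1 outside the ball where m < w. *)
Lemma hopf_contradiction z y1 : U y1 -> w y1 = m -> z != y1 ->
  (forall q, U q -> sqd z q < sqd z y1 -> m < w q) -> False.
Proof.
move=> Uy wy zy H.
have [beta [kappa [k0 L0]]] := barrier_exists Uy zy.
pose s q := sqd z y1 - sqd z q.
pose hb q := s q + beta * (s q * s q) + (- kappa) * sqd y1 q.
have ss : smooth_on U s by apply: smoothB => //; [exact: smooth_cst|exact: smooth_sqd].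
have sr : smooth_on U (sqd y1) by exact: smooth_sqd.
have sh : smooth_on U hb.
  apply: smoothD => //; last by apply: smoothM => //; exact: smooth_cst.
  by apply: smoothD => //; apply: smoothM => //; [exact: smooth_cst|exact: smoothM].
have sLh := smooth_elliptic sh.
have e0 : 0 < elliptic hb y1 / 2 by rewrite divr_gt0.
have /continuous_atP/(_ _ e0) N1 := smooth_continuous sLh Uy.
have s1 : smooth_on U (fun q => 1 + beta * s q).
  by apply: smoothD => //; [exact: smooth_cst|apply: smoothM => //; exact: smooth_cst].
have h20 : 0 < 1 / 2 :> R by rewrite divr_gt0.
have /continuous_atP/(_ _ h20) N2 := smooth_continuous s1 Uy.
have [r r0 Hr] := near_in_ball (near_and (near_and N1 N2) (near_open oU Uy (fun _ Uq => Uq))).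
pose r' := r / 2; have r'0 : 0 < r' by rewrite divr_gt0.
have r'r : r' < r by rewrite ltr_pdivrMr// ltr_pMr// ltr1n.
pose K := [set q : 'rV[R]_n | `|y1 - q| <= r'].
have KB q : K q -> ball y1 r q by rewrite in_ballE => /le_lt_trans; apply.
have KU q : K q -> U q by move=> /KB/Hr[].
have KL q : K q -> 0 < elliptic hb q.
  move=> /KB/Hr[[+ _] _]; move: (elliptic hb q) (elliptic hb y1) e0 => x y.
  exact: pos_of_close.
have Ks q : K q -> 0 < 1 + beta * s q.
  move=> /KB/Hr[[_ +] _]; rewrite {1}/s subrr mulr0 addr0; move: (1 + _) => x.
  exact: pos_of_close h20.
have cK : compact K by exact: compact_cball.
have K1 : K y1 by rewrite /K /= subrr normr0 ltW.
pose S := [set q : 'rV[R]_n | `|y1 - q| = r'].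
have SK q : S q -> K q by rewrite /S /K /= => ->.
have Sw q : S q -> 0 <= hb q -> m < w q.
  move=> Sq hq; have Kq := SK _ Sq; apply: H; first exact: KU.
  rewrite -subr_gt0 -/(s q); have sp := Ks _ Kq.
  have rho : 0 < sqd y1 q.
    rewrite lt_def sqd_ge0 andbT sqd_eq0; apply: contraTneq r'0 => y1q.
    by rewrite -Sq -y1q subrr normr0 ltxx.
  have : 0 < s q * (1 + beta * s q).
    have kr : 0 < kappa * sqd y1 q by rewrite mulr_gt0.
    apply: lt_le_trans kr _; rewrite -subr_ge0.
    have -> : s q * (1 + beta * s q) - kappa * sqd y1 q = hb q; last by [].
    rewrite /hb; move: (s q) (sqd y1 q) => x y; ring.
  by rewrite pmulr_lgt0.
have wcont q : K q -> {for q, continuous w} by move=> /KU; exact: smooth_continuous.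
have hcont q : K q -> {for q, continuous hb} by move=> /KU; exact: smooth_continuous.
have [eps ep0 Heps] : exists2 eps, 0 < eps & forall q, S q -> m < w q - eps * hb q.
  (* In dimension 0 the sphere is empty and any positive [eps] serves. *)
  have [S0|S0] := pselect (S !=set0); last first.
    by exists 1 => // q Sq; exfalso; apply: S0; exists q.
  (* This continuous function equals w - m where [hb >= 0] and exceeds it elsewhere, so it is
     positive on the compact sphere; [eps] is its minimum divided by a bound for [hb]. *)
  pose F q := w q - m + (`|hb q| - hb q).
  have [q1 Sq1 Hq1] : exists2 q1, S q1 & forall q, S q -> F q1 <= F q.
    apply: compact_attains_min => //; first exact: compact_sphere.
    move=> q /SK Kq; apply: continuousD.
      by apply: continuousB; [exact: wcont|exact: cst_continuous].
    apply: continuousB; last exact: hcont.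
    exact: (continuous_comp (hcont _ Kq) (@norm_continuous _ _ _)).
  have F0 : 0 < F q1.
    have [h0|h0] := leP 0 (hb q1).
      by rewrite /F (ger0_norm h0) subrr addr0 subr_gt0 Sw.
    rewrite /F (ltr0_norm h0) ltr_wpDl//; first by rewrite subr_ge0; apply: mw; exact/KU/SK.
    by rewrite -mulr2n pmulrn_lgt0// oppr_gt0.
  have [q2 Sq2 Hq2] : exists2 q2, S q2 & forall q, S q -> hb q <= hb q2.
    apply: compact_attains_max => //; first exact: compact_sphere.
    by move=> q /SK; exact: hcont.
  exists (F q1 / (`|hb q2| + 1)); first by rewrite divr_gt0// ltr_wpDl.
  move=> q Sq; have mwq := mw (KU _ (SK _ Sq)).
  have e0' : 0 < F q1 / (`|hb q2| + 1) by rewrite divr_gt0// ltr_wpDl.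
  have [h0|h0] := leP 0 (hb q); last first.
    by apply: le_lt_trans mwq _; rewrite ltrBrDr -ltrBrDl subrr pmulr_rlt0.
  rewrite ltrBrDr -ltrBrDl; apply: (@lt_le_trans _ _ (F q1)); last first.
    by apply: le_trans (Hq1 _ Sq) _; rewrite /F (ger0_norm h0) subrr addr0.
  rewrite mulrAC ltr_pdivrMr ?ltr_wpDl// ltr_pM2l//.
  by apply: le_lt_trans (Hq2 _ Sq) _; apply: le_lt_trans (ler_norm _) _; rewrite ltrDl.
(* [v] equals m at [y1] and exceeds m on the sphere, so its minimum over the closed ball is
   interior. There L v >= 0, whereas L v = L w - eps L hb < 0. *)
pose v q := w q + (- eps) * hb q.
have sv : smooth_on U v by apply: smoothD => //; apply: smoothM => //; exact: smooth_cst.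
have [q0 Kq0 Hq0] : exists2 q0, K q0 & forall q, K q -> v q0 <= v q.
  apply: compact_attains_min => //; first by exists y1.
  by move=> q /KU; exact: smooth_continuous.
have vq0 : v q0 <= m.
  apply: le_trans (Hq0 _ K1) _; rewrite /v wy /hb /s subrr mulr0 mulr0 addr0 add0r.
  by rewrite /sqd big1 ?mulr0 ?addr0// => i _; rewrite subrr expr0n.
have qr : `|y1 - q0| < r'.
  rewrite lt_neqAle Kq0 andbT; apply/eqP => qr.
  move: vq0; apply/negP; rewrite -ltNge /v mulNr.
  have [hq|hq] := leP 0 (hb q0); first by apply: Heps.
  by apply: le_lt_trans (mw (KU _ Kq0)) _; rewrite ltrBrDr -ltrBrDl subrr pmulr_rlt0.
have Uq0 := KU _ Kq0.
have M : \forall q \near q0, v q0 <= v q.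
  have B0 : ball y1 r' q0 by rewrite in_ballE.
  have BB q : ball y1 r' q -> v q0 <= v q.
    by rewrite in_ballE => qq; apply: Hq0; exact: ltW.
  exact: near_of_ball B0 BB.
have := elliptic_min_ge0 sv Uq0 M.
rewrite (elliptic_lin _ sw sh Uq0) leNgt => /negP; apply.
rewrite mulNr subr_lt0; apply: le_lt_trans (Lw Uq0) _.
by rewrite mulr_gt0// KL.
Qed.

(** If w z > m for some [z] near [y0], the point [y1] of {w <= m} nearest to [z] lies on the
    boundary of a Euclidean ball about [z] in which w > m, contrary to Hopf's lemma. *)
Lemma strong_minimum y0 : U y0 -> w y0 = m -> \forall q \near y0, w q = m.
Proof.
move=> Uy0 wy0; have [r r0 rU] := open_ball_sub oU Uy0.
pose r2 := r / 2; have r20 : 0 < r2 by rewrite divr_gt0.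
have r2r : r2 < r by rewrite ltr_pdivrMr// ltr_pMr// ltr1n.
(* Comparing the sup norm with the Euclidean one costs a factor below [n.+1]: points that are closer
   to [z] than [y0] in Euclidean distance still lie in the cube of radius [r2] about [y0]. *)
pose r1 := r2 / (2 * n.+1%:R).
have n0 : 0 < 2 * n.+1%:R :> R by rewrite mulr_gt0.
have r10 : 0 < r1 by rewrite divr_gt0.
have r12 : r1 <= r2 / 2.
  by rewrite ler_pM2l// lef_pV2 ?posrE// ler_peMr// ler1n.
apply/nbhs_ballP; exists r1 => // z; rewrite in_ballE => zr; apply: contrapT => wz.
have KU q : `|y0 - q| <= r2 -> U q.
  by move=> qr; apply: rU; rewrite in_ballE (le_lt_trans qr).
have Uz : U z by apply: KU; apply: le_trans (ltW zr) (le_trans r12 _); rewrite ler_pdivrMr// ler_pMr// ler1n.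
have mz : m < w z by rewrite lt_def mw// andbT; apply/eqP.
pose Z := [set q : 'rV[R]_n | `|y0 - q| <= r2 /\ w q <= m].
have cZ : compact Z.
  have sub : Z `<=` [set q | `|y0 - q| <= r2] by move=> q [].
  apply: (subclosed_compact _ (@compact_cball _ _ y0 r2) sub).
  move=> q clq.
  have ccb : closed [set q : 'rV[R]_n | `|y0 - q| <= r2].
    by apply: compact_closed; [exact: norm_hausdorff|exact: compact_cball].
  have q2 : `|y0 - q| <= r2.
    by have := closure_subset sub clq; rewrite -((closure_id _).1 ccb).
  split=> //; rewrite leNgt; apply/negP => mq.
  have Uq := KU _ q2.
  have d0 : 0 < (w q - m) / 2 by rewrite divr_gt0// subr_gt0.
  have /continuous_atP/(_ _ d0) N := smooth_continuous sw Uq.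
  have [q' [[_ wq'] cl]] := clq _ N.
  by move: cl; apply/negP; rewrite -ltNge; apply: far_from_below.
have Z0 : Z !=set0 by exists y0; split; [rewrite subrr normr0 ltW|rewrite wy0].
have [y1 [y12 wy1'] Hy1] : exists2 y1, Z y1 & forall q, Z q -> sqd z y1 <= sqd z q.
  apply: compact_attains_min => // q _; apply: (smooth_continuous (U := setT)) => //.
  by apply: smooth_sqd; exact: openT.
have Uy1 := KU _ y12.
have wy1 : w y1 = m by apply/eqP; rewrite eq_le wy1' mw.
apply: (@hopf_contradiction z y1 Uy1 wy1).
  by apply: contraTneq mz => ->; rewrite wy1 ltxx.
move=> q Uq qz; rewrite ltNge; apply/negP => wq.
have zq : sqd z q < sqd z y0.
  apply: lt_le_trans qz _; apply: Hy1; split; [by rewrite subrr normr0 ltW|by rewrite wy0].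
have : sqd z y1 <= sqd z q.
  apply: Hy1; split=> //.
  have h1 : `|q - z| <= r2 / 2.
    have r22 : 0 <= r2 / 2 by apply: ltW; rewrite divr_gt0.
    rewrite -(@ler_pXn2r _ 2) ?nnegrE//.
    apply: le_trans (sqd_ge_norm z q) _; apply: le_trans (ltW zq) _.
    apply: le_trans (sqd_le_norm z y0) _.
    apply: (@le_trans _ _ (n%:R * r1 ^+ 2)).
      by rewrite ler_wpM2l// lerXn2r ?nnegrE ?(ltW zr) ?(ltW r10).
    have -> : r2 / 2 = n.+1%:R * r1.
      by apply: half_split; rewrite pnatr_eq0.
    exact: natr_sqr_le.
  have -> : y0 - q = (y0 - z) - (q - z) by rewrite opprB addrA subrK.
  apply: le_trans (ler_normB _ _) _; rewrite [r2]splitr; apply: lerD => //.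
  exact: le_trans (ltW zr) r12.
by rewrite leNgt qz.
Qed.

End Barrier.
End Elliptic.

(** * Functions on the manifold *)

Section Charts.
Context {R : realType} {n : nat}.
Variables (M : manifold R n) (g : riemannian_metric M).
Implicit Types (i j : atlas_index M) (x y : M) (f h u : M -> R).

Definition cimg i : set 'rV[R]_n := chart i @` dom i.

Lemma cimg_chart i x : dom i x -> cimg i (chart i x).
Proof. by move=> dx; exists x. Qed.

Lemma open_cimg i : open (cimg i).
Proof. exact: image_open. Qed.

Lemma paramK i q : cimg i q -> chart i (param i q) = q.
Proof. by case=> x dx <-; rewrite chartK. Qed.

Lemma dom_param i q : cimg i q -> dom i (param i q).
Proof. by case=> x dx <-; rewrite chartK. Qed.

Lemma chart_metricP i : chart_metric (cimg i) (g i).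
Proof.
split.
- exact: open_cimg.
- by move=> a b; exact: metric_smooth.
- move=> p [x dx xp]; rewrite -xp.
  exact: (Defs.metric_sym g dx).
- move=> p [x dx xp] v v0; rewrite -xp.
  exact: (Defs.metric_pos g dx v0).
Qed.

Lemma near_param i x (P : set M) : dom i x -> (\forall y \near x, P y) ->
  \forall q \near chart i x, P (param i q).
Proof.
move=> dx Px; have := param_continuous (cimg_chart dx); rewrite /prop_for /continuous_at.
by rewrite chartK// => /(_ _ Px).
Qed.

Lemma near_chart i x (P : set M) : dom i x ->
  (\forall q \near chart i x, P (param i q)) -> \forall y \near x, P y.
Proof.
move=> dx Pq; have C := chart_continuous dx.
have N1 : \forall y \near x, P (param i (chart i y)) by exact: C _ Pq.
have N2 : \forall y \near x, dom i y by exact: open_nbhs_nbhs (conj (dom_open i) dx).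
by apply: near_imp (near_and N1 N2) _ => y [Py dy]; rewrite -(chartK dy).
Qed.

Lemma open_chart_image i (V : set M) : open V -> open (chart i @` (dom i `&` V)).
Proof.
move=> oV; rewrite openE => _ [x [dx Vx] <-].
have N1 : \forall q \near chart i x, V (param i q).
  by apply: near_param => //; exact: open_nbhs_nbhs.
have N2 := near_open (@open_cimg i) (cimg_chart dx) (fun _ H => H).
apply: near_imp (near_and N1 N2) _ => q [Vq Iq].
by exists (param i q); [split=> //; exact: dom_param|exact: paramK].
Qed.

Lemma chart_continuous_fun i f x : dom i x -> {for chart i x, continuous (f \o param i)} ->
  {for x, continuous f}.
Proof.
move=> dx /continuous_atP C; apply/continuous_atP => e e0.
apply: (near_chart dx); apply: near_imp (C _ e0) _ => q /=.
by rewrite chartK.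
Qed.

(** Asked in every chart around [x], for direct use; [smooth_atP] shows that one chart is enough. *)
Definition smooth_at f x := forall i, dom i x -> exists2 V, open V /\ V (chart i x) &
  smooth_on V (f \o param i).

Lemma smooth_atP f x i V : dom i x -> open V -> V (chart i x) ->
  smooth_on V (f \o param i) -> smooth_at f x.
Proof.
move=> dx oV Vx sV j dj.
pose tau := chart i \o param j.
have oI := @open_chart_image j _ (@dom_open _ _ _ i).
have st b : smooth_on (chart j @` (dom j `&` dom i)) (fun q => tau q 0 b) by exact: transition_smooth.
have Ix : (chart j @` (dom j `&` dom i)) (chart j x) by exists x.
have ct : {for chart j x, continuous tau}.
  by apply: row_C0_continuous Ix => b; exact: smooth_C.
have tx : tau (chart j x) = chart i x by rewrite /tau /= chartK.
have N1 : \forall q \near chart j x, V (tau q).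
  by apply: ct; rewrite tx; exact: open_nbhs_nbhs.
have N2 := near_open oI Ix (fun _ H => H).
have [W [oW Wx WP]] := near_ex_open (near_and N1 N2).
exists W => //; apply: (smooth_ext oW (f := (f \o param i) \o tau)); last first.
  move=> k; apply: (@C_on_comp _ k _ _ W V tau (f \o param i)) => //.
  - by move=> q /WP[].
  - by move=> b; apply: C_on_sub (st b k) => q /WP[].
move=> q /WP[_ [y [dy diy] <-]] /=.
by rewrite /tau /= (chartK dy) (chartK diy).
Qed.

Lemma smooth_fun_at f x : smooth_fun f -> smooth_at f x.
Proof. by move=> sf i dx; exists (cimg i); [split; [exact: open_cimg|exact: cimg_chart]|exact: sf]. Qed.

Lemma smooth_at_continuous f x : smooth_at f x -> {for x, continuous f}.
Proof.
move=> sf; have dx := dom_chart_at x; have [V [_ Vx] sV] := sf _ dx.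
by apply: (chart_continuous_fun dx); exact: smooth_continuous sV Vx.
Qed.

Lemma smooth_fun_continuous f : smooth_fun f -> continuous f.
Proof. by move=> sf x; apply: smooth_at_continuous; exact: smooth_fun_at. Qed.

Definition ipc i f h x := ipg (g i) (f \o param i) (h \o param i) (chart i x).

Lemma transition_jacobian i j x f : dom i x -> dom j x -> smooth_at f x ->
  grad (f \o param i) (chart i x) =
  'J (chart j \o param i) (chart i x) *m grad (f \o param j) (chart j x).
Proof.
move=> dx dj sf; have [V [oV Vx] sV] := sf _ dj.
pose tau := chart j \o param i.
have oI := @open_chart_image i _ (@dom_open _ _ _ j).
have st b : smooth_on (chart i @` (dom i `&` dom j)) (fun q => tau q 0 b) by exact: transition_smooth.
have Ix : (chart i @` (dom i `&` dom j)) (chart i x) by exists x.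
have ct : {for chart i x, continuous tau}.
  by apply: row_C0_continuous Ix => b; exact: smooth_C.
have tx : tau (chart i x) = chart j x by rewrite /tau /= chartK.
have N1 : \forall q \near chart i x, V (tau q).
  by apply: ct; rewrite tx; exact: open_nbhs_nbhs.
have N2 := near_open oI Ix (fun _ H => H).
have [W [oW Wx WP]] := near_ex_open (near_and N1 N2).
have st1 b : C_on 1 W (fun q => tau q 0 b).
  by apply: C_on_sub (st b 1%N) => q /WP[].
apply/matrixP => a k; rewrite ord1 gradE mxME.
rewrite (partial_ext (h := (f \o param j) \o tau) a oW _ Wx); last first.
  move=> q /WP[_ [y [dy djy] <-]] /=; by rewrite /tau /= (chartK dy) (chartK djy).
have VT : V (tau (chart i x)) by rewrite tx.
rewrite (partial_comp a oW oV st1 (sV 1%N) Wx VT) tx.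
by apply: eq_bigr => b _; rewrite (jacobianE a b oW st1 Wx) gradE.
Qed.

(** The Jacobian that the chain rule puts before each differential cancels against the congruence of
    the two metric matrices. *)
Lemma ipc_invariant i j x f h : dom i x -> dom j x -> smooth_at f x -> smooth_at h x ->
  ipc i f h x = ipc j f h x.
Proof.
move=> dx dj sf sh; rewrite /ipc !ipgE (transition_jacobian dx dj sf) (transition_jacobian dx dj sh).
have := metric_transition g dx dj.
set J := 'J _ _ => E.
have uGi : g i (chart i x) \in unitmx by exact: (metric_unit (chart_metricP i) (cimg_chart dx)).
have uGj : g j (chart j x) \in unitmx by exact: (metric_unit (chart_metricP j) (cimg_chart dj)).
have uJ : J \in unitmx.
  by move: uGi; rewrite E !unitmx_mul => /andP[/andP[]].
congr (fun_of_matrix _ 0 0); rewrite E; apply: congruence_cancel => //.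
Qed.

Lemma grad_sqE i u x : dom i x -> smooth_at u x -> grad_sq g u x = ipc i u u x.
Proof.
by move=> dx su; rewrite -(ipc_invariant (dom_chart_at x) dx su su).
Qed.

End Charts.

Lemma connected_clopen (T : topologicalType) (P : set T) x : connected [set: T] ->
  open P -> closed P -> P x -> forall y, P y.
Proof.
move=> cT oP cP Px y.
suff -> : P = setT by [].
by apply: cT; [exists x|exists P; rewrite ?setTI|exists P; rewrite ?setTI].
Qed.

Section DriftForm.
Context {R : realType} {n : nat}.

(** Rewrites Delta w - u^-1 <Du, Dw> in the form of [elliptic]: [A] is the inverse metric, [C] the
    Christoffel symbols, [e] and [h] the partial derivatives of u and w, and [c] is u^-1. *)
Lemma sum_drift (A F : 'I_n -> 'I_n -> R) (C : 'I_n -> 'I_n -> 'I_n -> R) (e h : 'I_n -> R) c :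
  \sum_i \sum_j A i j * (F i j - \sum_k C i j k * h k)
    - c * (\sum_i \sum_j A i j * e i * h j) =
  \sum_i \sum_j A i j * F i j +
  \sum_k (- (\sum_i \sum_j A i j * C i j k) - c * \sum_i A i k * e i) * h k.
Proof.
have -> : \sum_k (- (\sum_i \sum_j A i j * C i j k) - c * \sum_i A i k * e i) * h k =
    - \sum_i \sum_j A i j * \sum_k C i j k * h k - c * \sum_i \sum_j A i j * e i * h j.
  under eq_bigr => k _ do rewrite mulrBl mulNr.
  rewrite sumrB sumrN; congr (- _ - _).
    under eq_bigr => k _ do rewrite mulr_suml.
    rewrite exchange_big; apply: eq_bigr => i _.
    under eq_bigr => k _ do rewrite mulr_suml.
    rewrite exchange_big; apply: eq_bigr => j _; rewrite mulr_sumr.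
    by apply: eq_bigr => k _; rewrite mulrA.
  under eq_bigr => k _ do rewrite -mulrA mulr_suml.
  by rewrite -mulr_sumr exchange_big.
rewrite addrA; congr (_ - _); rewrite -sumrB; apply: eq_bigr => i _.
by rewrite -sumrB; apply: eq_bigr => j _; rewrite mulrBr.
Qed.

End DriftForm.

(** * The deficit W on the manifold and its lower limit at infinity *)

Section StaticTriple.
Context {R : realType} {n : nat}.
Variables (M : manifold R n) (g : riemannian_metric M) (u : M -> R).
Hypothesis st : static_triple g u.
Implicit Types (i j : atlas_index M) (x y : M).

Lemma static_u_continuous : continuous u.
Proof. exact: smooth_fun_continuous (static_smooth st). Qed.

Lemma static_u_at x : smooth_at u x.
Proof. exact: smooth_fun_at (static_smooth st). Qed.

Lemma static_u_chart i : smooth_on (cimg i) (u \o param i).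
Proof. exact: static_smooth st i. Qed.

Lemma closed_sublevel s : closed [set x | u x <= s].
Proof.
apply: (@closed_comp _ _ u [set t | t <= s]); last exact: closed_le.
by move=> x _; exact: static_u_continuous.
Qed.

(** A sublevel set contained in no member of the exhaustion would supply a sequence leaving all of
    them with [u] bounded by [s]. *)
Lemma sublevel_compact s : compact [set x | u x <= s].
Proof.
have [K [Kc _ _] KP] := static_infinity st.
have [k Hk] : exists k, [set x | u x <= s] `<=` K k.
  apply: contrapT => H.
  have H' k : exists x, ~ K k x /\ u x <= s.
    apply: contrapT => Hn; apply: H; exists k => x ux.
    by apply: contrapT => Kx; apply: Hn; exists x.
  have [x_ xP] := choice H'.
  have := KP x_ (fun k => (xP k).1) => /cvgryPgt /(_ s) N.
  have [k] := @filter_ex _ _ eventually_filter _ N.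
  by rewrite ltNge (xP k).2.
by apply: subclosed_compact (Kc k) Hk; exact: closed_sublevel.
Qed.

Lemma static_inhabited : [set: M] !=set0.
Proof.
apply/set0P/eqP => M0; apply: (static_noncompact st).
by rewrite M0; exact: compact0.
Qed.

Lemma u_min_attained : exists2 p, u p = u_min u & forall x, u_min u <= u x.
Proof.
have [x0 _] := static_inhabited.
have [p Kp Hp] : exists2 p, u p <= u x0 & forall x, u x <= u x0 -> u p <= u x.
  apply: (@compact_attains_min _ _ [set x | u x <= u x0] u); [by exists x0; rewrite /= lexx|exact: sublevel_compact|].
  by move=> q _; exact: static_u_continuous.
have Hall x : u p <= u x.
  have [ux|ux] := leP (u x) (u x0); first exact: Hp.
  exact: le_trans Kp (ltW ux).
have E : u p = u_min u.
  apply/eqP; rewrite eq_le; apply/andP; split.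
    apply: lb_le_inf; first by exists (u p), p.
    by move=> _ [x _ <-].
  apply: ge_inf; last by exists p.
  by exists (u p) => _ [x _ <-].
by exists p => // x; rewrite -E.
Qed.

Lemma static_u_gt0 i q : cimg i q -> 0 < (u \o param i) q.
Proof. by move=> _; exact: (static_pos st). Qed.

Lemma static_ricci_chart i q : cimg i q -> (u \o param i) q *: ricci (g i) q =
  hessian (g i) (u \o param i) q - (n%:R * (u \o param i) q) *: g i q.
Proof. by case=> x dx <-; rewrite /= (chartK dx); exact: (static_ricci st). Qed.

Lemma static_laplacian_chart i q : cimg i q ->
  laplacian (g i) (u \o param i) q = n%:R * (u \o param i) q.
Proof. by case=> x dx <-; rewrite /= (chartK dx); exact: (static_laplacian st). Qed.

Definition deficit x : R := u x ^+ 2 - u_min u ^+ 2 - grad_sq g u x.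

Let w i q : R := (u \o param i) q ^+ 2 - u_min u ^+ 2 - sqnorm_grad (g i) (u \o param i) q.

Lemma deficit_chart i q : cimg i q -> deficit (param i q) = w i q.
Proof.
move=> Iq; rewrite /deficit (grad_sqE g (dom_param Iq)); last exact: static_u_at.
by rewrite /ipc paramK.
Qed.

Let drift i k q : R :=
  - (\sum_a \sum_b invmx (g i q) a b * christoffel (g i) k a b q)
  - ((u \o param i) q)^-1 * \sum_a invmx (g i q) a k * partial a (u \o param i) q.

Lemma smooth_drift i k : smooth_on (cimg i) (drift i k).
Proof.
have mG := chart_metricP g i; have oU := cm_open mG; have su := static_u_chart i.
apply: smoothB => //.
  apply: smoothN => //; apply: smooth_sum => // a; apply: smooth_sum => // b.
  by apply: smoothM => //; [exact: (smx_Gi mG)|exact: (smooth_christoffel mG)].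
apply: smoothM => //.
  by apply: smoothV => // q /static_u_gt0 uq; rewrite gt_eqF.
apply: smooth_sum => // a; apply: smoothM => //; first exact: (smx_Gi mG).
exact: smooth_partial.
Qed.

Lemma elliptic_deficit i q : cimg i q -> elliptic (g i) (drift i) (w i) q =
  - 2 * \tr (invmx (g i q) *m stress (g i) (u \o param i) q
             *m invmx (g i q) *m stress (g i) (u \o param i) q).
Proof.
move=> Iq; have mG := chart_metricP g i; have su := static_u_chart i.
rewrite -(lap_w mG su (u_min u ^+ 2) (@static_u_gt0 i) (@static_ricci_chart i)
  (@static_laplacian_chart i) Iq).
rewrite /elliptic /drift -sum_drift; congr (_ - _).
apply: eq_bigr => a _; apply: eq_bigr => b _; rewrite hessE mxME; congr (_ * (_ - _)).
by apply: eq_bigr => k _; rewrite connE gradE.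
Qed.

(** The set where the minimum is attained is open by the strong minimum principle and closed by
    continuity, and the manifold is connected. *)
Lemma deficit_min_const x0 : (forall y, deficit x0 <= deficit y) ->
  forall y, deficit y = deficit x0.
Proof.
move=> H.
have lc x : deficit x = deficit x0 -> \forall y \near x, deficit y = deficit x0.
  move=> dx0; have dx := dom_chart_at x; set i := chart_at x in dx.
  apply: (near_chart dx).
  have mG := chart_metricP g i; have su := static_u_chart i; have Ix := cimg_chart dx.
  have N : \forall q \near chart i x, w i q = deficit x0.
    apply: (strong_minimum mG (smooth_drift i) _ _ _ Ix).
    - exact: (smooth_w mG su).
    - move=> q Iq; rewrite elliptic_deficit// mulNr oppr_le0 mulr_ge0//.
      have [] := mxtrace_sq_ge0 (cm_sym mG Iq) (cm_pos mG Iq) (stress_sym mG su Iq).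
      by [].
    - by move=> q Iq; rewrite -deficit_chart.
    - by rewrite -(deficit_chart Ix) chartK.
  have N2 := near_open (@open_cimg _ _ _ i) Ix (fun _ H => H).
  by apply: near_imp (near_and N N2) _ => q [<- Iq]; rewrite deficit_chart.
have lc' x : deficit x != deficit x0 -> \forall y \near x, deficit y != deficit x0.
  move=> dx0; have dx := dom_chart_at x; set i := chart_at x in dx.
  have c : {for x, continuous deficit}.
    apply: (chart_continuous_fun dx).
    have mG := chart_metricP g i; have su := static_u_chart i; have Ix := cimg_chart dx.
    apply: (continuous_ext_at (f := w i)).
      apply: near_imp (near_open (@open_cimg _ _ _ i) Ix (fun _ H => H)) _ => q Iq /=.
      by rewrite deficit_chart.
    exact: (smooth_continuous (smooth_w mG su _)).
  have d0 : 0 < `|deficit x - deficit x0| / 2 by rewrite divr_gt0// normr_gt0 subr_eq0.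
  have /continuous_atP/(_ _ d0) N := c.
  apply: near_imp N _ => y; apply: contraTneq => ->.
  by rewrite -ltNge ltr_pdivrMr// ltr_pMr ?ltr1n// normr_gt0 subr_eq0.
apply: (@connected_clopen _ [set y | deficit y = deficit x0] x0 (static_connected st)) => //.
  by rewrite openE => x /lc.
move=> x cl; apply/eqP; apply: contrapT => /negP/lc' N.
by have [y [/= yx /negP]] := cl _ N; rewrite yx eqxx.
Qed.

Let L := liminf_infinity deficit.

Lemma exists_outside (K : set M) : compact K -> exists x, ~ K x.
Proof.
move=> cK; apply: contrapT => H; apply: (static_noncompact st).
suff -> : [set: M] = K by [].
by apply/seteqP; split=> x // _; apply: contrapT => Kx; apply: H; exists x.
Qed.

Lemma deficit_continuous : continuous deficit.
Proof.
move=> x; have dx := dom_chart_at x; set i := chart_at x in dx.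
have mG := chart_metricP g i; have su := static_u_chart i; have Ix := cimg_chart dx.
apply: (chart_continuous_fun dx); apply: (continuous_ext_at (f := w i)).
  apply: near_imp (near_open (@open_cimg _ _ _ i) Ix (fun _ H => H)) _ => q Iq /=.
  by rewrite deficit_chart.
exact: (smooth_continuous (smooth_w mG su _)).
Qed.

(** Otherwise W exceeds W(x) outside some compact K; then [x] is in K and the minimum of W over K is
    global, so W is constant, which contradicts the strict inequality at a point outside K. *)
Lemma liminf_le_deficit x : (L <= (deficit x)%:E)%E.
Proof.
rewrite leNgt; apply/negP => /ereal_sup_gt[_ [K cK <-]] H.
have HK y : ~ K y -> deficit x < deficit y.
  move=> Ky; rewrite -lte_fin; apply: lt_le_trans H _.
  by apply: ereal_inf_lbound; exists y.
have Kx : K x by apply: contrapT => /HK; rewrite ltxx.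
have [x0 Kx0 Hx0] : exists2 x0, K x0 & forall y, K y -> deficit x0 <= deficit y.
  apply: compact_attains_min => //; first by exists x.
  by move=> q _; exact: deficit_continuous.
have Hall y : deficit x0 <= deficit y.
  have [Ky|Ky] := pselect (K y); first exact: Hx0.
  exact: le_trans (Hx0 _ Kx) (ltW (HK _ Ky)).
have [y Ky] := exists_outside cK.
have := HK _ Ky; rewrite (deficit_min_const Hall x) (deficit_min_const Hall y).
by rewrite ltxx.
Qed.

Lemma deficit_at_min p : u p = u_min u -> deficit p = 0.
Proof.
move=> up; have dp := dom_chart_at p; set i := chart_at p in dp.
have su := static_u_chart i; have Ip := cimg_chart dp.
rewrite /deficit up subrr sub0r; apply/eqP; rewrite oppr_eq0; apply/eqP.
rewrite (grad_sqE g dp); last exact: static_u_at.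
rewrite /ipc /ipg big1// => a _; rewrite big1// => b _.
have g0 k : partial k (u \o param i) (chart i p) = 0.
  have M0 : \forall q \near chart i p, (u \o param i) (chart i p) <= (u \o param i) q.
    have [_ _ H] := u_min_attained.
    by apply: (near_open (@open_cimg _ _ _ i) Ip) => q _ /=; rewrite (chartK dp) up.
  have := local_min_grad (delta_mx 0 k) (@open_cimg _ _ _ i) su Ip M0.
  rewrite (bigD1 k)//= mxE !eqxx mul1r big1 ?addr0// => l lk.
  by rewrite mxE (negbTE lk) andbF mul0r.
by rewrite !g0 mulr0.
Qed.

Lemma liminf_le0 : (L <= 0)%E.
Proof.
have [p up _] := u_min_attained.
by have := liminf_le_deficit p; rewrite (deficit_at_min up).
Qed.

Lemma liminf0_deficit : L = 0%E -> forall x, deficit x = 0.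
Proof.
move=> L0; have [p up _] := u_min_attained; have p0 := deficit_at_min up.
rewrite -{1}p0; apply: deficit_min_const => y.
by have := liminf_le_deficit y; rewrite p0 L0 lee_fin.
Qed.

(** W vanishes identically, so the Bochner formula reduces to |T|^2 = 0 for the stress T. *)
Lemma liminf0_stress : L = 0%E -> forall i q, cimg i q ->
  hessian (g i) (u \o param i) q = (u \o param i) q *: g i q.
Proof.
move=> L0 i q Iq; have mG := chart_metricP g i; have su := static_u_chart i.
have oU := cm_open mG; have d0 := liminf0_deficit L0.
have w0 q' : cimg i q' -> w i q' = 0 by move=> Iq'; rewrite -deficit_chart.
have e0 : elliptic (g i) (drift i) (w i) q = 0.
  have p1 k q' : cimg i q' -> partial k (w i) q' = 0.
    move=> Iq'; rewrite (partial_ext (h := fun=> 0) k oU _ Iq') ?partial_cst//.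
  rewrite /elliptic big1 ?add0r => [|a _].
    by rewrite big1// => k _; rewrite p1// mulr0.
  rewrite big1// => b _; rewrite (partial_ext (h := fun=> 0) a oU _ Iq) ?partial_cst ?mulr0//.
  by move=> q' Iq'; exact: p1.
have [_ T0] := mxtrace_sq_ge0 (cm_sym mG Iq) (cm_pos mG Iq) (stress_sym mG su Iq).
apply/eqP; rewrite -subr_eq0; apply/eqP; apply: T0.
move: e0; rewrite elliptic_deficit// mulNr => /eqP.
by rewrite oppr_eq0 mulf_eq0 pnatr_eq0/= => /eqP.
Qed.

Lemma liminf0_grad : L = 0%E -> forall i x, dom i x ->
  ipc g i u u x = u x ^+ 2 - u_min u ^+ 2.
Proof.
move=> L0 i x dx; have := liminf0_deficit L0 x; rewrite /deficit.
rewrite (grad_sqE g dx); last exact: static_u_at.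
by move=> /eqP; rewrite subr_eq0 => /eqP.
Qed.

End StaticTriple.

(** * Parallel sections of a flat connection *)

Section MatrixNorm.
Context {R : realType}.

Lemma mulmx_norm_le m n p (A : 'M[R]_(m, n)) (B : 'M[R]_(n, p)) :
  `|A *m B| <= n%:R * `|A| * `|B|.
Proof.
apply: norm_le_coord => [|i j]; first by rewrite !mulr_ge0.
rewrite mxME; apply: le_trans (ler_norm_sum _ _ _) _.
apply: (@le_trans _ _ (\sum_(k < n) `|A| * `|B|)).
  by apply: ler_sum => k _; rewrite normrM ler_pM//; exact: coord_le_norm.
by rewrite sumr_const card_ord -[leLHS]mulr_natl mulrA.
Qed.

Lemma mx_continuous_at (T : topologicalType) m n (Z : T -> 'M[R]_(m, n)) p :
  (forall i j, {for p, continuous (fun q => Z q i j)}) -> {for p, continuous Z}.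
Proof.
move=> C; apply/continuous_atP => e e0.
have nb i : \forall q \near p, forall j, `|Z p i j - Z q i j| <= e.
  by apply: near_forall => j; exact: (continuous_atP _ _).1 (C i j) _ e0.
apply: near_imp (near_forall nb) _ => q H.
by apply: norm_le_coord => [|i j]; [exact: ltW|rewrite !mxE].
Qed.

Lemma ball_dist_lt n (y0 z q : 'rV[R]_n) r : ball y0 r z -> ball y0 r q -> `|q - z| <= 2 * r.
Proof.
rewrite !in_ballE => zr qr; have -> : q - z = (y0 - z) - (y0 - q).
  by apply/matrixP => a b; rewrite !mxE; ring.
apply: le_trans (ler_normB _ _) _; rewrite mulr_natl mulr2n.
by apply: lerD; exact: ltW.
Qed.

Lemma sum_coord_le n (v c : 'I_n -> R) a e : 0 <= a -> (forall i, `|v i| <= a) ->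
  (forall i, `|c i| <= e) -> `|\sum_i v i * c i| <= n%:R * a * e.
Proof.
move=> a0 va ce; apply: le_trans (ler_norm_sum _ _ _) _.
apply: (@le_trans _ _ (\sum_(k < n) a * e)).
  by apply: ler_sum => k _; rewrite normrM ler_pM.
by rewrite sumr_const card_ord -[leLHS]mulr_natl mulrA.
Qed.

Lemma absorb_half (mu a e : R) : a <= 1 / 2 -> 0 <= mu -> mu <= a * mu + e -> mu <= 2 * e.
Proof. by move=> ? ? ?; nra. Qed.

Lemma between01 (t t0 : R) : 0 <= t0 -> t0 <= 1 -> (0 <= t <= t0) || (t0 <= t <= 0) ->
  0 <= t <= 1.
Proof. by move=> ? ? /orP[]/andP[? ?]; apply/andP; split; lra. Qed.

Lemma split_eps (eps x y : R) : 0 < 2 + x ->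
  eps / (2 + x) + eps / (2 + x) + (x * (eps / (2 + x)) + y) = eps + y.
Proof. by move=> x0; field; rewrite gt_eqF. Qed.

(* Gronwall's inequality on a ball so small that the linear term can be absorbed. *)
Lemma segment_bound n m (A : 'I_n -> 'rV[R]_n -> 'M[R]_m) (Z : 'rV[R]_n -> 'cV[R]_m)
    (y0 z : 'rV[R]_n) (r K e : R) :
  0 < r -> 0 <= K -> 4 * r * n%:R * m%:R * K <= 1 -> 0 <= e ->
  (forall a, C_on 1 (ball y0 r) (fun q => Z q a 0)) ->
  (forall i q, ball y0 r q -> `|A i q| <= K) ->
  (forall i q, ball y0 r q -> `|dmx i Z q - A i q *m Z q| <= e) ->
  ball y0 r z -> Z z = 0 -> forall q, ball y0 r q -> `|Z q| <= 4 * r * n%:R * e.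
Proof.
move=> r0 K0 small e0 CZ AK dZ Bz Zz q Bq.
have oB : open (ball y0 r) by exact: ball_open.
have inB (t : R) : 0 <= t <= 1 -> ball y0 r (t *: (q - z) + z).
  by move=> tt; exact: ball_segment.
pose S := `[0, 1]%classic : set R.
have cS : compact S by exact: segment_compact.
have S0 : S !=set0 by exists 0; rewrite /S /= in_itv /= lexx ler01.
(* [t0] maximises |Z| on the segment from [z] to [q]; an inequality bounding the maximum [mu] by a
   fraction of itself takes the place of an integral inequality. *)
have [t0 St0 Ht0] : exists2 t0, S t0 &
    forall t, S t -> `|Z (t *: (q - z) + z)| <= `|Z (t0 *: (q - z) + z)|.
  apply: (@compact_attains_max _ _ S (fun t => `|Z (t *: (q - z) + z)|)) => //.
  move=> t; rewrite /S /= in_itv /= => tt.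
  have cl : {for t, continuous (fun t : R => Z (t *: (q - z) + z))}.
    apply: mx_continuous_at => a j; rewrite ord1.
    have := C1_is_derive_line oB (CZ a) (inB _ tt).
    by move=> [/derivable1_diffP/differentiable_continuous].
  exact: (continuous_comp cl (@norm_continuous _ _ _)).
set mu := `|Z (t0 *: (q - z) + z)| in Ht0.
have mu0 : 0 <= mu by exact: normr_ge0.
have q1 : `|Z q| <= mu.
  have := Ht0 1; rewrite /S /= in_itv /= lexx ler01 => /(_ isT).
  by rewrite scale1r subrK.
apply: le_trans q1 _.
have n0 : 0 <= n%:R :> R by [].
have dZb (a : 'I_m) (t : R) : 0 <= t <= 1 ->
    `|\sum_i (q - z) 0 i * partial i (fun p => Z p a 0) (t *: (q - z) + z)|
    <= n%:R * (2 * r) * (m%:R * K * mu + e).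
  move=> tt; apply: sum_coord_le; first by rewrite mulr_ge0// ltW.
    by move=> i; apply: le_trans (coord_le_norm _ _ _) _; exact: ball_dist_lt Bz Bq.
  move=> i; have Bt := inB _ tt; rewrite -(dmxE Z).
  have -> : dmx i Z (t *: (q - z) + z) a 0 =
     (dmx i Z (t *: (q - z) + z) - A i (t *: (q - z) + z) *m Z (t *: (q - z) + z)) a 0
     + (A i (t *: (q - z) + z) *m Z (t *: (q - z) + z)) a 0.
    by rewrite mxDE mxNE subrK.
  apply: le_trans (ler_normD _ _) _; rewrite addrC; apply: lerD; last first.
    by apply: le_trans (coord_le_norm _ _ _) _; exact: dZ.
  apply: le_trans (coord_le_norm _ _ _) _; apply: le_trans (mulmx_norm_le _ _) _.
  rewrite -!mulrA ler_wpM2l//; apply: ler_pM => //; first exact: AK.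
  by apply: Ht0; rewrite /S /= in_itv.
have mub : mu <= n%:R * (2 * r) * (m%:R * K * mu + e).
  rewrite /mu; apply: norm_le_coord => [|a j]; rewrite ?ord1.
    by rewrite !(mulr_ge0, addr_ge0)// ltW.
  have t01 : 0 <= t0 <= 1 by move: St0; rewrite /S /= in_itv.
  have /andP[t00 t0le] := t01.
  have [|c cb E] := @MVT_between _ (fun t : R => Z (t *: (q - z) + z) a 0)
    (fun t : R => \sum_i (q - z) 0 i * partial i (fun p => Z p a 0) (t *: (q - z) + z)) 0 t0.
    move=> t tb; apply: (C1_is_derive_line oB (CZ a)); apply: inB.
    exact: between01 t00 t0le tb.
  have c01 : 0 <= c <= 1.
    exact: between01 t00 t0le cb.
  rewrite -[X in `|X|]subr0.
  have {1}-> : 0 = Z (0 *: (q - z) + z) a 0 by rewrite scale0r add0r Zz mxE.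
  rewrite E subr0 normrM (ger0_norm t00).
  by apply: le_trans (ler_piMr _ t0le) (dZb _ _ c01).
(* The smallness hypothesis is calibrated for this: the linear term is at most mu / 2 and can be
   absorbed on the left. *)
have half : n%:R * (2 * r) * (m%:R * K) <= 1 / 2.
  move: small; move: (n%:R : R) (m%:R : R) => x y; lra.
have : mu <= n%:R * (2 * r) * (m%:R * K) * mu + n%:R * (2 * r) * e.
  by apply: le_trans mub _; rewrite mulrDr mulrA.
move=> /(absorb_half half mu0) H; apply: le_trans H _.
by rewrite le_eqVlt; apply/orP; left; apply/eqP; move: (n%:R : R) => x; ring.
Qed.

Lemma lipschitz_ball n (f : 'rV[R]_n -> R) y0 r K p q : 0 <= K ->
  C_on 1 (ball y0 r) f -> (forall i x, ball y0 r x -> `|partial i f x| <= K) ->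
  ball y0 r p -> ball y0 r q -> `|f q - f p| <= n%:R * `|q - p| * K.
Proof.
move=> K0 Cf fK Bp Bq; have oB : open (ball y0 r) by exact: ball_open.
have [|c cb E] := @MVT_between _ (fun t : R => f (t *: (q - p) + p))
    (fun t : R => \sum_i (q - p) 0 i * partial i f (t *: (q - p) + p)) 0 1.
  move=> t tb; apply: (C1_is_derive_line oB Cf); apply: ball_segment => //.
  by case/orP: tb => // /andP[x1 x2]; rewrite (le_trans ler01 x1) (le_trans x2 ler01).
have c01 : 0 <= c <= 1.
  by case/orP: cb => // /andP[x1 x2]; rewrite (le_trans ler01 x1) (le_trans x2 ler01).
move: E; rewrite scale1r subrK scale0r add0r subr0 mulr1 => ->.
apply: sum_coord_le => //; first by move=> i; exact: coord_le_norm.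
by move=> i; apply: fK; exact: ball_segment.
Qed.

(** On the ball of radius 3 r d about [x] the first derivatives oscillate by at most n (3 r d) K,
    and [C1_increment] converts this into an error of order d^2. Since d <= 1, that ball stays
    within radius 4 r of [y0]. *)
Lemma taylor2 n (f : 'rV[R]_n -> R) y0 (r K d : R) x w : 0 < r -> 0 <= K ->
  C_on 2 (ball y0 (4 * r)) f ->
  (forall i j q, ball y0 (4 * r) q -> `|partial i (partial j f) q| <= K) ->
  ball y0 r x -> 0 < d -> d <= 1 -> `|w| <= 2 * r * d ->
  `|f (w + x) - f x - \sum_i w 0 i * partial i f x| <= n%:R * (n%:R * (3 * r * d) * K) * (2 * r * d).
Proof.
move=> r0 K0 C2 fK Bx d0 d1 wr.
have sub q : ball x (3 * r * d) q -> ball y0 (4 * r) q.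
  rewrite !in_ballE => xq; have -> : y0 - q = (y0 - x) + (x - q) by rewrite addrA subrK.
  apply: le_lt_trans (ler_normD _ _) _.
  move: Bx xq; rewrite in_ballE; move: (`|_|) (`|_|) => a b ha hb; nra.
have e0 : 0 <= n%:R * (3 * r * d) * K by rewrite !mulr_ge0// ltW.
have wlt : `|w| < 3 * r * d.
  by apply: le_lt_trans wr _; rewrite ltr_pM2r// ltr_pM2r// ltr_nat.
have Cx : C_on 2 (ball x (3 * r * d)) f by exact: C_on_sub sub C2.
apply: (le_trans (@C1_increment _ _ f x (3 * r * d) _ w e0 wlt _ _)); last first.
- by rewrite ler_wpM2l// mulr_ge0.
- move=> q Bq i; have [_ /(_ i)[_ Ci]] := Cx.
  have Bxx : ball x (3 * r * d) x by rewrite in_ballE subrr normr0 !mulr_gt0.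
  apply: (le_trans (@lipschitz_ball _ (partial i f) x (3 * r * d) K x q K0 Ci _ Bxx Bq)).
    by move=> k y By; apply: fK; exact: sub.
  rewrite ler_wpM2r// ler_wpM2l//; move: Bq; rewrite in_ballE distrC; exact: ltW.
- by move=> q Bq i; have [_ /(_ i)[D _]] := Cx; exact: D.
Qed.

(** Every [a N - e N] lies below every [a M + e M], so the supremum of the former is within [e N] of
    each [a N]; the rate stays explicit. *)
Lemma squeeze_limit (a e : nat -> R) : (forall N M, `|a N - a M| <= e N + e M) ->
  exists l, forall N, `|a N - l| <= e N.
Proof.
move=> H; pose E := [set a N - e N | N in setT].
have ub N : ubound E (a N + e N).
  move=> _ [M _ <-]; have := H M N; rewrite ler_norml => /andP[_].
  by move: (a M) (a N) (e M) (e N) => *; lra.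
exists (sup E) => N; rewrite ler_norml; apply/andP; split.
  rewrite lerBrDr addrC lerBlDr; apply: ge_sup; last exact: ub.
  by exists (a 0%N - e 0%N), 0%N.
rewrite lerBlDr -lerBlDl; apply: ub_le_sup; last by exists N.
by exists (a 0%N + e 0%N); exact: ub.
Qed.

Lemma small_inv (C eps : R) : 0 < eps -> exists N : nat, C / N.+1%:R <= eps.
Proof.
move=> e0; pose N := Num.truncn (`|C| / eps).
exists N; rewrite ler_pdivrMr//; apply: le_trans (ler_norm C) _.
have := truncnS_gt (`|C| / eps); rewrite -/N ltr_pdivrMr// => /ltW.
by rewrite mulrC.
Qed.

Lemma rate_limit_continuous (T : topologicalType) (U : set T) (F : nat -> T -> R) (f : T -> R) C p :
  open U -> U p -> (forall N q, U q -> `|F N q - f q| <= C / N.+1%:R) ->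
  (forall N, {for p, continuous (F N)}) -> {for p, continuous f}.
Proof.
move=> oU Up H cF; apply/continuous_atP => e e0.
have e3 : 0 < e / 3 by rewrite divr_gt0.
have [N CN] := small_inv C e3.
have NU := near_open oU Up (fun _ H => H).
apply: near_imp (near_and NU ((continuous_atP _ _).1 (cF N) _ e3)) _ => q [Uq Hq].
have h1 := le_trans (H N _ Up) CN; have h2 := le_trans (H N _ Uq) CN.
have -> : f p - f q = (F N p - F N q) - (F N p - f p) + (F N q - f q) by rewrite addrAC; ring.
apply: le_trans (ler_normD _ _) _; apply: le_trans (lerD (ler_normB _ _) (lexx _)) _.
apply: le_trans (lerD (lerD Hq h1) h2) _.
by rewrite le_eqVlt; apply/orP; left; apply/eqP; field.
Qed.

Lemma derive_of_estimate n (f : 'rV[R]_n -> R) p i (l : R) :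
  (forall e : R, 0 < e -> exists2 d : R, 0 < d & forall t : R, `|t| < d ->
    `|f (t *: delta_mx 0 i + p) - f p - t * l| <= e * `|t|) ->
  derivable f p (delta_mx 0 i) /\ partial i f p = l.
Proof.
move=> D; suff : is_derive p (delta_mx 0 i : 'rV[R]_n) f l by case=> ? <-; split.
have cv : (fun t : R => t^-1 *: (f (t *: delta_mx 0 i + p) - f p)) @ 0^' --> l.
  apply/cvgrPdist_le => e e0; have [d d0 Hd] := D e e0; near=> t.
  have tn0 : t != 0 by near: t; exact: nbhs_dnbhs_neq.
  have td : `|t| < d by near: t; exact: dnbhs0_lt.
  have := Hd t td.
  have -> : f (t *: delta_mx 0 i + p) - f p - t * l =
      - (t * (l - t^-1 *: (f (t *: delta_mx 0 i + p) - f p))).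
    by rewrite mulrBr [t * (_ *: _)]mulrA mulfV// mul1r opprB.
  by rewrite normrN normrM mulrC ler_pM2r// normr_gt0.
by apply: DeriveDef; [apply/cvg_ex; exists l|exact: cvg_lim].
Unshelve. all: by end_near. Qed.

(** At a fixed [t] the mean value theorem is applied to [F N] with N so large that all approximation
    errors together are below [eps]; letting [eps] tend to 0 leaves the oscillation of [h], at most
    [e * |t|]. *)
Lemma rate_limit_derive n (U : set 'rV[R]_n) (F : nat -> 'rV[R]_n -> R) (f h : 'rV[R]_n -> R)
    i C p : open U -> U p -> (forall N, C_on 1 U (F N)) ->
  (forall N q, U q -> `|F N q - f q| <= C / N.+1%:R) ->
  (forall N q, U q -> `|partial i (F N) q - h q| <= C / N.+1%:R) ->
  {for p, continuous h} ->
  derivable f p (delta_mx 0 i) /\ partial i f p = h p.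
Proof.
move=> oU Up CF Hf Hh ch.
have D : forall e : R, 0 < e -> exists2 d : R, 0 < d & forall t : R, `|t| < d ->
    `|f (t *: delta_mx 0 i + p) - f p - t * h p| <= e * `|t|.
  move=> e e0; have [r r0 Hr] := near_in_ball (near_and (near_open oU Up (fun _ H => H))
    ((continuous_atP _ _).1 ch _ e0)).
  exists r => // t tr; apply/ler_addgt0Pl => eps eps0.
  have inr (s : R) : (0 <= s <= t) || (t <= s <= 0) -> ball p r (s *: delta_mx 0 i + p).
    move=> sb; rewrite in_ballE opprD addrCA subrr addr0 normrN normrZ.
    apply: le_lt_trans tr; apply: le_trans (ler_piMr _ (norm_delta_le1 i)) _ => //.
    by case/orP: sb => /andP[s1 s2]; [rewrite !ger0_norm// (le_trans s1)|rewrite !ler0_norm ?lerN2// (le_trans s1)].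
  have pos : 0 < 2 + `|t| by rewrite ltr_pwDl.
  have [N CN] := small_inv C (divr_gt0 eps0 pos).
  have [|c cb E] := @MVT_between _ (fun s : R => F N (s *: delta_mx 0 i + p))
     (fun s : R => partial i (F N) (s *: delta_mx 0 i + p)) 0 t.
    move=> s sb; apply: partial_line; have [_ /(_ i)[d _]] := CF N; apply: d.
    by have [] := Hr _ (inr _ sb).
  have Bt : ball p r (t *: delta_mx 0 i + p).
    by apply: inr; have [t0|t0] := leP 0 t; rewrite lexx ?(ltW t0) ?orbT.
  have Bc := inr _ cb.
  move: E; rewrite scale0r add0r subr0 => E.
  have [Ut _] := Hr _ Bt; have [Uc hc] := Hr _ Bc.
  have h1 := le_trans (Hf N _ Up) CN; have h2 := le_trans (Hf N _ Ut) CN.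
  have h3 := le_trans (Hh N _ Uc) CN.
  have -> : f (t *: delta_mx 0 i + p) - f p - t * h p =
     (F N p - f p) - (F N (t *: delta_mx 0 i + p) - f (t *: delta_mx 0 i + p))
     + ((F N (t *: delta_mx 0 i + p) - F N p) - t * h p).
    move: (f _) (f _) (F N _) (F N _) (t * _) => x1 x2 x3 x4 x5; ring.
  rewrite E.
  have -> : partial i (F N) (c *: delta_mx 0 i + p) * t - t * h p =
    t * ((partial i (F N) (c *: delta_mx 0 i + p) - h (c *: delta_mx 0 i + p))
      - (h p - h (c *: delta_mx 0 i + p))).
    move: (partial _ _ _) (h _) (h _) => x1 x2 x3; ring.
  apply: le_trans (ler_normD _ _) _.
  have k1 := le_trans (ler_normB _ _) (lerD h1 h2).
  have k2 := le_trans (ler_normB _ _) (lerD h3 hc).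
  have k3 : `|t| * (eps / (2 + `|t|) + e) <= `|t| * (eps / (2 + `|t|)) + e * `|t|.
    by rewrite mulrDr (mulrC _ e).
  apply: le_trans (lerD k1 _) _.
    by rewrite normrM; apply: le_trans k3; rewrite ler_wpM2l//; exact: k2.
  have -> : eps / (2 + `|t|) + eps / (2 + `|t|) + (`|t| * (eps / (2 + `|t|)) + e * `|t|)
      = eps + e * `|t|.
    exact: split_eps.
  by [].
exact: derive_of_estimate D.
Qed.

End MatrixNorm.

Section EulerAlgebra.
Context {R : realType}.

(** One Euler step for the defect dP - s a P. Here [P] and [dP] are the polygon and its i-th
    derivative, [a] and [a'] the matrix A_i at consecutive nodes, [x] the slope, [Dt] and [Dm] the
    contractions with q - z of d_i A_j and d_j A_i, and [T] a Taylor remainder. Flatness, the first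
    hypothesis, cancels the terms of first order in [h] except h x (dP - s a P). *)
Lemma euler_step_alg m (P dP : 'cV[R]_m) (a a' x Dt Dm T : 'M[R]_m) h s :
  Dt - Dm + x *m a - a *m x = 0 -> a' = a + h *: Dm + T ->
  (dP + h *: ((a + s *: Dt) *m P + x *m dP)) - (s + h) *: (a' *m (P + h *: (x *m P)))
  = (dP - s *: (a *m P)) + h *: (x *m (dP - s *: (a *m P)))
    - (h ^+ 2 *: (Dm *m P + a *m (x *m P) + (s + h) *: (Dm *m (x *m P)))
       + (s + h) *: (T *m P) + ((s + h) * h) *: (T *m (x *m P))).
Proof.
move=> F ->; have -> : Dt = Dm - x *m a + a *m x.
  apply/eqP; rewrite -subr_eq0; apply/eqP; rewrite -F.
  by apply/matrixP => i j; rewrite !(mxDE, mxNE); ring.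
do 3! rewrite ?(mulmxDl, mulmxDr, mulmxBl, mulmxBr, mulNmx, mulmxN) -?scalemxAl -?scalemxAr.
rewrite -!mulmxA.
move: (Dm *m (x *m P)) (a *m (x *m P)) (x *m (a *m P)) (Dm *m P) (T *m (x *m P)) (T *m P) (a *m P) (x *m dP).
move=> v1 v2 v3 v4 v5 v6 v7 v8; apply/matrixP => i j; rewrite !(mxDE, mxNE, mxZE).
ring.
Qed.

Lemma remainder_split m (a a' b : 'M[R]_m) : a' = a + b + (a' - a - b).
Proof. by apply/matrixP => i j; rewrite !(mxDE, mxNE); ring. Qed.

Lemma expR_pow_bound (N l : nat) : (l <= N.+1)%N ->
  (1 + N.+1%:R^-1) ^+ l <= expR 1 :> R.
Proof.
move=> lN; apply: (@le_trans _ _ (expR (N.+1%:R^-1) ^+ l)).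
  by rewrite lerXn2r ?nnegrE ?addr_ge0 ?expR_ge0// expR_ge1Dx.
have -> : expR N.+1%:R^-1 ^+ l = expR (l%:R * N.+1%:R^-1) :> R by rewrite expRM_natl.
by rewrite ler_expR ler_pdivrMr// mul1r ler_nat.
Qed.

(** Discrete form of Gronwall's lemma. *)
Lemma linear_recurrence_bound (e : nat -> R) h C N : 0 <= h -> 0 <= C -> e 0%N <= 0 ->
  (forall l, (l < N)%N -> e l.+1 <= (1 + h) * e l + C) ->
  forall l, (l <= N)%N -> e l <= l%:R * C * (1 + h) ^+ l.
Proof.
move=> h0 C0 e0 H; elim=> [_|l IH lN]; first by rewrite !mul0r.
apply: le_trans (H _ lN) _.
have h1 : 1 <= 1 + h by rewrite lerDl.
apply: (@le_trans _ _ ((1 + h) * (l%:R * C * (1 + h) ^+ l) + C * (1 + h) ^+ l.+1)).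
  apply: lerD; first by rewrite ler_wpM2l ?IH ?(ltnW lN)// (le_trans ler01).
  by rewrite ler_peMr// exprn_ege1.
rewrite le_eqVlt; apply/orP; left; apply/eqP; rewrite exprS -natr1.
by move: (l%:R : R) (_ ^+ _) => x y; ring.
Qed.

Lemma norm_scale_le m n (A : 'M[R]_(m, n)) c d b : 0 <= c -> c <= d -> `|A| <= b -> `|c *: A| <= d * b.
Proof. by move=> c0 cd Ab; rewrite normrZ (ger0_norm c0) ler_pM. Qed.

Lemma mulmx_le m n p (A : 'M[R]_(m, n)) (B : 'M[R]_(n, p)) a b :
  `|A| <= a -> `|B| <= b -> `|A *m B| <= n%:R * a * b.
Proof.
move=> Aa Bb; apply: le_trans (mulmx_norm_le _ _) _.
by rewrite -!mulrA ler_wpM2l// ler_pM.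
Qed.

Lemma norm_sum_scale_le m p n (v : 'I_n -> R) (A : 'I_n -> 'M[R]_(m, p)) a b : 0 <= b -> 0 <= a ->
  (forall j, `|v j| <= a) -> (forall j, `|A j| <= b) -> `|\sum_j v j *: A j| <= n%:R * a * b.
Proof.
move=> b0 a0 va Ab; apply: norm_le_coord => [|i j]; first by rewrite !mulr_ge0.
rewrite summxE; under eq_bigr => k _ do rewrite mxZE.
apply: sum_coord_le => // k; exact: le_trans (coord_le_norm _ _ _) (Ab k).
Qed.

End EulerAlgebra.

(** * Convergence of Euler polygons for a flat connection *)

Section Euler.
Context {R : realType} {n m : nat}.
Variables (A : 'I_n -> 'rV[R]_n -> 'M[R]_m) (y0 : 'rV[R]_n) (r K : R).
Hypothesis r0 : 0 < r.
Hypothesis K0 : 0 <= K.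
Let B := ball y0 r.
Let B4 := ball y0 (4 * r).
Hypothesis sA : forall i, smx B4 (A i).
Hypothesis A0 : forall i q, B4 q -> `|A i q| <= K.
Hypothesis A1 : forall i j q, B4 q -> `|dmx j (A i) q| <= K.
Hypothesis A2 : forall i a b j k q, B4 q ->
  `|partial j (partial k (fun q => A i q a b)) q| <= K.
Hypothesis flat : forall i j q, B4 q ->
  dmx i (A j) q - dmx j (A i) q + A j q *m A i q - A i q *m A j q = 0.
Hypothesis small : 4 * r * n%:R * m%:R * K <= 1.
Variables (z : 'rV[R]_n) (Y0 : 'cV[R]_m).
Hypothesis Bz : B z.

Let oB : open B. Proof. exact: ball_open. Qed.
Let oB4 : open B4. Proof. exact: ball_open. Qed.
Let BB4 q : B q -> B4 q.
Proof. by rewrite /B /B4 !in_ballE => H; apply: lt_le_trans H _; rewrite ler_peMl ?ltW// ltr1n. Qed.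

Definition node (s : R) (q : 'rV[R]_n) : 'rV[R]_n := s *: (q - z) + z.

Lemma node_ball s q : 0 <= s <= 1 -> B q -> B (node s q).
Proof. by move=> s01 Bq; apply: ball_segment. Qed.

Let nodeE s b : (fun q => node s q 0 b) = (fun q : 'rV[R]_n => s * (q 0 b - z 0 b) + z 0 b).
Proof. by apply/funext => q; rewrite !mxE. Qed.

Lemma smooth_node s b V : open V -> smooth_on V (fun q => node s q 0 b).
Proof.
move=> oV; rewrite nodeE; apply: smoothD => //; last exact: smooth_cst.
apply: smoothM => //; first exact: smooth_cst.
by apply: smoothB => //; [exact: smooth_coord|exact: smooth_cst].
Qed.

Lemma partial_node s b i q : partial i (fun q => node s q 0 b) q = s * (i == b)%:R.
Proof.
have oT : open (@setT 'rV[R]_n) by exact: openT.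
have sc := smoothB oT (@smooth_coord _ _ setT b) (@smooth_cst _ _ setT (z 0 b)).
rewrite nodeE.
rewrite (partialD i (smoothM oT (@smooth_cst _ _ setT s) sc) (@smooth_cst _ _ setT (z 0 b)) (I : setT q)).
rewrite (partialZ i s sc (I : setT q)) partial_cst addr0.
rewrite (partialB i oT (@smooth_coord _ _ setT b) (@smooth_cst _ _ setT (z 0 b)) (I : setT q)).
by rewrite partial_coord partial_cst subr0.
Qed.

Lemma smooth_comp_node f s : 0 <= s <= 1 -> smooth_on B4 f -> smooth_on B (fun q => f (node s q)).
Proof.
move=> s01 sf k; apply: (@C_on_comp _ k _ _ B B4 (node s) f) => //.
- by move=> q Bq; apply: BB4; exact: node_ball.
- by move=> b; exact: smooth_node.
Qed.

Lemma partial_comp_node f s i q : 0 <= s <= 1 -> smooth_on B4 f -> B q ->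
  partial i (fun q => f (node s q)) q = s * partial i f (node s q).
Proof.
move=> s01 sf Bq; have Bn := BB4 (node_ball s01 Bq).
have sn b : C_on 1 B (fun q => node s q 0 b) by exact: smooth_node.
have := partial_comp i oB oB4 sn (sf 1%N) Bq Bn.
rewrite (bigD1 i)//= partial_node eqxx mulr1 big1 ?addr0 => [<-//|b bi].
by rewrite partial_node eq_sym (negbTE bi) mulr0 mul0r.
Qed.

(** The coefficient of the transport equation along the segment: the connection at the node,
    contracted with the velocity q - z. *)
Definition slope (s : R) (q : 'rV[R]_n) : 'M[R]_m := \sum_j (q 0 j - z 0 j) *: A j (node s q).

Lemma smx_slope s : 0 <= s <= 1 -> smx B (slope s).
Proof.
move=> s01 a b; apply: (smooth_ext oB (f := fun q => \sum_j (q 0 j - z 0 j) * A j (node s q) a b)).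
  by move=> q _; rewrite summxE; apply: eq_bigr => j _; rewrite mxZE.
apply: smooth_sum => // j; apply: smoothM => //.
  by apply: smoothB => //; [exact: smooth_coord|exact: smooth_cst].
exact: smooth_comp_node (sA j a b).
Qed.

Lemma dmx_slope s i q : 0 <= s <= 1 -> B q -> dmx i (slope s) q =
  A i (node s q) + s *: \sum_j (q 0 j - z 0 j) *: dmx i (A j) (node s q).
Proof.
move=> s01 Bq; apply/matrixP => a b; rewrite dmxE mxDE mxZE summxE.
have sc j : smooth_on B (fun q : 'rV[R]_n => q 0 j - z 0 j).
  by apply: smoothB => //; [exact: smooth_coord|exact: smooth_cst].
rewrite (partial_ext (h := fun q => \sum_j (q 0 j - z 0 j) * A j (node s q) a b) i oB _ Bq); last first.
  by move=> q' _; rewrite summxE; apply: eq_bigr => j _; rewrite mxZE.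
rewrite (partial_sum (F := fun j q => (q 0 j - z 0 j) * A j (node s q) a b) _ _ _ oB _ Bq); last first.
  by move=> j; apply: smoothM => //; exact: smooth_comp_node (sA j a b).
rewrite mulr_sumr (bigD1 i)//= [in RHS](bigD1 i)//= addrA; congr (_ + _).
  rewrite (partialM i (sc i) (smooth_comp_node s01 (sA i a b)) Bq).
  rewrite (partial_comp_node i s01 (sA i a b) Bq) mxZE dmxE.
  rewrite (partialB i oB (@smooth_coord _ _ B i) (@smooth_cst _ _ B (z 0 i)) Bq).
  by rewrite partial_coord partial_cst subr0 eqxx mul1r mulrCA.
apply: eq_bigr => j ji.
rewrite (partialM i (sc j) (smooth_comp_node s01 (sA j a b)) Bq).
rewrite (partial_comp_node i s01 (sA j a b) Bq) mxZE dmxE.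
rewrite (partialB i oB (@smooth_coord _ _ B j) (@smooth_cst _ _ B (z 0 j)) Bq).
by rewrite partial_coord partial_cst subr0 eq_sym (negbTE ji) mul0r add0r mulrCA.
Qed.

(* Explicit Euler scheme of step h for the transport along the segment from z to q; the
   polygons and their derivatives in q converge because their defect from parallelism
   is O(h) when A is flat. *)
Fixpoint euler (h : R) (l : nat) (q : 'rV[R]_n) : 'cV[R]_m :=
  if l is l'.+1 then euler h l' q + h *: (slope (l'%:R * h) q *m euler h l' q) else Y0.

Let eulerS h l q : euler h l.+1 q = euler h l q + h *: (slope (l%:R * h) q *m euler h l q).
Proof. by []. Qed.

Let hN (N : nat) : R := N.+1%:R^-1.

Let h_gt0 N : 0 < hN N. Proof. by rewrite invr_gt0. Qed.
Let h_le1 N : hN N <= 1. Proof. by rewrite invf_le1// ler1n. Qed.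
Let s01 N l : (l <= N.+1)%N -> 0 <= l%:R * hN N <= 1.
Proof. by move=> lN; rewrite mulr_ge0 ?(ltW (h_gt0 N))//= ler_pdivrMr// mul1r ler_nat. Qed.

Lemma smx_euler N l : (l <= N.+1)%N -> smx B (euler (hN N) l).
Proof.
elim: l => [|l IH] lN; first exact: smx_cst.
apply: smxD => //; first exact/IH/ltnW.
move=> a b; apply: (smooth_ext oB (f := fun q => hN N * (slope (l%:R * hN N) q *m euler (hN N) l q) a b)).
  by move=> q _; rewrite mxZE.
apply: smoothM => //; first exact: smooth_cst.
by apply: smxM => //; [exact/smx_slope/s01/ltnW|exact/IH/ltnW].
Qed.

Lemma dmx_eulerS N l i q : (l < N.+1)%N -> B q ->
  dmx i (euler (hN N) l.+1) q = dmx i (euler (hN N) l) q +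
   hN N *: ((A i (node (l%:R * hN N) q)
     + (l%:R * hN N) *: \sum_j (q 0 j - z 0 j) *: dmx i (A j) (node (l%:R * hN N) q))
      *m euler (hN N) l q + slope (l%:R * hN N) q *m dmx i (euler (hN N) l) q).
Proof.
move=> lN Bq; have se := smx_euler (ltnW lN); have ss := smx_slope (s01 (ltnW lN)).
have sse := smxM oB ss se.
have sh : smx B (fun q => hN N *: (slope (l%:R * hN N) q *m euler (hN N) l q)).
  move=> a b; apply: (smooth_ext oB (f := fun q => hN N * (slope (l%:R * hN N) q *m euler (hN N) l q) a b)).
    by move=> q' _; rewrite mxZE.
  by apply: smoothM => //; exact: smooth_cst.
rewrite (dmxD i oB se sh Bq); congr (_ + _).
rewrite -dmx_slope ?s01 1?ltnW// -(dmxM i oB ss se Bq).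
apply/matrixP => a b; rewrite mxZE !dmxE -(partialZ i (hN N) (sse a b) Bq).
by apply: (partial_ext i oB _ Bq) => q' _; rewrite mxZE.
Qed.

Let rho := n%:R * (2 * r) * K.

Let rho0 : 0 <= rho. Proof. by rewrite !mulr_ge0// ltW. Qed.
Let mrho : m%:R * rho <= 1.
Proof. rewrite /rho; move: small K0 (ltW r0); move: (n%:R : R) (m%:R : R) => x y; move: (ler0n R n); lra. Qed.

Lemma slope_le s q : 0 <= s <= 1 -> B q -> `|slope s q| <= rho.
Proof.
move=> s1 Bq; apply: norm_sum_scale_le => //; first by rewrite mulr_ge0// ltW.
  by move=> j; have := ball_dist_lt Bz Bq; apply: le_trans; have := coord_le_norm (q - z) 0 j; rewrite !mxE.
by move=> j; apply: A0; apply: BB4; exact: node_ball.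
Qed.

Let p := expR 1 * `|Y0|.

(** As [m rho <= 1], each step enlarges the norm at most by the factor 1 + h, and at most [N.+1]
    such factors stay below e. *)
Lemma euler_le N l q : (l <= N.+1)%N -> B q -> `|euler (hN N) l q| <= p.
Proof.
move=> lN Bq.
have : `|euler (hN N) l q| <= (1 + hN N) ^+ l * `|Y0|.
  elim: l lN => [|l IH] lN; first by rewrite mul1r.
  rewrite eulerS; apply: le_trans (ler_normD _ _) _; rewrite normrZ (gtr0_norm (h_gt0 N)).
  have IH' := IH (ltnW lN).
  apply: (@le_trans _ _ (`|euler (hN N) l q| + hN N * `|euler (hN N) l q|)).
    rewrite lerD2l ler_wpM2l ?(ltW (h_gt0 N))//; apply: le_trans (mulmx_norm_le _ _) _.
    rewrite ler_piMl//; apply: le_trans mrho; rewrite ler_wpM2l//.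
    by apply: slope_le => //; exact/s01/ltnW.
  rewrite -{1}[`|euler _ _ _|]mul1r -mulrDl exprS -mulrA ler_wpM2l//.
  by rewrite addr_ge0// ltW.
move=> H; apply: le_trans H _; rewrite ler_wpM2r//; exact: expR_pow_bound.
Qed.

(** The polygon at parameter s = l h approximates a section at z + s (q - z), whose derivative in
    [q] carries a factor s; hence the comparison with s A_i P. At s = 1 this is the failure of
    parallelism. *)
Definition defect N l i q : 'cV[R]_m :=
  dmx i (euler (hN N) l) q - (l%:R * hN N) *: (A i (node (l%:R * hN N) q) *m euler (hN N) l q).

Let tau := n%:R * (n%:R * (3 * r) * K) * (2 * r).

Let tau0 : 0 <= tau. Proof. by rewrite !mulr_ge0// ltW. Qed.

(** The bounds of the five second-order terms of [euler_step_alg]; [tau] is the constant of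
    [taylor2] without its factor d^2. *)
Let C0 := m%:R * rho * p + m%:R * K * (m%:R * rho * p) + m%:R * rho * (m%:R * rho * p)
  + m%:R * tau * p + m%:R * tau * (m%:R * rho * p).

Let p0 : 0 <= p. Proof. by rewrite mulr_ge0// expR_ge0. Qed.
Let C00 : 0 <= C0. Proof. by rewrite !(addr_ge0, mulr_ge0)// ltW. Qed.

Lemma defect_step N l i q : (l < N.+1)%N -> B q ->
  `|defect N l.+1 i q| <= (1 + hN N) * `|defect N l i q| + hN N ^+ 2 * C0.
Proof.
move=> lN Bq; set h := hN N; set s := l%:R * h.
have h0 : 0 < h := h_gt0 N; have h1 : h <= 1 := h_le1 N.
have sE : l.+1%:R * h = s + h by rewrite -natr1 mulrDl mul1r.
have s1 : 0 <= s <= 1 by exact/s01/ltnW.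
have s1' : 0 <= s + h <= 1 by rewrite -sE; exact: s01.
have Bn := node_ball s1 Bq; have B4n := BB4 Bn.
set a := A i (node s q); set a' := A i (node (s + h) q).
set x := slope s q; set P := euler h l q.
pose Dt := \sum_j (q 0 j - z 0 j) *: dmx i (A j) (node s q).
pose Dm := \sum_j (q 0 j - z 0 j) *: dmx j (A i) (node s q).
pose T := a' - a - h *: Dm.
have F : Dt - Dm + x *m a - a *m x = 0.
  rewrite /Dt /Dm /x /slope mulmx_suml mulmx_sumr -sumrB -big_split -sumrB /=.
  apply: big1 => j _; rewrite -scalemxAl -scalemxAr -scalerBr -scalerDr -scalerBr.
  by rewrite flat// scaler0.
have a'E : a' = a + h *: Dm + T by exact: remainder_split.
have vq j : `|q 0 j - z 0 j| <= 2 * r.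
  have := ball_dist_lt Bz Bq; apply: le_trans; have := coord_le_norm (q - z) 0 j; by rewrite !mxE.
have r20 : 0 <= 2 * r by rewrite mulr_ge0// ltW.
have Dmb : `|Dm| <= rho by apply: norm_sum_scale_le => // j; exact: A1.
have xb : `|x| <= rho by exact: slope_le.
have Pb : `|P| <= p by exact: euler_le (ltnW lN) Bq.
have ab : `|a| <= K by exact: A0.
have Tb : `|T| <= h ^+ 2 * tau.
  apply: norm_le_coord => [|c d]; first by rewrite mulr_ge0// sqr_ge0.
  have wb : `|h *: (q - z)| <= 2 * r * h.
    rewrite normrZ (gtr0_norm h0) mulrC ler_wpM2r ?(ltW h0)//; exact: ball_dist_lt Bz Bq.
  have C2 : C_on 2 (ball y0 (4 * r)) (fun q => A i q c d) by exact: sA.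
  have := @taylor2 _ _ (fun q => A i q c d) y0 r K h (node s q) (h *: (q - z)) r0 K0 C2
    (fun j k q' => @A2 i c d j k q') Bn h0 h1 wb.
  have -> : h *: (q - z) + node s q = node (s + h) q.
    by rewrite /node addrA -scalerDl (addrC h).
  have -> : T c d = A i (node (s + h) q) c d - A i (node s q) c d -
     \sum_j (h *: (q - z)) 0 j * partial j (fun q => A i q c d) (node s q).
    rewrite !(mxDE, mxNE) mxZE summxE mulr_sumr; congr (_ - _).
    apply: eq_bigr => j _; rewrite mxZE dmxE mulrA; congr (_ * _); by rewrite !mxE.
  move=> H; apply: le_trans H _; rewrite le_eqVlt; apply/orP; left; apply/eqP.
  rewrite /tau; move: (n%:R : R) => y; ring.
have xP : `|x *m P| <= m%:R * rho * p by exact: mulmx_le.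
rewrite {1}/defect sE (dmx_eulerS i lN Bq) [euler _ _ _]/= -/h -/s -/P -/x -/a -/a' -/Dt.
rewrite (euler_step_alg P _ s F a'E).
set E := dmx i (euler h l) q - s *: (a *m P).
have -> : defect N l i q = E by [].
apply: le_trans (ler_normB _ _) _; apply: lerD.
  apply: le_trans (ler_normD _ _) _; rewrite mulrDl mul1r lerD2l normrZ (gtr0_norm h0).
  rewrite ler_wpM2l ?(ltW h0)//; apply: le_trans (mulmx_norm_le _ _) _.
  by rewrite ler_piMl//; apply: le_trans mrho; rewrite ler_wpM2l.
have /andP[sh0 sh1] := s1'.
apply: (@le_trans _ _ (h ^+ 2 * (m%:R * rho * p + m%:R * K * (m%:R * rho * p)
    + 1 * (m%:R * rho * (m%:R * rho * p))) + 1 * (m%:R * (h ^+ 2 * tau) * p)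
    + 1 * (m%:R * (h ^+ 2 * tau) * (m%:R * rho * p)))); last first.
  rewrite le_eqVlt; apply/orP; left; apply/eqP; rewrite /C0.
  move: (m%:R : R) rho p tau => y1 y2 y3 y4; ring.
apply: le_trans (ler_normD _ _) _; apply: lerD; last first.
  apply: norm_scale_le; [by rewrite mulr_ge0// ltW| |exact: mulmx_le].
  by rewrite -[leRHS]mul1r ler_pM// ltW.
apply: le_trans (ler_normD _ _) _; apply: lerD; last first.
  by apply: norm_scale_le => //; exact: mulmx_le.
apply: norm_scale_le => //; first exact: sqr_ge0.
apply: le_trans (ler_normD _ _) _; apply: lerD; last first.
  by apply: norm_scale_le => //; exact: mulmx_le.
by apply: le_trans (ler_normD _ _) _; apply: lerD; exact: mulmx_le.
Qed.

(** The defect vanishes initially and each of the [N.+1] steps adds O(h^2), so O(h) is left at the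
    end. *)
Lemma euler_defect N i q : B q ->
  `|dmx i (euler (hN N) N.+1) q - A i q *m euler (hN N) N.+1 q| <= (C0 * expR 1) / N.+1%:R.
Proof.
move=> Bq; have E1 : N.+1%:R * hN N = 1 by rewrite /hN mulfV// pnatr_eq0.
have -> : dmx i (euler (hN N) N.+1) q - A i q *m euler (hN N) N.+1 q = defect N N.+1 i q.
  by rewrite /defect E1 scale1r /node scale1r subrK.
have e00 : `|defect N 0 i q| <= 0.
  by rewrite /defect mul0r scale0r subr0 dmx_cst normr0.
have := @linear_recurrence_bound _ (fun l => `|defect N l i q|) (hN N) (hN N ^+ 2 * C0) N.+1
  (ltW (h_gt0 N)) _ e00 _ N.+1 (leqnn _).
move=> H; apply: le_trans (H _ _) _.
- by rewrite mulr_ge0// sqr_ge0.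
- by move=> l lN; exact: defect_step.
have -> : N.+1%:R * (hN N ^+ 2 * C0) = C0 * hN N.
  by rewrite expr2 mulrA [_ * (hN N * _)]mulrA E1 mul1r mulrC.
rewrite [leRHS]mulrAC ler_wpM2l ?mulr_ge0 ?(ltW (h_gt0 N))//; exact: expR_pow_bound.
Qed.

Lemma euler_base N l : euler (hN N) l z = Y0.
Proof.
elim: l => //= l ->; rewrite [slope _ _]big1 ?mul0mx ?scaler0 ?addr0// => j _.
by rewrite subrr scale0r.
Qed.

(** The difference of two polygons vanishes at [z] and is almost parallel, so [segment_bound] makes
    the polygons uniformly Cauchy with rate 1/N. Their derivatives are close to A_i times the
    polygons and converge as well, which passes the equation to the limit. *)
Theorem parallel_exists : exists Y : 'rV[R]_n -> 'cV[R]_m,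
  [/\ smx B Y, Y z = Y0 & forall i q, B q -> dmx i Y q = A i q *m Y q].
Proof.
pose F N := euler (hN N) N.+1.
have sF N : smx B (F N) by exact: smx_euler.
pose c := C0 * expR 1; have c0 : 0 <= c by rewrite mulr_ge0// expR_ge0.
pose C1 := 4 * r * n%:R * c.
have C10 : 0 <= C1 by rewrite !mulr_ge0// ltW.
have cauchy q a N N' : B q -> `|F N q a 0 - F N' q a 0| <= C1 / N.+1%:R + C1 / N'.+1%:R.
  move=> Bq; pose e := c / N.+1%:R + c / N'.+1%:R.
  have e0 : 0 <= e by rewrite addr_ge0// divr_ge0.
  have sD : smx B (fun q => F N q - F N' q) by apply: smxB.
  have := @segment_bound _ n m A (fun q => F N q - F N' q) y0 z r K e r0 K0 small e0.
  move=> /(_ _ _ _ Bz _ q Bq) H.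
  have -> : F N q a 0 - F N' q a 0 = (F N q - F N' q) a 0 by rewrite [RHS]mxDE [X in _ = _ + X]mxNE.
  apply: le_trans (coord_le_norm _ _ _) _; apply: le_trans (H _ _ _ _) _.
  - by move=> b; exact: (sD b 0 1%N).
  - by move=> i q' Bq'; apply: A0; exact: BB4.
  - move=> i q' Bq'; rewrite (dmxB i oB (sF N) (sF N') Bq') mulmxBr.
    have -> : dmx i (F N) q' - dmx i (F N') q' - (A i q' *m F N q' - A i q' *m F N' q') =
      (dmx i (F N) q' - A i q' *m F N q') - (dmx i (F N') q' - A i q' *m F N' q').
      by rewrite !opprB addrACA [RHS]addrACA; congr (_ + _); rewrite addrC.
    by apply: le_trans (ler_normB _ _) _; apply: lerD; exact: euler_defect.
  - by rewrite /F !euler_base subrr.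
  by rewrite /e /C1 mulrDr !mulrA.
have lim q a : exists l, B q -> forall N, `|F N q a 0 - l| <= C1 / N.+1%:R.
  have [Bq|Bq] := pselect (B q); last by exists 0.
  have [l Hl] := squeeze_limit (fun N N' => cauchy q a N N' Bq).
  by exists l.
have [f fP] := choice (fun qa : 'rV[R]_n * 'I_m => lim qa.1 qa.2).
pose Y q : 'cV[R]_m := \col_a f (q, a).
have YE q a : Y q a 0 = f (q, a) by rewrite mxE.
have FY N q : B q -> `|F N q - Y q| <= C1 / N.+1%:R.
  move=> Bq; apply: norm_le_coord => [|a b]; first by rewrite divr_ge0.
  by rewrite ord1 mxDE mxNE YE; exact: (fP (q, a)).
have cY q a : B q -> {for q, continuous (fun q => Y q a 0)}.
  move=> Bq; have HF N q' : B q' -> `|F N q' a 0 - Y q' a 0| <= C1 / N.+1%:R.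
    by move=> Bq'; rewrite YE; exact: (fP (q', a)).
  have cF N : {for q, continuous (fun q => F N q a 0)}.
    exact: smooth_continuous (sF N a 0) Bq.
  exact: (rate_limit_continuous oB Bq HF cF).
pose C2 := c + m%:R * K * C1.
have C20 : 0 <= C2 by apply: addr_ge0 => //; apply: mulr_ge0 => //; exact: mulr_ge0.
have C12 : C1 <= C1 + C2 by rewrite lerDl.
have AYc i a q : B q -> {for q, continuous (fun q => (A i q *m Y q) a 0)}.
  move=> Bq; apply: (continuous_ext_at (f := fun q => \sum_b A i q a b * Y q b 0)).
    by apply: (near_open oB Bq) => q' _; rewrite mxME.
  have : C_on 0 B (fun q => \sum_b A i q a b * Y q b 0).
    apply: C_on_bigsum => // b _; apply: C_on_M => //.
      by apply: C_on_sub (sA i a b 0%N); exact: BB4.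
    by split=> // q' Bq'; exact: cY.
  by case=> + _; apply.
have dY i a q : B q -> derivable (fun q => Y q a 0) q (delta_mx 0 i) /\
    partial i (fun q => Y q a 0) q = (A i q *m Y q) a 0.
  move=> Bq; apply: (@rate_limit_derive _ _ B (fun N q => F N q a 0) _
     (fun q => (A i q *m Y q) a 0) i (C1 + C2) q oB Bq).
  - by move=> N; exact: (sF N a 0 1%N).
  - move=> N q' Bq'; rewrite YE; apply: le_trans (fP (q', a) Bq' N) _.
    by rewrite ler_wpM2r.
  - move=> N q' Bq'; rewrite -(dmxE (F N)).
    have -> : dmx i (F N) q' a 0 - (A i q' *m Y q') a 0 =
       ((dmx i (F N) q' - A i q' *m F N q') + A i q' *m (F N q' - Y q')) a 0.
      by rewrite mulmxBr addrA subrK mxDE mxNE.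
    apply: le_trans (coord_le_norm _ _ _) _; apply: le_trans (ler_normD _ _) _.
    apply: (@le_trans _ _ (c / N.+1%:R + m%:R * K * (C1 / N.+1%:R))).
      apply: lerD; first exact: euler_defect.
      by apply: mulmx_le; [apply: A0; exact: BB4|exact: FY].
    by rewrite mulrA -mulrDl ler_wpM2r// lerDr.
  - exact: AYc.
exists Y; split.
(* Bootstrap: the derivatives of [Y] are sums of products of smooth functions with [Y], so each
   order of regularity yields the next. *)
- move=> a b; rewrite ord1 => k; elim: k a => [|k IH] a.
    by split=> // q Bq; exact: cY.
  split; first by move=> q Bq; exact: cY.
  move=> i; split; first by move=> q Bq; exact: (dY i a q Bq).1.
  apply: (C_on_ext oB (f := fun q => \sum_b A i q a b * Y q b 0)).
    by move=> q Bq; rewrite (dY i a q Bq).2 mxME.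
  apply: C_on_bigsum => // b' _; apply: C_on_M => //.
  by apply: C_on_sub (sA i a b' k); exact: BB4.
- apply/matrixP => a b; rewrite ord1 YE; apply/eqP; rewrite -subr_eq0 -normr_le0.
  apply/ler_addgt0Pl => eps eps0; have [N HN] := small_inv C1 eps0.
  rewrite addr0; apply: le_trans HN; have := fP (z, a) Bz N.
  by rewrite /F euler_base distrC.
- by move=> i q Bq; apply/matrixP => a b; rewrite ord1 dmxE (dY i a q Bq).2.
Qed.

End Euler.

(** * Propagation of flatness *)

Section ConnectionCurvature.
Context {R : realType} {n m : nat}.
Implicit Types (p q : 'rV[R]_n).

Definition conn_curv (A : 'I_n -> 'rV[R]_n -> 'M[R]_m) i j p : 'M[R]_m :=
  dmx i (A j) p - dmx j (A i) p + A j p *m A i p - A i p *m A j p.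

(** Here a = A_i, b = A_j, c = A_k, [ij] stands for d_i A_j and [kij] for d_k d_i A_j; three letters
    suffice for the second derivatives because these commute. *)
Lemma bianchi_alg (a b c ij ji jk kj ki ik kij kji ijk : 'M[R]_m) :
  (kij - kji + (kj *m a + b *m ki) - (ki *m b + a *m kj))
    + (ij - ji + b *m a - a *m b) *m c - c *m (ij - ji + b *m a - a *m b)
  + ((ijk - kij + (ik *m b + c *m ij) - (ij *m c + b *m ik))
    + (jk - kj + c *m b - b *m c) *m a - a *m (jk - kj + c *m b - b *m c))
  + ((kji - ijk + (ji *m c + a *m jk) - (jk *m a + c *m ji))
    + (ki - ik + a *m c - c *m a) *m b - b *m (ki - ik + a *m c - c *m a)) = 0.
Proof.
rewrite !(mulmxDl, mulmxDr, mulmxBl, mulmxBr, mulNmx, mulmxN) -!mulmxA.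
move: (kj *m a) (b *m ki) (ki *m b) (a *m kj) (ij *m c) (ji *m c) (c *m ij) (c *m ji) => x1 x2 x3 x4 x5 x6 x7 x8.
move: (ik *m b) (b *m ik) (jk *m a) (a *m jk) => y1 y2 y3 y4.
move: (a *m (b *m c)) (a *m (c *m b)) (b *m (a *m c)) (b *m (c *m a)) (c *m (a *m b)) (c *m (b *m a)) => z1 z2 z3 z4 z5 z6.
apply/matrixP => s t; rewrite !(mxDE, mxNE) mxE; ring.
Qed.

Lemma sub_sub_eq0 a b (x y z w : 'M[R]_(a, b)) : x + y = z + w -> x - z + y - w = 0.
Proof.
move=> E; have -> : x = z + w - y by rewrite -E addrK.
by apply/matrixP => i j; rewrite !(mxDE, mxNE) mxE; ring.
Qed.

Lemma bianchi_rearr (x g y z w1 w2 w3 w4 : 'M[R]_m) :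
  (x + g) + (- y + (- w1 + w2)) + (z + (w3 - w4)) = 0 -> x + g - y + z = w1 - w2 - w3 + w4.
Proof.
move=> E; apply/eqP; rewrite -subr_eq0 -E; apply/eqP/matrixP => s t.
by rewrite !(mxDE, mxNE); ring.
Qed.

Lemma scale_lincomb (c : R) (x g y z w1 w2 w3 w4 : 'M[R]_m) : x + g - y + z = w1 - w2 - w3 + w4 ->
  c *: x + c *: g - c *: y + c *: z = c *: w1 - c *: w2 - c *: w3 + c *: w4.
Proof. by move=> E; rewrite -scalerDr -scalerBr -scalerDr E scalerDr !scalerBr. Qed.

Variables (U : set 'rV[R]_n) (A : 'I_n -> 'rV[R]_n -> 'M[R]_m).
Hypothesis oU : open U.
Hypothesis sA : forall i, smx U (A i).
Local Notation F := (conn_curv A).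

Lemma smx_conn_curv i j : smx U (F i j).
Proof.
by apply: smxB; [|apply: smxD; [|apply: smxB|apply: smxM]|apply: smxM] => //;
  exact: smx_dmx.
Qed.

Lemma conn_curvC i j p : F i j p = - F j i p.
Proof. exact: commutator_antisym. Qed.

Lemma dmx_conn_curv k i j p : U p -> dmx k (F i j) p =
  dmx k (dmx i (A j)) p - dmx k (dmx j (A i)) p
  + (dmx k (A j) p *m A i p + A j p *m dmx k (A i) p)
  - (dmx k (A i) p *m A j p + A i p *m dmx k (A j) p).
Proof.
move=> Up; have sd a b := smx_dmx a oU (sA b).
have sM a b := smxM oU (sA a) (sA b).
rewrite (dmxB k oU (smxD oU (smxB oU (sd i j) (sd j i)) (sM j i)) (sM i j) Up).
rewrite (dmxD k oU (smxB oU (sd i j) (sd j i)) (sM j i) Up).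
rewrite (dmxB k oU (sd i j) (sd j i) Up).
by rewrite (dmxM k oU (sA j) (sA i) Up) (dmxM k oU (sA i) (sA j) Up).
Qed.

Lemma bianchi k i j p : U p ->
  (dmx k (F i j) p + F i j p *m A k p - A k p *m F i j p)
  + (dmx i (F j k) p + F j k p *m A i p - A i p *m F j k p)
  + (dmx j (F k i) p + F k i p *m A j p - A j p *m F k i p) = 0.
Proof.
move=> Up; rewrite !dmx_conn_curv//.
rewrite (dmxC i k oU (sA j) Up) (dmxC j i oU (sA k) Up) (dmxC j k oU (sA i) Up).
exact: bianchi_alg.
Qed.

(** Mixed second derivatives of a parallel section commute; expanding them with the equation leaves
    F Y = 0. *)
Lemma conn_curv_parallel (Y : 'rV[R]_n -> 'cV[R]_m) i j p : smx U Y ->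
  (forall i q, U q -> dmx i Y q = A i q *m Y q) -> U p -> F i j p *m Y p = 0.
Proof.
move=> sY dY Up.
have dd a b : dmx a (dmx b Y) p = dmx a (A b) p *m Y p + A b p *m (A a p *m Y p).
  rewrite (dmx_ext (B := fun q => A b q *m Y q) a oU _ Up); last by move=> q; exact: dY.
  by rewrite (dmxM a oU (sA b) sY Up) dY.
have := dmxC i j oU sY Up; rewrite !dd => E.
rewrite /conn_curv !(mulmxDl, mulmxBl, mulNmx) -!mulmxA.
exact: sub_sub_eq0.
Qed.

Opaque conn_curv.

Variables (N : 'I_n -> 'rV[R]_n -> R) (u : 'rV[R]_n -> R).
Variable C : 'I_n -> 'I_n -> 'I_n -> 'rV[R]_n -> R.
Hypothesis sN : forall k, smooth_on U (N k).
Hypothesis NF : forall j p, U p -> \sum_k N k p *: F k j p = 0.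
Hypothesis dN : forall i k p, U p ->
  partial i (N k) p = (i == k)%:R * u p - \sum_l C i k l p * N l p.

(** Differentiating the identity sum_k N_k F_kj = 0 trades the derivative of F for that of N, whose
    covariant part is u times the identity. *)
Lemma contract_derive i j p : U p ->
  \sum_k N k p *: dmx i (F k j) p =
  - (u p *: F i j p) + \sum_k (\sum_l C i k l p * N l p) *: F k j p.
Proof.
move=> Up; apply/matrixP => a b.
have := partial_cst (0 : R) i p.
rewrite (partial_ext (h := fun q => \sum_k N k q * F k j q a b) i oU _ Up); last first.
  move=> q Uq; have E : (\sum_k N k q *: F k j q) a b = 0 by rewrite NF// mxE.
  transitivity ((\sum_k N k q *: F k j q) a b); first exact: esym E.
  by rewrite summxE; apply: eq_bigr => k _; rewrite mxZE.
rewrite (partial_sum (F := fun k q => N k q * F k j q a b) _ _ _ oU _ Up); last first.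
  by move=> k; apply: smoothM => //; exact: smx_conn_curv.
under eq_bigr => k _ do rewrite (partialM i (sN k) (smx_conn_curv k j a b) Up) dN// mulrBl.
rewrite big_split /= sumrB (bigD1 i)//= eqxx mul1r big1 ?addr0 => [E|k /negbTE ki]; last first.
  by rewrite eq_sym ki !mul0r.
rewrite mxDE mxNE mxZE !summxE.
have -> : \sum_k (N k p *: dmx i (F k j) p) a b = \sum_k N k p * partial i (fun q => F k j q a b) p.
  by apply: eq_bigr => k _; rewrite mxZE dmxE.
have -> : \sum_k ((\sum_l C i k l p * N l p) *: F k j p) a b = \sum_k (\sum_l C i k l p * N l p) * F k j p a b.
  by apply: eq_bigr => k _; rewrite mxZE.
move: E; move: (u p * _) (\sum_k _ * _) (\sum_k _ * _) => x y z /eqP.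
by rewrite addr_eq0 => /eqP /(congr1 -%R); rewrite opprK opprB => <-; rewrite addrC.
Qed.

(* N stands for Du, for which the contraction [\sum_k N k F k j] vanishes; the Bianchi identity
   then turns the derivative of F along N into terms of order zero. *)
Definition transport_rest i j p : 'M[R]_m :=
  \sum_k (\sum_l C i k l p * N l p) *: F k j p
  - \sum_k (\sum_l C j k l p * N l p) *: F k i p
  - \sum_k N k p *: (F i j p *m A k p - A k p *m F i j p).

(** In the contracted Bianchi identity the commutator terms containing F_kj or F_ki vanish by
    contraction, and each of the two remaining derivative terms gives one - u F_ij: this is the
    factor 2. *)
Lemma transport i j p : U p ->
  \sum_k N k p *: dmx k (F i j) p = - ((2 * u p) *: F i j p) + transport_rest i j p.
Proof.
move=> Up; pose G k := F i j p *m A k p - A k p *m F i j p.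
have S0 a (X : 'M[R]_m) : \sum_k N k p *: (F k a p *m X) = 0.
  by under eq_bigr do rewrite scalemxAl; rewrite -mulmx_suml NF// mul0mx.
have S1 a (X : 'M[R]_m) : \sum_k N k p *: (X *m F k a p) = 0.
  by under eq_bigr do rewrite scalemxAr; rewrite -mulmx_sumr NF// mulmx0.
have B : \sum_k N k p *: dmx k (F i j) p + \sum_k N k p *: G k
    - \sum_k N k p *: dmx i (F k j) p + \sum_k N k p *: dmx j (F k i) p = 0.
  rewrite -big_split -sumrB -big_split /=.
  transitivity (\sum_k (N k p *: (F k j p *m A i p) - N k p *: (A i p *m F k j p)
     - N k p *: (F k i p *m A j p) + N k p *: (A j p *m F k i p))); last first.
    by rewrite big_split !sumrB /= !S0 !S1 !subr0 addr0.
  apply: eq_bigr => k _; apply: scale_lincomb.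
  apply: bianchi_rearr; rewrite -(bianchi k i j Up) /G -!addrA; congr (_ + (_ + (_ + _))).
  have -> : - dmx i (F k j) p = dmx i (F j k) p.
    rewrite (dmx_ext (A := F j k) (B := fun q => - F k j q) i oU _ Up) ?(dmxN i oU (smx_conn_curv k j) Up)//.
    by move=> q _; exact: conn_curvC.
  by rewrite (conn_curvC j k) mulNmx mulmxN opprK.
move: B; rewrite (contract_derive i j Up) (contract_derive j i Up) /transport_rest -/G.
have -> : F j i p = - F i j p by exact: conn_curvC.
move: (\sum_k _) (\sum_k _) (\sum_k _) (\sum_k _) => x g y z B.
rewrite -[LHS]subr0 -[X in _ - X]B; apply/matrixP => s t.
move: (F i j p) B => f _; rewrite !(mxDE, mxNE, mxZE).
move: (x s t) (g s t) (y s t) (z s t) (f s t) (u p) => *; ring.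
Qed.

(** The square of a Euclidean norm of F, smooth where the sup norm is not; its vanishing is
    equivalent to flatness at the point. *)
Definition energy p : R :=
  \sum_(x : ('I_n * 'I_n) * ('I_m * 'I_m)) F x.1.1 x.1.2 p x.2.1 x.2.2 ^+ 2.

Lemma smooth_energy : smooth_on U energy.
Proof. by apply: smooth_sum => // x; apply: smoothX => //; exact: smx_conn_curv. Qed.

Lemma energy_ge0 p : 0 <= energy p.
Proof. by apply: sumr_ge0 => x _; exact: sqr_ge0. Qed.

Lemma sqr_conn_curv_le i j p a b : F i j p a b ^+ 2 <= energy p.
Proof.
rewrite /energy (bigD1 ((i, j), (a, b)))//= lerDl.
by apply: sumr_ge0 => x _; exact: sqr_ge0.
Qed.

Lemma conn_curv_le i j p : `|F i j p| <= Num.sqrt (energy p).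
Proof.
apply: norm_le_coord => [|a b]; first exact: sqrtr_ge0.
by rewrite -sqrtr_sqr ler_sqrt ?energy_ge0//; exact: sqr_conn_curv_le.
Qed.

Lemma energy_eq0 p : energy p = 0 -> forall i j, F i j p = 0.
Proof.
move=> E i j; apply/eqP; rewrite -normr_eq0 eq_le normr_ge0 andbT.
by apply: le_trans (conn_curv_le i j p) _; rewrite E sqrtr0.
Qed.

(** Each term of the rest contains one factor N and one factor F; the factor [nu] is what makes the
    rest negligible near critical points of u. *)
Lemma transport_rest_le i j p t nu K : 0 <= t -> 0 <= nu -> 0 <= K ->
  (forall i j, `|F i j p| <= t) -> (forall l, `|N l p| <= nu) ->
  (forall i k l, `|C i k l p| <= K) -> (forall k, `|A k p| <= K) ->
  `|transport_rest i j p| <= (2 * n%:R * (n%:R * K) + 2 * n%:R * m%:R * K) * nu * t.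
Proof.
move=> t0 nu0 K0 Ft Nn CK AK.
have CN i' k : `|\sum_l C i' k l p * N l p| <= n%:R * K * nu by exact: sum_coord_le.
have b0 : 0 <= n%:R * K * nu by rewrite !mulr_ge0.
apply: (@le_trans _ _ (n%:R * (n%:R * K * nu) * t + n%:R * (n%:R * K * nu) * t
   + n%:R * nu * (m%:R * t * K + m%:R * K * t))); last first.
  rewrite le_eqVlt; apply/orP; left; apply/eqP; move: (n%:R : R) (m%:R : R) => *; ring.
apply: le_trans (ler_normB _ _) _; apply: lerD.
  by apply: le_trans (ler_normB _ _) _; apply: lerD; exact: norm_sum_scale_le.
apply: norm_sum_scale_le => // [|k]; first by rewrite addr_ge0// !mulr_ge0.
by apply: le_trans (ler_normB _ _) _; apply: lerD; exact: mulmx_le.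
Qed.

Lemma energy_derive p : U p -> \sum_k N k p * partial k energy p =
  - (4 * u p) * energy p + \sum_(x : ('I_n * 'I_n) * ('I_m * 'I_m))
    2 * (F x.1.1 x.1.2 p x.2.1 x.2.2 * transport_rest x.1.1 x.1.2 p x.2.1 x.2.2).
Proof.
move=> Up; have sF x := smx_conn_curv (x : ('I_n * 'I_n) * ('I_m * 'I_m)).1.1 x.1.2 x.2.1 x.2.2.
have dE k : partial k energy p = \sum_(x : ('I_n * 'I_n) * ('I_m * 'I_m))
    2 * (F x.1.1 x.1.2 p x.2.1 x.2.2 * partial k (fun q => F x.1.1 x.1.2 q x.2.1 x.2.2) p).
  rewrite (partial_sum (F := fun x q => F x.1.1 x.1.2 q x.2.1 x.2.2 ^+ 2) _ _ _ oU _ Up); last first.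
    by move=> x; apply: smoothX => //; exact: sF.
  apply: eq_bigr => x _; rewrite (partialM k (sF x) (sF x) Up).
  by move: (partial _ _ _) (F _ _ _ _ _) => a b; ring.
under eq_bigr => k _ do rewrite dE mulr_sumr.
rewrite exchange_big /energy mulr_sumr -big_split /=; apply: eq_bigr => -[[i j] [a b]] _ /=.
have := congr1 (fun X : 'M[R]_m => X a b) (transport i j Up).
rewrite summxE mxDE mxNE mxZE => E.
transitivity (2 * (F i j p a b * (- (2 * u p * F i j p a b) + transport_rest i j p a b))); last first.
  by move: (F i j p a b) (transport_rest i j p a b) (u p) => x y z; ring.
rewrite -E !mulr_sumr; apply: eq_bigr => k _; rewrite mxZE dmxE.
by move: (N k p) (F i j p a b) (partial _ _ _) => x y z; ring.
Qed.

Definition transport_const (K : R) : R :=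
  2 * #|{: ('I_n * 'I_n) * ('I_m * 'I_m)}|%:R *
  (2 * n%:R * (n%:R * K) + 2 * n%:R * m%:R * K).

(** Near a critical point [nu] can be taken small and the factor is negative; elsewhere the useful
    information is that the factor is bounded above. *)
Lemma energy_transport p nu K : U p -> 0 <= nu -> 0 <= K -> (forall l, `|N l p| <= nu) ->
  (forall i k l, `|C i k l p| <= K) -> (forall k, `|A k p| <= K) ->
  \sum_k N k p * partial k energy p <= (transport_const K * nu - 4 * u p) * energy p.
Proof.
move=> Up nu0 K0 Nn CK AK; rewrite energy_derive// [leRHS]mulrBl addrC lerD// ?mulNr//.
have t0 := sqrtr_ge0 (energy p); have tt := sqr_sqrtr (energy_ge0 p).
set t := Num.sqrt _ in t0 tt.
set k0 := 2 * n%:R * (n%:R * K) + 2 * n%:R * m%:R * K.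
apply: (@le_trans _ _ (\sum_(x : ('I_n * 'I_n) * ('I_m * 'I_m)) 2 * (t * (k0 * nu * t)))).
  apply: ler_sum => -[[i j] [a b]] _ /=; rewrite ler_wpM2l//.
  apply: le_trans (ler_norm _) _; rewrite normrM ler_pM//.
    by apply: le_trans (coord_le_norm _ _ _) _; exact: conn_curv_le.
  apply: le_trans (coord_le_norm _ _ _) _; apply: transport_rest_le => // i' j'.
  exact: conn_curv_le.
rewrite sumr_const -mulr_natr -tt /transport_const -/k0 le_eqVlt; apply/orP; left; apply/eqP.
by move: (_%:R : R) => c; ring.
Qed.

End ConnectionCurvature.

Section CriticalPoint.
Context {R : realType} {n : nat}.

Lemma compact_sqd_ball (y : 'rV[R]_n) r : compact [set q | sqd y q <= r].
Proof.
apply: (subclosed_compact _ (@compact_cball _ _ y (r + 1))).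
  apply: (@closed_comp _ _ (sqd y) [set t | t <= r]); last exact: closed_le.
  by move=> q _; exact: smooth_continuous (smooth_sqd y (@openT _)) I.
move=> q /= H; rewrite distrC; have := le_trans (sqd_ge_norm y q) H.
have := normr_ge0 (q - y); move: `|q - y| => a; nra.
Qed.

(** A positive maximum of [h] over the Euclidean ball would be interior, so the derivative of [h]
    along N would vanish there instead of being negative. *)
Lemma transport_max (U : set 'rV[R]_n) (N : 'I_n -> 'rV[R]_n -> R) h y r :
  open U -> smooth_on U h -> (forall q, sqd y q <= r -> U q) ->
  (forall q, sqd y q = r -> h q <= 0) ->
  (forall q, sqd y q <= r -> 0 < h q -> \sum_k N k q * partial k h q < 0) ->
  forall q, sqd y q <= r -> h q <= 0.
Proof.
move=> oU sh DU bd neg q Dq; rewrite leNgt; apply/negP => hq.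
have [q0 /= D0 M] : exists2 q0, [set q | sqd y q <= r] q0 &
    forall q, [set q | sqd y q <= r] q -> h q <= h q0.
  apply: compact_attains_max; [by exists q|exact: compact_sqd_ball|].
  by move=> q' /= /DU; exact: smooth_continuous sh.
have h0 : 0 < h q0 by exact: lt_le_trans hq (M q Dq).
have r0 : sqd y q0 < r.
  by rewrite lt_neqAle D0 andbT; apply/eqP => /bd; rewrite leNgt h0.
have := neg q0 D0 h0; have U0 := DU _ D0.
have oD : open [set q | sqd y q < r].
  apply: (@open_comp _ _ (sqd y) [set t | t < r]); last exact: open_lt.
  by move=> q' _; exact: smooth_continuous (smooth_sqd y (@openT _)) I.
have := @local_min_grad R n U (fun q => - h q) q0 (\row_k N k q0) oU (smoothN oU sh) U0.
have near0 : \forall q' \near q0, - h q0 <= - h q'.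
  by apply: (near_open oD r0) => q' /= /ltW /M; rewrite lerN2.
move=> /(_ near0) E.
suff -> : \sum_k N k q0 * partial k h q0 = 0 by rewrite ltxx.
apply/eqP; rewrite -oppr_eq0 -sumrN -[X in _ == X]E; apply/eqP/eq_bigr => k _.
by rewrite mxE (partialN k sh U0) mulrN.
Qed.

End CriticalPoint.

Section Blocks.
Context {R : realType} {n : nat}.

Lemma block_mx_cases a b c d (P : 'I_(a + b) -> 'I_(c + d) -> Prop) :
  (forall i j, P (lshift b i) (lshift d j)) -> (forall i j, P (lshift b i) (rshift c j)) ->
  (forall i j, P (rshift a i) (lshift d j)) -> (forall i j, P (rshift a i) (rshift c j)) ->
  forall i j, P i j.
Proof.
move=> H1 H2 H3 H4 i j; rewrite -(splitK i) -(splitK j).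
by case: (fintype.split i) => i'; case: (fintype.split j) => j' /=.
Qed.

Variables a b c d : nat.
Variables (A : 'rV[R]_n -> 'M[R]_(a, c)) (B : 'rV[R]_n -> 'M[R]_(a, d)).
Variables (C : 'rV[R]_n -> 'M[R]_(b, c)) (D : 'rV[R]_n -> 'M[R]_(b, d)).
Let X q := block_mx (A q) (B q) (C q) (D q).

Let Eul i j : (fun q => X q (lshift b i) (lshift d j)) = (fun q => A q i j).
Proof. by apply/funext => q; rewrite block_mxEul. Qed.
Let Eur i j : (fun q => X q (lshift b i) (rshift c j)) = (fun q => B q i j).
Proof. by apply/funext => q; rewrite block_mxEur. Qed.
Let Edl i j : (fun q => X q (rshift a i) (lshift d j)) = (fun q => C q i j).
Proof. by apply/funext => q; rewrite block_mxEdl. Qed.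
Let Edr i j : (fun q => X q (rshift a i) (rshift c j)) = (fun q => D q i j).
Proof. by apply/funext => q; rewrite block_mxEdr. Qed.

Lemma smx_block U : smx U A -> smx U B -> smx U C -> smx U D -> smx U X.
Proof.
move=> sA sB sC sD.
by apply: block_mx_cases => i j; rewrite ?Eul ?Eur ?Edl ?Edr.
Qed.

Lemma dmx_block k p : dmx k X p = block_mx (dmx k A p) (dmx k B p) (dmx k C p) (dmx k D p).
Proof.
apply/matrixP; apply: block_mx_cases => i j; rewrite dmxE ?Eul ?Eur ?Edl ?Edr.
- by rewrite block_mxEul dmxE.
- by rewrite block_mxEur dmxE.
- by rewrite block_mxEdl dmxE.
- by rewrite block_mxEdr dmxE.
Qed.

End Blocks.

(** The classical argument for curvature tensors: four instances of the cyclic identity, combined by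
    means of the two skew-symmetries. *)
Lemma pair_symmetry (R : realFieldType) (I : Type) (T : I -> I -> I -> I -> R) :
  (forall i j k l, T i j k l = - T j i k l) -> (forall i j k l, T i j k l = - T i j l k) ->
  (forall i j k l, T i j k l + T j k i l + T k i j l = 0) ->
  forall i j k l, T i j k l = T k l i j.
Proof.
move=> a1 a2 cy i j k l.
have e1 := a2 j k l i; have e2 := a2 k l j i; have e4 := a2 i k l j.
have e3 : T l j k i = T j l i k by rewrite a1 a2 opprK.
have e5 : T l i k j = T i l j k by rewrite a1 a2 opprK.
have e6 := a1 l i j k; have e7 := a2 i j l k; have e8 := a1 k i j l.
have := cy i j k l; have := cy j k l i; have := cy k l i j; have := cy l i j k.
rewrite e1 e2 e3 e4 e5 e6 e7 e8.
move: (T i j k l) (T k l i j) (T i k j l) (T j l i k) (T i l j k) (T j k i l).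
clear; move=> x1 x2 x3 x4 x5 x6; lra.
Qed.

Section MatrixAlgebra.
Context {R : comNzRingType}.

Lemma opp_add_sub m n (a x y : 'M[R]_(m, n)) : - a + (x - y) = - (a + (y - x)).
Proof. by rewrite opprD opprB. Qed.

Lemma mulmx_entry_cyc n (A B C G : 'M[R]_n) a b c l :
  (forall m, A a m + B b m + C c m = 0) ->
  (A *m G) a l + (B *m G) b l + (C *m G) c l = 0.
Proof.
by move=> H; rewrite !mxE -!big_split big1//= => m _; rewrite -!mulrDl H mul0r.
Qed.

Lemma col_torsion_alg n (ci cj g : 'M[R]_n) i j : col j (g *m ci^T) = col i (g *m cj^T) ->
  col j (ci *m g + g *m ci^T) - col i (cj *m g + g *m cj^T) + cj *m col i g - ci *m col j g = 0.
Proof.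
move=> E; rewrite !linearD /= E !colM.
move: (ci *m col j g) (cj *m col i g) (col i _) => x y z.
by apply/matrixP => a b; rewrite !(mxDE, mxNE) [RHS]mxE; ring.
Qed.

Lemma add_cyc_cancel (x y z a b c : R) : x + y + z = 0 ->
  x + (a - b) + (y + (b - c)) + (z + (c - a)) = 0.
Proof. by move=> <-; ring. Qed.

End MatrixAlgebra.

(** * The connection whose parallel sections solve D^2 x = x g *)

Section HyperbolicConnection.
Context {R : realType} {n : nat}.
Variables (U : set 'rV[R]_n) (G : 'rV[R]_n -> 'M[R]_n).
Hypothesis mG : chart_metric U G.
Implicit Types (f : 'rV[R]_n -> R) (p q : 'rV[R]_n).

Let oU : open U := cm_open mG.
Let sG : smx U G := cm_smooth mG.

(* [D^2 x = x g] means that (x, dx) is parallel for this connection. *)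
Definition ext_conn (i : 'I_n) p : 'M[R]_(1 + n) :=
  block_mx 0 (delta_mx 0 i) (col i (G p)) (conn G i p).

Lemma smx_col_metric i : smx U (fun p => col i (G p)).
Proof. by move=> a b; apply: (smooth_ext oU (f := fun p => G p a i)) => // q _; rewrite mxE. Qed.

Lemma smx_ext_conn i : smx U (ext_conn i).
Proof.
apply: smx_block; [exact: smx_cst|exact: smx_cst|exact: smx_col_metric|].
exact: smx_conn.
Qed.

Definition hyp_curv i j p : 'M[R]_n :=
  curv G i j p + (col j (G p) *m delta_mx 0 i - col i (G p) *m delta_mx 0 j).

Lemma dmx_col i j p : dmx i (fun q => col j (G q)) p = col j (dmx i G p).
Proof.
apply/matrixP => a b; rewrite dmxE [RHS]mxE dmxE; congr partial.
by apply/funext => q; rewrite mxE.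
Qed.

Lemma deltaM a b (j : 'I_a) (X : 'M[R]_(a, b)) : delta_mx (0 : 'I_1) j *m X = row j X.
Proof. by rewrite rowE. Qed.

(** The upper left block vanishes by symmetry of the metric, the upper right one by vanishing
    torsion, and the lower left one by metric compatibility together with vanishing torsion. *)
Lemma conn_curv_ext i j p : U p -> conn_curv ext_conn i j p = block_mx 0 0 0 (hyp_curv i j p).
Proof.
move=> Up; have E : forall a b, conn_curv ext_conn a b p = dmx a (ext_conn b) p - dmx b (ext_conn a) p
   + ext_conn b p *m ext_conn a p - ext_conn a p *m ext_conn b p by [].
rewrite E /ext_conn !dmx_block !mulmx_block !opp_block_mx !add_block_mx.
rewrite !dmx_cst !mul0mx !mulmx0 !subr0 !add0r !deltaM.
have sE k l : G p k l = G p l k by rewrite -[in LHS](cm_sym mG Up) mxTE.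
congr block_mx.
- by apply/matrixP => a b; rewrite !(mxDE, mxNE) !mxE sE subrr.
- apply/matrixP => a b; rewrite !(mxDE, mxNE) [row j _ _ _]mxE [row i _ _ _]mxE (conn_torsion mG i j _ Up).
  by rewrite subrr mxE.
- rewrite !dmx_col !(conn_compat mG _ Up); apply: col_torsion_alg.
  apply/matrixP => a b; rewrite [LHS]mxE [RHS]mxE [LHS]mxME [RHS]mxME; apply: eq_bigr => s _.
  by rewrite !mxTE (conn_torsion mG i j _ Up).
- rewrite /hyp_curv curv_def.
  move: (dmx i _ p) (dmx j _ p) (conn G j p *m _) (conn G i p *m _) (col j _ *m _) (col i _ *m _).
  move=> x1 x2 x3 x4 x5 x6; apply/matrixP => a b; rewrite !(mxDE, mxNE); ring.
Qed.

Definition ext_section f p : 'cV[R]_(1 + n) := col_mx (f p)%:M (grad f p).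

Lemma smx_col_block a b c (A : 'rV[R]_n -> 'M[R]_(a, c)) (B : 'rV[R]_n -> 'M[R]_(b, c)) V :
  smx V A -> smx V B -> smx V (fun q => col_mx (A q) (B q)).
Proof.
move=> sA sB i j; rewrite -(splitK i); case: (fintype.split i) => i' /=.
  by rewrite (_ : (fun _ => _) = (fun q => A q i' j))//; apply/funext => q; rewrite col_mxEu.
by rewrite (_ : (fun _ => _) = (fun q => B q i' j))//; apply/funext => q; rewrite col_mxEd.
Qed.

Lemma dmx_col_block a b c (A : 'rV[R]_n -> 'M[R]_(a, c)) (B : 'rV[R]_n -> 'M[R]_(b, c)) k p :
  dmx k (fun q => col_mx (A q) (B q)) p = col_mx (dmx k A p) (dmx k B p).
Proof.
apply/matrixP => i j; rewrite -(splitK i); case: (fintype.split i) => i' /=.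
  rewrite dmxE col_mxEu dmxE; congr partial; by apply/funext => q; rewrite col_mxEu.
rewrite dmxE col_mxEd dmxE; congr partial; by apply/funext => q; rewrite col_mxEd.
Qed.

Lemma smx_ext_section f : smooth_on U f -> smx U (ext_section f).
Proof.
move=> sf; apply: smx_col_block; last exact: (smx_grad mG sf).
move=> i j; rewrite !ord1; apply: (smooth_ext oU (f := f)) => // q _.
by rewrite mxE.
Qed.

Lemma ext_section_parallel f i p : U p ->
  hessian G f p = f p *: G p -> dmx i (ext_section f) p = ext_conn i p *m ext_section f p.
Proof.
move=> Up H; rewrite /ext_section dmx_col_block /ext_conn mul_block_col mul0mx add0r deltaM.
have -> : dmx i (grad f) p = conn G i p *m grad f p + (f p *: row i (G p))^T.
  have -> : f p *: row i (G p) = row i (hessian G f p) by rewrite H linearZ.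
  by rewrite hess_row addrC subrK.
congr col_mx.
  apply/matrixP => a b; rewrite !ord1 dmxE [RHS]mxE gradE; congr partial.
  by apply/funext => q; rewrite mxE.
rewrite addrC; congr (_ + _); rewrite mul_mx_scalar linearZ /=; congr (_ *: _).
by rewrite tr_row (cm_sym mG Up).
Qed.

Lemma ext_curv_section f i j p : smooth_on U f ->
  (forall q, U q -> hessian G f q = f q *: G q) -> U p -> hyp_curv i j p *m grad f p = 0.
Proof.
move=> sf H Up.
have := conn_curv_parallel oU smx_ext_conn i j (smx_ext_section sf)
  (fun i q Uq => ext_section_parallel i Uq (H q Uq)) Up.
rewrite conn_curv_ext// mul_block_col !mul0mx !add0r => /(congr1 dsubmx).
by rewrite col_mxKd => ->; apply/matrixP => a b; rewrite !mxE.
Qed.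

Let sE k l p : U p -> G p k l = G p l k.
Proof. by move=> Up; rewrite -[in LHS](cm_sym mG Up) mxTE. Qed.

Lemma hyp_curv_low i j k l p : U p -> (hyp_curv i j p *m G p) k l =
  (curv G i j p *m G p) k l + (G p k j * G p i l - G p k i * G p j l).
Proof.
move=> Up; rewrite /hyp_curv; move: (curv G i j p) => c.
have E a b : (col a (G p) *m delta_mx 0 b *m G p) k l = G p k a * G p b l.
  by rewrite -mulmxA deltaM mxME big_ord1 [col _ _ _ _]mxE [row _ _ _ _]mxE.
by rewrite mulmxDl mxDE (mulmxBl (col _ _ *m _)) mxDE mxNE !E.
Qed.

Lemma hyp_curvC i j p : hyp_curv i j p = - hyp_curv j i p.
Proof.
rewrite /hyp_curv; have -> : curv G i j p = - curv G j i p by exact: curvC.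
exact: opp_add_sub.
Qed.

Lemma hyp_curv_skew i j k l p : U p ->
  (hyp_curv i j p *m G p) k l = - (hyp_curv i j p *m G p) l k.
Proof.
move=> Up; rewrite (hyp_curv_low i j k l Up) (hyp_curv_low i j l k Up).
have -> : (curv G i j p *m G p) k l = - (curv G i j p *m G p) l k.
  by rewrite {1}(curv_skew mG i j Up) mxNE mxTE.
rewrite (sE i l Up) (sE k j Up) (sE k i Up) (sE j l Up).
by move: (_ l k) => x; ring.
Qed.

Lemma hyp_curv_cyc i j k l p : U p -> (hyp_curv i j p *m G p) k l
  + (hyp_curv j k p *m G p) i l + (hyp_curv k i p *m G p) j l = 0.
Proof.
move=> Up; rewrite (hyp_curv_low i j k l Up) (hyp_curv_low j k i l Up) (hyp_curv_low k i j l Up).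
have E : (curv G i j p *m G p) k l + (curv G j k p *m G p) i l + (curv G k i p *m G p) j l = 0.
  by apply: (@mulmx_entry_cyc R n (curv G i j p) (curv G j k p) (curv G k i p)) => m; exact: (curv_cyc mG i j k m Up).
rewrite (sE k j Up) (sE k i Up) (sE i j Up); move: E.
exact: add_cyc_cancel.
Qed.

Opaque hyp_curv.

Lemma hyp_curv_pair i j k l p : U p ->
  (hyp_curv i j p *m G p) k l = (hyp_curv k l p *m G p) i j.
Proof.
move=> Up; apply: (pair_symmetry (T := fun i j k l => (hyp_curv i j p *m G p) k l)) => {}i {}j {}k {}l.
- have -> : hyp_curv i j p = - hyp_curv j i p by exact: hyp_curvC.
  by rewrite mulNmx mxNE.
- exact: hyp_curv_skew.
- exact: hyp_curv_cyc.
Qed.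

Variable u : 'rV[R]_n -> R.
Hypothesis su : smooth_on U u.
Hypothesis hu : forall q, U q -> hessian G u q = u q *: G q.

Definition grad_vec k p : R := (invmx (G p) *m grad u p) k 0.

Lemma smooth_grad_vec k : smooth_on U (grad_vec k).
Proof. by apply: (smxM oU (smx_Gi mG) (smx_grad mG su)). Qed.

(** Since (u, du) is parallel, the curvature annihilates du on the covector side; pair symmetry
    moves this contraction to the first index of the curvature form. *)
Lemma grad_vec_hyp_curv j p : U p -> \sum_k grad_vec k p *: hyp_curv k j p = 0.
Proof.
move=> Up; have uG := metric_unit mG Up.
suff H : (\sum_k grad_vec k p *: hyp_curv k j p) *m G p = 0.
  by rewrite -[LHS](mulmxK uG) H mul0mx.
rewrite mulmx_suml; apply/matrixP => a b; rewrite summxE mxE.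
have := ext_curv_section a b su hu Up.
have -> : grad u p = G p *m (invmx (G p) *m grad u p) by rewrite mulmxA mulmxV// mul1mx.
rewrite mulmxA => /matrixP /(_ j 0); rewrite mxE [RHS]mxE => E.
rewrite -[RHS]oppr0 -[in RHS]E -sumrN; apply: eq_bigr => k _.
rewrite -scalemxAl mxZE (hyp_curv_pair k j a b Up) (hyp_curv_skew a b k j Up) mulrN mulrC.
by rewrite /grad_vec.
Qed.

Lemma partial_grad_vec i k p : U p -> partial i (grad_vec k) p =
  (i == k)%:R * u p - \sum_l conn G i p l k * grad_vec l p.
Proof.
move=> Up; have -> : partial i (grad_vec k) p = dmx i (fun q => invmx (G q) *m grad u q) p k 0.
  by rewrite dmxE.
rewrite (dmxM i oU (smx_Gi mG) (smx_grad mG su) Up) (dmx_Gi mG i Up).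
have -> : dmx i (grad u) p = u p *: (row i (G p))^T + conn G i p *m grad u p.
  by rewrite -linearZ /= -linearZ /= -hu// hess_row subrK.
have -> : (row i (G p))^T = G p *m delta_mx i 0.
  by rewrite tr_row (cm_sym mG Up) colE.
rewrite mulmxDr -scalemxAr (mulmxA (invmx _) (G p)) mulVmx ?(metric_unit mG Up)// mul1mx.
rewrite mulmxBl mulNmx -!mulmxA.
have -> : \sum_l conn G i p l k * grad_vec l p = ((conn G i p)^T *m (invmx (G p) *m grad u p)) k 0.
  by rewrite mxME; apply: eq_bigr => l _; rewrite mxTE.
rewrite !(mxDE, mxNE) mxZE [delta_mx _ _ _ _]mxE eqxx andbT eq_sym.
by move: (_ k 0) (_ k 0) (_%:R) => x y z; ring.
Qed.

End HyperbolicConnection.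

Lemma near_bounded (R : realType) (T : topologicalType) (I : finType) (f : I -> T -> R) y :
  (forall i, {for y, continuous (f i)}) ->
  exists2 K, 0 <= K & \forall q \near y, forall i, `|f i q| <= K.
Proof.
move=> cf; exists (\sum_i (`|f i y| + 1)); first by apply: sumr_ge0 => i _; rewrite addr_ge0.
apply: near_forall => i; apply: near_imp ((continuous_atP _ _).1 (cf i) 1 ltr01) _ => q H.
apply: (@le_trans _ _ (`|f i y| + 1)).
  by rewrite -lerBlDl; apply: le_trans H; rewrite distrC lerB_dist.
by rewrite (bigD1 i)//= lerDl; apply: sumr_ge0 => j _; rewrite addr_ge0.
Qed.

Section Radial.
Context {R : realType} {n : nat}.

Lemma radial_term (v w d e a : R) (b : bool) : 0 <= e -> `|d - b%:R * a| <= e -> (b -> v = w) ->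
  b%:R * (a * v ^+ 2) - e * (v ^+ 2 + w ^+ 2) / 2 <= v * (w * d).
Proof.
move=> e0; rewrite ler_norml => /andP[h1 h2] vw.
case: b vw h1 h2 => [/(_ isT) <-|_]; rewrite ?mul1r ?mul0r => h1 h2.
  have : 0 <= v ^+ 2 * (d - a + e) by rewrite mulr_ge0 ?sqr_ge0//; move: h1; clear; lra.
  by clear; lra.
have [s|s] := leP 0 (v * w).
  have : 0 <= (v * w) * (d + e) by rewrite mulr_ge0//; move: h1; clear; lra.
  have : 0 <= e * (v - w) ^+ 2 by rewrite mulr_ge0// sqr_ge0.
  by clear; lra.
have : 0 <= (- (v * w)) * (e - d).
  by rewrite mulr_ge0 ?oppr_ge0 ?(ltW s)//; move: h2; clear; lra.
have : 0 <= e * (v + w) ^+ 2 by rewrite mulr_ge0// sqr_ge0.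
by clear; lra.
Qed.

(** The mean value theorem writes the sum as the quadratic form of DN, at an intermediate point, on
    v = q - y. As DN differs from a times the identity by at most [e] in each entry, the form is at
    least (a - n e) |v|^2. *)
Lemma radial_nonneg (U : set 'rV[R]_n) (N : 'I_n -> 'rV[R]_n -> R) y r a e :
  open U -> (forall k, smooth_on U (N k)) -> (forall q, ball y r q -> U q) ->
  (forall k, N k y = 0) -> 0 <= e -> n%:R * e <= a ->
  (forall q i k, ball y r q -> `|partial i (N k) q - (i == k)%:R * a| <= e) ->
  forall q, ball y r q -> 0 <= \sum_k N k q * (q 0 k - y 0 k).
Proof.
move=> oU sN BU N0 e0 ea H q Bq; pose v := q - y.
have vE k : v 0 k = q 0 k - y 0 k by rewrite !mxE.
pose h x := \sum_k v 0 k * N k x.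
have sh : smooth_on U h.
  by apply: smooth_sum => // k; apply: smoothM => //; exact: smooth_cst.
have By : ball y r y by move: Bq; rewrite !in_ballE subrr normr0; apply: le_lt_trans.
have Bt (t : R) : 0 <= t <= 1 -> ball y r (t *: v + y) by move=> t01; exact: ball_segment.
have dh (t : R) : (0 <= t <= 1) || (1 <= t <= 0) ->
   is_derive t 1 (fun s : R => h (s *: v + y)) (\sum_i v 0 i * partial i h (t *: v + y)).
  move=> /orP[t01|/andP[t1 t0]]; last by have := le_trans t1 t0; rewrite ler10.
  exact: smooth_is_derive_line oU sh (BU _ (Bt _ t01)).
have [c c01 E] := MVT_between dh.
have {}c01 : 0 <= c <= 1.
  by case/orP: c01 => // /andP[t1 t0]; have := le_trans t1 t0; rewrite ler10.
move: E; rewrite scale1r scale0r add0r subrK subr0 mulr1.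
have -> : h y = 0 by rewrite /h big1// => k _; rewrite N0 mulr0.
rewrite subr0 => E; have Bc := Bt c c01.
have -> : \sum_k N k q * (q 0 k - y 0 k) = h q by apply: eq_bigr => k _; rewrite vE mulrC.
rewrite E; apply: (@le_trans _ _ (\sum_i \sum_k
   ((i == k)%:R * (a * v 0 i ^+ 2) - e * (v 0 i ^+ 2 + v 0 k ^+ 2) / 2))); last first.
  apply: ler_sum => i _.
  rewrite (partial_sum (F := fun k x => v 0 k * N k x) _ _ _ oU _ (BU _ Bc)); last first.
    by move=> k; apply: smoothM => //; exact: smooth_cst.
  rewrite mulr_sumr; apply: ler_sum => k _; rewrite (partialZ i _ (sN k) (BU _ Bc)).
  by apply: radial_term => // [|/eqP -> //]; exact: H.
set S := \sum_i v 0 i ^+ 2.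
have C (x : R) : \sum_(k < n) x = n%:R * x by rewrite sumr_const card_ord mulr_natl.
have S0 : 0 <= S by apply: sumr_ge0 => i _; exact: sqr_ge0.
suff -> : \sum_i \sum_k ((i == k)%:R * (a * v 0 i ^+ 2) - e * (v 0 i ^+ 2 + v 0 k ^+ 2) / 2) =
    (a - n%:R * e) * S by rewrite mulr_ge0// subr_ge0.
transitivity (\sum_i (a * v 0 i ^+ 2 - e / 2 * (n%:R * v 0 i ^+ 2 + S))).
  apply: eq_bigr => i _; rewrite sumrB (bigD1 i)//= eqxx mul1r big1 ?addr0 => [|k /negbTE ki]; last first.
    by rewrite eq_sym ki mul0r.
  by congr (_ - _); rewrite -mulr_suml -mulr_sumr big_split /= C mulrAC.
rewrite sumrB -!mulr_sumr big_split /= -mulr_sumr C -/S.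
by move: (n%:R : R) => x; field.
Qed.

End Radial.

Section Numbers.
Context {R : realType}.

Lemma sum_product_rule (I : finType) (N a b : I -> R) c e :
  \sum_k N k * (a k * c - e * b k) = (\sum_k N k * a k) * c - e * \sum_k N k * b k.
Proof.
by rewrite mulr_suml mulr_sumr -sumrB; apply: eq_bigr => k _; rewrite mulrBr (mulrA (N k)) (mulrCA (N k)).
Qed.

Lemma half_lt (a b : R) : 0 < a -> a - b <= a / 4 -> a / 2 < b.
Proof. lra. Qed.

Lemma sub4_lt0 (a x y : R) : 0 < y -> y / 2 < x -> a <= y -> a - 4 * x < 0.
Proof. lra. Qed.

Lemma cutoff_neg (a b K e d : R) : a <= K * e -> K < 0 -> 0 < e -> 0 < d -> 0 <= b ->
  a * d - e * b < 0.
Proof.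
move=> aK K0 e0 d0 b0; have a0 : a < 0 by apply: le_lt_trans aK _; rewrite nmulr_rlt0.
by rewrite subr_lt0; apply: (@lt_le_trans _ _ 0); rewrite ?nmulr_rlt0 ?mulr_ge0// ltW.
Qed.

Lemma cutoff_neg_slope (a x w b K e d D : R) : a <= K * e -> 0 <= K -> 0 < e -> d <= D ->
  0 < d -> w / 2 - b <= x -> K * D + b < w / 2 -> a * d - e * x < 0.
Proof.
move=> aK K0 e0 dD d0 wx H.
have h1 : a * d <= K * e * d by rewrite ler_wpM2r// ltW.
have h2 : K * e * d <= K * e * D by rewrite ler_wpM2l// mulr_ge0// ltW.
have h3 : e * (K * D) < e * x by rewrite ltr_pM2l//; move: wx H; clear; lra.
by rewrite subr_lt0; apply: le_lt_trans h1 _; apply: le_lt_trans h2 _; rewrite (mulrC K) -mulrA.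
Qed.

Lemma small_slope (K b w rho : R) : 0 <= K -> 0 <= b -> 0 < w -> 0 < rho ->
  exists2 d, 0 < d & K * d + d / rho * b < w.
Proof.
move=> K0 b0 w0 r0; have c0 : 0 < K + b / rho + 1 by rewrite ltr_wpDl// addr_ge0// divr_ge0// ltW.
exists (w / (K + b / rho + 1)); first by rewrite divr_gt0.
set d := w / _; have d0 : 0 < d by rewrite divr_gt0.
have -> : w = d * (K + b / rho + 1) by rewrite mulfVK// gt_eqF.
have -> : K * d + d / rho * b = d * (K + b / rho) by rewrite mulrDr mulrC; congr (_ + _); rewrite -mulrA (mulrC _ b).
by rewrite ltr_pM2l// ltrDl.
Qed.

Lemma sqr_lt_half (a r : R) : 0 < r -> 0 <= a -> a ^+ 2 <= (r / 2) ^+ 2 -> a < r.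
Proof. nra. Qed.

End Numbers.

Lemma energy_flat (R : realType) n m (A : 'I_n -> 'rV[R]_n -> 'M[R]_m) q :
  (forall i j, conn_curv A i j q = 0) -> energy A q = 0.
Proof. by move=> H; apply: big1 => x _; rewrite H mxE expr0n. Qed.

Lemma eq_leLR (R : realType) (x y : R) : x = y -> x <= y. Proof. by move->. Qed.

Opaque energy.

(** * Flatness across a level set of u *)

Section FlatExtension.
Context {R : realType} {n : nat}.
Variables (U : set 'rV[R]_n) (G : 'rV[R]_n -> 'M[R]_n).
Hypothesis mG : chart_metric U G.
Variable u : 'rV[R]_n -> R.
Hypothesis su : smooth_on U u.
Hypothesis u0 : forall q, U q -> 0 < u q.
Hypothesis hu : forall q, U q -> hessian G u q = u q *: G q.
Implicit Types (p q y : 'rV[R]_n).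

Let oU : open U := cm_open mG.
Let N := grad_vec G u.
Let A := ext_conn G.
Let E := energy A.
Let sN k : smooth_on U (N k). Proof. exact: smooth_grad_vec. Qed.
Let sA k : smx U (A k). Proof. exact: smx_ext_conn. Qed.
Let sE : smooth_on U E. Proof. exact: smooth_energy. Qed.

Lemma sum_block_dr (c : 'I_n -> R) (S : 'I_n -> 'M[R]_n) :
  \sum_k c k *: (block_mx 0 0 0 (S k) : 'M[R]_(1 + n)) = block_mx 0 0 0 (\sum_k c k *: S k).
Proof.
rewrite (big_morph (fun X : 'M[R]_n => block_mx 0 0 0 X : 'M[R]_(1 + n)) (id1 := 0) (op1 := +%R)).
- by apply: eq_bigr => k _; rewrite scale_block_mx !scaler0.
- by move=> X Y; rewrite add_block_mx !addr0.
- by rewrite block_mx0.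
Qed.

Let NF j p : U p -> \sum_k N k p *: conn_curv A k j p = 0.
Proof.
move=> Up; under eq_bigr => k _ do rewrite (conn_curv_ext mG k j Up).
by rewrite sum_block_dr (grad_vec_hyp_curv mG su hu j Up) block_mx0.
Qed.

Let dN i k p : U p ->
  partial i (N k) p = (i == k)%:R * u p - \sum_l conn G i p l k * N l p.
Proof. exact: partial_grad_vec. Qed.

Lemma energy_local_bound y : U y -> exists2 K, 0 <= K & \forall q \near y, U q /\
  forall nu, 0 <= nu -> (forall l, `|N l q| <= nu) ->
  \sum_k N k q * partial k E q <= (K * nu - 4 * u q) * E q.
Proof.
move=> Uy.
have [K1 K10 H1] := @near_bounded R _ _ (fun x : 'I_n * 'I_n * 'I_n => fun q => conn G x.1.1 q x.2 x.1.2) y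
  (fun x => smooth_continuous (smx_conn mG x.1.1 x.2 x.1.2) Uy).
have [K2 K20 H2] := @near_bounded R _ _ (fun x : 'I_n * 'I_(1 + n) * 'I_(1 + n) => fun q => A x.1.1 q x.1.2 x.2) y
  (fun x => smooth_continuous (sA x.1.1 x.1.2 x.2) Uy).
have K0 : 0 <= K1 + K2 by exact: addr_ge0.
exists (@transport_const R n (1 + n) (K1 + K2)).
  by rewrite /transport_const !(mulr_ge0, addr_ge0).
apply: near_imp (near_and (near_open oU Uy (fun _ h => h)) (near_and H1 H2)) _ => q [Uq [h1 h2]].
split=> // nu nu0 Nn.
apply: (energy_transport oU sA sN NF dN Uq nu0 K0 Nn) => [i k l|k].
  by apply: le_trans (h1 (i, k, l)) _; rewrite lerDl.
apply: le_trans (_ : K2 <= _); last by rewrite lerDr.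
by apply: norm_le_coord => // a b; exact: h2 (k, a, b).
Qed.

Lemma flat_of_energy y : (\forall q \near y, E q = 0) ->
  \forall q \near y, forall i j, conn_curv A i j q = 0.
Proof. by move=> H; apply: near_imp H _ => q /energy_eq0. Qed.

Let partial_cutoff h c p k : smooth_on U h -> U p ->
  partial k (fun q => E q * (c - h q)) p = partial k E p * (c - h p) - E p * partial k h p.
Proof.
move=> sh Up; have sc : smooth_on U (fun q => c - h q).
  by apply: smoothB => //; exact: smooth_cst.
rewrite (partialM k sE sc Up) (partialB k oU (@smooth_cst _ _ U c) sh Up) partial_cst.
by rewrite sub0r mulrN.
Qed.

Let sum_cutoff h c p : smooth_on U h -> U p ->
  \sum_k N k p * partial k (fun q => E q * (c - h q)) p =
  (\sum_k N k p * partial k E p) * (c - h p) - E p * (\sum_k N k p * partial k h p).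
Proof.
move=> sh Up; rewrite -sum_product_rule; apply: eq_bigr => k _; congr (_ * _).
exact: partial_cutoff.
Qed.

Let sqd_ball y r q : 0 < r -> sqd y q <= (r / 2) ^+ 2 -> ball y r q.
Proof.
move=> r0 H; rewrite in_ballE distrC; have := le_trans (sqd_ge_norm y q) H.
exact: sqr_lt_half.
Qed.

(** Near a critical point N = Du points away from [y], because DN = u times the identity there, and
    the factor in the energy inequality is negative. Hence E (rho - |q - y|^2) strictly decreases
    along N where it is positive, while it vanishes on the sphere. *)
Lemma flat_critical y : U y -> grad u y = 0 ->
  \forall q \near y, forall i j, conn_curv A i j q = 0.
Proof.
move=> Uy g0; apply: flat_of_energy; have uy := u0 Uy.
have Ny k : N k y = 0 by rewrite /N /grad_vec g0 mulmx0 mxE.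
have [K K0 HK] := energy_local_bound Uy.
(* Then K nu <= u(y), which is less than 4 u(q) as soon as u(q) > u(y) / 2. *)
pose nu := u y / (K + 1).
have K1 : 0 < K + 1 by rewrite ltr_wpDl.
have nu0 : 0 < nu by rewrite divr_gt0.
(* The tolerance n e <= u(y) required by [radial_nonneg]. *)
pose e := u y / n.+1%:R; have e0 : 0 < e by rewrite divr_gt0.
have ea : n%:R * e <= u y.
  by rewrite /e mulrCA ler_piMr ?(ltW uy)// ler_pdivrMr// mul1r ler_nat.
have H1 : \forall q \near y, forall k, `|N k q| <= nu.
  apply: near_forall => k; have cN := smooth_continuous (sN k) Uy.
  apply: near_imp ((continuous_atP _ _).1 cN nu nu0) _ => q.
  by rewrite Ny sub0r normrN.
have H2 : \forall q \near y, u y / 2 < u q.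
  have cu := smooth_continuous su Uy; have u4 : 0 < u y / 4 by rewrite divr_gt0.
  apply: near_imp ((continuous_atP _ _).1 cu _ u4) _ => q.
  by rewrite ler_norml => /andP[_]; exact: half_lt.
have H3 : \forall q \near y, forall x : 'I_n * 'I_n,
    `|partial x.1 (N x.2) q - (x.1 == x.2)%:R * u y| <= e.
  apply: near_forall => -[i k] /=.
  have cN := smooth_continuous (smooth_partial i (sN k)) Uy.
  apply: near_imp ((continuous_atP _ _).1 cN e e0) _ => q.
  rewrite distrC (dN i k Uy) big1 ?subr0// => l _; by rewrite Ny mulr0.
have [r r0 Hr] := near_in_ball (near_and HK (near_and H1 (near_and H2 H3))).
have BU q : ball y r q -> U q by move=> /Hr[[]].
have rad := radial_nonneg oU sN BU Ny (ltW e0) ea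
  (fun q i k Bq => (Hr q Bq).2.2.2 (i, k)).
pose rho := (r / 2) ^+ 2; have rho0 : 0 < rho by rewrite exprn_gt0// divr_gt0.
have sB q : sqd y q <= rho -> ball y r q by exact: sqd_ball.
have ssq := smooth_sqd y oU.
have sh : smooth_on U (fun q => E q * (rho - sqd y q)).
  by apply: smoothM => //; apply: smoothB => //; exact: smooth_cst.
have M := transport_max oU sh (fun q Dq => BU _ (sB q Dq)) (N := N) (y := y) (r := rho).
have {}M q : sqd y q <= rho -> E q * (rho - sqd y q) <= 0.
  apply: M => {}q; first by move=> ->; rewrite subrr mulr0.
  move=> Dq hq; have Bq := sB q Dq; have [[Uq HKq] [H1q [H2q _]]] := Hr q Bq.
  have d0 : 0 <= rho - sqd y q by rewrite subr_ge0.
  have E0 : 0 < E q.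
    rewrite lt_neqAle energy_ge0 andbT; apply/eqP => E0; by rewrite -E0 mul0r ltxx in hq.
  have d1 : 0 < rho - sqd y q by rewrite -(pmulr_rgt0 _ E0).
  rewrite (sum_cutoff _ ssq Uq).
  apply: (cutoff_neg (HKq nu (ltW nu0) H1q)) => //.
    have Knu : K * nu <= u y.
      by rewrite /nu mulrCA ler_piMr ?(ltW uy)// ler_pdivrMr// mul1r lerDl.
    exact: sub4_lt0 uy H2q Knu.
  have -> : \sum_k N k q * partial k (sqd y) q = 2 * \sum_k N k q * (q 0 k - y 0 k).
    by rewrite mulr_sumr; apply: eq_bigr => k _; rewrite partial_sqd mulrCA.
  by rewrite mulr_ge0//; exact: rad.
have oD : open [set q | sqd y q < rho].
  apply: (@open_comp _ _ (sqd y) [set t | t < rho]); last exact: open_lt.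
  by move=> q' _; exact: smooth_continuous (smooth_sqd y (@openT _)) I.
have yD : sqd y y < rho by rewrite (_ : sqd y y = 0)//; apply/eqP; rewrite sqd_eq0.
apply: (near_open oD yD) => q /= Dq; apply/eqP; rewrite eq_le energy_ge0 andbT.
by have := M q (ltW Dq); rewrite pmulr_lle0// subr_gt0.
Qed.

(* With h(q) = u(q) - u(y) + (d / rho) |q - y|^2, the product of E and d - h is nonpositive on
   {u < u(y)}, where E = 0, and on the sphere |q - y|^2 = rho; elsewhere it decreases
   along N where it is positive, so it is nonpositive on the ball. *)
Lemma flat_noncritical y : U y -> grad u y != 0 ->
  (forall q, U q -> u q < u y -> forall i j, conn_curv A i j q = 0) ->
  \forall q \near y, forall i j, conn_curv A i j q = 0.
Proof.
move=> Uy g0 low; apply: flat_of_energy.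
have lowE q : U q -> u q < u y -> E q = 0 by move=> Uq /(low q Uq); exact: energy_flat.
(* The derivative of u along N, that is |Du|^2; it stays above half of its value at [y] and makes
   the cutoff d - h decrease along N. *)
pose w q := \sum_k N k q * partial k u q.
have sw : smooth_on U w.
  by apply: smooth_sum => // k; apply: smoothM => //; exact: smooth_partial.
have wy : 0 < w y.
  have -> : w y = ((grad u y)^T *m invmx (G y) *m (grad u y)^T^T) 0 0.
    rewrite -{1}(Gi_sym mG Uy) -trmx_mul mxME; apply: eq_bigr => k _.
    by rewrite [in RHS]mxTE [in RHS]mxTE mxTE gradE.
  apply: (posdef_inv (cm_sym mG Uy) (cm_pos mG Uy)).
  by apply: contra_neq g0 => /(congr1 trmx); rewrite trmxK trmx0.
have [K K0 HK] := energy_local_bound Uy.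
have [nu nu0 H1] := near_bounded (fun k => smooth_continuous (sN k) Uy).
have H2 : \forall q \near y, w y / 2 < w q.
  have w4 : 0 < w y / 4 by rewrite divr_gt0.
  apply: near_imp ((continuous_atP _ _).1 (smooth_continuous sw Uy) _ w4) _ => q.
  by rewrite ler_norml => /andP[_]; exact: half_lt.
have [r r0 Hr] := near_in_ball (near_and HK (near_and H1 H2)).
have BU q : ball y r q -> U q by move=> /Hr[[]].
pose rho := (r / 2) ^+ 2; have rho0 : 0 < rho by rewrite exprn_gt0// divr_gt0.
have sB q : sqd y q <= rho -> ball y r q by exact: sqd_ball.
(* A bound on the ball for the derivative of |q - y|^2 along N. *)
pose b := 2 * (n%:R * nu * r).
have b0 : 0 <= b by rewrite !mulr_ge0// ltW.
have Knu0 : 0 <= K * nu by rewrite mulr_ge0.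
have w20 : 0 < w y / 2 by rewrite divr_gt0.
(* [d] is so small that the growth of E, at most K nu d after multiplication by the cutoff, and the
   slope (d / rho) b of the quadratic term are together below w(y) / 2. *)
have [d d0 Hd] := small_slope Knu0 b0 w20 rho0.
have dr0 : 0 <= d / rho by rewrite divr_ge0// ltW.
pose h q := (u q - u y) + d / rho * sqd y q.
have ssq := smooth_sqd y oU.
have suy : smooth_on U (fun q => u q - u y) by apply: smoothB => //; exact: smooth_cst.
have sds : smooth_on U (fun q => d / rho * sqd y q) by apply: smoothM => //; exact: smooth_cst.
have sh : smooth_on U h by exact: smoothD.
have sEh : smooth_on U (fun q => E q * (d - h q)).
  by apply: smoothM => //; apply: smoothB => //; exact: smooth_cst.
have M := transport_max oU sEh (fun q Dq => BU _ (sB q Dq)) (N := N) (y := y) (r := rho).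
have {}M q : sqd y q <= rho -> E q * (d - h q) <= 0.
  apply: M => {}q.
    move=> Sq; have Uq := BU _ (sB q (eq_leLR Sq)).
    have [lt|le] := ltP (u q) (u y); first by rewrite lowE// mul0r.
    rewrite /h Sq mulfVK ?gt_eqF// mulr_ge0_le0 ?energy_ge0//.
    by rewrite opprD addrCA subrr addr0 oppr_le0 subr_ge0.
  move=> Dq hq; have Bq := sB q Dq; have [[Uq HKq] [H1q H2q]] := Hr q Bq.
  have E0 : 0 < E q.
    rewrite lt_neqAle energy_ge0 andbT; apply/eqP => E0; by rewrite -E0 mul0r ltxx in hq.
  have d1 : 0 < d - h q by rewrite -(pmulr_rgt0 _ E0).
  have uq : 0 <= u q - u y.
    by rewrite subr_ge0 leNgt; apply/negP => /(lowE q Uq) E1; rewrite E1 ltxx in E0.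
  have hd : d - h q <= d by rewrite lerBlDr lerDl addr_ge0// mulr_ge0// sqd_ge0.
  rewrite (sum_cutoff _ sh Uq).
  have EK : \sum_k N k q * partial k E q <= K * nu * E q.
    apply: le_trans (HKq nu nu0 H1q) _; rewrite ler_wpM2r ?energy_ge0//.
    by rewrite lerBlDr lerDl mulr_ge0// ltW// u0.
  apply: (cutoff_neg_slope EK Knu0 E0 hd d1 (w := w y) (b := d / rho * b)) => //.
  have -> : \sum_k N k q * partial k h q = w q + d / rho * \sum_k N k q * partial k (sqd y) q.
    rewrite mulr_sumr -big_split /=; apply: eq_bigr => k _.
    rewrite (partialD k suy sds Uq) (partialB k oU su (@smooth_cst _ _ U (u y)) Uq) partial_cst subr0.
    by rewrite (partialZ k _ ssq Uq) mulrDr (mulrCA (N k q)).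
  apply: lerD; first exact: ltW.
  rewrite -mulrN ler_wpM2l//.
  have -> : \sum_k N k q * partial k (sqd y) q = 2 * \sum_k N k q * (q 0 k - y 0 k).
    by rewrite mulr_sumr; apply: eq_bigr => k _; rewrite partial_sqd mulrCA.
  rewrite -mulrN ler_wpM2l// lerNl; apply: le_trans (ler_norm _) _.
  rewrite normrN; apply: sum_coord_le => // k.
  have := coord_le_norm (q - y) 0 k; rewrite !mxE => /le_trans; apply.
  by move: Bq; rewrite in_ballE distrC => /ltW.
have N1 : \forall q \near y, h q < d.
  have hy : h y = 0.
    by rewrite /h subrr add0r (_ : sqd y y = 0) ?mulr0//; apply/eqP; rewrite sqd_eq0.
  have d2 : 0 < d / 2 by rewrite divr_gt0.
  apply: near_imp ((continuous_atP _ _).1 (smooth_continuous sh Uy) _ d2) _ => q.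
  rewrite hy sub0r normrN => /(le_trans (ler_norm _)) /le_lt_trans; apply.
  by rewrite ltr_pdivrMr// mulr_natr mulr2n ltrDl.
have oD : open [set q | sqd y q < rho].
  apply: (@open_comp _ _ (sqd y) [set t | t < rho]); last exact: open_lt.
  by move=> q' _; exact: smooth_continuous (smooth_sqd y (@openT _)) I.
have yD : sqd y y < rho by rewrite (_ : sqd y y = 0)//; apply/eqP; rewrite sqd_eq0.
apply: near_imp (near_and N1 (near_open oD yD (fun _ h => h))) _ => q [hq Dq].
apply/eqP; rewrite eq_le energy_ge0 andbT.
by have := M q (ltW Dq); rewrite pmulr_lle0// subr_gt0.
Qed.

Lemma flat_extend y : U y ->
  (forall q, U q -> u q < u y -> forall i j, conn_curv A i j q = 0) ->
  \forall q \near y, forall i j, conn_curv A i j q = 0.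
Proof.
move=> Uy; have [g0 _|] := eqVneq (grad u y) 0; first exact: flat_critical.
exact: flat_noncritical.
Qed.

End FlatExtension.

(** * Local isometries to hyperbolic space *)

Section LocalSolutions.
Context {R : realType} {n : nat}.
Variables (U : set 'rV[R]_n) (G : 'rV[R]_n -> 'M[R]_n).
Hypothesis mG : chart_metric U G.
Implicit Types (p q y z : 'rV[R]_n).

Let oU : open U := cm_open mG.
Let A := ext_conn G.
Let sA k : smx U (A k). Proof. exact: smx_ext_conn. Qed.

Lemma chart_metric_sub V : open V -> V `<=` U -> chart_metric V G.
Proof.
move=> oV VU; split => // [|p Vp|p Vp].
- exact: smx_sub VU (cm_smooth mG).
- exact: (cm_sym mG (VU _ Vp)).
- exact: (cm_pos mG (VU _ Vp)).
Qed.

(** Converse of [ext_section_parallel]: the first row of the equation says that the lower block is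
    the differential of the first component, and the remaining rows are the Hessian equation. *)
Lemma parallel_solution V (Y : 'rV[R]_n -> 'cV[R]_(1 + n)) : open V -> V `<=` U -> smx V Y ->
  (forall i q, V q -> dmx i Y q = A i q *m Y q) ->
  let f q := usubmx (Y q) 0 0 in
  [/\ smooth_on V f, forall q, V q -> grad f q = dsubmx (Y q) &
      forall q, V q -> hessian G f q = f q *: G q].
Proof.
move=> oV VU sY dY f.
have fE q : f q = Y q (lshift n 0) 0 by rewrite /f mxE.
have sf : smooth_on V f by apply: smooth_ext oV _ (sY (lshift n 0) 0) => q _; rewrite fE.
have AY i q : A i q *m Y q = col_mx (row i (dsubmx (Y q)))
    (col i (G q) *m usubmx (Y q) + conn G i q *m dsubmx (Y q)).
  by rewrite -{1}(vsubmxK (Y q)) /A /ext_conn mul_block_col mul0mx add0r deltaM.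
have gf q : V q -> grad f q = dsubmx (Y q).
  move=> Vq; apply/matrixP => i j; rewrite !ord1 gradE.
  transitivity (dmx i Y q (lshift n 0) 0).
    by rewrite dmxE; congr partial; apply/funext => q'; rewrite fE.
  by rewrite dY// AY col_mxEu mxE.
split=> // q Vq; apply/trmx_inj; rewrite linearZ /= (cm_sym mG (VU _ Vq)).
apply/matrixP => a i.
have -> : (hessian G f q)^T a i = (row i (hessian G f q))^T a 0 by rewrite !mxTE [in RHS]mxE.
rewrite hess_row mxDE mxNE gf// dmxE.
rewrite (partial_ext (h := fun q => Y q (rshift 1 a) 0) i oV _ Vq); last first.
  by move=> q' Vq'; rewrite gf// mxE.
rewrite -(dmxE Y) dY// AY col_mxEd mxDE addrK mxME big_ord1 [col _ _ _ _]mxE.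
by rewrite mxZE mulrC.
Qed.

Lemma bounded_nbhd y : U y -> exists K, exists rho, [/\ 0 <= K, 0 < rho, ball y rho `<=` U &
  forall q, ball y rho q -> [/\ forall i, `|A i q| <= K, forall i j, `|dmx j (A i) q| <= K &
    forall i a b j k, `|partial j (partial k (fun q => A i q a b)) q| <= K]].
Proof.
move=> Uy.
have [K1 K10 H1] := @near_bounded R _ _ (fun x : 'I_n * 'I_(1 + n) * 'I_(1 + n) =>
  fun q => A x.1.1 q x.1.2 x.2) y (fun x => smooth_continuous (sA x.1.1 x.1.2 x.2) Uy).
have [K2 K20 H2] := @near_bounded R _ _ (fun x : 'I_n * 'I_n * 'I_(1 + n) * 'I_(1 + n) =>
  fun q => partial x.1.1.2 (fun q => A x.1.1.1 q x.1.2 x.2) q) y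
  (fun x => smooth_continuous (smooth_partial x.1.1.2 (sA x.1.1.1 x.1.2 x.2)) Uy).
have [K3 K30 H3] := @near_bounded R _ _ (fun x : 'I_n * 'I_n * 'I_n * 'I_(1 + n) * 'I_(1 + n) =>
  fun q => partial x.1.1.1.2 (partial x.1.1.2 (fun q => A x.1.1.1.1 q x.1.2 x.2)) q) y
  (fun x => smooth_continuous (smooth_partial x.1.1.1.2 (smooth_partial x.1.1.2 (sA x.1.1.1.1 x.1.2 x.2))) Uy).
have [rho rho0 H] := near_in_ball (near_and (near_open oU Uy (fun _ h => h)) (near_and H1 (near_and H2 H3))).
have K0 : 0 <= K1 + K2 + K3 by rewrite !addr_ge0.
have le1 : K1 <= K1 + K2 + K3 by rewrite -addrA lerDl addr_ge0.
have le2 : K2 <= K1 + K2 + K3 by rewrite addrAC lerDr addr_ge0.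
have le3 : K3 <= K1 + K2 + K3 by rewrite lerDr addr_ge0.
exists (K1 + K2 + K3), rho; split=> // [q /H[]//|q /H[_ [h1 [h2 h3]]]]; split.
- by move=> i; apply: norm_le_coord => // a b; apply: le_trans le1; exact: (h1 (i, a, b)).
- move=> i j; apply: norm_le_coord => // a b; rewrite dmxE; apply: le_trans le2.
  exact: (h2 (i, j, a, b)).
- by move=> i a b j k; apply: le_trans le3; exact: (h3 (i, j, k, a, b)).
Qed.

Lemma small_radius (K rho : R) : 0 <= K -> 0 < rho ->
  exists2 r, 0 < r & 4 * r <= rho /\ forall s, 0 < s -> s <= r -> 4 * s * n%:R * (1 + n)%:R * K <= 1.
Proof.
move=> K0 rho0; pose c := 4 * n%:R * (1 + n)%:R * K.
have c0 : 0 <= c by rewrite !mulr_ge0.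
have c1 : 0 < c + 1 by rewrite ltr_wpDl.
exists (Num.min (rho / 4) (c + 1)^-1); first by rewrite lt_min divr_gt0//= invr_gt0.
split; first by rewrite -ler_pdivlMl// mulrC ge_min lexx.
move=> s s0; rewrite le_min => /andP[_ sc].
have -> : 4 * s * n%:R * (1 + n)%:R * K = c * s.
  by rewrite /c; move: (n%:R : R) ((1 + n)%:R : R) => x1 x2; ring.
apply: (@le_trans _ _ (c * (c + 1)^-1)); first by rewrite ler_wpM2l.
by rewrite ler_pdivrMr// mul1r lerDl.
Qed.

Definition solution V (f : 'rV[R]_n -> R) :=
  smooth_on V f /\ forall q, V q -> hessian G f q = f q *: G q.

(** Gronwall with error 0 for the section (f, df). One radius serves all smaller balls and all base
    points [z], so that smaller balls can be chosen later. *)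
Lemma unique_nbhd y : U y -> exists2 r, 0 < r & ball y r `<=` U /\
  forall s f z, 0 < s -> s <= r -> solution (ball y s) f -> ball y s z ->
    f z = 0 -> grad f z = 0 -> forall q, ball y s q -> f q = 0.
Proof.
move=> Uy; have [K [rho [K0 rho0 BU HK]]] := bounded_nbhd Uy.
have [r r0 [rr small]] := small_radius K0 rho0.
have sr (s : R) : s <= r -> ball y s `<=` ball y rho.
  move=> sr q; rewrite !in_ballE => /lt_le_trans; apply; apply: le_trans rr.
  by apply: le_trans sr _; rewrite ler_peMl ?(ltW r0)// ler1n.
exists r => //; split; first by move=> q /(sr _ (lexx _)) /BU.
move=> s f z s0 ler [sf hf] Bz fz gz q Bq.
have oB : open (ball y s) by exact: ball_open.
have BsU : ball y s `<=` U by move=> q' /(sr _ ler) /BU.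
have mB := chart_metric_sub oB BsU.
have sY := smx_ext_section mB sf.
have := @segment_bound _ n (1 + n) A (ext_section f) y z s K 0 s0 K0 (small s s0 ler) (lexx _).
move=> /(_ (fun a => sY a 0 1%N)) H.
have Y0 : ext_section f z = 0.
  by rewrite /ext_section fz gz raddf0 col_mx0.
have {}H : `|ext_section f q| <= 4 * s * n%:R * 0.
  apply: H => //.
    by move=> i q' /(sr _ ler) /HK[].
  move=> i q' Bq'; by rewrite (ext_section_parallel mB i Bq' (hf q' Bq')) subrr normr0.
move: H; rewrite mulr0 normr_le0 => /eqP /matrixP /(_ (lshift n 0) 0).
by rewrite col_mxEu !mxE.
Qed.

(** A parallel section with initial value (a, v) at [z]; the radius does not depend on the initial
    data. *)
Lemma solution_nbhd y : U y -> (\forall q \near y, forall i j, conn_curv A i j q = 0) ->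
  exists2 r, 0 < r & ball y r `<=` U /\
  forall z (a : R) (v : 'cV[R]_n), ball y r z ->
    exists f, [/\ solution (ball y r) f, f z = a & grad f z = v].
Proof.
move=> Uy F0; have [K [rho1 [K0 rho10 BU1 HK]]] := bounded_nbhd Uy.
have [rho2 rho20 HF] := near_in_ball F0.
pose rho := Num.min rho1 rho2; have rho0 : 0 < rho by rewrite lt_min rho10.
have [r r0 [rr small]] := small_radius K0 rho0.
have B4 q : ball y (4 * r) q -> ball y rho1 q /\ ball y rho2 q.
  rewrite !in_ballE => H; have := lt_le_trans H rr.
  by rewrite lt_min => /andP[].
have BB : ball y r `<=` ball y (4 * r).
  by move=> q; rewrite !in_ballE => /lt_le_trans; apply; rewrite ler_peMl ?(ltW r0)// ler1n.
have BU : ball y r `<=` U by move=> q /BB /B4[/BU1].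
exists r => //; split=> // z a v Bz.
have sA4 i : smx (ball y (4 * r)) (A i) by apply: smx_sub (sA i) => q /B4[/BU1].
have [Y [sY Yz dY]] := @parallel_exists R n (1 + n) A y r K r0 K0 sA4
  (fun i q Bq => let: And3 h _ _ := HK q (B4 q Bq).1 in h i)
  (fun i j q Bq => let: And3 _ h _ := HK q (B4 q Bq).1 in h i j)
  (fun i a b j k q Bq => let: And3 _ _ h := HK q (B4 q Bq).1 in h i a b j k)
  (fun i j q Bq => HF q (B4 q Bq).2 i j) (small r r0 (lexx _)) z (col_mx a%:M v) Bz.
have oB : open (ball y r) by exact: ball_open.
have [sf gf hf] := parallel_solution oB BU sY dY.
exists (fun q => usubmx (Y q) 0 0); split => //.
  by rewrite Yz col_mxKu mxE eqxx.
by rewrite gf// Yz col_mxKd.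
Qed.

(** When both Hessians are multiples of g, d<df, dh> = f dh + h df. Thus <df, dh> - f h is a first
    integral. *)
Lemma solution_gram V f h k p : open V -> V `<=` U -> solution V f -> solution V h -> V p ->
  partial k (ipg G f h) p = partial k (fun q => f q * h q) p.
Proof.
move=> oV VU [sf hf] [sh hh] Vp; have mV := chart_metric_sub oV VU.
rewrite (partial_ipg mV k sf sh Vp) (hf p Vp) (hh p Vp) (partialM k sf sh Vp).
have uG := metric_unit mV Vp.
have r1 c : row k (c *: G p) *m invmx (G p) = c *: delta_mx 0 k.
  by rewrite linearZ /= -scalemxAl rowE -mulmxA mulmxV// mulmx1.
rewrite r1 -scalemxAl mxZE deltaM [row _ _ _ _]mxE gradE.
have -> : ((grad f p)^T *m invmx (G p) *m (row k (h p *: G p))^T) 0 0 = h p * partial k f p.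
  rewrite -[LHS]mxTE trmx_mul trmxK trmx_mul trmxK (Gi_sym mV Vp) mulmxA r1.
  by rewrite -scalemxAl mxZE deltaM [row _ _ _ _]mxE gradE.
by rewrite addrC mulrC.
Qed.

Lemma smooth_const_ball f y r p q : smooth_on (ball y r) f ->
  (forall i q, ball y r q -> partial i f q = 0) -> ball y r p -> ball y r q -> f q = f p.
Proof.
move=> sf df Bp Bq; have := @lipschitz_ball _ n f y r 0 p q (lexx _) (sf 1%N) _ Bp Bq.
rewrite mulr0 => H; apply/eqP; rewrite -subr_eq0 -normr_le0; apply: H => i x Bx.
by rewrite df// normr0.
Qed.

Lemma solution_gram_const f h y r p q : ball y r `<=` U -> solution (ball y r) f ->
  solution (ball y r) h -> ball y r p -> ball y r q ->
  ipg G f h q - f q * h q = ipg G f h p - f p * h p.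
Proof.
move=> BU Sf Sh Bp Bq; have oB : open (ball y r) by exact: ball_open.
have mB := chart_metric_sub oB BU; have [sf _] := Sf; have [sh _] := Sh.
have s1 := smooth_ipg mB sf sh; have s2 := smoothM oB sf sh.
apply: (@smooth_const_ball (fun q => ipg G f h q - f q * h q) y r) => //.
  exact: smoothB.
move=> i x Bx; rewrite (partialB i oB s1 s2 Bx) (solution_gram i oB BU Sf Sh Bx).
exact: subrr.
Qed.

End LocalSolutions.

Section Koszul.
Context {R : realType} {n : nat}.

Lemma mulmx_col_entry m k (A : 'M[R]_(m, k)) (S : 'M[R]_m) (C : 'M[R]_(m, k)) d c :
  (A^T *m S *m C) d c = ((col d A)^T *m S *m col c C) 0 0.
Proof.
by rewrite tr_col -row_mul !mxME; apply: eq_bigr => j _; rewrite [row _ _ _ _]mxE [col _ _ _ _]mxE.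
Qed.

Lemma sub_eq_neg (a b c d : R) : a + b = c + d -> a - c = - (b - d).
Proof. lra. Qed.

Lemma koszul_zero (I : Type) (T : I -> I -> I -> R) : (forall a b c, T a b c = T a c b) ->
  (forall a b c, T a b c = - T b a c) -> forall a b c, T a b c = 0.
Proof.
move=> s t a b c; have := t a b c; have := t b c a; have := t c a b.
rewrite (s c b a) (s b a c) (s a c b); move: (T a b c) (T b c a) (T c a b).
by clear; move=> x y z; lra.
Qed.

Lemma posdef_one_plus (x : 'rV[R]_n) : posdef (1%:M + x^T *m x).
Proof.
move=> v v0; rewrite mulmxDr mulmx1 mulmxDl mxDE.
have -> : v *m (x^T *m x) *m v^T = (v *m x^T) *m (v *m x^T)^T.
  by rewrite trmx_mul trmxK !mulmxA.
rewrite ltr_pwDl//; last first.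
  by rewrite mxME; apply: sumr_ge0 => i _; rewrite mxTE -expr2 sqr_ge0.
rewrite lt_neqAle; apply/andP; split; last first.
  by rewrite mxME; apply: sumr_ge0 => i _; rewrite mxTE -expr2 sqr_ge0.
apply: contra_neq v0; rewrite mxME => /esym/eqP.
rewrite psumr_eq0 => [/allP H|i _]; last by rewrite mxTE -expr2 sqr_ge0.
apply/rowP => i; rewrite mxE; apply/eqP; rewrite -sqrf_eq0 expr2.
by have := H i (mem_index_enum _); rewrite /= mxTE.
Qed.

Variables (U : set 'rV[R]_n) (G : 'rV[R]_n -> 'M[R]_n).
Hypothesis mG : chart_metric U G.
Variable X : 'I_n -> 'rV[R]_n -> R.
Hypothesis sX : forall a, smooth_on U (X a).
Hypothesis gX : forall a b q, U q -> ipg G (X a) (X b) q = (a == b)%:R + X a q * X b q.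
Implicit Types (q : 'rV[R]_n).

Let oU : open U := cm_open mG.

(** The Jacobian matrix in the convention of ['J]; column [a] is the differential of [X a]. *)
Definition frame q : 'M[R]_n := \matrix_(i, a) partial i (X a) q.

Lemma col_frame a q : col a (frame q) = grad (X a) q.
Proof. by apply/matrixP => i j; rewrite ord1 gradE !mxE. Qed.

Lemma frame_gram q : U q -> (frame q)^T *m invmx (G q) *m frame q =
  1%:M + (\row_a X a q)^T *m \row_a X a q.
Proof.
move=> Uq; apply/matrixP => a b; rewrite [RHS]mxDE [X in _ = _ + X]mxME big_ord1 mxTE.
rewrite [1%:M _ _]mxE ![(\row__ _) _ _]mxE -gX// ipgE.
by rewrite mulmx_col_entry !col_frame.
Qed.

Lemma frame_unit q : U q -> frame q \in unitmx.
Proof.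
move=> /frame_gram E; have := posdef_unit (posdef_one_plus (\row_a X a q)).
by rewrite -E unitmx_mul => /andP[].
Qed.

(** The numbers (D^2 X_b - X_b g)(DX_c, DX_d) are symmetric in c and d, and differentiating the
    relation for <dX_b, dX_c> shows that they are skew in b and c. They vanish by the permutation
    argument of the Koszul formula, and the DX_a span. *)
Lemma koszul a q : U q -> hessian G (X a) q = X a q *: G q.
Proof.
move=> Uq; pose H a := hessian G (X a) q - X a q *: G q.
have uG := metric_unit mG Uq.
have sH b : (H b)^T = H b.
  by rewrite /H raddfB /= linearZ /= (hess_sym mG (sX b) Uq) (cm_sym mG Uq).
pose K b c : 'cV[R]_n := H b *m (invmx (G q) *m grad (X c) q).
have HK k b c : K b c k 0 = (row k (hessian G (X b) q) *m invmx (G q) *m grad (X c) q) 0 0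
    - X b q * partial k (X c) q.
  rewrite /K /H mulmxBl mxDE mxNE -scalemxAl mulKVmx// mxZE gradE; congr (_ - _).
  by rewrite -mulmxA !mxME; apply: eq_bigr => j _; rewrite [row _ _ _ _]mxE.
have anti k b c : K b c k 0 = - K c b k 0.
  have := partial_ipg mG k (sX b) (sX c) Uq.
  rewrite (partial_ext (h := fun p => (b == c)%:R + X b p * X c p) k oU _ Uq); last first.
    by move=> p; exact: gX.
  rewrite (partialD k (@smooth_cst _ _ U (b == c)%:R) (smoothM oU (sX b) (sX c)) Uq).
  rewrite partial_cst add0r (partialM k (sX b) (sX c) Uq).
  have -> : ((grad (X b) q)^T *m invmx (G q) *m (row k (hessian G (X c) q))^T) 0 0 =
      (row k (hessian G (X c) q) *m invmx (G q) *m grad (X b) q) 0 0.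
    by rewrite -[LHS]mxTE !trmx_mul !trmxK (Gi_sym mG Uq) mulmxA.
  by rewrite !HK => E; apply: sub_eq_neg; rewrite -E addrC; congr (_ + _); exact: mulrC.
pose T b c d := ((grad (X d) q)^T *m invmx (G q) *m K b c) 0 0.
have T0 b c d : T b c d = 0.
  apply: (koszul_zero (T := T)) => {}b {}c {}d.
    rewrite /T -[LHS]mxTE /K !trmx_mul !trmxK sH (Gi_sym mG Uq) !mulmxA.
    by rewrite -!mulmxA.
  rewrite /T !mxME -sumrN; apply: eq_bigr => k _.
  by rewrite anti mulrN.
suff : H a = 0 by move=> /eqP; rewrite subr_eq0 => /eqP.
pose B := (frame q)^T *m invmx (G q).
have uB : B \in unitmx by rewrite unitmx_mul unitmx_tr frame_unit// unitmx_inv.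
have uC : invmx (G q) *m frame q \in unitmx by rewrite unitmx_mul unitmx_inv uG frame_unit.
have E : B *m H a *m (invmx (G q) *m frame q) = 0.
  apply/matrixP => d c; rewrite [RHS]mxE -(T0 a c d) /T /K.
  rewrite -(col_frame d) -(col_frame c) /B -!mulmxA (mulmxA (invmx _) (H a)).
  have -> : (col d (frame q))^T *m (invmx (G q) *m (H a *m (invmx (G q) *m col c (frame q)))) =
     (col d (frame q))^T *m (invmx (G q) *m H a *m invmx (G q)) *m col c (frame q).
    by rewrite -!mulmxA.
  by rewrite -mulmx_col_entry -!mulmxA.
by rewrite -[H a](mulKmx uB) -[B *m H a](mulmxK uC) E mul0mx mulmx0.
Qed.

End Koszul.

Section FrameData.
Context {R : realType} {n : nat}.

Lemma sub_const_eq (a b a' b' d : R) : a - b = a' - b' -> a' = d + b' -> a = d + b.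
Proof. lra. Qed.

Lemma ipg_ext (G : 'rV[R]_n -> 'M[R]_n) V f f' h h' q : open V -> V q ->
  (forall p, V p -> f p = f' p) -> (forall p, V p -> h p = h' p) ->
  ipg G f h q = ipg G f' h' q.
Proof.
move=> oV Vq ff hh; apply: eq_bigr => i _; apply: eq_bigr => j _.
by rewrite (partial_ext i oV ff Vq) (partial_ext j oV hh Vq).
Qed.

Lemma quad_scale (A : 'M[R]_n) (w : 'cV[R]_n) k :
  ((k *: w)^T *m A *m (k *: w)) 0 0 = k ^+ 2 * (w^T *m A *m w) 0 0.
Proof. by rewrite -scalemxAr mxZE [_^T]linearZ /= -!scalemxAl mxZE mulrA -expr2. Qed.

(* The square root of [1 + b b^T] is [1 + (v + 1)^-1 b b^T] when [v^2 = 1 + |b|^2]. *)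
Lemma sqrt_rank_one (b : 'cV[R]_n) (v : R) : 0 < v + 1 -> v ^+ 2 = 1 + (b^T *m b) 0 0 ->
  let S := 1%:M + (v + 1)^-1 *: (b *m b^T) in
  S^T *m S = 1%:M + b *m b^T /\ S^T *m b = v *: b.
Proof.
move=> v1 vb S; have bb : b^T *m b = (v ^+ 2 - 1)%:M.
  by apply/matrixP => i j; rewrite !ord1 vb addrC addKr [RHS]mxE eqxx.
have SE : S^T = S.
  by rewrite /S raddfD /= trmx1 linearZ /= trmx_mul trmxK.
have Sb : S *m b = v *: b.
  rewrite /S mulmxDl mul1mx -scalemxAl -mulmxA bb mul_mx_scalar scalerA -{1}[b]scale1r -scalerDl.
  congr (_ *: _); field; by rewrite gt_eqF.
rewrite SE; split=> //; rewrite {2}/S mulmxDr mulmx1 -scalemxAr mulmxA Sb -scalemxAl scalerA.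
rewrite {1}/S -addrA -scalerDl; congr (_ + _).
rewrite (_ : (v + 1)^-1 + _ = 1) ?scale1r//; field; by rewrite gt_eqF.
Qed.

(** Initial data for a local isometry at one point: [A] is the inverse metric, w = du / c, v = u /
    c; [x] holds the values of the coordinates and the columns of [D] their differentials. In an
    orthonormal coframe one may take [D] to be the square root of 1 + x^T x. *)
Lemma frame_data (A : 'M[R]_n) (w : 'cV[R]_n) (v : R) : A^T = A -> posdef A -> 0 < v ->
  (w^T *m A *m w) 0 0 = v ^+ 2 - 1 ->
  exists x : 'rV[R]_n, exists D : 'M[R]_n,
    D^T *m A *m D = 1%:M + x^T *m x /\ D^T *m A *m w = v *: x^T.
Proof.
move=> sA pA v0 wv; have [E EA] := posdef_diagonalize sA pA.
have uE : E \in unitmx.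
  have := unitmx1 R n; rewrite -EA !unitmx_mul => /andP[/andP[]] //.
have EE : A *m (E^T *m E) = 1%:M.
  by rewrite mulmxA; apply: mulmx1C; rewrite mulmxA.
pose b := E *m (A *m w).
have bb : v ^+ 2 = 1 + (b^T *m b) 0 0.
  rewrite /b !trmx_mul sA -!mulmxA (mulmxA E^T) (mulmxA A (E^T *m E)) EE mul1mx.
  by rewrite mulmxA wv addrC subrK.
have v1 : 0 < v + 1 by rewrite ltr_wpDl// ltW.
have [S1 S2] := sqrt_rank_one v1 bb; set S := 1%:M + _ in S1 S2.
have ET : (E^T *m S)^T = S^T *m E by rewrite trmx_mul trmxK.
exists b^T, (E^T *m S); rewrite trmxK ET; split.
  by rewrite -S1 -!mulmxA (mulmxA A) (mulmxA E) (mulmxA E A) EA mul1mx.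
by rewrite -S2 -!mulmxA.
Qed.

(* Here D is invertible, so the first two relations determine [w^T A w]. *)
Lemma frame_norm (A D : 'M[R]_n) (w : 'cV[R]_n) (x : 'rV[R]_n) (v c : R) : v != 0 ->
  D^T *m A *m D = 1%:M + x^T *m x -> D^T *m A *m w = v *: x^T ->
  A^T = A ->
  (w^T *m A *m w) 0 0 = v ^+ 2 - c ^+ 2 -> v ^+ 2 = c ^+ 2 * (1 + (x *m x^T) 0 0).
Proof.
move=> v0 DD Dw sA ww; set s := (x *m x^T) 0 0.
have xx : x *m x^T = s%:M by apply/matrixP => i j; rewrite !ord1 [RHS]mxE eqxx.
have s0 : 0 <= s by rewrite /s mxME sumr_ge0// => i _; rewrite mxTE -expr2 sqr_ge0.
have s1 : 1 + s != 0 by rewrite gt_eqF// ltr_pwDl.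
have : D^T *m A *m D \in unitmx by rewrite DD; exact/posdef_unit/posdef_one_plus.
rewrite unitmx_mul => /andP[uB _].
have wE : w = (v / (1 + s)) *: (D *m x^T).
  apply: (can_inj (mulKmx uB)); rewrite Dw -scalemxAr mulmxA DD mulmxDl mul1mx -mulmxA xx.
  rewrite mul_mx_scalar -{2}[x^T]scale1r -scalerDl scalerA.
  by rewrite mulfVK.
have : (w^T *m A *m w) 0 0 = v ^+ 2 * s / (1 + s).
  rewrite wE -scalemxAr -{1}wE mxZE.
  have -> : w^T *m A *m (D *m x^T) = (x *m (D^T *m A *m w))^T.
    by rewrite !trmx_mul !trmxK sA !mulmxA.
  rewrite Dw -scalemxAr mxTE mxZE -/s; field; exact: s1.
rewrite ww => E; have {}E : (v ^+ 2 - c ^+ 2) * (1 + s) = v ^+ 2 * s by rewrite E mulfVK.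
by move: E; clear; lra.
Qed.

End FrameData.

Section Sections.
Context {R : realType} {n : nat}.
Variables (M : manifold R n) (g : riemannian_metric M) (u : M -> R) (c : R).
Hypothesis su : smooth_fun u.
Hypothesis u_gt0 : forall x, 0 < u x.
Hypothesis c_gt0 : 0 < c.
Hypothesis hess_u : forall i q, cimg i q ->
  hessian (g i) (u \o param i) q = (u \o param i) q *: g i q.
Hypothesis grad_u : forall i x, dom i x -> ipc g i u u x = u x ^+ 2 - c ^+ 2.
Implicit Types (i j : atlas_index M) (x y : M) (Phi : M -> 'rV[R]_n).

Definition coordf Phi a x : R := Phi x 0 a.

(* The hyperbolic metric of R^n has inverse matrix 1 + x^T x, so the first relation says
   that Phi is isometric; with |Du|^2 = u^2 - c^2 the second one forces
   u = c sqrt (1 + |Phi|^2), see [frame_norm]. *)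
Definition iso_at Phi x := (forall a, smooth_at (coordf Phi a) x) /\
  forall i, dom i x ->
    (forall a b, ipc g i (coordf Phi a) (coordf Phi b) x = (a == b)%:R + coordf Phi a x * coordf Phi b x) /\
    (forall a, ipc g i (coordf Phi a) u x = coordf Phi a x * u x).

Definition chart_section i (V : set 'rV[R]_n) (X : 'I_n -> 'rV[R]_n -> R) :=
  (forall a, smooth_on V (X a)) /\ forall q, V q ->
    (forall a b, ipg (g i) (X a) (X b) q = (a == b)%:R + X a q * X b q) /\
    (forall a, ipg (g i) (X a) (u \o param i) q = X a q * u (param i q)).

Lemma section_chart Phi x i : (\forall y \near x, iso_at Phi y) -> dom i x ->
  exists V, [/\ open V, V (chart i x), V `<=` cimg i &
    chart_section i V (fun a => coordf Phi a \o param i)].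
Proof.
move=> H dx.
have [V [oV Vx HV]] := near_ex_open (near_and (near_param dx H)
  (near_open (@open_cimg _ _ _ i) (cimg_chart dx) (fun _ h => h))).
exists V; split=> // [q /HV[]//|]; split.
  move=> a; apply: smooth_pointwise => q Vq; have [[sP _] Iq] := HV q Vq.
  have [W [oW Wq] sW] := sP a i (dom_param Iq).
  by exists W => //; move: Wq; rewrite paramK.
move=> q Vq; have [[_ gP] Iq] := HV q Vq; have := gP i (dom_param Iq).
by rewrite /ipc paramK//.
Qed.

Lemma chart_section_iso Phi i V y : open V -> V `<=` cimg i ->
  chart_section i V (fun a => coordf Phi a \o param i) -> dom i y -> V (chart i y) -> iso_at Phi y.
Proof.
move=> oV VI [sX gX] dy Vy.
have sP a : smooth_at (coordf Phi a) y by exact: smooth_atP dy oV Vy (sX a).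
have sU : smooth_at u y by exact: smooth_fun_at.
split=> // j dj; have [g1 g2] := gX _ Vy; split=> [a b|a].
  rewrite (ipc_invariant g dj dy (sP a) (sP b)) /ipc g1 /=.
  by rewrite (chartK dy).
rewrite (ipc_invariant g dj dy (sP a) sU) /ipc g2 /=.
by rewrite (chartK dy).
Qed.

Lemma chart_section_solution i V X a : open V -> V `<=` cimg i -> chart_section i V X ->
  solution (g i) V (X a).
Proof.
move=> oV VI [sX gX]; have mV := chart_metric_sub (chart_metricP g i) oV VI.
split=> // q Vq; apply: (koszul mV sX _ a Vq) => {}a b p Vp.
by have [+ _] := gX p Vp; apply.
Qed.

(** Each coordinate solves D^2 X = X g, so the curvature annihilates its differential, and these
    differentials form an invertible matrix. *)
Lemma section_flat Phi x i : (\forall y \near x, iso_at Phi y) -> dom i x ->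
  \forall q \near chart i x, forall j k : 'I_n, conn_curv (ext_conn (g i)) j k q = 0.
Proof.
move=> H dx; have [V [oV Vx VI CS]] := section_chart H dx.
have mV := chart_metric_sub (chart_metricP g i) oV VI.
apply: (near_open oV Vx) => q Vq j k; rewrite (conn_curv_ext mV j k Vq).
set X := fun a => _ in CS.
have Xg a b p : V p -> ipg (g i) (X a) (X b) p = (a == b)%:R + X a p * X b p.
  by move=> Vp; have [+ _] := CS.2 p Vp; apply.
suff -> : hyp_curv (g i) j k q = 0 by rewrite block_mx0.
have uF := frame_unit Xg Vq.
suff E : hyp_curv (g i) j k q *m frame X q = 0 by rewrite -[LHS](mulmxK uF) E mul0mx.
apply/matrixP => a b; rewrite [RHS]mxE.
have [sX hX] := chart_section_solution b oV VI CS.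
have := ext_curv_section mV j k sX hX Vq.
rewrite -col_frame -colM => /matrixP /(_ a 0).
by rewrite mxE => ->; rewrite mxE.
Qed.

Lemma u_solution i V : open V -> V `<=` cimg i -> solution (g i) V (u \o param i).
Proof.
move=> oV VI; split; first exact: smooth_sub VI (su i).
by move=> q /VI; exact: hess_u.
Qed.

Lemma grad_u_chart i q : cimg i q ->
  ipg (g i) (u \o param i) (u \o param i) q = (u \o param i) q ^+ 2 - c ^+ 2.
Proof. by move=> Iq; have := grad_u (dom_param Iq); rewrite /ipc paramK. Qed.

(** Since <df, dh> - f h is constant for solutions, and u is itself a solution, the relations
    propagate from the single point [z]. *)
Lemma chart_section_of_solutions i (y : 'rV[R]_n) r z X : ball y r `<=` cimg i -> ball y r z ->
  (forall a, solution (g i) (ball y r) (X a)) ->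
  (forall a b, ipg (g i) (X a) (X b) z = (a == b)%:R + X a z * X b z) ->
  (forall a, ipg (g i) (X a) (u \o param i) z = X a z * u (param i z)) ->
  chart_section i (ball y r) X.
Proof.
move=> BI Bz sX g1 g2; have oB : open (ball y r) by exact: ball_open.
split=> [a|q Bq]; first by have [] := sX a.
split=> [a b|a].
  apply: sub_const_eq (g1 a b).
  exact: (solution_gram_const (chart_metricP g i) BI (sX a) (sX b) Bz Bq).
rewrite -[RHS]add0r; apply: (@sub_const_eq R _ _ _ (X a z * u (param i z))); last by rewrite add0r.
exact: (solution_gram_const (chart_metricP g i) BI (sX a) (u_solution oB BI) Bz Bq).
Qed.

Lemma section_exists x i : dom i x ->
  (\forall q \near chart i x, forall j k : 'I_n, conn_curv (ext_conn (g i)) j k q = 0) ->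
  exists Phi, \forall y \near x, iso_at Phi y.
Proof.
move=> dx F0; have mI := chart_metricP g i; have Ix := cimg_chart dx.
have [r r0 [BI H]] := solution_nbhd mI Ix F0.
set y := chart i x in Ix F0 BI H.
have By : ball y r y by exact: ballxx.
pose A := invmx (g i y); have sA : A^T = A by exact: (Gi_sym mI Ix).
have pA : posdef A by exact: posdef_inv (cm_sym mI Ix) (cm_pos mI Ix).
pose v := u x / c; have v0 : 0 < v by rewrite divr_gt0.
pose w := grad (u \o param i) y.
have ux : (u \o param i) y = u x by rewrite /= /y chartK.
have wv : ((c^-1 *: w)^T *m A *m (c^-1 *: w)) 0 0 = v ^+ 2 - 1.
  rewrite quad_scale -ipgE (grad_u_chart Ix) ux /v.
  field; by rewrite gt_eqF.
have [X0 [D [DD Dw]]] := frame_data sA pA v0 wv.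
have [X XP] := choice (fun a => H y (X0 0 a) (col a D) By).
have CS : chart_section i (ball y r) X.
  apply: (chart_section_of_solutions BI By) => [a|a b|a]; first by have [] := XP a.
    have [_ Xa ga] := XP a; have [_ Xb gb] := XP b.
    rewrite ipgE ga gb -mulmx_col_entry DD Xa Xb mxDE mxME big_ord1 mxTE.
    by rewrite [1%:M _ _]mxE.
  have [_ Xa ga] := XP a; rewrite ipgE ga Xa -/w -[u _]/((u \o param i) y) ux.
  have -> : ((col a D)^T *m invmx (g i y) *m w) 0 0 = (D^T *m A *m w) a 0.
    by rewrite tr_col -!row_mul mxE.
  have -> : w = c *: (c^-1 *: w) by rewrite scalerA mulfV ?scale1r// gt_eqF.
  rewrite -scalemxAr Dw !mxZE mxTE /v; field; by rewrite gt_eqF.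
pose Phi z : 'rV[R]_n := \row_a X a (chart i z).
have oB : open (ball y r) by exact: ball_open.
have PX a q : ball y r q -> (coordf Phi a \o param i) q = X a q.
  by move=> Bq; rewrite /coordf /= mxE paramK//; exact: BI.
exists Phi; apply: (near_chart dx); apply: (near_open oB By) => q Bq.
apply: (@chart_section_iso Phi i (ball y r)) => //; last first.
- by rewrite paramK//; exact: BI.
- exact/dom_param/BI.
split=> [a|p Bp]; first by apply: smooth_ext oB _ (CS.1 a) => p Bp; rewrite PX.
have [g1 g2] := CS.2 p Bp; split=> [a b|a].
  by rewrite (ipg_ext (g i) oB Bp (PX a) (PX b)) !PX// g1.
by rewrite (ipg_ext (g i) (f' := X a) (h' := u \o param i) oB Bp (PX a) _)// PX// g2.
Qed.

(** Among the points without a section a lowest one [y] exists by compactness of sublevel sets.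
    Strictly below its level sections exist, so the curvature vanishes there; it then vanishes
    around [y], where a section exists after all. *)
Lemma section_everywhere : (forall s, compact [set x | u x <= s]) ->
  forall x, exists Phi, \forall y \near x, iso_at Phi y.
Proof.
move=> cpt; pose Fl x := exists Phi, \forall y \near x, iso_at Phi y.
have oFl : open [set x | Fl x].
  rewrite openE => x [Phi] H; have [V [oV Vx HV]] := near_ex_open H.
  apply: (near_open oV Vx) => z Vz; exists Phi; exact: near_open oV Vz HV.
move=> x0; apply: contrapT => nF.
have K : compact ([set x | u x <= u x0] `&` ~` [set x | Fl x]).
  by apply: compact_closedI; [exact: cpt|exact: open_closedC].
have [y [yu yF] ymin] := compact_attains_min (ex_intro _ x0 (conj (lexx _) nF)) K
  (fun q _ => @smooth_fun_continuous _ _ _ u su q).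
apply: yF; have dy := dom_chart_at y; set i := chart_at y in dy.
apply: (section_exists dy).
have mI := chart_metricP g i.
apply: (flat_extend mI (su i) _ (@hess_u i) (cimg_chart dy)); first by move=> q _; exact: u_gt0.
move=> q Iq /= uq j k.
have [Phi HP] : Fl (param i q).
  apply: contrapT => nq; have := ymin (param i q) (conj _ nq).
  rewrite (chartK dy) in uq; rewrite leNgt uq => /(_ (ltW (lt_le_trans uq yu))).
  by [].
have := section_flat HP (dom_param Iq) => /nbhs_singleton /(_ j k).
by rewrite paramK.
Qed.

End Sections.

Lemma sqr_lt_succ (R : realType) n (d : R) : 0 < d -> n%:R * d ^+ 2 < ((n%:R + 1) * d) ^+ 2.
Proof.
move=> d0; rewrite exprMn ltr_pM2r ?exprn_gt0//; have := ler0n R n.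
by move: (n%:R : R) => x; nra.
Qed.

Lemma absorb_bound (R : realType) (k a b x : R) : 0 <= b -> k * x <= a / 2 ->
  a <= k * (b + x) -> a <= (2 * k + 1) * b.
Proof.
rewrite mulrDr mulrDl mul1r -mulrA; move: (k * x) (k * b) => y z; lra.
Qed.

Lemma dist_bound (R : realType) (a b e m d : R) : a <= b + e -> b < d -> d * (m + 2) <= a ->
  (m + 1) * d <= e.
Proof. lra. Qed.

(** * The inverse function theorem *)

Section InverseFunction.
Context {R : realType} {n : nat}.
Variables (V : set 'rV[R]_n) (X : 'I_n -> 'rV[R]_n -> R).
Hypothesis oV : open V.
Hypothesis sX : forall a, smooth_on V (X a).
Hypothesis uX : forall q, V q -> frame X q \in unitmx.
Implicit Types (p q y w : 'rV[R]_n).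

Definition rowf q : 'rV[R]_n := \row_a X a q.

Lemma smx_frame : smx V (frame X).
Proof. by move=> i a; apply: smooth_ext oV _ (smooth_partial i (sX a)) => q _; rewrite mxE. Qed.

Lemma linear_estimate y e : V y -> 0 < e -> exists2 r, 0 < r & ball y r `<=` V /\
  forall p q, ball y r p -> ball y r q ->
  `|rowf q - rowf p - (q - p) *m frame X y| <= n%:R * `|q - p| * e.
Proof.
move=> Vy e0.
have H : \forall q \near y, forall x : 'I_n * 'I_n, `|partial x.1 (X x.2) q - frame X y x.1 x.2| <= e.
  apply: near_forall => -[i a] /=.
  have := (continuous_atP _ _).1 (smooth_continuous (smooth_partial i (sX a)) Vy) _ e0.
  by move=> H; apply: near_imp H _ => q; rewrite distrC mxE.
have [r r0 Hr] := near_in_ball (near_and (near_open oV Vy (fun _ h => h)) H).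
exists r => //; split=> [q /Hr[]//|p q Bp Bq].
have oB : open (ball y r) by exact: ball_open.
have BV : ball y r `<=` V by move=> q' /Hr[].
apply: norm_le_coord => [|i a]; first by rewrite !mulr_ge0// ltW.
pose f x := X a x - \sum_i x 0 i * frame X y i a.
have s1 : smooth_on (ball y r) (X a) by exact: smooth_sub BV (sX a).
have s3 k : smooth_on (ball y r) (fun x : 'rV[R]_n => x 0 k * frame X y k a).
  by apply: smoothM => //; [exact: smooth_coord|exact: smooth_cst].
have s2 : smooth_on (ball y r) (fun x : 'rV[R]_n => \sum_i x 0 i * frame X y i a).
  by apply: smooth_sum => // k.
have sf : smooth_on (ball y r) f by exact: smoothB.
have -> : (rowf q - rowf p - (q - p) *m frame X y) i a = f q - f p.
  rewrite /f !(mxDE, mxNE) !mxE.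
  have -> : \sum_j (q - p) i j * frame X y j a =
      \sum_j q 0 j * frame X y j a - \sum_j p 0 j * frame X y j a.
    by rewrite -sumrB; apply: eq_bigr => k _; rewrite (ord1 i) mxDE mxNE mulrBl.
  by move: (X a q) (X a p) (\sum_j _) (\sum_j _) => x1 x2 x3 x4; ring.
apply: (@lipschitz_ball _ n f y r e p q (ltW e0) (sf 1%N)) => // k x Bx.
rewrite (partialB k oB s1 s2 Bx) (partial_sum (F := fun i (x : 'rV[R]_n) => x 0 i * frame X y i a) _ _ _ oB s3 Bx).
rewrite (bigD1 k)//= big1 ?addr0 => [|j jk].
  rewrite (partialM k (@smooth_coord _ _ _ k) (@smooth_cst _ _ _ (frame X y k a)) Bx).
  rewrite partial_coord eqxx mul1r partial_cst mulr0 addr0.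
  by have [_ /(_ (k, a))] := Hr x Bx.
rewrite (partialM k (@smooth_coord _ _ _ j) (@smooth_cst _ _ _ (frame X y j a)) Bx).
by rewrite partial_coord partial_cst eq_sym (negbTE jk) mul0r mulr0 addr0.
Qed.

Lemma inverse_lipschitz y : V y -> exists L r, [/\ 0 < L, 0 < r, ball y r `<=` V &
  forall p q, ball y r p -> ball y r q -> `|q - p| <= L * `|rowf q - rowf p|].
Proof.
move=> Vy; pose k := n%:R * `|invmx (frame X y)| : R.
have k0 : 0 <= k by rewrite mulr_ge0.
(* With this tolerance the nonlinear error, multiplied by the inverse of the frame, is at most half
   of |q - p| and can be absorbed. *)
pose e := (2 * (k * n%:R + 1))^-1.
have d0 : 0 < 2 * (k * n%:R + 1) by rewrite mulr_gt0// ltr_wpDl// mulr_ge0.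
have e0 : 0 < e by rewrite invr_gt0.
have [r r0 [BV H]] := linear_estimate Vy e0.
exists (2 * k + 1), r; split=> //; first by rewrite ltr_wpDl// mulr_ge0.
move=> p q Bp Bq.
have E : q - p = ((rowf q - rowf p) - (rowf q - rowf p - (q - p) *m frame X y)) *m invmx (frame X y).
  by rewrite opprB addrCA subrr addr0 mulmxK// uX.
have : `|q - p| <= k * (`|rowf q - rowf p| + n%:R * `|q - p| * e).
  rewrite {1}E; apply: le_trans (mulmx_norm_le _ _) _.
  rewrite mulrAC /k ler_wpM2l ?mulr_ge0//.
  by apply: le_trans (ler_normB _ _) _; rewrite lerD2l; exact: H.
have h1 : k * (n%:R * `|q - p| * e) <= `|q - p| / 2.
  have -> : k * (n%:R * `|q - p| * e) = k * n%:R * e * `|q - p|.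
    by move: (n%:R : R) => x; ring.
  rewrite mulrC ler_wpM2l//.
  rewrite /e ler_pdivrMr// mulrA mulVf ?pnatr_eq0// mul1r lerDl.
  exact: ler01.
by apply: absorb_bound h1.
Qed.

(** The squared distance |X(q) - w|^2 has a minimum over a closed cube. Its boundary values are too
    large, so the minimum is interior; there the frame annihilates X(q) - w, which is therefore
    0. *)
Lemma inverse_function y : V y -> exists L r d, [/\ 0 < r, 0 < d, ball y r `<=` V,
  forall p q, ball y r p -> ball y r q -> `|q - p| <= L * `|rowf q - rowf p| &
  forall w, `|w - rowf y| < d -> exists2 q, ball y r q & rowf q = w].
Proof.
move=> Vy; have [L [r [L0 r0 BV H]]] := inverse_lipschitz Vy.
pose rho := r / 2; have rho0 : 0 < rho by rewrite divr_gt0.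
have rr : rho < r by rewrite ltr_pdivrMr// ltr_pMr// ltr1n.
(* On the boundary |X(q) - X(y)| >= rho / L = (n + 2) d, hence |X(q) - w| >= (n + 1) d in the sup
   norm, while the squared Euclidean distance from X(y) to w is at most n d^2. *)
pose d := rho / L / (n%:R + 2).
have n2 : 0 < n%:R + 2 :> R by rewrite ltr_wpDl.
have d0 : 0 < d by rewrite !divr_gt0.
exists L, r, d; split=> // w wd.
pose K := [set q | `|y - q| <= rho].
have KB q : K q -> ball y r q by rewrite in_ballE /K /= => /le_lt_trans; apply.
have By : ball y r y by exact: ballxx.
pose f q := \sum_a (X a q - w 0 a) ^+ 2.
have fE q : f q = sqd w (rowf q) by apply: eq_bigr => a _; rewrite mxE.
have sXw a : smooth_on V (fun q => X a q - w 0 a) by apply: smoothB => //; exact: smooth_cst.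
have sf : smooth_on V f by apply: smooth_sum => // a; exact: smoothX.
have [q0 Kq0 M] : exists2 q0, K q0 & forall q, K q -> f q0 <= f q.
  apply: compact_attains_min; [|exact: compact_cball|].
    by exists y; rewrite /K /= subrr normr0 ltW.
  by move=> q /KB /BV; exact: smooth_continuous sf.
have Bq0 := KB _ Kq0.
have int : `|y - q0| < rho.
  rewrite lt_neqAle Kq0 andbT; apply/eqP => E.
  have := M y; rewrite /K /= subrr normr0 => /(_ (ltW rho0)); apply/negP; rewrite -ltNge !fE.
  have a1 : rho <= L * `|rowf y - rowf q0| by rewrite -E; exact: H.
  have a2 : `|rowf y - rowf q0| <= `|w - rowf y| + `|rowf q0 - w|.
    have -> : rowf y - rowf q0 = - (w - rowf y) - (rowf q0 - w).
      by move: (rowf y) (rowf q0) => x1 x2; apply/matrixP => s t; rewrite !(mxDE, mxNE); ring.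
    by apply: le_trans (ler_normB _ _) _; rewrite normrN.
  apply: (@le_lt_trans _ _ (n%:R * d ^+ 2)).
    apply: le_trans (sqd_le_norm _ _) _; rewrite ler_wpM2l//.
    by rewrite lerXn2r ?nnegrE ?(ltW d0)// distrC ltW.
  apply: (@lt_le_trans _ _ (((n%:R + 1) * d) ^+ 2)).
    by apply: sqr_lt_succ.
  apply: le_trans (sqd_ge_norm _ _); rewrite lerXn2r ?nnegrE//.
    by rewrite mulr_ge0// ?addr_ge0// ltW.
  have : rho / L <= `|rowf y - rowf q0| by rewrite ler_pdivrMr// mulrC.
  have -> : rho / L = d * (n%:R + 2) by rewrite /d mulfVK// gt_eqF.
  exact: dist_bound a2 wd.
exists q0 => //.
have Vq0 := BV _ Bq0.
have near0 : \forall q' \near q0, f q0 <= f q'.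
  by apply: (@near_of_ball _ _ _ y q0 rho) => [|q']; rewrite in_ballE// => /ltW; exact: M.
have grad0 i : \sum_a frame X q0 i a * (X a q0 - w 0 a) = 0.
  have := local_min_grad (delta_mx 0 i) oV sf Vq0 near0.
  rewrite (bigD1 i)//= mxE !eqxx mul1r big1 ?addr0 => [|k ki]; last first.
    by rewrite mxE (negbTE ki) andbF mul0r.
  rewrite (partial_sum (F := fun a q => (X a q - w 0 a) ^+ 2) _ _ _ oV _ Vq0); last first.
    by move=> a; exact: smoothX.
  move=> E; apply: (@mulfI _ (2 : R)); first by rewrite pnatr_eq0.
  rewrite mulr0 -[RHS]E mulr_sumr; apply: eq_bigr => a _.
  have -> : partial i (fun q => (X a q - w 0 a) ^+ 2) q0 =
      partial i (fun q => (X a q - w 0 a) * (X a q - w 0 a)) q0 by [].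
  rewrite (partialM i (sXw a) (sXw a) Vq0) (partialB i oV (sX a) (@smooth_cst _ _ V (w 0 a)) Vq0).
  rewrite partial_cst subr0 mxE.
  by move: (partial _ _ _) (X a q0) => x1 x2; ring.
have : frame X q0 *m (rowf q0 - w)^T = 0.
  apply/matrixP => i j; rewrite [RHS]mxE -(grad0 i) mxME; apply: eq_bigr => a _.
  by rewrite ord1 mxTE mxDE mxNE [rowf _ _ _]mxE.
move=> /(congr1 (mulmx (invmx (frame X q0)))); rewrite mulKmx ?uX// mulmx0.
by move=> /(congr1 trmx); rewrite trmxK trmx0 => /eqP; rewrite subr_eq0 => /eqP.
Qed.

End InverseFunction.

(** [D0] and [D1] are the frames of two sections at a point, [x0] and [x1] their values there; the
    terms x^T x of the two Gram relations match and leave Q^T Q = 1. *)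
Lemma rotation_alg (R : comNzRingType) n (A D0 D1 Q : 'M[R]_n) (x0 x1 : 'rV[R]_n) :
  D0^T *m A *m D0 = 1%:M + x0^T *m x0 -> D1^T *m A *m D1 = 1%:M + x1^T *m x1 ->
  D1 = D0 *m Q -> x1 = x0 *m Q -> Q^T *m Q = 1%:M.
Proof.
move=> G0 G1 E xQ; move: G1; rewrite E xQ !trmx_mul.
have -> : Q^T *m D0^T *m A *m (D0 *m Q) = Q^T *m (D0^T *m A *m D0) *m Q by rewrite !mulmxA.
rewrite G0 mulmxDr mulmx1 mulmxDl.
have -> : Q^T *m (x0^T *m x0) *m Q = Q^T *m x0^T *m (x0 *m Q) by rewrite !mulmxA.
exact: addIr.
Qed.

(** * Local inverses and the developing map *)

Section LinearCombinations.
Context {R : realType} {n : nat}.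
Variables (V : set 'rV[R]_n) (G : 'rV[R]_n -> 'M[R]_n).
Hypothesis mG : chart_metric V G.
Implicit Types (q : 'rV[R]_n).
Let oV : open V := cm_open mG.

Lemma grad_comb (X : 'I_n -> 'rV[R]_n -> R) (c : 'I_n -> R) q :
  (forall b, smooth_on V (X b)) -> V q ->
  grad (fun p => \sum_b X b p * c b) q = frame X q *m \col_b c b.
Proof.
move=> sX Vq; apply/matrixP => i j; rewrite gradE mxME.
rewrite (partial_sum (F := fun b p => X b p * c b) _ _ _ oV _ Vq); last first.
  by move=> b; apply: smoothM => //; exact: smooth_cst.
apply: eq_bigr => b _; rewrite (partialM i (sX b) (@smooth_cst _ _ V (c b)) Vq) partial_cst mulr0 addr0.
by rewrite !mxE.
Qed.

Lemma gradB f h q : smooth_on V f -> smooth_on V h -> V q ->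
  grad (fun p => f p - h p) q = grad f q - grad h q.
Proof.
move=> sf sh Vq; apply/matrixP => i j; rewrite mxDE mxNE !gradE.
exact: partialB oV sf sh Vq.
Qed.

Lemma solutionB f h : solution G V f -> solution G V h -> solution G V (fun p => f p - h p).
Proof.
move=> [sf hf] [sh hh]; split=> [|q Vq]; first exact: smoothB.
apply/row_matrixP => i; apply: trmx_inj; rewrite hess_row (gradB sf sh Vq).
rewrite (dmx_ext (B := fun p => grad f p - grad h p) i oV _ Vq); last first.
  by move=> p Vp; exact: gradB.
rewrite (dmxB i oV (smx_grad mG sf) (smx_grad mG sh) Vq) mulmxBr opprB addrACA.
have e1 := hess_row G f i q; have e2 := hess_row G h i q.
rewrite hf// in e1; rewrite hh// in e2.
rewrite scalerBl linearB /= linearB /= e1 e2 opprB.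
by move: (dmx _ _ _) (dmx _ _ _) (_ *m _) (_ *m _) => a b x y; apply/matrixP => s t; rewrite !(mxDE, mxNE); ring.
Qed.

Lemma solution_comb (X : 'I_n -> 'rV[R]_n -> R) (c : 'I_n -> R) :
  (forall b, solution G V (X b)) -> solution G V (fun p => \sum_b X b p * c b).
Proof.
move=> H; have sX b : smooth_on V (X b) by have [] := H b.
have sM b : smooth_on V (fun p => X b p * c b) by apply: smoothM => //; exact: smooth_cst.
split=> [|q Vq]; first by apply: smooth_sum.
have sF := smx_frame oV sX.
apply/row_matrixP => i; apply: trmx_inj; rewrite hess_row (grad_comb c sX Vq).
rewrite (dmx_ext (B := fun p => frame X p *m \col_b c b) i oV _ Vq); last first.
  by move=> p Vp; exact: grad_comb.
rewrite (dmxM i oV sF (@smx_cst _ _ _ _ _ (\col_b c b)) Vq) dmx_cst mulmx0 addr0 mulmxA -mulmxBl.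
apply/matrixP => a j; rewrite ord1 mxME mxTE [row _ _ _ _]mxE mxZE mulr_suml.
apply: eq_bigr => b _; rewrite [(\col__ _) _ _]mxE mulrAC; congr (_ * _).
have := hess_row G (X b) i q; have [_ hX] := H b; rewrite hX// => /matrixP /(_ a 0).
rewrite mxTE [row _ _ _ _]mxE mxZE => ->; rewrite !(mxDE, mxNE) !dmxE !mxME; congr (_ - _).
  by congr partial; apply/funext => p; rewrite gradE mxE.
by apply: eq_bigr => k _; rewrite gradE [frame _ _ _ _]mxE.
Qed.

End LinearCombinations.

Section LocalInverses.
Context {R : realType} {n : nat}.
Variables (M : manifold R n) (g : riemannian_metric M) (u : M -> R).
Hypothesis su : smooth_fun u.
Hypothesis u_gt0 : forall x, 0 < u x.
Implicit Types (i : atlas_index M) (x z : M) (Phi : M -> 'rV[R]_n) (Psi : 'rV[R]_n -> M).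
Local Notation iso_at := (iso_at g u).

Lemma section_frame_gram Phi x i : iso_at Phi x -> dom i x ->
  let D := frame (fun a => coordf Phi a \o param i) (chart i x) in
  D^T *m invmx (g i (chart i x)) *m D = 1%:M + (Phi x)^T *m Phi x /\
  D^T *m invmx (g i (chart i x)) *m grad (u \o param i) (chart i x) = u x *: (Phi x)^T.
Proof.
move=> [_ /(_ i) H] dx D; have [g1 g2] := H dx; split.
  have E : \row_a (coordf Phi a \o param i) (chart i x) = Phi x.
    by apply/rowP => a; rewrite mxE /= chartK.
  rewrite -E; apply: (@frame_gram _ _ [set chart i x]) => // a b q -> /=.
  by rewrite (chartK dx); exact: g1.
apply/matrixP => a j; rewrite ord1 mxZE mxTE.
rewrite [RHS]mulrC -[RHS]g2 /ipc ipgE.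
by rewrite -(@col_frame _ _ (fun a => coordf Phi a \o param i) a) tr_col -!row_mul [RHS]mxE.
Qed.

Lemma section_continuous Phi x : iso_at Phi x -> {for x, continuous Phi}.
Proof.
move=> [sP _]; apply: mx_continuous_at => a b; rewrite (ord1 a).
exact: smooth_at_continuous (sP b).
Qed.

Lemma section_inverse Phi y : (\forall x \near y, iso_at Phi x) ->
  exists Psi e O, [/\ 0 < e, open O, O y,
    forall q, ball (Phi y) e q -> [/\ O (Psi q), Phi (Psi q) = q & {for q, continuous Psi}] &
    forall x, O x -> iso_at Phi x /\ (ball (Phi y) e (Phi x) -> Psi (Phi x) = x)].
Proof.
move=> H; have dy := dom_chart_at y; set i := chart_at y in dy.
have [V [oV Vy VI CS]] := section_chart H dy.
set X := fun a => _ in CS.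
have uX q : V q -> frame X q \in unitmx.
  by apply: frame_unit => a b p Vp; have [+ _] := CS.2 p Vp; apply.
have [L [r [d [r0 d0 BV lip surj]]]] := inverse_function oV CS.1 uX Vy.
have rowE q : rowf X q = Phi (param i q) by apply/rowP => a; rewrite mxE.
pose y0 := chart i y.
have psiP q : exists p, ball (Phi y) d q -> ball y0 r p /\ rowf X p = q.
  have [B|nB] := pselect (ball (Phi y) d q); last by exists y0.
  have [|p Bp E] := surj q; last by exists p.
  by move: B; rewrite in_ballE rowE chartK// distrC.
have [psi psiE] := choice psiP.
pose O := [set x | dom i x /\ ball y0 r (chart i x)].
have oO : open O.
  rewrite openE => x [dx Bx]; apply: (near_chart dx).
  have Ix := cimg_chart dx.
  apply: near_imp (near_and (near_open (@open_cimg _ _ _ i) Ix (fun _ h => h))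
    (near_open (@ball_open _ _ y0 r) Bx (fun _ h => h))) _ => q [Iq Bq].
  by split; [exact: dom_param|rewrite paramK].
have BI q : ball y0 r q -> cimg i q by move=> /BV /VI.
exists (param i \o psi), d, O; split=> //.
- by split=> //; exact: ballxx.
- move=> q Bq; have [Bp E] := psiE q Bq; split=> /=.
  + by split; [exact/dom_param/BI|rewrite paramK//; exact: BI].
  + by rewrite -rowE.
  apply: continuous_comp; last exact: param_continuous (BI _ Bp).
  apply/continuous_atP => e e0.
  have L0 : 0 < `|L| + 1 by rewrite ltr_wpDl.
  have e1 : 0 < e / (`|L| + 1) by rewrite divr_gt0.
  apply: near_imp (near_and (near_open (@ball_open _ _ (Phi y) d) Bq (fun _ h => h))
    (near_open (@ball_open _ _ q _) (ballxx q e1) (fun _ h => h))) _ => q' [Bq' qq'].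
  have [Bp' E'] := psiE q' Bq'.
  apply: le_trans (lip _ _ Bp' Bp) _; rewrite E E'.
  move: qq'; rewrite in_ballE => qq'.
  apply: (@le_trans _ _ ((`|L| + 1) * (e / (`|L| + 1)))); last by rewrite mulrCA mulfV ?mulr1// gt_eqF.
  apply: (@le_trans _ _ ((`|L| + 1) * `|q - q'|)).
    by rewrite ler_wpM2r// (le_trans (ler_norm L))// lerDl.
  by rewrite ler_wpM2l ?(ltW L0)// ltW.
- move=> x [dx Bx]; split; first by apply: (chart_section_iso su oV VI CS dx); exact: BV.
  move=> Bq /=; have [Bp E] := psiE _ Bq.
  suff -> : psi (Phi x) = chart i x by exact: chartK.
  apply/eqP; rewrite -subr_eq0 -normr_le0; apply: le_trans (lip _ _ Bx Bp) _.
  by rewrite E rowE chartK// subrr normr0 mulr0.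
Qed.

(** Q is the change of frame at [z]. The relation <dx_a, du> = x_a u forces the values to change by
    Q as well, and then the Gram relation makes Q orthogonal. The components of Phi and of Phi0 Q
    solve the same equation with the same value and differential at [z]. *)
Lemma section_rotation Phi0 Phi z : (\forall x \near z, iso_at Phi0 x) ->
  (\forall x \near z, iso_at Phi x) ->
  exists2 Q : 'M[R]_n, Q^T *m Q = 1%:M & \forall x \near z, Phi x = Phi0 x *m Q.
Proof.
move=> H0 H1; have dz := dom_chart_at z; set i := chart_at z in dz.
have [V0 [oV0 Vz0 VI0 CS0]] := section_chart H0 dz.
have [V1 [oV1 Vz1 VI1 CS1]] := section_chart H1 dz.
have [G0 W0] := section_frame_gram (nbhs_singleton H0) dz.
have [G1 W1] := section_frame_gram (nbhs_singleton H1) dz.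
set X0 := fun a => _ in CS0 G0 W0; set X1 := fun a => _ in CS1 G1 W1.
pose y := chart i z; rewrite -/y in G0 W0 G1 W1 Vz0 Vz1.
have uX0 : frame X0 y \in unitmx.
  by apply: (frame_unit (U := V0) (G := g i)) => // a b p Vp; have [+ _] := CS0.2 p Vp; apply.
pose Q := invmx (frame X0 y) *m frame X1 y.
have E1 : frame X1 y = frame X0 y *m Q by rewrite mulKVmx.
have xQ : Phi z = Phi0 z *m Q.
  apply: trmx_inj; rewrite trmx_mul; apply: (@scalerI _ _ (u z)); first by rewrite gt_eqF.
  by rewrite -W1 E1 trmx_mul scalemxAr -W0 !mulmxA.
have QQ : Q^T *m Q = 1%:M.
  exact: rotation_alg G0 G1 E1 xQ.
exists Q => //.
have [r r0 [BrI uniq]] := unique_nbhd (chart_metricP g i) (cimg_chart dz).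
have [s1 s10 B1] := near_in_ball (near_and (near_open oV0 Vz0 (fun _ h => h))
  (near_open oV1 Vz1 (fun _ h => h))).
pose s := Num.min r s1; have s0 : 0 < s by rewrite lt_min r0.
have sr : s <= r by rewrite ge_min lexx.
have B01 q : ball y s q -> V0 q /\ V1 q.
  move=> Bq; apply: B1; move: Bq; rewrite !in_ballE => /lt_le_trans; apply.
  by rewrite ge_min lexx orbT.
have oB : open (ball y s) by exact: ball_open.
have By : ball y s y by exact: ballxx.
have BI : ball y s `<=` cimg i by move=> q /B01[/VI0].
have mB := chart_metric_sub (chart_metricP g i) oB BI.
have subsol V X a : V `<=` cimg i -> open V -> chart_section g u i V X -> (forall q, ball y s q -> V q) ->
    solution (g i) (ball y s) (X a).
  move=> VI oV CS BV; have [sX hX] := chart_section_solution a oV VI CS.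
  by split=> [|q /BV]; [exact: smooth_sub BV sX|exact: hX].
have S0 b := subsol V0 X0 b VI0 oV0 CS0 (fun q Bq => (B01 q Bq).1).
have S1 b := subsol V1 X1 b VI1 oV1 CS1 (fun q Bq => (B01 q Bq).2).
have zero a q : ball y s q -> X1 a q - \sum_b X0 b q * Q b a = 0.
  have SC := @solution_comb _ _ _ _ mB X0 (fun b => Q b a) S0.
  apply: (uniq s (fun q => X1 a q - \sum_b X0 b q * Q b a) y s0 sr _ By).
  - exact (solutionB mB (S1 a) SC).
  - rewrite /X1 /= /coordf /y (chartK dz) xQ mxME; apply/eqP; rewrite subr_eq0; apply/eqP.
    by apply: eq_bigr => b _; rewrite /X0 /= /coordf (chartK dz).
  rewrite (gradB mB (S1 a).1 SC.1 By) (grad_comb mB (fun b => Q b a) (fun b => (S0 b).1) By).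
  have -> : \col_b Q b a = col a Q by apply/matrixP => k l; rewrite !mxE.
  by rewrite -colM -E1 col_frame subrr.
apply: (near_chart dz); apply: (near_open oB By) => q Bq.
apply/rowP => a; rewrite mxME; apply/eqP; rewrite -subr_eq0; apply/eqP.
exact: zero.
Qed.

(** The set is chosen before [z]: [unique_nbhd] works on one ball for every base point, so agreement
    near any of its points spreads to all of it. *)
Lemma section_continuation Phi1 Phi2 y : (\forall x \near y, iso_at Phi1 x) ->
  (\forall x \near y, iso_at Phi2 x) ->
  exists O, [/\ open O, O y & forall z, O z -> (\forall x \near z, Phi1 x = Phi2 x) ->
    forall x, O x -> Phi1 x = Phi2 x].
Proof.
move=> H1 H2; have dy := dom_chart_at y; set i := chart_at y in dy.
have [V1 [oV1 Vy1 VI1 CS1]] := section_chart H1 dy.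
have [V2 [oV2 Vy2 VI2 CS2]] := section_chart H2 dy.
pose y0 := chart i y.
have [r r0 [BrI uniq]] := unique_nbhd (chart_metricP g i) (cimg_chart dy).
have [s1 s10 B1] := near_in_ball (near_and (near_open oV1 Vy1 (fun _ h => h))
  (near_open oV2 Vy2 (fun _ h => h))).
pose s := Num.min r s1; have s0 : 0 < s by rewrite lt_min r0.
have sr : s <= r by rewrite ge_min lexx.
have B12 q : ball y0 s q -> V1 q /\ V2 q.
  move=> Bq; apply: B1; move: Bq; rewrite !in_ballE => /lt_le_trans; apply.
  by rewrite ge_min lexx orbT.
have oB : open (ball y0 s) by exact: ball_open.
have BI q : ball y0 s q -> cimg i q by move=> /B12[/VI1].
have BI' : ball y0 s `<=` cimg i by [].
have mB := chart_metric_sub (chart_metricP g i) oB BI'.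
exists [set x | dom i x /\ ball y0 s (chart i x)]; split.
- rewrite openE => x [dx Bx]; apply: (near_chart dx); apply: (near_open oB Bx) => q Bq.
  by split; [exact/dom_param/BI|rewrite paramK//; exact: BI].
- by split=> //; exact: ballxx.
move=> z [dz Bz] E x [dx Bx]; apply/rowP => a.
have sol V X : V `<=` cimg i -> open V -> chart_section g u i V X -> (forall q, ball y0 s q -> V q) ->
    solution (g i) (ball y0 s) (X a).
  move=> VI oV CS BV; have [sX hX] := chart_section_solution a oV VI CS.
  by split=> [|q /BV]; [exact: smooth_sub BV sX|exact: hX].
have S1 := sol V1 _ VI1 oV1 CS1 (fun q Bq => (B12 q Bq).1).
have S2 := sol V2 _ VI2 oV2 CS2 (fun q Bq => (B12 q Bq).2).
have SD := solutionB mB S1 S2.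
have [W [oW Wz HW]] := near_ex_open (near_param dz E).
have := uniq s _ (chart i z) s0 sr SD Bz _ _ (chart i x) Bx.
rewrite /= /coordf !(chartK dx) !(chartK dz) (nbhs_singleton E) subrr => H.
apply/eqP; rewrite -subr_eq0; apply/eqP; apply: H => //.
apply/matrixP => k l; rewrite gradE mxE -(partial_cst (0 : R) k (chart i z)).
by apply: (partial_ext k oW _ Wz) => q Wq; rewrite (HW q Wq) subrr.
Qed.

End LocalInverses.

Lemma near_near (T : topologicalType) (P : set T) p : (\forall q \near p, P q) ->
  \forall q \near (p : T), \forall r \near (q : T), P r.
Proof.
move=> /near_ex_open[U [oU Up HU]]; apply: (near_open oU Up) => q Uq.
exact: near_open oU Uq HU.
Qed.

Lemma near_continuous (S T : topologicalType) (f : S -> T) (P : set T) p :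
  {for p, continuous f} -> (\forall y \near f p, P y) -> \forall q \near p, P (f q).
Proof. by move=> C H; exact: C _ H. Qed.

Section Rotations.
Context {R : realType} {n : nat}.

Lemma rotation_norm_le (Q : 'M[R]_n) : Q^T *m Q = 1%:M -> `|Q| <= 1.
Proof.
move=> QQ; apply: norm_le_coord => // i j.
rewrite -(@ler_pXn2r R 2)// ?nnegrE// expr1n -normrX ger0_norm ?sqr_ge0//.
have E : \sum_k Q^T j k * Q k j = 1 by rewrite -mxME QQ mxE eqxx.
by rewrite -[leRHS]E (bigD1 i)//= mxTE -expr2 lerDl; apply: sumr_ge0 => k _; rewrite mxTE -expr2 sqr_ge0.
Qed.

Lemma rotation_tr (Q : 'M[R]_n) : Q^T *m Q = 1%:M -> Q^T^T *m Q^T = 1%:M.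
Proof. by move=> /mulmx1C; rewrite trmxK. Qed.

Lemma rotate_dist (Q : 'M[R]_n) (p q : 'rV[R]_n) : Q^T *m Q = 1%:M ->
  `|p *m Q - q *m Q| <= n%:R * `|p - q|.
Proof.
move=> /rotation_norm_le Q1; rewrite -mulmxBl; apply: le_trans (mulmx_norm_le _ _) _.
by rewrite -[leRHS]mulr1 ler_wpM2l// mulr_ge0.
Qed.

Lemma rotate_continuous (Q : 'M[R]_n) (p : 'rV[R]_n) : {for p, continuous (fun q : 'rV[R]_n => q *m Q)}.
Proof.
apply: mx_continuous_at => i a.
apply: (continuous_ext_at (f := fun q : 'rV[R]_n => \sum_k q 0 k * Q k a)).
  by apply: (near_open (@openT _) I) => q _; rewrite mxME (ord1 i).
have oT := @openT 'rV[R]_n.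
have sf : smooth_on setT (fun q : 'rV[R]_n => \sum_k q 0 k * Q k a).
  by apply: smooth_sum => // k; apply: smoothM => //; [exact: smooth_coord|exact: smooth_cst].
exact: (smooth_continuous sf I).
Qed.

Definition segment_closed (W : set 'rV[R]_n) :=
  forall a b t, W a -> W b -> 0 <= t <= 1 -> W (t *: (b - a) + a).

Lemma ball_segment_closed (p : 'rV[R]_n) r : segment_closed (ball p r).
Proof. by move=> a b t Ba Bb t01; exact: ball_segment. Qed.

Lemma segment_closedI (A B : set 'rV[R]_n) : segment_closed A -> segment_closed B ->
  segment_closed (A `&` B).
Proof. by move=> HA HB a b t [Aa Ba] [Ab Bb] t01; split; [exact: HA|exact: HB]. Qed.

Lemma line_continuous (v a : 'rV[R]_n) (t : R) : {for t, continuous (fun s : R => s *: v + a)}.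
Proof.
apply/continuous_atP => e e0.
have d0 : 0 < `|v| + 1 by rewrite ltr_wpDl.
apply/nbhs_ballP; exists (e / (`|v| + 1)); first by rewrite /= divr_gt0.
move=> s /=; rewrite /ball /= => ts.
rewrite opprD addrACA subrr addr0 -scalerBl normrZ.
apply: (@le_trans _ _ (`|t - s| * (`|v| + 1))); first by rewrite ler_wpM2l// lerDl.
by rewrite -ler_pdivlMr// ltW.
Qed.

(** Shrinking [b] slightly towards the origin enters the open cube. *)
Lemma closed_ball_limit (b : 'rV[R]_n) t (P : set 'rV[R]_n) : 0 < t -> `|b| <= t ->
  (\forall q \near b, P q) -> exists2 q, P q & `|q| < t.
Proof.
move=> t0 bt /near_in_ball[r r0 HP].
have [d d0 Hd] := line_ball b (- b) r0.
pose s := Num.min (d / 2) (1 / 2).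
have s0 : 0 < s by rewrite lt_min !divr_gt0.
have sd : s < d by rewrite gt_min ltr_pdivrMr// ltr_pMr// ltr1n.
have s1 : s < 1 by rewrite gt_min [X in _ || X]ltr_pdivrMr// mul1r ltr1n orbT.
exists (s *: (- b) + b); first by apply: HP; apply: Hd; rewrite gtr0_norm.
have -> : s *: - b + b = (1 - s) *: b by rewrite scalerBl scale1r scalerN addrC.
rewrite normrZ gtr0_norm ?subr_gt0//.
have [->|b0] := eqVneq `|b| 0; first by rewrite mulr0.
apply: lt_le_trans bt; rewrite gtr_pMl; first by rewrite ltrBlDr ltrDl.
by rewrite lt_neqAle eq_sym b0 normr_ge0.
Qed.

End Rotations.

Section LocalInversePatching.
Context {R : realType} {n : nat}.
Variables (M : manifold R n) (g : riemannian_metric M) (u : M -> R) (c : R).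
Hypothesis su : smooth_fun u.
Hypothesis u_gt0 : forall x, 0 < u x.
Hypothesis grad_u : forall i x, dom i x -> ipc g i u u x = u x ^+ 2 - c ^+ 2.
Implicit Types (i : atlas_index M) (x z : M) (Phi : M -> 'rV[R]_n) (Psi : 'rV[R]_n -> M).
Local Notation iso_at := (iso_at g u).
Hypothesis all_sections : forall x, exists Phi, \forall y \near x, iso_at Phi y.

Lemma iso_rotate Phi (Q : 'M[R]_n) x : Q^T *m Q = 1%:M -> iso_at Phi x ->
  iso_at (fun y => Phi y *m Q) x.
Proof.
move=> QQ [sP gP].
have E a i : coordf (fun y => Phi y *m Q) a \o param i =
    (fun q => \sum_b (coordf Phi b \o param i) q * Q b a).
  by apply/funext => q; rewrite /= /coordf mxME.
have W i : dom i x -> exists V, [/\ open V, V (chart i x), V `<=` cimg i &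
    forall b, smooth_on V (coordf Phi b \o param i)].
  move=> dx; have HV b : \forall q \near chart i x, exists2 V, open V /\ V q & smooth_on V (coordf Phi b \o param i).
    have [V [oV Vx] sV] := sP b i dx.
    by apply: (near_open oV Vx) => q Vq; exists V.
  have [V [oV Vx HV']] := near_ex_open (near_and (near_open (@open_cimg _ _ _ i) (cimg_chart dx) (fun _ h => h)) (near_forall HV)).
  exists V; split=> // [q /HV'[]//|b].
  apply: smooth_pointwise => q /HV'[_ /(_ b)[V' [oV' Vq'] sV']].
  by exists V'.
split=> [a i dx|i dx].
  have [V [oV Vx VI sV]] := W i dx; exists V => //; rewrite E.
  by apply: smooth_sum => // b; apply: smoothM => //; exact: smooth_cst.
have [V [oV Vx VI sV]] := W i dx.
have mV := chart_metric_sub (chart_metricP g i) oV VI.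
have [G W'] := section_frame_gram (conj sP gP) dx.
set F := frame _ _ in G W'; set A := invmx _ in G W'.
have gE a : grad (coordf (fun y => Phi y *m Q) a \o param i) (chart i x) = F *m col a Q.
  rewrite E (grad_comb mV (fun b => Q b a) sV Vx); congr (_ *m _).
split=> [a b|a].
  rewrite /ipc ipgE !gE trmx_mul -/A.
  have -> : (col a Q)^T *m F^T *m A *m (F *m col b Q) = (col a Q)^T *m (F^T *m A *m F) *m col b Q.
    by rewrite !mulmxA.
  rewrite G mulmxDr mulmx1 mulmxDl mxDE; congr (_ + _).
    have := congr1 (fun X : 'M[R]_n => X a b) QQ; rewrite [RHS]mxE => <-.
    by rewrite !mxME; apply: eq_bigr => k _; rewrite !mxTE ![col _ _ _ _]mxE.
  have -> : (col a Q)^T *m ((Phi x)^T *m Phi x) *m col b Q = (Phi x *m col a Q)^T *m (Phi x *m col b Q).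
    by rewrite trmx_mul !mulmxA.
  by rewrite mxME big_ord1 mxTE -!colM ![col _ _ _ _]mxE.
rewrite /ipc ipgE gE trmx_mul -/A -mulmxA.
have -> : (col a Q)^T *m F^T *m (A *m grad (u \o param i) (chart i x)) =
   (col a Q)^T *m (F^T *m A *m grad (u \o param i) (chart i x)) by rewrite !mulmxA.
rewrite W' -scalemxAr mxZE mulrC; congr (_ * _).
by rewrite -trmx_mul mxTE -colM [col _ _ _ _]mxE.
Qed.

(** Both inverse relations are germs, at [Psi q] and at [q], so the property depends only on [Psi]
    near [q]. *)
Definition local_inverse Psi q := {for q, continuous Psi} /\
  exists Phi, [/\ \forall x \near Psi q, iso_at Phi x, \forall x \near Psi q, Psi (Phi x) = x &
    \forall p \near q, Phi (Psi p) = p].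

Lemma local_inverse_ext Psi Psi' q : (\forall p \near q, Psi p = Psi' p) ->
  local_inverse Psi q -> local_inverse Psi' q.
Proof.
move=> E [C [Phi [iP PP PPi]]]; have Eq := nbhs_singleton E; split.
  move=> A; rewrite -Eq => /C HA; apply: near_imp (near_and E HA) _ => p [e h].
  by rewrite /= -e.
exists Phi; rewrite -Eq; split=> //.
  have cP := section_continuous (nbhs_singleton iP).
  have Pq := nbhs_singleton PPi.
  have N : \forall x \near Psi q, Psi (Phi x) = Psi' (Phi x).
    by apply: (near_continuous (P := fun p => Psi p = Psi' p) cP); rewrite Pq.
  by apply: near_imp (near_and N PP) _ => x [e h]; rewrite -e.
by apply: near_imp (near_and E PPi) _ => p [e h]; rewrite -e.
Qed.

Lemma local_inverse_u Psi q : local_inverse Psi q ->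
  u (Psi q) ^+ 2 = c ^+ 2 * (1 + (q *m q^T) 0 0).
Proof.
move=> [_ [Phi [iP _ PPi]]]; have dx := dom_chart_at (Psi q); set i := chart_at _ in dx.
have [G W] := section_frame_gram (nbhs_singleton iP) dx.
rewrite (nbhs_singleton PPi) in G W.
apply: (frame_norm _ G W); first by rewrite gt_eqF.
  exact: (Gi_sym (chart_metricP g i) (cimg_chart dx)).
by rewrite -ipgE -(grad_u dx).
Qed.

(** By [section_rotation] every local inverse taking a value near [y] is a rotation of the single
    [Psi0]. Its argument falls in the half cube, so the rotated [Psi0] extends it over a cube whose
    size depends on [y] alone. *)
Lemma local_inverse_model y : exists b0 Psi0 e, [/\ 0 < e, Psi0 b0 = y,
  forall p q, ball b0 e p -> ball b0 e q -> Psi0 p = Psi0 q -> p = q,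
  forall Q : 'M[R]_n, Q^T *m Q = 1%:M -> forall q, ball b0 e (q *m Q^T) ->
    local_inverse (fun p => Psi0 (p *m Q^T)) q &
  \forall z \near y, forall Psi q, local_inverse Psi q -> Psi q = z ->
    exists Q : 'M[R]_n, [/\ Q^T *m Q = 1%:M, ball b0 (e / 2) (q *m Q^T) &
      \forall p \near q, Psi p = Psi0 (p *m Q^T)]].
Proof.
have [Phi0 H] := all_sections y.
have [Psi0 [e [Ob [e0 oO Oy HP HO]]]] := section_inverse su H.
exists (Phi0 y), Psi0, e; split=> //.
- by have [_ /(_ (ballxx _ e0))] := HO y Oy.
- by move=> p q /HP[_ Ep _] /HP[_ Eq _] E; rewrite -Ep -Eq E.
- move=> Q QQ q Bq; have [Oq PPq Cq] := HP _ Bq; split.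
    exact: (continuous_comp (@rotate_continuous _ _ Q^T q) Cq).
  have QT := mulmx1C QQ.
  exists (fun x => Phi0 x *m Q); split.
  + by apply: (near_open oO Oq) => x /HO[iP _]; exact: iso_rotate.
  + have cP := section_continuous (HO _ Oq).1.
    have N : \forall x \near Psi0 (q *m Q^T), ball (Phi0 y) e (Phi0 x).
      apply: near_continuous cP _; rewrite PPq.
      exact: near_open (@ball_open _ _ _ _) Bq (fun _ h => h).
    apply: near_imp (near_and N (near_open oO Oq (fun _ h => h))) _ => x [Bx Ox].
    by rewrite -mulmxA QT mulmx1; have [_] := HO x Ox; apply.
  + have N : \forall p \near q, ball (Phi0 y) e (p *m Q^T).
      apply: (near_continuous (@rotate_continuous _ _ Q^T q)).
      exact: near_open (@ball_open _ _ _ _) Bq (fun _ h => h).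
    apply: near_imp N _ => p Bp; have [_ -> _] := HP _ Bp.
    by rewrite -mulmxA QQ mulmx1.
have cPy := section_continuous (nbhs_singleton H).
have e20 : 0 < e / 2 by rewrite divr_gt0.
have N1 : \forall z \near y, ball (Phi0 y) (e / 2) (Phi0 z).
  apply: near_continuous cPy _; exact: near_open (@ball_open _ _ _ _) (ballxx _ e20) (fun _ h => h).
apply: near_imp (near_and N1 (near_open oO Oy (fun _ h => h))) _ => z [Bz Oz] Psi q [C [Phi [iP PP PPi]]] Pz.
rewrite Pz in iP PP.
have iP0 : \forall x \near z, iso_at Phi0 x by apply: (near_open oO Oz) => x /HO[].
have [Q QQ rot] := section_rotation u_gt0 iP0 iP.
have QT := mulmx1C QQ.
have back x : Phi x = Phi0 x *m Q -> Phi x *m Q^T = Phi0 x by move=> ->; rewrite -mulmxA QT mulmx1.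
have qE : q *m Q^T = Phi0 z.
  by rewrite -(back z (nbhs_singleton rot)) -Pz (nbhs_singleton PPi).
exists Q; split=> //; first by rewrite qE.
have cP0 := section_continuous (nbhs_singleton iP0).
have N2 : \forall x \near z, ball (Phi0 y) e (Phi0 x).
  apply: near_continuous cP0 _; apply: near_open (@ball_open _ _ _ _) _ (fun _ h => h).
  by move: Bz; rewrite !in_ballE => /lt_le_trans; apply; rewrite ler_pdivrMr// ler_peMr ?ltW// ltr1n.
have N3 : \forall p \near q, Phi (Psi p) = Phi0 (Psi p) *m Q /\ (ball (Phi0 y) e (Phi0 (Psi p)) /\ Ob (Psi p)).
  apply: (near_continuous (P := fun x => Phi x = Phi0 x *m Q /\ (ball (Phi0 y) e (Phi0 x) /\ Ob x)) C); rewrite Pz.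
  exact: near_and rot (near_and N2 (near_open oO Oz (fun _ h => h))).
apply: near_imp (near_and N3 PPi) _ => p [[r [Bp Op]] Ep].
rewrite -{2}Ep (back _ r); have [_ ->//] := HO _ Op.
Qed.

(** Agreement at points accumulating at [q] gives equal values at [q], as the manifold is Hausdorff.
    The two sections then agree near some nearby point, hence on a whole neighbourhood of the common
    value by [section_continuation], and so do their inverses. *)
Lemma local_inverse_limit Psi1 Psi2 q : local_inverse Psi1 q -> local_inverse Psi2 q ->
  (forall P : set 'rV[R]_n, (\forall p \near q, P p) ->
     exists2 p, P p & \forall r \near p, Psi1 r = Psi2 r) ->
  \forall p \near q, Psi1 p = Psi2 p.
Proof.
move=> [C1 [Phi1 [i1 PP1 PPi1]]] [C2 [Phi2 [i2 PP2 PPi2]]] H.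
have E : Psi1 q = Psi2 q.
  apply/eqP; apply/negPn/negP => ne.
  have hM := @carrier_hausdorff _ _ M; rewrite open_hausdorff in hM.
  have [[A B] /= [Aq Bq] [oA oB AB]] := hM _ _ ne.
  rewrite !inE in Aq Bq.
  have N1 : \forall p \near q, A (Psi1 p) by apply: near_continuous C1 _; exact: near_open oA Aq (fun _ h => h).
  have N2 : \forall p \near q, B (Psi2 p) by apply: near_continuous C2 _; exact: near_open oB Bq (fun _ h => h).
  have [p [Ap Bp] /nbhs_singleton Ep] := H _ (near_and N1 N2).
  move/eqP: AB => AB; have : (A `&` B) (Psi1 p) by split=> //; rewrite Ep.
  by rewrite AB.
rewrite -E in i2 PP2.
have [Ob [oO Oy cont]] := section_continuation i1 i2.
have NO : \forall p \near q, Ob (Psi1 p) by apply: near_continuous C1 _; exact: near_open oO Oy (fun _ h => h).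
have Ni : \forall p \near q, (\forall x \near Psi1 p, iso_at Phi1 x) /\ (\forall x \near Psi1 p, Psi1 (Phi1 x) = x).
  apply: (near_continuous (P := fun z => (\forall x \near z, iso_at Phi1 x) /\ (\forall x \near z, Psi1 (Phi1 x) = x)) C1).
  exact: near_and (near_near i1) (near_near PP1).
have [p [Op [[ip PPp] [e1 e2]]] eqp] := H _ (near_and NO (near_and Ni (near_and (near_near PPi1) (near_near PPi2)))).
have cP := section_continuous (nbhs_singleton ip).
have Ez : \forall x \near Psi1 p, Phi1 x = Phi2 x.
  have N : \forall x \near Psi1 p, Psi1 (Phi1 x) = Psi2 (Phi1 x) /\ Phi2 (Psi2 (Phi1 x)) = Phi1 x.
    apply: (near_continuous (P := fun p => Psi1 p = Psi2 p /\ Phi2 (Psi2 p) = p) cP).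
    by rewrite (nbhs_singleton e1); exact: near_and eqp e2.
  by apply: near_imp (near_and N PPp) _ => x [[a b] d]; rewrite -{2}d a b.
have all := cont _ Op Ez.
have N2 : \forall p \near q, Psi2 (Phi2 (Psi1 p)) = Psi1 p.
  exact: (near_continuous (P := fun x => Psi2 (Phi2 x) = x) C1).
apply: near_imp (near_and NO (near_and PPi1 N2)) _ => r [Or [er1 er2]].
by rewrite -{1}er2 -all// er1.
Qed.

(** On the segment from [q0] to [q] the parameters near whose image the two maps agree form an open
    set, which is closed by [local_inverse_limit]. *)
Lemma local_inverse_unique (W : set 'rV[R]_n) Psi1 Psi2 q0 : segment_closed W -> W q0 ->
  (forall q, W q -> local_inverse Psi1 q) -> (forall q, W q -> local_inverse Psi2 q) ->
  (\forall q \near q0, Psi1 q = Psi2 q) -> forall q, W q -> Psi1 q = Psi2 q.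
Proof.
move=> cW W0 L1 L2 E q Wq; pose gam (t : R) := t *: (q - q0) + q0.
pose P t := \forall p \near gam t, Psi1 p = Psi2 p.
have cg t : {for t, continuous gam} by exact: line_continuous.
have K := @segment_connected R 0 1.
have P0 : P 0 by rewrite /P /gam scale0r add0r.
suff : P 1 by rewrite /P /gam scale1r subrK => /nbhs_singleton.
pose B := `[0, 1]%classic `&` [set t | P t].
have B01 : B = `[0, 1]%classic.
  apply: K.
  - by exists 0; split=> //=; rewrite in_itv /= lexx ler01.
  - exists [set t | P t] => //; rewrite openE => t Pt.
    exact: near_continuous (cg t) (near_near Pt).
  - exists (closure [set t | P t]); first exact: closed_closure.
    apply/seteqP; split=> t [It Pt]; split=> //; first exact: subset_closure.
    have Wt : W (gam t) by apply: cW => //; move: It; rewrite /= in_itv.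
    apply: local_inverse_limit (L1 _ Wt) (L2 _ Wt) _ => A HA.
    have [s [Ps As]] := Pt _ (near_continuous (cg t) HA).
    by exists (gam s).
have : B 1 by rewrite B01 /= in_itv /= ler01 lexx.
by case.
Qed.

End LocalInversePatching.

Lemma le_sqr_succ (R : realDomainType) (v w : R) : v ^+ 2 <= w -> v <= w + 1.
Proof. by move=> H; have := sqr_ge0 (v - 1); nra. Qed.

(** * The developing map: extension over growing cubes *)

Section Developing.
Context {R : realType} {n : nat}.
Variables (M : manifold R n) (g : riemannian_metric M) (u : M -> R) (c : R).
Hypothesis su : smooth_fun u.
Hypothesis u_gt0 : forall x, 0 < u x.
Hypothesis grad_u : forall i x, dom i x -> ipc g i u u x = u x ^+ 2 - c ^+ 2.
Hypothesis sublevel_cpt : forall s, compact [set x | u x <= s].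
Implicit Types (x z : M) (Phi : M -> 'rV[R]_n) (Psi : 'rV[R]_n -> M).
Local Notation iso_at := (iso_at g u).
Hypothesis all_sections : forall x, exists Phi, \forall y \near x, iso_at Phi y.
Local Notation local_inverse := (local_inverse g u).

Lemma local_inverse_rotate Psi (T : 'M[R]_n) q : T^T *m T = 1%:M ->
  local_inverse Psi (q *m T) -> local_inverse (fun p => Psi (p *m T)) q.
Proof.
move=> TT [C [Phi [iP PP PPi]]]; have TT' := mulmx1C TT; split.
  exact: (continuous_comp (@rotate_continuous _ _ T q) C).
exists (fun x => Phi x *m T^T); split.
- by apply: near_imp iP _ => x; apply: iso_rotate; rewrite trmxK.
- by apply: near_imp PP _ => x; rewrite -mulmxA TT mulmx1.
have N := near_continuous (P := fun p => Phi (Psi p) = p) (@rotate_continuous _ _ T q) PPi.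
by apply: near_imp N _ => p ->; rewrite -mulmxA TT' mulmx1.
Qed.

Lemma norm_lt_segment_closed t : segment_closed [set q : 'rV[R]_n | `|q| < t].
Proof.
move=> a b s /= Ha Hb s01.
have := @ball_segment R n 0 a b t s s01; rewrite !in_ballE !sub0r !normrN.
by apply.
Qed.

Lemma norm_lt_near t (q : 'rV[R]_n) : `|q| < t -> \forall p \near q, `|p| < t.
Proof.
move=> qt; have Bq : ball (0 : 'rV[R]_n) t q by rewrite in_ballE sub0r normrN.
apply: (near_open (@ball_open _ _ _ _) Bq) => p.
by rewrite in_ballE sub0r normrN.
Qed.

Lemma local_inverse_u_bound Psi t q : 0 <= t -> local_inverse Psi q -> `|q| < t ->
  u (Psi q) <= c ^+ 2 * (1 + n%:R * t * t) + 1.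
Proof.
move=> t0 L qt; have := local_inverse_u u_gt0 grad_u L.
have : (q *m q^T) 0 0 <= n%:R * t * t.
  rewrite mxME; apply: le_trans (ler_norm _) _; apply: sum_coord_le => // i.
    by apply: le_trans (coord_le_norm _ _ _) (ltW qt).
  by rewrite mxTE; apply: le_trans (coord_le_norm _ _ _) (ltW qt).
have c2 : 0 <= c ^+ 2 by exact: sqr_ge0.
have := ltW (u_gt0 (Psi q)); move: (u _) ((q *m _) _ _) (n%:R * t * t) => v s r v0 sr E.
have : v ^+ 2 <= c ^+ 2 * (1 + r) by rewrite E ler_wpM2l// lerD2l.
exact: le_sqr_succ.
Qed.

Definition extends_on Psi t b e := exists Psi', forall q, ball b e q ->
  local_inverse Psi' q /\ (`|q| < t -> Psi' q = Psi q).

(** On the cube the values of Psi stay in a compact sublevel set of u, so they cluster at some [y]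
    as the argument tends to [b]. The model around [y], suitably rotated, agrees with Psi near a
    point close to [b] and is defined around [b]. *)
Lemma extension_point Psi t b : 0 < t -> (forall q, `|q| < t -> local_inverse Psi q) ->
  `|b| <= t -> exists2 e, 0 < e & extends_on Psi t b e.
Proof.
move=> t0 L bt; pose D := [set q : 'rV[R]_n | `|q| < t].
have clD : closure D b.
  by move=> N HN; have [q Nq qt] := closed_ball_limit t0 bt HN; exists q.
have PF : ProperFilter (within D (nbhs b)) by exact: within_nbhs_proper.
pose F := fmap Psi (within D (nbhs b)).
have PF' : ProperFilter F by exact: fmap_proper_filter.
pose S := c ^+ 2 * (1 + n%:R * t * t) + 1.
have FK : F [set x | u x <= S].
  suff H : \forall q \near b, D q -> u (Psi q) <= S by exact: H.
  by apply: filterE => q Dq; exact: local_inverse_u_bound (ltW t0) (L q Dq) Dq.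
(* A cluster point is enough: convergence of Psi at [b] is not known in advance. *)
have [y [_ cl]] := sublevel_cpt PF' FK.
have [b0 [Psi0 [e [e0 Ey inj0 rotL model]]]] := local_inverse_model su u_gt0 all_sections y.
have n1 : 0 < n%:R + 1 :> R by rewrite ltr_wpDl.
(* Points of the cube of radius [eps] are at most 2 eps apart and a rotation is n-Lipschitz, so
   their images move by at most n (2 eps) <= e / 2, the room left by the half cube. *)
pose eps := e / 4 / (n%:R + 1).
have eps0 : 0 < eps by rewrite !divr_gt0.
have FA : F [set x | exists q, [/\ `|q| < t, ball b eps q & Psi q = x]].
  suff H : \forall q \near b, D q -> exists q', [/\ `|q'| < t, ball b eps q' & Psi q' = Psi q] by exact: H.
  by apply: (near_open (@ball_open _ _ b eps) (ballxx b eps0)) => q Bq Dq; exists q.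
have [x [/= [q0 [q0t Bq0 E]] Hx]] := cl _ _ FA model.
have [Q [QQ BQ EQ]] := Hx Psi q0 (L _ q0t) E.
have QT := rotation_tr QQ.
have incl q : ball b eps q -> ball b0 e (q *m Q^T).
  move=> Bq; rewrite in_ballE; move: BQ; rewrite in_ballE => BQ.
  have d1 := ball_dist_lt Bq Bq0; have d2 := @rotate_dist _ _ Q^T q0 q QT.
  have -> : b0 - q *m Q^T = (b0 - q0 *m Q^T) + (q0 *m Q^T - q *m Q^T) by rewrite addrA subrK.
  apply: le_lt_trans (ler_normD _ _) _.
  have -> : e = e / 2 + e / 2 by field.
  apply: ltr_leD BQ _; apply: le_trans d2 _.
  apply: (@le_trans _ _ (n%:R * (2 * eps))); first by rewrite ler_wpM2l.
  have -> : e / 2 = (n%:R + 1) * (2 * eps) by rewrite /eps; field; rewrite gt_eqF.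
  by apply: ler_wpM2r; [rewrite mulr_ge0// ltW|rewrite lerDl].
exists eps => //; exists (fun p => Psi0 (p *m Q^T)) => q Bq; split; first exact/rotL/incl.
move=> qt.
apply: (@local_inverse_unique _ _ _ g u (D `&` ball b eps) (fun p => Psi0 (p *m Q^T)) Psi q0) => //.
- by apply: segment_closedI; [exact: norm_lt_segment_closed|exact: ball_segment_closed].
- by move=> p [_ Bp]; exact/rotL/incl.
- by move=> p [Dp _]; exact: L.
- by apply: near_imp EQ _ => p ->.
Qed.

(** Compactness of the closed cube makes the size of the local extensions uniform. *)
Lemma uniform_extension Psi t : 0 < t -> (forall q, `|q| < t -> local_inverse Psi q) ->
  exists2 d, 0 < d & forall b : 'rV[R]_n, `|b| <= t -> extends_on Psi t b d.
Proof.
move=> t0 L.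
have K : compact [set b : 'rV[R]_n | `|b| <= t].
  have -> : [set b : 'rV[R]_n | `|b| <= t] = [set q | `|0 - q| <= t].
    by apply/funext => q /=; rewrite sub0r normrN.
  exact: compact_cball.
have H0 : \forall d \near (0 : R)^'+, [set b : 'rV[R]_n | `|b| <= t] `<=` (fun b => extends_on Psi t b d).
  apply: ((compact_near_coveringP _).1 K) => b bt.
  have [e e0 [Psi' H]] := extension_point t0 L bt.
  have e20 : 0 < e / 2 by rewrite divr_gt0.
  exists (ball b (e / 2), [set d : R | d < e / 2]).
    split=> /=; first exact: nbhsx_ballx.
    exact: nbhs_right_lt.
  move=> [b' d] [/= Bb' dd]; exists Psi' => q Bq; apply: H; move: Bb' Bq.
  rewrite !in_ballE => h1 h2; have -> : b - q = (b - b') + (b' - q) by rewrite addrA subrK.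
  apply: le_lt_trans (ler_normD _ _) _; have -> : e = e / 2 + e / 2 by field.
  by apply: ltrD => //; exact: lt_trans h2 dd.
have [d [d0 H]] := filter_ex (filterI (nbhs_right_gt (0 : R)) H0).
by exists d => // b bt; exact: H.
Qed.

Lemma radial_retract (q : 'rV[R]_n) t d : 0 < t -> `|q| < t + d ->
  exists2 b : 'rV[R]_n, `|b| <= t & `|q| < t \/ ball b d q.
Proof.
move=> t0 qt; have [lt|le] := ltP `|q| t; first by exists 0; [rewrite normr0 ltW|left].
have q0 : 0 < `|q| by exact: lt_le_trans t0 le.
exists ((t / `|q|) *: q).
  by rewrite normrZ ger0_norm ?divr_ge0 ?(ltW t0)// divfK// gt_eqF.
right; rewrite in_ballE distrC.
have -> : q - (t / `|q|) *: q = (1 - t / `|q|) *: q by rewrite scalerBl scale1r.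
rewrite normrZ ger0_norm; last first.
  by rewrite subr_ge0 ler_pdivrMr// mul1r.
by rewrite mulrBl mul1r divfK ?gt_eqF// ltrBlDr addrC.
Qed.

(** The extensions around the points of the closed cube are patched. Two of them agree where their
    cubes overlap, because the overlap is convex and meets the open cube, where both equal Psi. *)
Lemma extend_ball Psi t : 0 < t -> (forall q, `|q| < t -> local_inverse Psi q) ->
  exists2 d, 0 < d & exists Psi', forall q, `|q| < t + d ->
    local_inverse Psi' q /\ (`|q| < t -> Psi' q = Psi q).
Proof.
move=> t0 L; have [d d0 H] := uniform_extension t0 L; exists d => //.
have H' (b : 'rV[R]_n) : exists Psi', `|b| <= t -> forall q, ball b d q ->
    local_inverse Psi' q /\ (`|q| < t -> Psi' q = Psi q).
  have [bt|nb] := boolP (`|b| <= t); last by exists Psi.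
  by have [Psi' HP] := H b bt; exists Psi'.
have [Ps PsP] := choice H'.
have compat b b' q : `|b| <= t -> `|b'| <= t -> ball b d q -> ball b' d q -> Ps b q = Ps b' q.
  move=> bt bt' Bq Bq'.
  (* The midpoint of the centres lies in the closed cube and, as the two cubes meet, in both of
     them. *)
  pose m := 2^-1 *: (b' - b) + b.
  have mt : `|m| <= t.
    have -> : m = 2^-1 *: b + 2^-1 *: b'.
      by rewrite /m scalerBr addrAC [RHS]addrC -addrA; congr (_ + _); rewrite -{1}[b]scale1r -scaleNr -scalerDl; congr (_ *: _); field.
    apply: le_trans (ler_normD _ _) _; rewrite !normrZ gtr0_norm//.
    have -> : t = 2^-1 * t + 2^-1 * t by field.
    by apply: lerD; rewrite ler_wpM2l.
  have bb : `|b' - b| < 2 * d.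
    have -> : b' - b = (b' - q) - (b - q) by rewrite opprB addrA subrK.
    apply: le_lt_trans (ler_normB _ _) _; rewrite mulr_natl mulr2n.
    by move: Bq Bq'; rewrite !in_ballE => h1 h2; exact: ltrD.
  have half : `|2^-1 *: (b' - b)| < d.
    by rewrite normrZ gtr0_norm// -ltr_pdivlMl// invrK.
  have Bm : ball b d m by rewrite in_ballE /m opprD addrCA subrr addr0 normrN.
  have Bm' : ball b' d m.
    rewrite in_ballE; have -> : b' - m = 2^-1 *: (b' - b).
      rewrite /m opprD addrCA addrC -{1}[b' - b]scale1r.
      by rewrite -scalerBl; congr (_ *: _); field.
    exact: half.
  have [p [Bp Bp'] pt] := closed_ball_limit t0 mt (near_and
    (near_open (@ball_open _ _ b d) Bm (fun _ h => h)) (near_open (@ball_open _ _ b' d) Bm' (fun _ h => h))).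
  apply: (@local_inverse_unique _ _ _ g u (ball b d `&` ball b' d) (Ps b) (Ps b') p) => //.
  - by apply: segment_closedI; exact: ball_segment_closed.
  - by move=> r [Br _]; have [] := PsP b bt r Br.
  - by move=> r [_ Br]; have [] := PsP b' bt' r Br.
  have N := near_and (norm_lt_near pt) (near_and
    (near_open (@ball_open _ _ b d) Bp (fun _ h => h)) (near_open (@ball_open _ _ b' d) Bp' (fun _ h => h))).
  apply: near_imp N _ => r [rt [Br Br']].
  by have [_ ->//] := PsP b bt r Br; have [_ ->//] := PsP b' bt' r Br'.
have cen q : exists b : 'rV[R]_n, `|q| < t + d -> `|b| <= t /\ ball b d q.
  have [qt|nq] := boolP (`|q| < t + d); last by exists 0.
  have [b bt [lt|Bq]] := radial_retract t0 qt; last by exists b.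
  by exists q => _; split; [exact: ltW|exact: ballxx].
have [beta betaP] := choice cen.
exists (fun q => Ps (beta q) q) => q qt; have [bt Bq] := betaP q qt.
have [Lq Eq] := PsP _ bt _ Bq; split=> //.
apply: local_inverse_ext Lq.
apply: near_imp (near_and (norm_lt_near qt) (near_open (@ball_open _ _ (beta q) d) Bq (fun _ h => h))) _ => p [pt Bp].
have [bt' Bp'] := betaP p pt; exact: compat.
Qed.

(* [`|q|] is the sup norm of a row vector, so the balls below are cubes. *)
Definition developed (Psi0 : 'rV[R]_n -> M) t := exists2 Psi, forall q, `|q| < t -> local_inverse Psi q &
  \forall q \near (0 : 'rV[R]_n), Psi q = Psi0 q.

Lemma developed_agree t1 t2 Psi1 Psi2 Psi0 q : `|q| < t1 -> `|q| < t2 ->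
  (forall q, `|q| < t1 -> local_inverse Psi1 q) -> (forall q, `|q| < t2 -> local_inverse Psi2 q) ->
  (\forall q \near (0 : 'rV[R]_n), Psi1 q = Psi0 q) ->
  (\forall q \near (0 : 'rV[R]_n), Psi2 q = Psi0 q) -> Psi1 q = Psi2 q.
Proof.
move=> q1 q2 L1 L2 E1 E2.
apply: (@local_inverse_unique _ _ _ g u ([set q | `|q| < t1] `&` [set q | `|q| < t2]) _ _ 0) => //.
- by apply: segment_closedI; exact: norm_lt_segment_closed.
- by split; rewrite /= normr0; apply: le_lt_trans (normr_ge0 q) _.
- by move=> p [] /= + _; exact: L1.
- by move=> p [] /= _; exact: L2.
- by apply: near_imp (near_and E1 E2) _ => p [-> ->].
Qed.

Lemma developed_union Psi0 e : 0 < e -> developed Psi0 e ->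
  exists2 Psi, forall q t, developed Psi0 t -> `|q| < t -> local_inverse Psi q &
    \forall q \near (0 : 'rV[R]_n), Psi q = Psi0 q.
Proof.
move=> e0 De.
have ex (q : 'rV[R]_n) : exists x : M, forall t Psi, `|q| < t -> (forall p, `|p| < t -> local_inverse Psi p) ->
    (\forall p \near (0 : 'rV[R]_n), Psi p = Psi0 p) -> x = Psi q.
  have [[t [Psi [qt L E]]]|nex] := pselect (exists t Psi, [/\ `|q| < t, forall p, `|p| < t -> local_inverse Psi p &
     \forall p \near (0 : 'rV[R]_n), Psi p = Psi0 p]).
    exists (Psi q) => t' Psi' qt' L' E'; exact: developed_agree qt qt' L L' E E'.
  by exists (Psi0 q) => t Psi qt L E; case: nex; exists t, Psi.
have [Psi PsiP] := choice ex; exists Psi.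
  move=> q t [Psi1 L1 E1] qt; apply: local_inverse_ext (L1 q qt).
  by apply: near_imp (norm_lt_near qt) _ => p pt; rewrite (PsiP p t Psi1).
have [Psi1 L1 E1] := De.
have z : `|0 : 'rV[R]_n| < e by rewrite normr0.
by apply: near_imp (near_and (norm_lt_near z) E1) _ => p [pe <-]; rewrite (PsiP p e Psi1).
Qed.

(** If the admissible radii were bounded, the union of the developments would live on the cube of
    their supremum, and [extend_ball] would go beyond it. *)
Lemma developing_map Psi0 e : 0 < e -> developed Psi0 e ->
  exists2 Psi, forall q, local_inverse Psi q & \forall q \near (0 : 'rV[R]_n), Psi q = Psi0 q.
Proof.
move=> e0 De; have [Psi L E] := developed_union e0 De; exists Psi => // q.
have [[t Dt qt]|nex] := pselect (exists2 t, developed Psi0 t & `|q| < t); first exact: L Dt qt.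
exfalso.
pose T := [set t | developed Psi0 t].
have ubT : ubound T `|q|.
  by move=> t Dt; rewrite leNgt; apply/negP => qt; apply: nex; exists t.
have hs : has_sup T by split; [exists e|exists `|q|].
have se : e <= sup T by exact: sup_upper_bound.
have s0 : 0 < sup T by exact: lt_le_trans e0 se.
have Ls p : `|p| < sup T -> local_inverse Psi p.
  move=> ps; have d0 : 0 < sup T - `|p| by rewrite subr_gt0.
  have [t Dt] := sup_adherent d0 hs; rewrite opprB addrC subrK => pt.
  exact: L Dt pt.
have [d d0 [Psi' H]] := extend_ball s0 Ls.
have : sup T + d <= sup T.
  apply: sup_upper_bound => //; exists Psi'; first by move=> p /H[].
  have z : `|0 : 'rV[R]_n| < sup T by rewrite normr0.
  apply: near_imp (near_and (norm_lt_near z) E) _ => p [pt <-].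
  by have [|_ ->] := H p; first by apply: lt_trans pt _; rewrite ltrDl.
by rewrite gerDl leNgt d0.
Qed.

Variable Psi : 'rV[R]_n -> M.
Hypothesis LI : forall q, local_inverse Psi q.
Hypothesis cT : connected [set: M].

(** The image is open because Psi is locally invertible. Near a limit point z of the image Psi
    coincides with a rotated model, which takes the value z at its centre, so the image is
    closed. *)
Lemma developing_surjective x : exists q, Psi q = x.
Proof.
pose P z := exists q, Psi q = z.
suff : forall z, P z by exact.
apply: (@connected_clopen M [set z | P z] (Psi 0) cT) => [|z cl|]; last by exists 0.
- rewrite openE => _ [q <-]; have [C [Phi [_ PP _]]] := LI q.
  by apply: near_imp PP _ => z <-; exists (Phi z).
have [b0 [Psi0 [e [e0 Ey inj0 rotL model]]]] := local_inverse_model su u_gt0 all_sections z.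
have [_ [[q <-] Hq]] := cl _ model.
have [Q [QQ BQ EQ]] := Hq Psi q (LI q) erefl.
have QT := mulmx1C QQ.
have Bq : ball b0 e (q *m Q^T).
  by move: BQ; rewrite !in_ballE => /lt_le_trans; apply; rewrite ler_pdivrMr// ler_peMr ?(ltW e0)// ler1n.
pose W := [set p : 'rV[R]_n | ball b0 e (p *m Q^T)].
have cW : segment_closed W.
  move=> a b t Wa Wb t01; rewrite /W /= mulmxDl -scalemxAl mulmxBl.
  exact: (@ball_segment_closed _ _ b0 e (a *m Q^T) (b *m Q^T)).
exists (b0 *m Q); rewrite -Ey.
have -> : Psi0 b0 = Psi0 (b0 *m Q *m Q^T) by rewrite -mulmxA QT mulmx1.
apply: (@local_inverse_unique _ _ _ g u W Psi (fun p => Psi0 (p *m Q^T)) q) => //.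
- exact: rotL.
- by rewrite /W /= -mulmxA QT mulmx1; exact: ballxx.
Qed.

Lemma developing_injective : injective Psi.
Proof.
move=> a b E.
have [b0 [Psi0 [e [e0 Ey inj0 rotL model]]]] := local_inverse_model su u_gt0 all_sections (Psi a).
have Hz := nbhs_singleton model.
have [Qa [QQa Ba Ea]] := Hz Psi a (LI a) erefl.
have [Qb [QQb Bb Eb]] := Hz Psi b (LI b) (esym E).
have QTa := mulmx1C QQa; have QTb := mulmx1C QQb.
have lt_half q : ball b0 (e / 2) q -> ball b0 e q.
  by rewrite !in_ballE => /lt_le_trans; apply; rewrite ler_pdivrMr// ler_peMr ?(ltW e0)// ler1n.
have ab : a *m Qa^T = b *m Qb^T.
  apply: inj0; [exact: lt_half|exact: lt_half|].
  by rewrite -(nbhs_singleton Ea) -(nbhs_singleton Eb).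
pose T := Qa^T *m Qb.
have TT : T^T *m T = 1%:M.
  by rewrite /T trmx_mul trmxK mulmxA -(mulmxA _ Qa) QTa mulmx1.
have aT : a *m T = b by rewrite /T mulmxA ab -mulmxA QQb mulmx1.
have near_a : \forall p \near a, Psi p = Psi (p *m T).
  have N : \forall p \near a, Psi (p *m T) = Psi0 (p *m T *m Qb^T).
    apply: (near_continuous (P := fun p => Psi p = Psi0 (p *m Qb^T)) (@rotate_continuous _ _ T a)).
    by rewrite aT.
  apply: near_imp (near_and N Ea) _ => p [-> ->].
  by rewrite /T -!mulmxA QTb mulmx1.
(* Agreement near [a] spreads to the whole space, because composing with a rotation preserves local
   inverses. *)
have E1 : forall p, setT p -> Psi p = Psi (p *m T).
  apply: (@local_inverse_unique _ _ _ g u setT Psi (fun p => Psi (p *m T)) a) => // p _.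
  by apply: local_inverse_rotate.
have [_ [Phi [_ _ PPi]]] := LI 0.
have c0 : \forall p \near (0 : 'rV[R]_n), Phi (Psi (p *m T)) = p *m T.
  apply: (near_continuous (P := fun p => Phi (Psi p) = p) (@rotate_continuous _ _ T 0)).
  by rewrite mul0mx.
have [r r0 Hr] := near_in_ball (near_and PPi c0).
(* A small multiple of [a] lies where Psi is injective; linearity of T then gives a T = a, that is a
   = b. *)
have [d d0 Hd] := line_ball 0 a r0.
have d20 : 0 < d / 2 by rewrite divr_gt0.
have [h1 h2] : Phi (Psi ((d / 2) *: a)) = (d / 2) *: a /\ Phi (Psi ((d / 2) *: a *m T)) = (d / 2) *: a *m T.
  apply: Hr; rewrite -[_ *: a]addr0; apply: Hd.
  by rewrite gtr0_norm// ltr_pdivrMr// ltr_pMr// ltr1n.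
have := h2; rewrite -(E1 _ I) h1 -scalemxAl aT => /scalerI; apply.
by rewrite gt_eqF.
Qed.

End Developing.

(** * The isometry *)

Section SmoothInverse.
Context {R : realType} {n : nat}.
Variables (V W : set 'rV[R]_n) (X : 'I_n -> 'rV[R]_n -> R) (Z : 'rV[R]_n -> 'rV[R]_n).
Hypothesis oV : open V.
Hypothesis oW : open W.
Hypothesis sX : forall a, smooth_on V (X a).
Hypothesis uX : forall q, V q -> frame X q \in unitmx.
Hypothesis ZV : forall w, W w -> V (Z w).
Hypothesis XZ : forall w, W w -> rowf X (Z w) = w.
Hypothesis cZ : forall w, W w -> {for w, continuous Z}.

(** The linear estimate for X at Z(w), multiplied by the inverse frame, controls the increment of Z,
    whose size is O(|t|) by the Lipschitz bound; [e1] compensates for the constants. *)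
Lemma inverse_derive w i a : W w -> derivable (fun v => Z v 0 a) w (delta_mx 0 i) /\
  partial i (fun v => Z v 0 a) w = invmx (frame X (Z w)) i a.
Proof.
move=> Ww; have Vw := ZV Ww; apply: derive_of_estimate => e e0.
set F := frame X (Z w); pose k := n%:R * `|invmx F|.
have [L [r1 [L0 r10 BV1 lip]]] := inverse_lipschitz oV sX uX Vw.
have k0 : 0 <= k by rewrite mulr_ge0.
pose e1 := e / (k * (n%:R * L) + 1).
have d0 : 0 < k * (n%:R * L) + 1 by rewrite ltr_wpDl// !mulr_ge0// ltW.
have e10 : 0 < e1 by rewrite divr_gt0.
have [r2 r20 [BV2 lin]] := linear_estimate oV sX Vw e10.
pose r := Num.min r1 r2; have r0 : 0 < r by rewrite lt_min r10.
have near_w : \forall v \near w, W v /\ ball (Z w) r (Z v).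
  apply: near_and (near_open oW Ww (fun _ h => h)) _.
  exact: (near_continuous (cZ Ww) (near_open (@ball_open _ _ _ _) (ballxx _ r0) (fun _ h => h))).
have [d dd Hd] := near_in_ball near_w.
exists d => // t td; set w' := t *: _ + w.
have [Ww' Bw'] : W w' /\ ball (Z w) r (Z w').
  apply: Hd; rewrite in_ballE /w' opprD addrCA subrr addr0 normrN normrZ.
  by apply: le_lt_trans td; apply: ler_piMr (norm_delta_le1 i).
have sub r' : r <= r' -> ball (Z w) r' (Z w').
  by move=> rr; move: Bw'; rewrite !in_ballE => /lt_le_trans; apply.
have B1 : ball (Z w) r1 (Z w') by apply: sub; rewrite ge_min lexx.
have B2 : ball (Z w) r2 (Z w') by apply: sub; rewrite ge_min lexx orbT.
have hl := lip _ _ (ballxx _ r10) B1; have hn := lin _ _ (ballxx _ r20) B2.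
rewrite !XZ// in hl hn.
have ww : w' - w = t *: delta_mx 0 i by rewrite /w' addrK.
rewrite ww in hl hn.
have tt : `|t *: delta_mx 0 i : 'rV[R]_n| <= `|t| by rewrite normrZ ler_piMr// norm_delta_le1.
have E : Z w' - Z w - t *: row i (invmx F) = - ((t *: delta_mx 0 i - (Z w' - Z w) *m F) *m invmx F).
  rewrite mulmxBl mulmxK ?uX// -scalemxAl deltaM opprB.
  by [].
have -> : Z w' 0 a - Z w 0 a - t * invmx F i a = (Z w' - Z w - t *: row i (invmx F)) 0 a.
  by rewrite !(mxDE, mxNE) mxZE [row _ _ _ _]mxE.
apply: le_trans (coord_le_norm _ _ _) _; rewrite E normrN.
apply: le_trans (mulmx_norm_le _ _) _; rewrite mulrAC -/k.
apply: (@le_trans _ _ (k * (n%:R * (L * `|t|) * e1))).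
  rewrite ler_wpM2l//; apply: le_trans hn _; rewrite ler_wpM2r ?(ltW e10)// ler_wpM2l//.
  by apply: le_trans hl _; rewrite ler_wpM2l// ltW.
have -> : k * (n%:R * (L * `|t|) * e1) = (k * (n%:R * L)) * e1 * `|t|.
  by move: (n%:R : R) => x; ring.
rewrite ler_wpM2r// /e1 mulrCA ler_piMr ?(ltW e0)// ler_pdivrMr// mul1r lerDl.
exact: ler01.
Qed.

(** The derivatives of Z are the smooth entries of the inverse frame composed with Z, so regularity
    improves by one order at a time. *)
Lemma inverse_smooth a : smooth_on W (fun w => Z w 0 a).
Proof.
have cZa b w : W w -> {for w, continuous (fun w => Z w 0 b)}.
  by move=> Ww; exact: (continuous_comp (cZ Ww) (@coord_continuous _ _ _ 0 b (Z w))).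
have sI := smx_invmx oV (smx_frame oV sX) uX.
move=> k; elim: k a => [|k IH] a; first by split=> // w; exact: cZa.
split=> [w|i]; first exact: cZa.
split=> [w Ww|]; first by have [] := inverse_derive i a Ww.
apply: (C_on_ext oW (f := (fun q => invmx (frame X q) i a) \o Z)).
  by move=> w Ww /=; have [_ ->] := inverse_derive i a Ww.
by apply: (C_on_comp oW oV ZV) => //; exact: (sI i a k).
Qed.

End SmoothInverse.

Section HyperbolicMatrix.
Context {R : realType} {n : nat}.

Lemma enorm_mulmx (x : 'rV[R]_n) : enorm x ^+ 2 = (x *m x^T) 0 0.
Proof. by rewrite enorm_sqr mxME; apply: eq_bigr => i _; rewrite mxTE expr2. Qed.

(** The Sherman-Morrison formula for a rank one perturbation of the identity. *)
Lemma ads_mx_inverse (x : 'rV[R]_n) : ads_mx x *m (1%:M + x^T *m x) = 1%:M.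
Proof.
set s := 1 + enorm x ^+ 2; have s0 : s != 0 by rewrite gt_eqF// cst1D_enorm_gt0.
have -> : ads_mx x = 1%:M - s^-1 *: (x^T *m x).
  apply/matrixP => i j; rewrite mxDE mxNE mxZE mxME big_ord1 mxTE !mxE -/s.
  by rewrite [_ / s]mulrC.
have xx : x *m x^T = (s - 1)%:M.
  by apply/matrixP => i j; rewrite !ord1 [RHS]mxE eqxx /s addrC addKr enorm_mulmx.
rewrite mulmxBl mul1mx -scalemxAl mulmxDr mulmx1.
have -> : x^T *m x *m (x^T *m x) = (s - 1) *: (x^T *m x).
  by rewrite mulmxA -(mulmxA x^T) xx mul_mx_scalar -scalemxAl.
rewrite scalerDr scalerA -scalerDl (_ : s^-1 + _ = 1) ?scale1r ?addrK//.
by field.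
Qed.

Lemma metric_from_frame (G F P ads : 'M[R]_n) : G \in unitmx -> F \in unitmx ->
  F^T *m invmx G *m F = P -> ads *m P = 1%:M -> G = F *m ads *m F^T.
Proof.
move=> uG uF FP aP.
have E : F *m ads *m F^T *m invmx G = 1%:M.
  have {}FP : F^T *m invmx G = P *m invmx F by rewrite -FP mulmxK.
  by rewrite -!mulmxA FP (mulmxA ads) aP mul1mx mulmxV.
by rewrite -[RHS](mulmxKV uG) E mul1mx.
Qed.

End HyperbolicMatrix.

Section Rigidity.
Context {R : realType} {n : nat}.
Variables (M : manifold R n) (g : riemannian_metric M) (u : M -> R) (c : R).
Hypothesis su : smooth_fun u.
Hypothesis u_gt0 : forall x, 0 < u x.
Hypothesis c_gt0 : 0 < c.
Hypothesis hess_u : forall i q, cimg i q ->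
  hessian (g i) (u \o param i) q = (u \o param i) q *: g i q.
Hypothesis grad_u : forall i x, dom i x -> ipc g i u u x = u x ^+ 2 - c ^+ 2.
Hypothesis sublevel_cpt : forall s, compact [set x | u x <= s].
Hypothesis cT : connected [set: M].
Implicit Types (x z : M).
Local Notation iso_at := (iso_at g u).
Local Notation local_inverse := (local_inverse g u).

Lemma iso_at_ext (Phi Phi' : M -> 'rV[R]_n) x : (\forall z \near x, Phi z = Phi' z) ->
  iso_at Phi x -> iso_at Phi' x.
Proof.
move=> E [sP gP].
have Ex := nbhs_singleton E.
have coordE a z : Phi z = Phi' z -> coordf Phi a z = coordf Phi' a z by rewrite /coordf => ->.
split=> [a i dx|i dx].
  have [V [oV Vx] sV] := sP a i dx.
  have [W [oW Wx HW]] := near_ex_open (near_and (near_param dx E) (near_open oV Vx (fun _ h => h))).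
  exists W => //; apply: (smooth_ext oW (f := coordf Phi a \o param i)).
    by move=> q /HW[E' _]; rewrite /= (coordE _ _ E').
  by apply: smooth_sub sV => q /HW[].
have [U [oU Ux HU]] := near_ex_open (near_param dx E).
have EU a q : U q -> (coordf Phi' a \o param i) q = (coordf Phi a \o param i) q.
  by move=> Uq; rewrite /= (coordE a _ (HU q Uq)).
have [g1 g2] := gP i dx; split=> [a b|a]; rewrite -!(coordE _ _ Ex) -?g1 -?g2 /ipc.
  exact: (ipg_ext _ oU Ux (EU a) (EU b)).
exact: (ipg_ext _ oU Ux (EU a) (fun _ _ => erefl)).
Qed.

Lemma hyperbolic_isometry p : u p = c ->
  exists2 Phi : M -> euclidean_space R n, riemannian_isometry g (ads_metric R n) Phi &
    forall x, u x = c * ads_potential R n (Phi x).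
Proof.
move=> up; have secs := section_everywhere su u_gt0 c_gt0 hess_u grad_u sublevel_cpt.
have [b0 [Psi0 [e [e0 Ey _ rotL _]]]] := local_inverse_model su u_gt0 secs p.
(* The model supplies local inverses in rotated form; the identity is used as rotation. *)
have I1 : (1%:M : 'M[R]_n)^T *m 1%:M = 1%:M by rewrite trmx1 mulmx1.
have L0 q : ball b0 e q -> local_inverse (fun p => Psi0 (p *m (1%:M : 'M[R]_n)^T)) q.
  by move=> Bq; apply: (rotL _ I1); rewrite trmx1 mulmx1.
(* By u^2 = c^2 (1 + |q|^2) the value c is taken only over the origin, so the model at the minimum
   point [p] is centred at 0, where the development starts. *)
have b00 : b0 = 0.
  have := local_inverse_u u_gt0 grad_u (L0 b0 (ballxx _ e0)).
  rewrite trmx1 mulmx1 Ey up mulrDr mulr1 => /eqP; rewrite -subr_eq0 opprD addrA subrr sub0r oppr_eq0.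
  rewrite mulf_eq0 expf_eq0 /= gt_eqF//= -enorm_mulmx expf_eq0 /= enorm_eq0.
  by move/eqP.
have D0 : developed g u (fun p => Psi0 (p *m (1%:M : 'M[R]_n)^T)) e.
  exists (fun p => Psi0 (p *m (1%:M : 'M[R]_n)^T)); last by apply: filterE.
  by move=> q qe; apply: L0; rewrite b00 in_ballE sub0r normrN.
have [Psi LI _] := developing_map su u_gt0 grad_u sublevel_cpt secs e0 D0.
have surj := developing_surjective su u_gt0 secs LI cT.
have inj := developing_injective su u_gt0 secs LI.
have [Phi PhiK] := choice surj.
have PsiK : cancel Psi Phi by move=> q; apply: inj; rewrite PhiK.
(* Near [x] the global inverse coincides with the section that Psi inverts at [Phi x]. *)
have iso x : iso_at Phi x.
  have [_ [Ps [iP PP _]]] := LI (Phi x); rewrite PhiK in iP PP.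
  apply: iso_at_ext (nbhs_singleton iP).
  by apply: near_imp PP _ => z Ez; rewrite -{2}Ez PsiK.
have CS i : chart_section g u i (cimg i) (fun a => coordf Phi a \o param i).
  split=> [a|q Iq].
    apply: smooth_pointwise => q Iq; have [+ _] := iso (param i q).
    move=> /(_ a i (dom_param Iq))[V [oV Vx] sV]; exists V => //.
    by rewrite paramK in Vx.
  have [_ /(_ i (dom_param Iq))] := iso (param i q).
  by rewrite /ipc paramK.
have uF i q : cimg i q -> frame (fun a => coordf Phi a \o param i) q \in unitmx.
  apply: (frame_unit (G := g i)) => a b q' Iq'.
  by have [+ _] := (CS i).2 q' Iq'; apply.
exists Phi; last first.
  move=> x; have := local_inverse_u u_gt0 grad_u (LI (Phi x)).
  rewrite PhiK -enorm_mulmx => E.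
  rewrite /ads_potential -[LHS]ger0_norm ?(ltW (u_gt0 x))// -sqrtr_sqr E.
  by rewrite sqrtrM ?sqr_ge0// sqrtr_sqr gtr0_norm.
split.
- split=> [x|i j a]; first exact: section_continuous (iso x).
  apply: smooth_sub ((CS i).1 a) => _ [x [dx _] <-]; exact: cimg_chart.
- exists Psi; split=> //; split=> [q|i j a]; first by have [] := LI q.
  pose W : set 'rV[R]_n := [set q | dom j (Psi q)].
  have oW : open W.
    rewrite openE => q Wq; have [C _] := LI q.
    exact: (near_continuous C (near_open (@dom_open _ _ _ j) Wq (fun _ h => h))).
  (* In the chart [j], Psi is a continuous right inverse of a smooth map with invertible frame. *)
  have sW : smooth_on W (fun w => chart j (Psi w) 0 a).
    apply: (@inverse_smooth _ _ (cimg j) W (fun a => coordf Phi a \o param j) (fun w => chart j (Psi w))) => //.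
    - exact: open_cimg.
    - exact: (CS j).1.
    - exact: uF.
    - by move=> w Ww; exact: cimg_chart.
    - by move=> w Ww; apply/rowP => b; rewrite mxE /= (chartK Ww) /coordf PsiK.
    - move=> w Ww; have [C _] := LI w.
      exact: (continuous_comp C (chart_continuous Ww)).
  by apply: smooth_sub sW => _ [q [_ Wq] <-].
move=> i j x dx _; have Ix := cimg_chart dx.
have [G _] := section_frame_gram (iso x) dx.
have -> : 'J (chart j \o Phi \o param i) (chart i x) = frame (fun a => coordf Phi a \o param i) (chart i x).
  apply/matrixP => a b.
  rewrite (jacobianE a b (@open_cimg _ _ _ i) (fun b => (CS i).1 b 1%N) Ix).
  by rewrite mxE.
apply: metric_from_frame G _; [exact: metric_unit (chart_metricP g i) _ Ix|exact: uF|].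
exact: ads_mx_inverse.
Qed.

End Rigidity.

Theorem theorem3p1 (R : realType) (n : nat) (n_ge3 : (3 <= n)%N)
    (M : manifold R n) (g : riemannian_metric M) (u : M -> R)
    (static : static_triple g u) :
  let L := liminf_infinity
             (fun x : M => u x ^+ 2 - u_min u ^+ 2 - grad_sq g u x) in
  (L <= 0)%E /\
  (L = 0%E ->
    exists2 c : R, 0 < c &
      exists2 Phi : M -> euclidean_space R n,
        riemannian_isometry g (ads_metric R n) Phi &
        forall x, u x = c * ads_potential R n (Phi x)).
Proof.
split; first exact: liminf_le0.
move=> L0; have [p up _] := u_min_attained static.
have c0 : 0 < u_min u by rewrite -up; exact: (static_pos static).
exists (u_min u) => //.
apply: (hyperbolic_isometry (static_smooth static) (static_pos static) c0
  (liminf0_stress static L0) (liminf0_grad static L0)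
  (sublevel_compact static) (static_connected static) up).
Qed.
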